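(* Let $\mathrm{G}$ be a compact semisimple classical Lie group. Each coadjoint orbit $\mathcal{O}$ of $\mathrm{G}$ is locally parameterized in terms of the canonical coordinates $\{z_\alpha,\ \alpha\in\Delta^+\}$ in a nilpotent subgroup $\mathrm{Z}$ of $\mathrm{G}^{\mathbb{C}}$, according to the system of local charts on the orbit $$\mathcal{O}=\mathrm{P}\backslash\mathrm{G}^{\mathbb{C}}=\bigcap_{w\in\mathrm{W}(\mathrm{G})}\mathrm{Z}w .$$
   Context: The compact classical groups considered are $\mathrm{SO}(n)$, $\mathrm{SU}(n)$, $\mathrm{Sp}(n)$. $\mathfrak{g}$ is the Lie algebra of $\mathrm{G}$, $\mathfrak{g}^*$ its dual space, $\mathrm{T}$ the maximal torus of $\mathrm{G}$, $\mathfrak{h}$ the Cartan (maximal commutative) subalgebra of $\mathfrak{g}$, $\mathfrak{h}^*$ its dual space, $\Delta^+$ the set of positive roots, and $\langle\cdot,\cdot\rangle$ a bilinear form on $\mathfrak{g}^*$. The coadjoint orbit through $\mu_0$ is $\mathcal{O}_{\mu_0}=\{g^{-1}\mu_0 g\mid g\in\mathrm{G}\}\subset\mathfrak{g}^*$, identified with the right coset space $\mathrm{G}_{\mu_0}\backslash\mathrm{G}$, where $\mathrm{G}_{\mu_0}$ is the stability subgroup of $\mu_0$. Each orbit is defined by an initial point $\mu_0\in\mathfrak{h}^*$ in the closure of the positive Weyl chamber $C=\{\mu\in\mathfrak{h}^*\mid\langle\mu,\alpha\rangle>0\ \forall\alpha\in\Delta^+\}$. The orbit is generic if $\mu_0\in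 C$ (then $\mathrm{G}_{\mu_0}=\mathrm{T}$), and degenerate if $\mu_0$ belongs to a wall $\{\mu\in\mathfrak{h}^*\mid\langle\mu,\alpha\rangle=0\}$, $\alpha\in\Delta^+$ (then $\mathrm{G}_{\mu_0}\supset\mathrm{T}$, $\mathrm{G}_{\mu_0}\neq\mathrm{T}$). $\mathrm{W}(\mathrm{G})=N(\mathrm{T})/C(\mathrm{T})$ is the Weyl group, where $N(\mathrm{T})$ is the normalizer and $C(\mathrm{T})=\mathrm{T}$ the centralizer of $\mathrm{T}$ in $\mathrm{G}$; $\mathrm{W}(\mathrm{G}_{\mu_0})$ is the Weyl group of $\mathrm{G}_{\mu_0}$. $\mathrm{G}^{\mathbb{C}}=\exp\{\mathfrak{g}+i\mathfrak{g}\}$ is the complexification of $\mathrm{G}$. For $\alpha\in\Delta^+$, $X_\alpha$ and $X_{-\alpha}$ are positive and negative root vectors, chosen so that $X_\alpha-X_{-\alpha}$ and $i(X_\alpha+X_{-\alpha})$ lie in $\mathfrak{g}$, and $H_\alpha\in\mathfrak{h}$ are the corresponding Cartan vectors. Put $\mathrm{N}\simeq\exp\{\sum_{\alpha\in\Delta^+}n_\alpha X_\alpha\}$, $n_\alpha\in\mathbb{C}$; $\mathrm{A}\simeq\exp\{\sum_{\alpha\in\Delta^+}a_\alpha iH_\alpha\}$, $a_\alpha\in\mathbb{R}$; and $\mathrm{Z}=\exp\{\sum_{\alpha\in\Delta^+}z_\alpha X_{-\alpha}\}$, $z_\alpha\in\mathbb{C}$. The numbers $z_\alpha$ are the canonical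 coordinates in $\mathrm{Z}$. The minimal parabolic subgroup of $\mathrm{G}^{\mathbb{C}}$ is $\mathrm{P}=\mathrm{NAT}$. By the Iwasawa decomposition $\mathrm{G}^{\mathbb{C}}=\mathrm{NAG}$, a generic orbit satisfies $\mathcal{O}=\mathrm{T}\backslash\mathrm{G}\simeq\mathrm{P}\backslash\mathrm{G}^{\mathbb{C}}$. The system of local charts in the claim is given by the Gauss-Bruhat decomposition, written $\mathrm{G}^{\mathbb{C}}=\bigcap_{w\in\mathrm{W}(\mathrm{G})}\mathrm{P}\mathrm{Z}w$. The formulas are written for a generic orbit. In the case of a degenerate orbit $\mathcal{O}_{\mu_0}=\mathrm{G}_{\mu_0}\backslash\mathrm{G}\simeq\mathrm{P}_{\mu_0}\backslash\mathrm{G}^{\mathbb{C}}$, $\mathrm{T}$ is to be replaced by $\mathrm{G}_{\mu_0}$ and $\mathrm{P}$ by the parabolic subgroup $\mathrm{P}_{\mu_0}=\mathrm{NAG}_{\mu_0}$; it is sufficient to take the intersection over $w\in\mathrm{W}(\mathrm{G}_{\mu_0})\backslash\mathrm{W}(\mathrm{G})$, and $\mathrm{Z}$ has fewer coordinates.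
   Formalization: The displayed intersection over w in W(G) is read as a union: the charts Zw cover the orbit (the literal intersection fails already for SU(2), where it omits two points of the sphere); and G^C = exp{g+ig} is read as the group generated by these exponentials. *)

(* Defs.v *)
From HB Require Import structures.
From mathcomp Require Import all_boot all_order all_algebra.
From mathcomp Require Import spectral complex.
From mathcomp Require Import boolp classical_sets reals topology normedtype.
From mathcomp Require Import sequences derive.

Set Implicit Arguments.
Unset Strict Implicit.
Unset Printing Implicit Defensive.

Import Order.TTheory GRing.Theory Num.Theory.
Import numFieldNormedType.Exports.

Local Open Scope classical_set_scope.
Local Open Scope ring_scope.

(* The type ascription makes the norm topology of the complex numbers, and
   hence that of complex matrices, available to unification. *)
Definition cplx (R : realType) : numClosedFieldType := R[i].

Definition toC {R : realType} (x : R) : cplx R := real_complex R x.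

Definition formJ (R : realType) (n : nat) : 'M[cplx R]_(n + n) :=
  block_mx 0 1%:M (- 1%:M) 0.

Definition SOgrp (R : realType) (n : nat) : set 'M[cplx R]_n :=
  [set map_mx toC B | B in [set B : 'M[R]_n | B *m B^T = 1%:M /\ \det B = 1]].

Definition SUgrp (R : realType) (n : nat) : set 'M[cplx R]_n :=
  [set A | A \is unitarymx /\ \det A = 1].

(* The compact group Sp(n), realized as the intersection of U(2n) with the
   complex symplectic group in dimension 2n. *)
Definition Spgrp (R : realType) (n : nat) : set 'M[cplx R]_(n + n) :=
  [set A | A \is unitarymx /\ A^T *m formJ R n *m A = formJ R n].

Inductive classical_group (R : realType) :
    forall N : nat, set 'M[cplx R]_N -> Prop :=
  | classical_SO n : classical_group (@SOgrp R n)
  | classical_SU n : classical_group (@SUgrp R n)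
  | classical_Sp n : classical_group (@Spgrp R n).

Section Charts.
Context {T : topologicalType} {R : realType} {m : nat}.
Implicit Types (O B : set T) (phi : 'rV[cplx R]_m -> T).

Definition open_in O B := exists2 U : set T, open U & B = O `&` U.

(* phi is a homeomorphism of C^m onto a relatively open subset of O. *)
Definition local_chart O phi :=
  [/\ injective phi, continuous phi
    & forall V : set 'rV[cplx R]_m, open V -> open_in O (phi @` V)].

(* The coordinate change from phi to phi' is holomorphic: differentiability is
   over the complex field, at each point of the (open) overlap. *)
Definition compatible_charts phi phi' :=
  exists tau : 'rV[cplx R]_m -> 'rV[cplx R]_m,
    forall z, range phi' (phi z) ->
      phi' (tau z) = phi z /\ differentiable tau z.

End Charts.

Section MatrixGroups.
Context {R : realType} {N : nat}.
Local Notation C := (cplx R).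
Local Notation M := 'M[cplx R]_N.
Implicit Types (G K T Z S A B : set M) (g h : set M) (X Y a mu : M).

Definition mexp X : M :=
  lim ((fun n : nat => \sum_(k < n) (k`!%:R^-1 : C) *: X ^+ k) @ \oo).

Definition bracket X Y : M := X *m Y - Y *m X.

Definition mulset A B : set M := [set a *m b | a in A & b in B].

Definition is_subgroup A :=
  [/\ forall a, A a -> a \in unitmx, A 1%:M,
      forall a b, A a -> A b -> A (a *m b)
    & forall a, A a -> A (invmx a)].

Definition subgroup_generated S : set M := smallest is_subgroup S.

Fixpoint lower_central Z (k : nat) : set M :=
  if k is k'.+1 then
    subgroup_generated [set x *m z *m invmx x *m invmx z
              | x in lower_central Z k' & z in Z]
  else Z.

Definition nilpotent_subgroup G Z :=
  [/\ is_subgroup Z, Z `<=` G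
    & exists c : nat, lower_central Z c = [set 1%:M]].

Definition lie G : set M := [set X | forall t : R, G (mexp (toC t *: X))].

Definition real_subspace h :=
  [/\ h 0, forall X Y, h X -> h Y -> h (X + Y)
    & forall (t : R) X, h X -> h (toC t *: X)].

(* No nonzero abelian ideal. *)
Definition semisimple g :=
  forall a : set M, real_subspace a -> a `<=` g ->
    (forall X Y, g X -> a Y -> a (bracket X Y)) ->
    (forall X Y, a X -> a Y -> bracket X Y = 0) ->
    a = [set 0].

Definition commutative_subalgebra g h :=
  [/\ real_subspace h, h `<=` g & forall X Y, h X -> h Y -> bracket X Y = 0].

Definition cartan g h :=
  commutative_subalgebra g h /\
  forall h' : set M, commutative_subalgebra g h' -> h `<=` h' -> h' = h.

Definition complexify g : set M := [set X + 'i *: Y | X in g & Y in g].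

(* exp is not onto the complexified group in general (e.g. for SL(2,C)), so
   exp{g + ig} is read as the group generated by these exponentials. *)
Definition complexification G : set M :=
  subgroup_generated (mexp @` complexify (lie G)).

Definition torus h : set M := mexp @` h.

(* The invariant form -tr(XY) is real and positive definite on the Lie algebra
   of a group of unitary matrices; it identifies g^* with g, and h^* with h.
   Functionals, in particular weights and roots, are thus matrices. *)
Definition trform X Y : R := - complex.Re (\tr (X *m Y)).

Definition root_vector g h a X :=
  [/\ complexify g X, X != 0
    & forall H, h H -> bracket H X = ('i * toC (trform a H)) *: X].

Definition is_root g h a :=
  [/\ h a, a != 0 & exists X, root_vector g h a X].

(* al enumerates the roots that are positive on some regular element H0. *)
Definition positive_roots g h (m : nat) (al : 'I_m -> M) :=
  injective al /\
  exists H0 : M,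
    [/\ h H0, forall a, is_root g h a -> trform a H0 != 0
      & range al = [set a | is_root g h a /\ 0 < trform a H0]].

(* X k and Y k are the root vectors for al k and - al k. *)
Definition root_vectors g h (m : nat) (al X Y : 'I_m -> M) :=
  forall k : 'I_m,
    [/\ root_vector g h (al k) (X k), root_vector g h (- al k) (Y k),
        g (X k - Y k) & g ('i *: (X k + Y k))].

Definition cartan_vector (m : nat) (X Y : 'I_m -> M) (k : 'I_m) : M :=
  'i *: bracket (X k) (Y k).

Definition chamber h (m : nat) (al : 'I_m -> M) : set M :=
  [set mu | h mu /\ forall k, 0 < trform mu (al k)].

Definition conj_orbit G mu : set M := [set invmx k *m mu *m k | k in G].

Definition stabilizer G mu : set M :=
  [set k | G k /\ invmx k *m mu *m k = mu].

Definition coadjoint_orbit G (O : set M) :=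
  exists2 mu, lie G mu & O = conj_orbit G mu.

Definition normalizer G T : set M :=
  [set n | G n /\ [set n *m t *m invmx n | t in T] = T].

Definition centralizer G T : set M :=
  [set c | G c /\ forall t, T t -> c *m t = t *m c].

(* The elements of N(T)/C(T), as cosets. *)
Definition weyl G T : set (set M) :=
  [set mulset (centralizer G T) [set n] | n in normalizer G T].

(* I meets every class of W(K)\W(G) exactly once. *)
Definition weyl_transversal K G T (I : set (set M)) :=
  I `<=` weyl G T /\
  forall w, weyl G T w ->
    exists! w', I w' /\ exists2 v, weyl K T v & w = mulset v w'.

Definition groupN (m : nat) (X : 'I_m -> M) : set M :=
  [set mexp (\sum_k c k *: X k) | c in @setT ('I_m -> C)].

Definition groupA (m : nat) (H : 'I_m -> M) : set M :=
  [set mexp (\sum_k toC (c k) *: ('i *: H k)) | c in @setT ('I_m -> R)].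

(* The canonical coordinates, restricted to the positive roots with index
   in D; they are numbered by 'I_#|D| through enum_val. *)
Definition expZ (m : nat) (Y : 'I_m -> M) (D : {set 'I_m})
    (z : 'rV[C]_#|D|) : M :=
  mexp (\sum_(j < #|D|) z ord0 j *: Y (enum_val j)).
Arguments expZ {m} Y D z.

Definition groupZ (m : nat) (Y : 'I_m -> M) (D : {set 'I_m}) : set M :=
  range (expZ Y D).

Definition parabolic (m : nat) (X Y : 'I_m -> M) K : set M :=
  mulset (mulset (groupN X) (groupA (cartan_vector X Y))) K.

Definition right_coset A X : set M := mulset A [set X].

(* psi induces a homeomorphism of P\G^C, with its quotient topology, onto the
   orbit of mu0; for k in G it sends the coset P k to k^-1 mu0 k, and by the
   Iwasawa decomposition this determines it on all of G^C. *)
Definition coset_identification G P mu0 (psi : M -> M) :=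
  let GC := complexification G in
  [/\ forall k, G k -> psi k = invmx k *m mu0 *m k,
      forall x y, GC x -> GC y -> psi x = psi y <-> right_coset P x = right_coset P y,
      psi @` GC = conj_orbit G mu0
    & forall B, B `<=` conj_orbit G mu0 ->
        open_in (conj_orbit G mu0) B <-> open_in GC (GC `&` psi @^-1` B)].

(* K is the stability subgroup, D indexes the coordinates of Z, the charts are
   indexed by I, and rep w is an element of N(T) representing w. The chart of w
   maps z to the point of the orbit given by the coset P exp(z) (rep w). *)
Definition orbit_charts G (m : nat) (X Y : 'I_m -> M) K (D : {set 'I_m})
    (I : set (set M)) (rep : set M -> M) mu0 :=
  let P := parabolic X Y K in
  let Z := groupZ Y D in
  nilpotent_subgroup (complexification G) Z /\
  exists2 psi : M -> M, coset_identification G P mu0 psi &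
    let chart w z := psi (expZ Y D z *m rep w) in
    [/\ conj_orbit G mu0 = \bigcup_(w in I) [set psi (z *m rep w) | z in Z],
        forall w, I w -> local_chart (conj_orbit G mu0) (chart w)
      & forall w w', I w -> I w' -> compatible_charts (chart w) (chart w')].

End MatrixGroups.

(* Main.v *)
(** Everything is done inside matrices.  The Lie algebra g of the compact group
    G consists of skew-Hermitian matrices, so a Cartan subalgebra h is
    diagonalized by one unitary U, and the eigenvalues of mu0 grade all
    matrices.  In this grading the parabolic subgroup P is the block upper
    triangular part of G^C and Z is its block lower unitriangular part; hence
    the chart of w is inverted by the block LU factorization of x w^-1 followed
    by the logarithm of its unipotent factor, both rational.

    - The Iwasawa decomposition comes from the LU factorization of g g^*, whose
      diagonal part is the exponential of a Hermitian element.
    - The map psi sends x to the sum of the orthogonal projections onto the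
      row spaces of the truncations of U x, weighted by the gaps between the
      eigenvalues of mu0: these row spaces do not change under P.
    - The charts cover the orbit (Bruhat decomposition): along the flow
      x exp(s i H0), H0 regular, the point psi has a limit point that maximizes
      a height function; it is a fixed point of the flow, so it lies in h and is
      a Weyl conjugate of mu0, and the chart around it is open and invariant
      under the flow.
    - Conjugacy into the closed Weyl chamber and Weyl conjugacy follow from
      first and second variations of <k^-1 A k, B> over a compact group.
    - The three families of groups enter only through the record [good]; its
      delicate field is the existence of a logarithm commuting with a given
      element, where the eigenvalue -1 needs a square root of a projection that
      is compatible with the bilinear form. *)

From HB Require Import structures.
Require Import Defs.
From mathcomp Require Import all_boot all_order all_algebra.
From mathcomp Require Import spectral complex ring lra.
From mathcomp Require Import boolp classical_sets reals topology normedtype.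
From mathcomp Require Import sequences derive exp trigo.
Set Implicit Arguments.
Unset Strict Implicit.
Unset Printing Implicit Defensive.
Import Order.TTheory GRing.Theory Num.Theory.
Import numFieldNormedType.Exports.
Local Open Scope classical_set_scope.
Local Open Scope ring_scope.
Local Open Scope sesquilinear_scope.

(** Matrices are graded by the eigenvalues of [mu0] rather than by roots, so that generic and
    degenerate orbits are one case: equal eigenvalues form the blocks. Triangular factors of an
    element of [Gc] stay in [Gc] because the anti-automorphism attached to the bilinear form, if
    there is one, respects the grading, and triangular factorizations are unique. Semisimplicity
    enters through one fact: an element of [h] on which all roots vanish is zero. Hence the coroots
    span [h], so that A, which is built from the Cartan vectors, contains every positive factor of
    the Iwasawa decomposition; moreover [h] is closed, so that the closure of the chamber stays in
    [h]. The covering is proved by dynamics because this treats the three families alike, without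
    the combinatorics of the Weyl group. All variations are read off from a second-order expansion
    of the exponential with an explicit remainder. *)

Lemma cvg_app (U V : topologicalType) (g : U -> V) (T : Type)
    (F : set_system T) {FF : Filter F} (u : T -> U) (l : U) :
  continuous g -> u x @[x --> F] --> l -> g (u x) @[x --> F] --> g l.
Proof. by move=> cg ul; apply: (cvg_comp u g ul); apply: cg. Qed.

(** * Real and imaginary parts of complex scalars *)

Section ComplexNumbers.
Context {R : realType}.
Local Notation C := (cplx R).
Local Notation re := (@complex.Re R).
Local Notation im := (@complex.Im R).
Implicit Types (x y : R) (z w : C).

HB.instance Definition _ := GRing.RMorphism.copy (@toC R) (@real_complex R).

Lemma reD z w : re (z + w) = re z + re w. Proof. by case: z; case: w. Qed.
Lemma reN z : re (- z) = - re z. Proof. by case: z. Qed.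
Lemma reB z w : re (z - w) = re z - re w. Proof. by rewrite reD reN. Qed.
Lemma re_toC x : re (toC x) = x. Proof. by []. Qed.
Lemma im_toC x : im (toC x) = 0. Proof. by []. Qed.
Lemma re_toCM x z : re (toC x * z) = x * re z.
Proof. by case: z => a b /=; rewrite mul0r subr0. Qed.
Lemma imD z w : im (z + w) = im z + im w. Proof. by case: z; case: w. Qed.
Lemma iE : ('i : C) = 'i%C. Proof. by []. Qed.
Lemma reim z : z = toC (re z) + 'i * toC (im z).
Proof. by rewrite {1}(complexE z). Qed.
Lemma conj_conjc z : Num.conj z = z^*%C. Proof. by []. Qed.
Lemma re_conj z : re (Num.conj z) = re z. Proof. by case: z. Qed.
Lemma im_conj z : im (Num.conj z) = - im z. Proof. by case: z. Qed.
Lemma conj_toC x : Num.conj (toC x) = toC x.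
Proof. by rewrite conj_conjc /toC /= oppr0. Qed.
Lemma re_iM z : re ('i * z) = - im z.
Proof. by case: z => a b; rewrite iE /= mul0r mul1r sub0r. Qed.
Lemma im_iM z : im ('i * z) = re z.
Proof. by case: z => a b; rewrite iE /= mul0r mul1r add0r. Qed.

Lemma toC_inj : injective (@toC R). Proof. by move=> x y []. Qed.
Lemma toC_real x : toC x \is Num.real.
Proof. by rewrite CrealE conj_toC. Qed.
Lemma CrealP z : reflect (z = toC (re z)) (z \is Num.real).
Proof.
apply: (iffP idP) => [|->]; last exact: toC_real.
rewrite CrealE => /eqP/(congr1 im); rewrite im_conj => h.
have h0 : im z = 0 by lra.
by rewrite {1}(reim z) h0 rmorph0 mulr0 addr0.
Qed.
Lemma toC_le x y : (toC x <= toC y) = (x <= y).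
Proof. by rewrite -lecR. Qed.
Lemma toC_lt x y : (toC x < toC y) = (x < y).
Proof. by rewrite -ltcR. Qed.
Lemma ge0_toC z : 0 <= z -> z = toC (re z).
Proof. by move/ger0_real/CrealP. Qed.
Lemma ge0_re z : 0 <= z -> 0 <= re z.
Proof. by move=> z0; rewrite -toC_le -ge0_toC// rmorph0. Qed.
Lemma gt0_re z : 0 < z -> 0 < re z.
Proof. by move=> z0; rewrite -toC_lt -ge0_toC ?ltW// rmorph0. Qed.

(** The norm of [cplx R] takes values in [cplx R] itself; comparison with real series such as [expR]
    needs a real number. *)
Definition cabs z : R := re `|z|.
Lemma cabsE z : `|z| = toC (cabs z). Proof. by apply: ge0_toC. Qed.
Lemma cabs_ge0 z : 0 <= cabs z. Proof. exact: ge0_re. Qed.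
Lemma cabs_eq0 z : (cabs z == 0) = (z == 0).
Proof. by rewrite -(inj_eq toC_inj) -cabsE rmorph0 normr_eq0. Qed.
Lemma cabsM z w : cabs (z * w) = cabs z * cabs w.
Proof. by apply: toC_inj; rewrite rmorphM /= -!cabsE normrM. Qed.
Lemma cabsD z w : cabs (z + w) <= cabs z + cabs w.
Proof. by rewrite -toC_le rmorphD /= -!cabsE ler_normD. Qed.
Lemma cabs0 : cabs 0 = 0. Proof. by apply/eqP; rewrite cabs_eq0. Qed.
Lemma cabs1 : cabs 1 = 1. Proof. by rewrite /cabs normr1. Qed.
Lemma cabsN z : cabs (- z) = cabs z. Proof. by rewrite /cabs normrN. Qed.
Lemma cabs_toC x : cabs (toC x) = `|x|.
Proof. by apply: toC_inj; rewrite -cabsE /toC normc_def /= expr0n /= addr0 sqrtr_sqr. Qed.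
Lemma cabs_sum (I : Type) (r : seq I) (P : pred I) (F : I -> C) :
  cabs (\sum_(i <- r | P i) F i) <= \sum_(i <- r | P i) cabs (F i).
Proof.
elim/big_rec2: _ => [|i a b _ h]; first by rewrite cabs0.
by rewrite (le_trans (cabsD _ _))// lerD2l.
Qed.
Lemma re_le_cabs z : `|re z| <= cabs z.
Proof. by rewrite -toC_le -cabsE; apply: normc_ge_Re. Qed.
Lemma im_le_cabs z : `|im z| <= cabs z.
Proof.
have -> : im z = - re ('i * z) by rewrite re_iM opprK.
by rewrite normrN (le_trans (re_le_cabs _))// cabsM /cabs normCi /= mul1r.
Qed.
Lemma mulCconj z : z * Num.conj z = toC (cabs z ^+ 2).
Proof. by rewrite -normCK cabsE -rmorphXn. Qed.

Lemma toC_continuous : continuous (@toC R).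
Proof.
move=> x; apply/cvgrPdist_lt => e e0.
have -> : e = toC (re e) by apply: ge0_toC; apply: ltW.
near=> t; rewrite -rmorphB /= cabsE toC_lt cabs_toC.
near: t; apply: cvgr_dist_lt => //; exact: gt0_re.
Unshelve. all: by end_near. Qed.

Lemma re_continuous : continuous (fun z : C => re z).
Proof.
move=> x; apply/(@cvgrPdist_lt _ _ _ (nbhs x) (nbhs_filter x)) => e e0.
have /(@cvgrPdist_lt _ _ _ (nbhs x) (nbhs_filter x))/(_ (toC e)) : (y : C) @[y --> (x : C)] --> (x : C) := cvg_id.
rewrite -(rmorph0 (@toC R)) toC_lt => /(_ e0); apply: filterS => t xt.
by rewrite -reB (le_lt_trans (re_le_cabs _))// -toC_lt -cabsE.
Qed.

Lemma conj_continuous : continuous (Num.conj : C -> C).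
Proof.
move=> x; apply/(@cvgrPdist_lt _ _ _ (nbhs x) (nbhs_filter x)) => e e0.
have /(@cvgrPdist_lt _ _ _ (nbhs x) (nbhs_filter x))/(_ e e0) : (y : C) @[y --> (x : C)] --> (x : C) := cvg_id.
by apply: filterS => t xt; rewrite -rmorphB /= norm_conjC.
Qed.

Lemma cabs_continuous : continuous (fun z : C => cabs z).
Proof.
move=> z; have h : (`|t| : C) @[t --> (z : C)] --> (`|z| : C) by exact: norm_continuous.
exact: (cvg_app re_continuous h).
Qed.

Lemma cvg_reim (T : Type) (F : set_system T) {FF : Filter F} (u : T -> C) (l : C) :
  re (u x) @[x --> F] --> re l -> im (u x) @[x --> F] --> im l ->
  u x @[x --> F] --> l.
Proof.
move=> hr hi; rewrite (_ : u = fun t => toC (re (u t)) + 'i * toC (im (u t))).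
  rewrite (reim l); apply: cvgD; first by apply: (cvg_app toC_continuous); exact: hr.
  apply: cvgM; first exact: cvg_cst.
  by apply: (cvg_app toC_continuous); exact: hi.
by apply/funext => t; rewrite -reim.
Qed.
End ComplexNumbers.

(** * Continuity of the matrix operations *)

Section MatrixLimits.
Context {K : numFieldType}.

Lemma cvg_bigsum (T I : Type) (F : set_system T) {FF : Filter F} (V : normedModType K)
   (r : seq I) (P : pred I) (f : I -> T -> V) (l : I -> V) :
  (forall i, P i -> f i x @[x --> F] --> l i) ->
  \sum_(i <- r | P i) f i x @[x --> F] --> \sum_(i <- r | P i) l i.
Proof.
move=> h; elim: r => [|i r IH].
  rewrite big_nil; under eq_fun do rewrite big_nil; exact: cvg_cst.
rewrite big_cons; under eq_fun do rewrite big_cons.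
by case: ifPn => // Pi; apply: cvgD => //; apply: h.
Qed.

Lemma cvg_bigprod (T I : Type) (F : set_system T) {FF : Filter F}
   (r : seq I) (P : pred I) (f : I -> T -> K) (l : I -> K) :
  (forall i, P i -> f i x @[x --> F] --> l i) ->
  \prod_(i <- r | P i) f i x @[x --> F] --> \prod_(i <- r | P i) l i.
Proof.
move=> h; elim: r => [|i r IH].
  rewrite big_nil; under eq_fun do rewrite big_nil; exact: cvg_cst.
rewrite big_cons; under eq_fun do rewrite big_cons.
by case: ifPn => // Pi; apply: cvgM => //; apply: h.
Qed.

Lemma cvg_mx (T : Type) (F : set_system T) {FF : Filter F} m n
    (f : T -> 'M[K]_(m, n)) (A : 'M[K]_(m, n)) :
  (forall i j, f x i j @[x --> F] --> A i j) -> f x @[x --> F] --> A.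
Proof.
move=> h U [P PA sPU]; rewrite /= /nbhs /=.
apply: (@filterS _ F _ [set x | forall i j, P i j (f x i j)]); first by move=> x /sPU.
by apply: filter_forall => i; apply: filter_forall => j; apply: h; apply: PA.
Qed.

Lemma cvg_coord (T : Type) (F : set_system T) {FF : Filter F} m n
    (f : T -> 'M[K]_(m, n)) (A : 'M[K]_(m, n)) i j :
  f x @[x --> F] --> A -> f x i j @[x --> F] --> A i j.
Proof. exact: (cvg_app (@coord_continuous _ _ _ i j)). Qed.

Lemma cvg_mulmx (T : Type) (F : set_system T) {FF : Filter F} m n p
    (f : T -> 'M[K]_(m, n)) (g : T -> 'M[K]_(n, p))
    (A : 'M[K]_(m, n)) (B : 'M[K]_(n, p)) :
  f x @[x --> F] --> A -> g x @[x --> F] --> B ->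
  f x *m g x @[x --> F] --> A *m B.
Proof.
move=> hf hg; apply: cvg_mx => i j; rewrite mxE.
under eq_fun do rewrite mxE.
by apply: cvg_bigsum => k _; apply: cvgM; apply: cvg_coord.
Qed.

Lemma cvg_tr (T : Type) (F : set_system T) {FF : Filter F} m n
    (f : T -> 'M[K]_(m, n)) (A : 'M[K]_(m, n)) :
  f x @[x --> F] --> A -> (f x)^T @[x --> F] --> A^T.
Proof.
move=> hf; apply: cvg_mx => i j; rewrite mxE.
by under eq_fun do rewrite mxE; apply: cvg_coord.
Qed.

Lemma cvg_mxtrace (T : Type) (F : set_system T) {FF : Filter F} n
    (f : T -> 'M[K]_n) (A : 'M[K]_n) :
  f x @[x --> F] --> A -> \tr (f x) @[x --> F] --> \tr A.
Proof. by move=> hf; apply: cvg_bigsum => k _; apply: cvg_coord. Qed.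

Lemma cvg_det (T : Type) (F : set_system T) {FF : Filter F} n
    (f : T -> 'M[K]_n) (A : 'M[K]_n) :
  f x @[x --> F] --> A -> \det (f x) @[x --> F] --> \det A.
Proof.
move=> hf; apply: cvg_bigsum => s _; apply: cvgM; first exact: cvg_cst.
by apply: cvg_bigprod => k _; apply: cvg_coord.
Qed.

Lemma cvg_adj (T : Type) (F : set_system T) {FF : Filter F} n
    (f : T -> 'M[K]_n) (A : 'M[K]_n) :
  f x @[x --> F] --> A -> \adj (f x) @[x --> F] --> \adj A.
Proof.
move=> hf; apply: cvg_mx => i j; rewrite mxE.
under eq_fun do rewrite mxE; apply: cvgM; first exact: cvg_cst.
apply: cvg_det; apply: cvg_mx => a b; rewrite !mxE.
by under eq_fun do rewrite !mxE; apply: cvg_coord.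
Qed.

Lemma near_unitmx (T : Type) (F : set_system T) {FF : Filter F} n
    (f : T -> 'M[K]_n) (A : 'M[K]_n) : A \in unitmx ->
  f x @[x --> F] --> A -> \forall x \near F, f x \in unitmx.
Proof.
rewrite unitmxE unitfE => uA /cvg_det/cvgrPdist_lt/(_ `|\det A|).
rewrite normr_gt0 => /(_ uA); apply: filterS => x.
by rewrite unitmxE unitfE; apply: contraTneq => ->; rewrite subr0 ltxx.
Qed.

(** [invmx] branches on invertibility; close to an invertible [A] it agrees with the adjugate
    divided by the determinant, which is continuous. *)
Lemma cvg_invmx (T : Type) (F : set_system T) {FF : Filter F} n
    (f : T -> 'M[K]_n) (A : 'M[K]_n) : A \in unitmx ->
  f x @[x --> F] --> A -> invmx (f x) @[x --> F] --> invmx A.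
Proof.
move=> uA hf.
have h : (\det (f x))^-1 *: \adj (f x) @[x --> F] --> (\det A)^-1 *: \adj A.
  apply: cvgZ; last exact: cvg_adj.
  by apply: cvgV; [rewrite -unitfE -unitmxE|exact: cvg_det].
rewrite [X in _ --> X]/invmx uA.
apply: cvg_trans h; apply: near_eq_cvg.
by apply: filterS (near_unitmx uA hf) => x /= ux; rewrite /invmx ux.
Qed.
End MatrixLimits.

Section ComplexMatrixTopology.
Context {R : realType}.
Local Notation C := (cplx R).
Local Notation re := (@complex.Re R).

Lemma cvg_star (T : Type) (F : set_system T) {FF : Filter F} m n
    (f : T -> 'M[C]_(m, n)) (A : 'M[C]_(m, n)) :
  f x @[x --> F] --> A -> (f x)^t* @[x --> F] --> A^t*.
Proof.
move=> hf; apply: cvg_mx => i j; rewrite !mxE.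
under eq_fun do rewrite !mxE.
by apply: cvg_app conj_continuous _; apply: cvg_coord.
Qed.

Lemma closed_eq_cont (T : topologicalType) (m n : nat) (f g : T -> 'M[C]_(m, n)) :
  continuous f -> continuous g -> closed [set x | f x = g x].
Proof.
move=> cf cg.
have -> : [set x | f x = g x] = (fun x => f x - g x) @^-1` [set 0].
  by apply/seteqP; split => x /= /eqP; [rewrite -subr_eq0|rewrite subr_eq0] => /eqP.
apply: closed_comp => [x _|]; last first.
  by apply: accessible_closed_set1; apply: hausdorff_accessible; apply: norm_hausdorff.
by apply: cvgB; [exact: cf|exact: cg].
Qed.

(** The set is closed inside a continuous image of the real box whose sides are the real and
    imaginary parts of the entries. *)
Lemma entries_compact m n : compact [set A : 'M[C]_(m, n) | forall i j, cabs (A i j) <= 1].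
Proof.
pose f (v : 'rV[R]_(m * n + m * n)) : 'M[C]_(m, n) := \matrix_(i, j)
  (toC (v ord0 (lshift _ (mxvec_index i j))) + 'i * toC (v ord0 (rshift _ (mxvec_index i j)))).
have cf : continuous f.
  move=> v; apply: (@cvg_mx _ _ (nbhs v)) => i j; rewrite mxE; under eq_fun do rewrite mxE.
  apply: cvgD; last apply: cvgM (cvg_cst _) _.
    by apply: cvg_app toC_continuous _; apply: coord_continuous.
  by apply: cvg_app toC_continuous _; apply: coord_continuous.
pose B := [set v : 'rV[R]_(m * n + m * n) | forall i, (v ord0 i) \in `[-1, 1]].
have cB : compact B.
  apply: (@rV_compact R _ (fun=> `[-1, 1]%classic)) => _; exact: segment_compact.
have cfB : compact (f @` B).
  by apply: continuous_compact cB; apply: continuous_subspaceT.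
apply: subclosed_compact cfB _ => [|A hA].
  have -> : [set A : 'M[C]_(m, n) | forall i j, cabs (A i j) <= 1] =
     \bigcap_(k in [set: 'I_m * 'I_n]) [set A : 'M[C]_(m, n) | cabs (A k.1 k.2) <= 1].
    by apply/seteqP; split => A h; [move=> k _; apply: h|move=> i j; apply: (h (i, j))].
  apply: closed_bigI => k _.
  apply: (@closed_comp _ _ (fun A : 'M[C]_(m, n) => cabs (A k.1 k.2)) [set x : R | x <= 1]).
    move=> A _; apply: (@cvg_app _ _ _ _ (nbhs A) _ (fun B => B k.1 k.2)).
      exact: cabs_continuous.
    exact: coord_continuous.
  exact: closed_le.
exists (row_mx (mxvec (map_mx re A)) (mxvec (map_mx (@complex.Im R) A))).
  move=> i; rewrite in_itv /= -ler_norml -(splitK i).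
  case: (split i) => k; rewrite /= ?row_mxEl ?row_mxEr;
    case/mxvec_indexP: k => a b; rewrite mxvecE mxE; apply: le_trans (hA a b).
    exact: re_le_cabs.
  exact: im_le_cabs.
apply/matrixP => i j; rewrite mxE row_mxEl row_mxEr !mxvecE !mxE.
by rewrite -reim.
Qed.

Lemma closure_le (T : topologicalType) (A : set T) (f : T -> R) (k : T) (c : R) :
  closure A k -> f x @[x --> k] --> f k -> (forall a, A a -> f a <= c) -> f k <= c.
Proof.
move=> clA cf hA; rewrite leNgt; apply/negP => ck.
have : nbhs k (f @^-1` [set y | c < y]).
  by apply: cf; apply: open_nbhs_nbhs; split; [exact: open_gt|].
by move=> /clA [a [Aa /=]]; rewrite ltNge hA.
Qed.
End ComplexMatrixTopology.

(** * Matrix exponential *)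

Section MatrixNorm.
Context {R : realType}.
Local Notation C := (cplx R).

Definition mnorm (m n : nat) (A : 'M[C]_(m, n)) : R := \sum_i \sum_j cabs (A i j).

Lemma mnorm_ge0 m n (A : 'M[C]_(m, n)) : 0 <= mnorm A.
Proof. by apply: sumr_ge0 => i _; apply: sumr_ge0 => j _; apply: cabs_ge0. Qed.

Lemma le_mnorm m n (A : 'M[C]_(m, n)) i j : cabs (A i j) <= mnorm A.
Proof.
rewrite /mnorm (bigD1 i)//= (bigD1 j)//= -addrA lerDl addr_ge0//.
  by apply: sumr_ge0 => k _; apply: cabs_ge0.
by apply: sumr_ge0 => k _; apply: sumr_ge0 => l _; apply: cabs_ge0.
Qed.

Lemma mnormD m n (A B : 'M[C]_(m, n)) : mnorm (A + B) <= mnorm A + mnorm B.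
Proof.
rewrite -big_split /=; apply: ler_sum => i _.
by rewrite -big_split /=; apply: ler_sum => j _; rewrite mxE cabsD.
Qed.

Lemma mnorm0 m n : mnorm (0 : 'M[C]_(m, n)) = 0.
Proof. by rewrite /mnorm big1 // => i _; rewrite big1 // => j _; rewrite mxE cabs0. Qed.

Lemma mnormZ m n c (A : 'M[C]_(m, n)) : mnorm (c *: A) = cabs c * mnorm A.
Proof.
rewrite mulr_sumr; apply: eq_bigr => i _; rewrite mulr_sumr.
by apply: eq_bigr => j _; rewrite mxE cabsM.
Qed.

Lemma mnormM m n p (A : 'M[C]_(m, n)) (B : 'M[C]_(n, p)) :
  mnorm (A *m B) <= mnorm A * mnorm B.
Proof.
rewrite /mnorm mulr_suml; apply: ler_sum => i _.
apply: (@le_trans _ _ (\sum_j \sum_k cabs (A i k) * cabs (B k j))).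
  apply: ler_sum => j _; rewrite mxE (le_trans (cabs_sum _ _ _))//.
  by apply: ler_sum => k _; rewrite cabsM.
rewrite exchange_big mulr_suml; apply: ler_sum => k _.
rewrite -mulr_sumr ler_wpM2l ?cabs_ge0// [leRHS](bigD1 k)//= lerDl.
by apply: sumr_ge0 => l _; apply: sumr_ge0 => j _; apply: cabs_ge0.
Qed.

Lemma mnorm_sum (I : Type) (r : seq I) (P : pred I) m n (F : I -> 'M[C]_(m, n)) :
  mnorm (\sum_(i <- r | P i) F i) <= \sum_(i <- r | P i) mnorm (F i).
Proof.
elim/big_rec2: _ => [|i a b _ h]; first by rewrite mnorm0.
by rewrite (le_trans (mnormD _ _))// lerD2l.
Qed.

Lemma mnorm_le0 m n (A : 'M[C]_(m, n)) : mnorm A <= 0 -> A = 0.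
Proof.
move=> h; apply/matrixP => i j; rewrite mxE; apply/eqP; rewrite -cabs_eq0.
by rewrite eq_le cabs_ge0 andbT (le_trans (le_mnorm _ _ _) h).
Qed.

Lemma mnorm1 n : mnorm (1%:M : 'M[C]_n) = n%:R.
Proof.
rewrite /mnorm -[n in RHS]card_ord -sum1_card natr_sum; apply: eq_bigr => i _.
rewrite (bigD1 i)//= big1 ?addr0 => [|j ji]; first by rewrite mxE eqxx cabs1.
by rewrite mxE eq_sym (negbTE ji) cabs0.
Qed.

(** The sum of the absolute values of the entries is submultiplicative but gives [n] to the
    identity; the constant covers [k = 0]. *)
Lemma mnormX n (A : 'M[C]_n) k : mnorm (A ^+ k) <= n.+1%:R * mnorm A ^+ k.
Proof.
elim: k => [|k IH].
  by rewrite !expr0 mulr1 [mnorm _]mnorm1 ler_nat.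
rewrite exprS (le_trans (mnormM _ _))// exprS mulrCA.
by rewrite ler_wpM2l ?mnorm_ge0.
Qed.

Lemma mnorm_continuous m n : continuous (fun A : 'M[C]_(m, n) => mnorm A).
Proof.
move=> A; apply: (@cvg_bigsum _ _ _ (nbhs A)) => i _.
apply: (@cvg_bigsum _ _ _ (nbhs A)) => j _.
apply: (@cvg_app _ _ _ _ (nbhs A) _ (fun B => B i j)); first exact: cabs_continuous.
exact: coord_continuous.
Qed.

Lemma mnorm_cvg0 (T : Type) (F : set_system T) {FF : Filter F} m n
   (f : T -> 'M[C]_(m, n)) (l : 'M[C]_(m, n)) :
  mnorm (f x - l) @[x --> F] --> (0 : R) -> f x @[x --> F] --> l.
Proof.
move=> h; apply: cvg_mx => i j; apply/cvgrPdist_lt => e e0.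
have -> : e = toC (complex.Re e) by apply: ge0_toC; apply: ltW.
have /cvgrPdist_lt/(_ _ (gt0_re e0)) := h; apply: filterS => x.
rewrite sub0r normrN ger0_norm ?mnorm_ge0// => hx.
rewrite cabsE toC_lt (le_lt_trans _ hx)// -cabsN opprB.
by have := le_mnorm (f x - l) i j; rewrite !mxE.
Qed.
End MatrixNorm.

Section Mexp.
Context {R : realType}.
Local Notation C := (cplx R).

Definition mpart N (X : 'M[C]_N) (n : nat) : 'M[C]_N :=
  \sum_(k < n) (k`!%:R^-1 : C) *: X ^+ k.

Definition epart (x : R) (n : nat) : R := \sum_(k < n) x ^+ k / k`!%:R.

Lemma epartE x : epart x = series (exp_coeff x).
Proof. by apply/funext => n; rewrite /epart seriesEord. Qed.

Lemma epart_cvg x : epart x n @[n --> \oo] --> expR x.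
Proof. rewrite epartE; exact: is_cvg_series_exp_coeff. Qed.

Lemma epart_le x n : 0 <= x -> epart x n <= expR x.
Proof.
move=> x0; rewrite epartE; apply: nondecreasing_cvgn_le.
  move=> a b ab; apply: nondecreasing_series => // k _ _.
  by apply: divr_ge0 => //; apply: exprn_ge0.
exact: is_cvg_series_exp_coeff.
Qed.

Lemma cabs_invfact k : cabs (k`!%:R^-1 : C) = k`!%:R^-1.
Proof.
have -> : (k`!%:R^-1 : C) = toC (k`!%:R^-1) by rewrite fmorphV /= rmorph_nat.
by rewrite cabs_toC ger0_norm // invr_ge0.
Qed.

Lemma mexp_cvg_ex N (X : 'M[C]_N) : exists L : 'M[C]_N, mpart X n @[n --> \oo] --> L.
Proof.
pose x := mnorm X.
(* Real and imaginary part are both additive functions bounded by [cabs], so one argument serves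
   them, and only domination by the real exponential series is used. *)
have key (f : C -> R) : (forall z, `|f z| <= cabs z) -> (forall z w, f (z + w) = f z + f w) ->
   f 0 = 0 -> forall i j, cvgn (fun n => f (mpart X n i j)).
  move=> fle fD f0 i j.
  have -> : (fun n => f (mpart X n i j)) =
      series (fun k => f ((k`!%:R^-1 *: X ^+ k) i j)).
    apply/funext => n; rewrite seriesEord /mpart summxE /=.
    by elim/big_rec2: _ => // k a b _ <-; rewrite fD.
  apply: normed_cvg; apply: (@series_le_cvg _ _ (fun k => N.+1%:R * exp_coeff x k)).
  - by move=> k /=.
  - move=> k; apply: mulr_ge0 => //.
    by apply: divr_ge0 => //; apply: exprn_ge0; apply: mnorm_ge0.
  - move=> k /=; rewrite (le_trans (fle _))// (le_trans (le_mnorm _ _ _))//.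
    rewrite mnormZ cabs_invfact /exp_coeff /= mulrA mulrC ler_wpM2r ?invr_ge0//.
    exact: mnormX.
  exact: (@is_cvg_seriesZ _ (exp_coeff x) N.+1%:R (is_cvg_series_exp_coeff x)).
exists (\matrix_(i, j) (toC (limn (fun n => complex.Re (mpart X n i j))) +
   'i * toC (limn (fun n => @complex.Im R (mpart X n i j))))).
apply: cvg_mx => i j; rewrite mxE; apply: cvg_reim.
  rewrite reD re_toC re_iM im_toC oppr0 addr0.
  apply: key; [exact: re_le_cabs|exact: reD|by []].
rewrite imD im_toC im_iM re_toC add0r.
by apply: key; [exact: im_le_cabs|exact: imD|].
Qed.

Lemma mexp_cvg N (X : 'M[C]_N) : mpart X n @[n --> \oo] --> mexp X.
Proof.
have [L hL] := mexp_cvg_ex X.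
suff -> : mexp X = L by [].
by apply: cvg_lim hL; apply: norm_hausdorff.
Qed.

(** Intertwining, transposition and adjunction are polynomial identities on the partial sums;
    continuity carries them to the limit. *)
Lemma mexp_ext N1 N2 m n (f : 'M[C]_N1 -> 'M[C]_(m, n)) (g : 'M[C]_N2 -> 'M[C]_(m, n))
    (X : 'M[C]_N1) (Y : 'M[C]_N2) :
  continuous f -> continuous g -> (forall n, f (mpart X n) = g (mpart Y n)) ->
  f (mexp X) = g (mexp Y).
Proof.
move=> cf cg h.
have hf : f (mpart X k) @[k --> \oo] --> f (mexp X).
  exact: (@cvg_app _ _ f _ \oo _ _ _ cf (@mexp_cvg _ X)).
have hg : g (mpart Y k) @[k --> \oo] --> g (mexp Y).
  exact: (@cvg_app _ _ g _ \oo _ _ _ cg (@mexp_cvg _ Y)).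
rewrite -(cvg_lim (@norm_hausdorff _ _) hf) -(cvg_lim (@norm_hausdorff _ _) hg).
by under eq_fun do rewrite h.
Qed.

Lemma mexp_closed N (X : 'M[C]_N) (K : set 'M[C]_N) : closed K ->
  (forall n, K (mpart X n)) -> K (mexp X).
Proof. move=> cK h; apply: closed_cvg cK _ _ (@mexp_cvg _ X); exact: nearW. Qed.

Lemma big_triangle (V : zmodType) (f : nat -> nat -> V) n :
  \sum_(k < n) \sum_(i < k.+1) f i (k - i)%N = \sum_(i < n) \sum_(j < n - i) f i j.
Proof.
elim: n => [|n IH]; first by rewrite !big_ord0.
rewrite big_ord_recr /= IH [RHS]big_ord_recr /= subSnn big_ord1.
rewrite [X in _ + X = _]big_ord_recr /= subnn addrA; congr (_ + _).
rewrite -big_split /=; apply: eq_bigr => i _.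
by rewrite subSn ?(ltnW (ltn_ord i))// big_ord_recr.
Qed.

Lemma mpartD N (X Y : 'M[C]_N) n : X *m Y = Y *m X ->
  mpart (X + Y) n = \sum_(i < n) \sum_(j < n - i)
    ((i`!%:R^-1 * j`!%:R^-1 : C) *: (X ^+ i *m Y ^+ j)).
Proof.
move=> cXY.
rewrite -(@big_triangle _ (fun i j => (i`!%:R^-1 * j`!%:R^-1 : C) *: (X ^+ i *m Y ^+ j))).
apply: eq_bigr => k _; rewrite addrC exprDn_comm; last exact: esym.
rewrite scaler_sumr; apply: eq_bigr => i _.
have ik : (i <= k)%N by rewrite -ltnS.
have -> : X ^+ i *m Y ^+ (k - i) = Y ^+ (k - i) * X ^+ i.
  by apply: commrX; apply: commr_sym; apply: commrX.
rewrite -(scaler_nat 'C(k, i)) scalerA; congr (_ *: _).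
have := bin_fact ik => /(congr1 (fun n => n%:R : C)); rewrite !natrM => <-.
have f0 a : (a`!%:R : C) != 0 by rewrite pnatr_eq0 -lt0n fact_gt0.
have b0 : ('C(k, i)%:R : C) != 0 by rewrite pnatr_eq0 -lt0n bin_gt0.
by field; rewrite !f0 b0.
Qed.

Lemma epartD x y n : epart (x + y) n = \sum_(i < n) \sum_(j < n - i)
    (i`!%:R^-1 * j`!%:R^-1) * (x ^+ i * y ^+ j).
Proof.
rewrite -(@big_triangle _ (fun i j => (i`!%:R^-1 * j`!%:R^-1 : R) * (x ^+ i * y ^+ j))).
apply: eq_bigr => k _; rewrite addrC exprDn mulr_suml; apply: eq_bigr => i _.
have ik : (i <= k)%N by rewrite -ltnS.
have := bin_fact ik => /(congr1 (fun n => n%:R : R)); rewrite !natrM => <-.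
have f0 a : (a`!%:R : R) != 0 by rewrite pnatr_eq0 -lt0n fact_gt0.
have b0 : ('C(k, i)%:R : R) != 0 by rewrite pnatr_eq0 -lt0n bin_gt0.
by rewrite -[_ *+ 'C(k, i)]mulr_natl; field; rewrite !f0 b0.
Qed.

Lemma big_square_sub (V : zmodType) (f : nat -> nat -> V) n :
  \sum_(i < n) \sum_(j < n) f i j - \sum_(i < n) \sum_(j < n - i) f i j =
  \sum_(i < n) \sum_(n - i <= j < n) f i j.
Proof.
rewrite -sumrB; apply: eq_bigr => i _.
rewrite -!(big_mkord xpredT (f i)) (big_cat_nat (n := n - i)) ?leq_subr//=.
by rewrite addrAC subrr add0r.
Qed.

(** The product of the partial sums runs over a square of indices, the partial sum at [X + Y] over a
    triangle. The difference is bounded, up to a constant, by the same difference for the real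
    numbers [x] and [y], which tends to 0 because [expR] is multiplicative. *)
Lemma mexpD N (X Y : 'M[C]_N) : X *m Y = Y *m X ->
  mexp (X + Y) = mexp X *m mexp Y.
Proof.
move=> cXY; pose x := mnorm X; pose y := mnorm Y.
have x0 : 0 <= x by exact: mnorm_ge0.
have y0 : 0 <= y by exact: mnorm_ge0.
pose D n := mpart X n *m mpart Y n - mpart (X + Y) n.
pose r n := N.+1%:R ^+ 2 * (epart x n * epart y n - epart (x + y) n).
have Dr n : mnorm (D n) <= r n.
  have -> : D n = \sum_(i < n) \sum_(n - i <= j < n)
      ((i`!%:R^-1 * j`!%:R^-1 : C) *: (X ^+ i *m Y ^+ j)).
    rewrite -(@big_square_sub _ (fun i j => (i`!%:R^-1 * j`!%:R^-1 : C) *: (X ^+ i *m Y ^+ j))).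
    rewrite /D mpartD //; congr (_ - _); rewrite /mpart mulmx_suml.
    apply: eq_bigr => i _; rewrite mulmx_sumr; apply: eq_bigr => j _.
    by rewrite -scalemxAl -scalemxAr scalerA.
  have -> : r n = N.+1%:R ^+ 2 * \sum_(i < n) \sum_(n - i <= j < n)
      ((i`!%:R^-1 * j`!%:R^-1) * (x ^+ i * y ^+ j)).
    rewrite -(@big_square_sub _ (fun i j => (i`!%:R^-1 * j`!%:R^-1) * (x ^+ i * y ^+ j))).
    rewrite /r epartD; congr (_ * (_ - _)); rewrite /epart mulr_suml.
    by apply: eq_bigr => i _; rewrite mulr_sumr; apply: eq_bigr => j _; rewrite mulrACA mulrC.
  rewrite (le_trans (mnorm_sum _ _ _))// mulr_sumr; apply: ler_sum => i _.
  rewrite (le_trans (mnorm_sum _ _ _))// mulr_sumr; apply: ler_sum => j _.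
  rewrite mnormZ cabsM !cabs_invfact mulrCA ler_wpM2l ?mulr_ge0 ?invr_ge0//.
  rewrite (le_trans (mnormM _ _))// expr2 mulrACA.
  by apply: ler_pM; rewrite ?mnorm_ge0 ?mnormX.
have hD : D n @[n --> \oo] --> mexp X *m mexp Y - mexp (X + Y).
  by apply: cvgB; [apply: cvg_mulmx|]; exact: mexp_cvg.
have hr : r n @[n --> \oo] --> N.+1%:R ^+ 2 * (expR x * expR y - expR (x + y)).
  apply: cvgM; first exact: cvg_cst.
  by apply: cvgB; [apply: cvgM|]; exact: epart_cvg.
have hN : mnorm (D n) @[n --> \oo] --> mnorm (mexp X *m mexp Y - mexp (X + Y)).
  by apply: (cvg_app (@mnorm_continuous _ _ _)); exact: hD.
have : mnorm (mexp X *m mexp Y - mexp (X + Y)) <=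
    N.+1%:R ^+ 2 * (expR x * expR y - expR (x + y)).
  exact: ler_cvg_to hN hr (nearW _ Dr).
rewrite expRD subrr mulr0 => h0; have := mnorm_le0 h0 => /eqP.
by rewrite subr_eq0 => /eqP.
Qed.

Lemma mpart0 N n : mpart (0 : 'M[C]_N) n.+1 = 1%:M.
Proof.
rewrite /mpart big_ord_recl /= expr0 fact0 invr1 scale1r big1 ?addr0// => k _.
by rewrite exprS mul0r scaler0.
Qed.

Lemma mexp0 N : mexp (0 : 'M[C]_N) = 1%:M.
Proof.
have h : mpart (0 : 'M[C]_N) n @[n --> \oo] --> (1%:M : 'M[C]_N).
  by apply: cvg_near_cst; exists 1%N => // -[//|k] _; apply: mpart0.
exact: (cvg_lim (@norm_hausdorff _ _) h).
Qed.

Lemma mexpNr N (X : 'M[C]_N) : mexp X *m mexp (- X) = 1%:M.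
Proof. by rewrite -mexpD ?subrr ?mexp0// mulmxN mulNmx. Qed.
Lemma mexpNl N (X : 'M[C]_N) : mexp (- X) *m mexp X = 1%:M.
Proof. by rewrite -{2}(opprK X) mexpNr. Qed.
Lemma mexp_unit N (X : 'M[C]_N) : mexp X \in unitmx.
Proof. have [u _] := mulmx1_unit (mexpNr X); exact: u. Qed.
Lemma mexpN N (X : 'M[C]_N) : mexp (- X) = invmx (mexp X).
Proof.
by rewrite -[LHS]mulmx1 -(mulmxV (mexp_unit X)) mulmxA mexpNl mul1mx.
Qed.

Lemma mulmxl_continuous m n p (A : 'M[C]_(m, n)) : continuous (fun B : 'M[C]_(n, p) => A *m B).
Proof. by move=> B; apply: (@cvg_mulmx _ _ (nbhs B)); [exact: cvg_cst|exact: cvg_id]. Qed.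
Lemma mulmxr_continuous m n p (A : 'M[C]_(n, p)) : continuous (fun B : 'M[C]_(m, n) => B *m A).
Proof. by move=> B; apply: (@cvg_mulmx _ _ (nbhs B)); [exact: cvg_id|exact: cvg_cst]. Qed.

Lemma mexp_intertwine N1 N2 (A : 'M[C]_(N1, N2)) X Y : X *m A = A *m Y ->
  mexp X *m A = A *m mexp Y.
Proof.
move=> XA; apply: (@mexp_ext N1 N2 N1 N2 (fun B => B *m A) (fun B => A *m B)).
- exact: mulmxr_continuous.
- exact: mulmxl_continuous.
have h j : X ^+ j *m A = A *m Y ^+ j.
  elim: j => [|j IH]; first by rewrite !expr0; apply: etrans (mul1mx A) (esym (mulmx1 A)).
  rewrite exprS exprSr -[X * X ^+ j]/(X *m X ^+ j) -[Y ^+ j * Y]/(Y ^+ j *m Y).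
  by rewrite -mulmxA IH mulmxA XA -!mulmxA -[Y *m _]/(Y * _) -[_ *m Y]/(_ * Y) -exprS -exprSr.
move=> n; rewrite mulmx_suml mulmx_sumr; apply: eq_bigr => k _.
by rewrite -scalemxAl -scalemxAr h.
Qed.

Lemma mexp_comm N (A X : 'M[C]_N) : A *m X = X *m A -> A *m mexp X = mexp X *m A.
Proof. by move=> h; rewrite (mexp_intertwine (A := A) (Y := X)). Qed.

Lemma mexp_conj N (U X : 'M[C]_N) : U \in unitmx ->
  mexp (U *m X *m invmx U) = U *m mexp X *m invmx U.
Proof.
move=> uU; rewrite -[LHS]mulmx1 -(mulmxV uU) mulmxA; congr (_ *m _).
by apply: mexp_intertwine; rewrite mulmxKV.
Qed.

Lemma mexp_conjV N (U X : 'M[C]_N) : U \in unitmx ->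
  mexp (invmx U *m X *m U) = invmx U *m mexp X *m U.
Proof. by move=> uU; have := @mexp_conj _ (invmx U) X; rewrite invmxK unitmx_inv; apply. Qed.

Lemma tr_expr N (X : 'M[C]_N) k : (X ^+ k)^T = X^T ^+ k.
Proof.
elim: k => [|k IH]; first by rewrite !expr0 trmx1.
by rewrite exprS exprSr -IH; exact: trmx_mul.
Qed.

Lemma mexp_tr N (X : 'M[C]_N) : mexp X^T = (mexp X)^T.
Proof.
apply: (@mexp_ext N N N N id trmx); first by move=> x; apply: cvg_id.
  by move=> A; apply: (@cvg_tr _ _ (nbhs A) _ N N id); exact: cvg_id.
move=> n; rewrite raddf_sum; apply: eq_bigr => k _.
by rewrite /= linearZ /= tr_expr.
Qed.

Lemma starE m n (A : 'M[C]_(m, n)) i j : (A^t*) i j = Num.conj (A j i).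
Proof. by rewrite !mxE. Qed.
Lemma star_mul m n p (A : 'M[C]_(m, n)) (B : 'M[C]_(n, p)) :
  (A *m B)^t* = B^t* *m A^t*.
Proof. by rewrite trmx_mul map_mxM. Qed.
Lemma starD m n (A B : 'M[C]_(m, n)) : (A + B)^t* = A^t* + B^t*.
Proof. by rewrite raddfD map_mxD. Qed.
Lemma starN m n (A : 'M[C]_(m, n)) : (- A)^t* = - A^t*.
Proof. by rewrite raddfN map_mxN. Qed.
Lemma starB m n (A B : 'M[C]_(m, n)) : (A - B)^t* = A^t* - B^t*.
Proof. by rewrite starD starN. Qed.
Lemma starZ m n c (A : 'M[C]_(m, n)) : (c *: A)^t* = Num.conj c *: A^t*.
Proof. by rewrite linearZ map_mxZ. Qed.
Lemma star1 n : (1%:M : 'M[C]_n)^t* = 1%:M.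
Proof. by rewrite trmx1 map_mx1. Qed.
Lemma star0 m n : (0 : 'M[C]_(m, n))^t* = 0.
Proof. by rewrite trmx0 map_mx0. Qed.
Lemma star_sum (I : Type) (r : seq I) (P : pred I) m n (F : I -> 'M[C]_(m, n)) :
  (\sum_(i <- r | P i) F i)^t* = \sum_(i <- r | P i) (F i)^t*.
Proof. by elim/big_rec2: _ => [|i a b _ <-]; rewrite ?star0 ?starD. Qed.
Lemma star_expr N (X : 'M[C]_N) k : (X ^+ k)^t* = (X^t*) ^+ k.
Proof.
elim: k => [|k IH]; first by rewrite !expr0 star1.
by rewrite exprS exprSr -IH; exact: star_mul.
Qed.
Lemma starK m n (A : 'M[C]_(m, n)) : A^t*^t* = A.
Proof. exact: trmxCK. Qed.
Lemma star_unit n (A : 'M[C]_n) : (A^t* \in unitmx) = (A \in unitmx).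
Proof. by rewrite map_unitmx unitmx_tr. Qed.
Lemma star_inv n (A : 'M[C]_n) : (invmx A)^t* = invmx (A^t*).
Proof. by rewrite trmx_inv map_invmx. Qed.
Lemma tr_star n (A : 'M[C]_n) : \tr (A^t*) = Num.conj (\tr A).
Proof. by rewrite /mxtrace rmorph_sum; apply: eq_bigr => i _; rewrite !mxE. Qed.
Lemma det_star n (A : 'M[C]_n) : \det (A^t*) = Num.conj (\det A).
Proof. by rewrite det_map_mx det_tr. Qed.

Lemma mexp_star N (X : 'M[C]_N) : mexp (X^t*) = (mexp X)^t*.
Proof.
apply: (@mexp_ext N N N N (fun A => A) (fun A : 'M[C]_N => A^t*) (X^t*) X).
  by move=> x; apply: cvg_id.
  by move=> A; apply: (@cvg_star _ _ (nbhs A) _ N N id); exact: cvg_id.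
move=> n; rewrite star_sum; apply: eq_bigr => k _.
rewrite starZ star_expr; congr (_ *: _).
by rewrite fmorphV rmorph_nat.
Qed.

Lemma mexp_rem_bound N (Z : 'M[C]_N) :
  mnorm (mexp Z - (1%:M + Z + 2^-1 *: (Z *m Z))) <=
  N.+1%:R * mnorm Z ^+ 3 * expR (mnorm Z).
Proof.
pose z := mnorm Z; have z0 : 0 <= z by exact: mnorm_ge0.
pose T : 'M[C]_N := 1%:M + Z + 2^-1 *: (Z *m Z).
have h n : mnorm (mpart Z (n + 3) - T) <= N.+1%:R * z ^+ 3 * expR z.
  have -> : mpart Z (n + 3) - T = \sum_(k < n) ((k + 3)`!%:R^-1 : C) *: Z ^+ (k + 3).
    have T3 : mpart Z 3 = T.
      rewrite /mpart !big_ord_recl big_ord0 /= /bump /= !fact0 factS fact0 expr0 expr1 expr2.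
      by rewrite !invr1 !scale1r addr0 addrA.
    rewrite addnC {1}/mpart big_split_ord /= -/(mpart Z 3) T3 addrAC subrr add0r.
    by apply: eq_bigr => k _; rewrite addnC.
  rewrite (le_trans (mnorm_sum _ _ _))//.
  apply: (@le_trans _ _ (N.+1%:R * z ^+ 3 * epart z n)); last first.
    by rewrite ler_wpM2l ?epart_le// mulr_ge0// exprn_ge0.
  rewrite mulr_sumr; apply: ler_sum => k _.
  rewrite mnormZ cabs_invfact -mulrA mulrCA.
  apply: (@le_trans _ _ (((k + 3)`!%:R)^-1 * (N.+1%:R * z ^+ (k + 3)))).
    by rewrite ler_wpM2l ?invr_ge0// mnormX.
  rewrite exprD [X in _ <= X](_ : _ = (k`!%:R)^-1 * (N.+1%:R * (z ^+ k * z ^+ 3))); last by ring.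
  rewrite ler_wpM2r ?mulr_ge0 ?exprn_ge0// lef_pV2 ?posrE ?ltr0n ?fact_gt0//.
  by rewrite ler_nat addn3 !factS !mulnA leq_pmull // !muln_gt0.
have hl : mpart Z (n + 3) - T @[n --> \oo] --> mexp Z - T.
  by apply: cvgB; [rewrite (cvg_shiftn 3 (mpart Z)); exact: mexp_cvg|exact: cvg_cst].
have hN : mnorm (mpart Z (n + 3) - T) @[n --> \oo] --> mnorm (mexp Z - T).
  by apply: (cvg_app (@mnorm_continuous _ _ _)); exact: hl.
exact: ler_cvg_to hN (cvg_cst _) (nearW _ h).
Qed.

(** Replaces differentiation of one-parameter groups: the expansion is exact for every [t], and the
    limit of [H] carries the second-order term. *)
Lemma mexp_taylor2 N (X : 'M[C]_N) : exists H : R -> 'M[C]_N,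
  (forall t, mexp (toC t *: X) = 1%:M + toC t *: X + toC (t ^+ 2) *: H t) /\
  H t @[t --> (0 : R)] --> 2^-1 *: (X *m X).
Proof.
pose L : 'M[C]_N := 2^-1 *: (X *m X).
(* At [t = 0] the remainder is given its limit as value; the identity holds there for any value. *)
pose H t : 'M[C]_N := if t == 0 then L else
  toC (t ^- 2) *: (mexp (toC t *: X) - 1%:M - toC t *: X).
exists H; split.
  move=> t; rewrite /H; case: eqP => [->|/eqP t0].
    by rewrite expr0n /= rmorph0 !scale0r mexp0 !addr0.
  rewrite scalerA -rmorphM /= divff ?expf_neq0// rmorph1 scale1r.
  by rewrite -addrA [X in _ = _ + X]addrC subrK addrC subrK.
pose x := mnorm X; have x0 : 0 <= x by exact: mnorm_ge0.
pose c := N.+1%:R * x ^+ 3 * expR x.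
have c0 : 0 <= c by rewrite !mulr_ge0 ?exprn_ge0 ?expR_ge0.
have hb t : `|t| <= 1 -> mnorm (H t - L) <= `|t| * c.
  move=> t1; rewrite /H; case: eqP => [->|/eqP t0].
    by rewrite subrr mnorm0 mulr_ge0.
  have := mexp_rem_bound (toC t *: X).
  rewrite mnormZ cabs_toC -/x => h.
  have -> : toC (t ^- 2) *: (mexp (toC t *: X) - 1%:M - toC t *: X) - L =
    toC (t ^- 2) *: (mexp (toC t *: X) - (1%:M + toC t *: X + 2^-1 *: ((toC t *: X) *m (toC t *: X)))).
    rewrite !opprD !addrA [in RHS]scalerBr; congr (_ - _).
    rewrite -scalemxAl -scalemxAr !scalerA -/L; congr (_ *: _).
    have -> : toC (t ^- 2) * 2^-1 * toC t * toC t = toC (t ^- 2 * t ^+ 2) * 2^-1.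
      by rewrite [in RHS]rmorphM /= [in RHS]expr2 [X in _ = _ * X * _]rmorphM /=; ring.
    by rewrite mulVf ?expf_neq0// rmorph1 mul1r.
  rewrite mnormZ cabs_toC normfV normrX.
  rewrite ler_pdivrMl ?exprn_gt0 ?normr_gt0//.
  apply: (le_trans h); rewrite exprMn.
  rewrite [leRHS](_ : _ = N.+1%:R * (`|t| ^+ 3 * x ^+ 3) * expR x); last by rewrite /c; ring.
  rewrite ler_wpM2l ?mulr_ge0 ?exprn_ge0//.
  by rewrite ler_expR ler_piMl.
apply: mnorm_cvg0; apply/cvgrPdist_lt => e e0; near=> t.
rewrite sub0r normrN ger0_norm ?mnorm_ge0//.
have t1 : `|t| <= 1 by near: t; apply: (@cvgr0_norm_le _ _ _ _ _ id) => //; exact: cvg_id.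
apply: (le_lt_trans (hb t t1)).
have : `|t| < e / (c + 1).
  near: t; apply: (@cvgr0_norm_lt _ _ _ _ _ id); first exact: cvg_id.
  by rewrite divr_gt0// ltr_wpDl.
rewrite ltr_pdivlMr ?ltr_wpDl//; apply: le_lt_trans.
by rewrite ler_wpM2l// lerDl.
Unshelve. all: by end_near. Qed.

Lemma mexp_nilp N (X : 'M[C]_N) n : X ^+ n = 0 -> mexp X = mpart X n.
Proof.
move=> Xn; have h : mpart X k @[k --> \oo] --> mpart X n.
  apply: cvg_near_cst; exists n => // k /= nk; rewrite -(subnKC nk).
  rewrite /mpart big_split_ord /= [X in _ + X]big1 ?addr0// => i _.
  by rewrite exprD Xn mul0r scaler0.
exact: (cvg_lim (@norm_hausdorff _ _) h).
Qed.
End Mexp.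

(** * Functional calculus *)

(* Equations between matrices are closed syntactically: comparing two distinct
   matrices over the concrete field cplx R up to conversion may not end. *)
Ltac mx_done :=
  with_strategy opaque [mulmx invmx diag_mx map_mx trmx scalar_mx mexp cplx]
  match goal with
  | |- @eq _ ?x ?y => constr_eq x y; exact (erefl x)
  | H : @eq _ ?a ?b |- @eq _ ?x ?y => constr_eq a x; constr_eq b y; exact H
  | |- _ => exact: erefl
  | H : @eq _ _ _ |- _ => exact: H
  end.

Ltac old_done :=
  trivial; hnf; intros; solve
   [ do ![solve [trivial | apply: sym_equal; trivial]
         | discriminate | contradiction | split]
   | match goal with H : ~ _ |- _ => solve [case H; trivial] end ].

Ltac core_done :=
  intros;
  lazymatch goal with
  | |- @eq ?T _ _ =>
      let U := eval hnf in T in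
      lazymatch U with
      | matrix _ _ _ => mx_done
      | _ => old_done
      end
  | _ => first [assumption | old_done]
  end.

Ltac done ::=
  lazymatch goal with
  | |- forall _, _ => first [assumption | core_done]
  | _ => core_done
  end.

Fact cexp_key : unit. Proof. exact: tt. Qed.

Section ScalarExp.
Context {R : realType}.
Local Notation C := (cplx R).

(* Locked: its body is a matrix coefficient, which rewriting with mxE would
   otherwise try to unfold. *)
Definition cexp (z : C) : C :=
  locked_with cexp_key (fun w : C => mexp (w%:M : 'M[C]_1) ord0 ord0) z.

Lemma cexpE z : cexp z = mexp (z%:M : 'M[C]_1) ord0 ord0.
Proof. by rewrite /cexp unlock. Qed.

Lemma mexp_scalar1 (z : C) : mexp (z%:M : 'M[C]_1) = (cexp z)%:M.
Proof. by rewrite cexpE; exact: mx11_scalar. Qed.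

Lemma cexpD z w : cexp (z + w) = cexp z * cexp w.
Proof.
rewrite {1}cexpE raddfD /= mexpD ?mexp_scalar1; last exact: scalar_mxC.
by rewrite -scalar_mxM mxE eqxx mulr1n.
Qed.

Lemma cexp0 : cexp 0 = 1.
Proof. by rewrite cexpE raddf0 mexp0 mxE eqxx. Qed.

Lemma cexp_sum (I : Type) (r : seq I) (P : pred I) (F : I -> C) :
  cexp (\sum_(i <- r | P i) F i) = \prod_(i <- r | P i) cexp (F i).
Proof. by elim/big_rec2: _ => [|i a b _ <-]; rewrite ?cexp0 ?cexpD. Qed.

Lemma scalar_expr N (z : C) k : (z%:M : 'M[C]_N) ^+ k = (z ^+ k)%:M.
Proof. elim: k => [|k IH]; first exact: erefl.
rewrite !exprS IH; exact: (esym (@scalar_mxM _ _ _ _)). Qed.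

Lemma cexp_cvg z : \sum_(k < n) (k`!%:R^-1 : C) * z ^+ k @[n --> \oo] --> cexp z.
Proof.
have h : mpart (z%:M : 'M[C]_1) n ord0 ord0 @[n --> \oo] --> cexp z.
  by rewrite cexpE; apply: cvg_coord; exact: mexp_cvg.
suff E : (fun n => mpart (z%:M : 'M[C]_1) n ord0 ord0) =
  (fun n => \sum_(k < n) (k`!%:R^-1 : C) * z ^+ k) by move: h; rewrite E.
apply/funext => n; rewrite /mpart summxE; apply: eq_bigr => k _.
by rewrite scalar_expr !mxE mulr1n.
Qed.

Lemma invfact_toC k : (k`!%:R^-1 : C) = toC (k`!%:R^-1).
Proof. by rewrite fmorphV /= rmorph_nat. Qed.

Lemma cexp_toC x : cexp (toC x) = toC (expR x).
Proof.
have h : toC (epart x n) @[n --> \oo] --> toC (expR x).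
  by apply: (cvg_app toC_continuous); exact: epart_cvg.
have h2 := @cexp_cvg (toC x).
suff E : (fun n => \sum_(k < n) (k`!%:R^-1 : C) * toC x ^+ k) = (fun n => toC (epart x n)).
  by rewrite E in h2; exact: (cvg_unique (@norm_hausdorff _ _) h2 h).
apply/funext => n; rewrite rmorph_sum; apply: eq_bigr => k _.
by rewrite invfact_toC -rmorphXn -rmorphM mulrC.
Qed.

Lemma expi k : ('i : C) ^+ k = (-1) ^+ k./2 * (if odd k then 'i else 1).
Proof.
rewrite -{1}(odd_double_half k) exprD -mul2n exprM sqrCi mulrC.
by case: (odd k).
Qed.

Lemma cexp_iM t : cexp ('i * toC t) = toC (cos t) + 'i * toC (sin t).
Proof.
have h := @cexp_cvg ('i * toC t).
have hr : series (cos_coeff t) n @[n --> \oo] --> cos t.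
  by rewrite cos.unlock; exact: is_cvg_series_cos_coeff.
have hi : series (sin_coeff t) n @[n --> \oo] --> sin t.
  by rewrite sin.unlock; exact: is_cvg_series_sin_coeff.
have term k : (k`!%:R^-1 : C) * ('i * toC t) ^+ k =
   toC (cos_coeff t k) + 'i * toC (sin_coeff t k).
  rewrite exprMn expi /cos_coeff /sin_coeff /= !rmorphM /= !rmorph_nat fmorphV /=.
  rewrite !rmorph_nat !rmorphXn /= !rmorphN1.
  case: (boolP (odd k)) => ok /=; last by rewrite !mul0r mulr0 addr0; ring.
  have -> : k.-1./2 = k./2 by case: k ok => //= k ok; rewrite uphalf_half (negbTE ok).
  by rewrite !mul0r add0r; ring.
have E n : \sum_(k < n) (k`!%:R^-1 : C) * ('i * toC t) ^+ k =
   toC (series (cos_coeff t) n) + 'i * toC (series (sin_coeff t) n).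
  rewrite !seriesEord /= !rmorph_sum mulr_sumr -big_split; apply: eq_bigr => k _.
  exact: term.
rewrite (funext E) in h.
apply: (cvg_unique (@norm_hausdorff _ _) h).
apply: cvgD; first by apply: (cvg_app toC_continuous); exact: hr.
by apply: cvgM; [exact: cvg_cst|apply: (cvg_app toC_continuous); exact: hi].
Qed.

Lemma diag_expr N (d : 'rV[C]_N) k : diag_mx d ^+ k = diag_mx (map_mx (fun z => z ^+ k) d).
Proof.
elim: k => [|k IH].
  by apply/matrixP => i j; rewrite expr0 !mxE expr0.
rewrite exprS IH -[_ * _]/(_ *m _) mulmx_diag; congr diag_mx.
by apply/rowP => i; rewrite !mxE exprS.
Qed.

Lemma mexp_diag N (d : 'rV[C]_N) : mexp (diag_mx d) = diag_mx (map_mx cexp d).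
Proof.
have h : mpart (diag_mx d) n @[n --> \oo] --> diag_mx (map_mx cexp d).
  apply: cvg_mx => i j; rewrite !mxE.
  rewrite (_ : (fun n => _) = fun n => (\sum_(k < n) (k`!%:R^-1 : C) * d ord0 i ^+ k) *+ (i == j)).
    by case: eqP => _; rewrite ?mulr1n; [exact: cexp_cvg|exact: cvg_cst].
  apply/funext => n; rewrite /mpart summxE -sumrMnl; apply: eq_bigr => k _.
  by rewrite diag_expr !mxE mulrnAr.
exact: (cvg_lim (@norm_hausdorff _ _) h).
Qed.

Lemma trig_mulmx N (A B : 'M[C]_N) : is_trig_mx A -> is_trig_mx B ->
  is_trig_mx (A *m B) /\ forall i, (A *m B) i i = A i i * B i i.
Proof.
move=> /is_trig_mxP tA /is_trig_mxP tB; split.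
  apply/is_trig_mxP => i j ij; rewrite mxE big1 // => k _.
  case: (ltnP i k) => ik; first by rewrite tA ?mul0r.
  by rewrite tB ?mulr0 // (leq_ltn_trans ik).
move=> i; rewrite mxE (bigD1 i) //= big1 ?addr0 // => k ki.
case: (ltnP i k) => ik; first by rewrite tA ?mul0r.
by rewrite tB ?mulr0 // ltn_neqAle ik andbT; apply: contraNneq ki => /val_inj ->.
Qed.

Lemma trig_expr N (A : 'M[C]_N) k : is_trig_mx A ->
  is_trig_mx (A ^+ k) /\ forall i, (A ^+ k) i i = A i i ^+ k.
Proof.
move=> tA; elim: k => [|k [IH1 IH2]].
  by rewrite expr0; split; [exact: scalar_mx_is_trig|move=> i; rewrite mxE eqxx].
by have [h1 h2] := trig_mulmx tA IH1; rewrite exprS; split => // i; rewrite h2 IH2 exprS.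
Qed.

Lemma mexp_trig N (A : 'M[C]_N) : is_trig_mx A ->
  is_trig_mx (mexp A) /\ forall i, mexp A i i = cexp (A i i).
Proof.
move=> tA.
have h i j : mpart A n i j @[n --> \oo] --> mexp A i j.
  by apply: cvg_coord; exact: mexp_cvg.
split.
  apply/is_trig_mxP => i j ij.
  apply: (cvg_unique (@norm_hausdorff _ _) (h i j)).
  apply: cvg_near_cst; apply: nearW => n; rewrite /mpart summxE big1 // => k _.
  have [/is_trig_mxP/(_ i j ij) hk _] := trig_expr k tA.
  by rewrite mxE hk mulr0.
move=> i; suff E : (fun n => mpart A n i i) = (fun n => (\sum_(k < n) (k`!%:R^-1 : C) * A i i ^+ k)).
  move: (h i i); rewrite E => h1; apply: (cvg_unique (@norm_hausdorff _ _) h1).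
  exact: cexp_cvg.
apply/funext => n; rewrite /mpart summxE; apply: eq_bigr => k _.
by have [_ hk] := trig_expr k tA; rewrite mxE hk.
Qed.

(** Unitary triangularization changes neither trace nor determinant, and on triangular matrices the
    exponential acts separately on each diagonal entry. *)
Lemma det_mexp N (X : 'M[C]_N) : \det (mexp X) = cexp (\tr X).
Proof.
case: N X => [|N] X; first by rewrite det_mx00 /mxtrace big_ord0 cexp0.
have [//|P uP /=] := @Schur _ _ X _.
rewrite /similar_to /= conjymx // -invmx_unitary // => tP.
have uPm := unitarymx_unit uP.
have <- : \det (P *m mexp X *m invmx P) = \det (mexp X).
  by rewrite !det_mulmx det_inv mulrAC divrr ?mul1r // -unitmxE.
have <- : \tr (P *m X *m invmx P) = \tr X.
  by rewrite mxtrace_mulC mulmxA mulVmx // mul1mx.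
rewrite -mexp_conj //; have [t1 t2] := mexp_trig tP.
by rewrite (det_trig t1) cexp_sum; apply: eq_bigr => i _.
Qed.
End ScalarExp.

Section ComplexParts.
Context {R : realType}.
Local Notation C := (cplx R).
Implicit Types (x : R) (z w : C).

Definition cre z : R := complex.Re z.
Definition cim z : R := @complex.Im R z.
Lemma creD z w : cre (z + w) = cre z + cre w. Proof. exact: reD. Qed.
Lemma creN z : cre (- z) = - cre z. Proof. exact: reN. Qed.
Lemma cre0 : cre 0 = 0. Proof. by []. Qed.
Lemma cre_toC x : cre (toC x) = x. Proof. by []. Qed.
Lemma cim_toC x : cim (toC x) = 0. Proof. by []. Qed.
Lemma cre_toCM x z : cre (toC x * z) = x * cre z. Proof. exact: re_toCM. Qed.
Lemma cre_conj z : cre (Num.conj z) = cre z. Proof. exact: re_conj. Qed.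
Lemma cim_conj z : cim (Num.conj z) = - cim z. Proof. exact: im_conj. Qed.
Lemma creim z : z = toC (cre z) + 'i * toC (cim z). Proof. exact: reim. Qed.
Lemma cre_iM z : cre ('i * z) = - cim z. Proof. exact: re_iM. Qed.
Lemma ccrealP z : reflect (z = toC (cre z)) (z \is Num.real).
Proof. exact: CrealP. Qed.
Lemma ge0_ctoC z : 0 <= z -> z = toC (cre z). Proof. exact: ge0_toC. Qed.
Lemma cre_continuous : continuous (fun z : C => cre z).
Proof. exact: re_continuous. Qed.
Lemma trformE N (X Y : 'M[C]_N) : trform X Y = - cre (\tr (X *m Y)).
Proof. by []. Qed.
Lemma cabs_sqr z : cabs z ^+ 2 = cre z ^+ 2 + cim z ^+ 2.
Proof. apply: toC_inj; rewrite rmorphXn /= -cabsE; exact: (esym (add_Re2_Im2 z)). Qed.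
End ComplexParts.

Section FunctionalCalculus.
Variables (C : numClosedFieldType) (N : nat).
Local Notation M := 'M[C]_N.
Implicit Types (A B F G U W : M) (a : 'rV[C]_N) (f : C -> C).

(** Functional calculus as a relation, so that any diagonalization may serve as witness;
    [fcalc_intertwine] with [W = 1] shows that [F] does not depend on it. *)
Definition fcalc A f F := exists U a,
  [/\ U \in unitmx, A = invmx U *m diag_mx a *m U &
      F = invmx U *m diag_mx (map_mx f a) *m U].

Lemma mul_diagE (m : nat) (d : 'rV[C]_m) (A : 'M[C]_m) i j :
  (diag_mx d *m A) i j = d ord0 i * A i j.
Proof.
rewrite mxE (bigD1 i) //= big1 ?addr0 => [|k ki]; first by rewrite mxE eqxx mulr1n.
by rewrite mxE eq_sym (negbTE ki) mulr0n mul0r.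
Qed.

Lemma diag_mulE (m : nat) (d : 'rV[C]_m) (A : 'M[C]_m) i j :
  (A *m diag_mx d) i j = A i j * d ord0 j.
Proof.
rewrite mxE (bigD1 j) //= big1 ?addr0 => [|k ki]; first by rewrite mxE eqxx mulr1n.
by rewrite mxE (negbTE ki) mulr0n mulr0.
Qed.

(** Entrywise, [a i] and [b j] agree wherever [W i j] is nonzero, and then so do their values under
    [f]. *)
Lemma diag_intertwine (a b : 'rV[C]_N) f W : diag_mx a *m W = W *m diag_mx b ->
  diag_mx (map_mx f a) *m W = W *m diag_mx (map_mx f b).
Proof.
move=> h; apply/matrixP => i j; rewrite mul_diagE diag_mulE !mxE.
have := congr1 (fun Z : M => Z i j) h; rewrite mul_diagE diag_mulE mulrC => /eqP.
rewrite -subr_eq0 -mulrBr mulf_eq0 subr_eq0 => /orP [/eqP ->|/eqP ->].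
  by rewrite mulr0 mul0r.
by rewrite mulrC.
Qed.

Lemma conj_diag_l U (D : M) : U \in unitmx -> U *m (invmx U *m D *m U) = D *m U.
Proof. by move=> uU; rewrite -mulmxA (mulKVmx uU). Qed.
Lemma conj_diag_r U (D : M) : U \in unitmx -> (invmx U *m D *m U) *m invmx U = invmx U *m D.
Proof. by move=> uU; rewrite mulmxK. Qed.

Lemma fcalc_intertwine A B f F G W : fcalc A f F -> fcalc B f G ->
  A *m W = W *m B -> F *m W = W *m G.
Proof.
move=> [U [a [uU eA eF]]] [V [b [uV eB eG]]] h.
have h' : diag_mx a *m (U *m W *m invmx V) = (U *m W *m invmx V) *m diag_mx b.
  rewrite mulmxA mulmxA -(conj_diag_l (diag_mx a) uU) -eA -(mulmxA U A) h mulmxA.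
  by rewrite -(mulmxA _ B) eB (conj_diag_r _ uV) mulmxA.
have := diag_intertwine f h' => /(congr1 (fun Z => invmx U *m Z *m V)).
rewrite eF eG => h2.
transitivity (invmx U *m (diag_mx (map_mx f a) *m (U *m W *m invmx V)) *m V).
  by rewrite -!mulmxA mulVmx // mulmx1.
by rewrite h2 -!mulmxA mulKmx.
Qed.

Lemma fcalc_comm A f F B : fcalc A f F -> A *m B = B *m A -> F *m B = B *m F.
Proof. by move=> h; apply: (fcalc_intertwine h h). Qed.

Lemma fcalc_tr A f F : fcalc A f F -> fcalc A^T f F^T.
Proof.
move=> [U [a [uU -> ->]]]; exists (invmx U)^T, a; split.
- by rewrite unitmx_tr unitmx_inv.
- by rewrite -trmx_inv invmxK !trmx_mul tr_diag_mx mulmxA.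
- by rewrite -trmx_inv invmxK !trmx_mul tr_diag_mx mulmxA.
Qed.

End FunctionalCalculus.

Section Spectral.
Context {R : realType}.
Local Notation C := (cplx R).
Variable N : nat.
Local Notation M := 'M[C]_N.
Implicit Types (A B F G U W X Y : M).

Definition skewdiag (d : 'I_N -> R) : 'rV[C]_N := \row_i ('i * toC (d i)).

Lemma fcalc_mexp A (f : C -> C) F : fcalc A f F -> fcalc A (cexp \o f) (mexp F).
Proof.
move=> [U [a [uU -> ->]]]; exists U, a; split; [exact: uU|by []|].
rewrite (mexp_conjV _ uU) mexp_diag.
by have -> : map_mx cexp (map_mx f a) = map_mx (cexp \o f) a by apply/rowP => i; rewrite !mxE /=.
Qed.

Lemma unitary_starE U : U \is unitarymx -> invmx U = U^t*.
Proof. exact: invmx_unitary. Qed.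

Lemma skew_diag A : A^t* = - A -> is_trig_mx A -> exists d, A = diag_mx (skewdiag d).
Proof.
move=> sA /is_trig_mxP tA; exists (fun i => cim (A i i)).
have hA i j : Num.conj (A j i) = - A i j.
  by have := congr1 (fun Z : M => Z i j) sA; rewrite !mxE.
apply/matrixP => i j; rewrite !mxE; case: (ltngtP i j) => ij.
- by rewrite tA // (_ : (i == j) = false) //; apply/eqP => h; rewrite h ltnn in ij.
- rewrite (_ : (i == j) = false) //; last by apply/eqP => h; rewrite h ltnn in ij.
  by apply/eqP; rewrite mulr0n -[A i j]opprK -hA tA // rmorph0 oppr0.
- have -> : j = i by apply: val_inj.
  rewrite eqxx mulr1n [LHS]creim; suff -> : cre (A i i) = 0 by rewrite rmorph0 add0r.
  have := congr1 (@cre R) (hA i i); rewrite cre_conj creN => h; lra.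
Qed.

(** Commuting matrices are triangularized by one unitary matrix, and a triangular skew-Hermitian
    matrix is diagonal with imaginary entries. *)
Lemma skew_codiag X Y : X^t* = - X -> Y^t* = - Y -> X *m Y = Y *m X ->
  exists U d e, [/\ U \is unitarymx, X = invmx U *m diag_mx (skewdiag d) *m U &
    Y = invmx U *m diag_mx (skewdiag e) *m U].
Proof.
move=> sX sY cXY; have [P uP /andP [/= tX tY]] := cotrigonalization2 cXY.
move: tX tY; rewrite /similar_to /= !conjymx // => tX tY.
have uPm := unitarymx_unit uP.
have [|d hd] := skew_diag _ tX; first by rewrite !star_mul starK sX mulNmx mulmxN mulmxA.
have [|e he] := skew_diag _ tY; first by rewrite !star_mul starK sY mulNmx mulmxN mulmxA.
exists P, d, e; split; first exact: uP.
  by rewrite -hd -(unitary_starE uP) !mulmxA (mulVmx uPm) mul1mx (mulmxKV uPm).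
by rewrite -he -(unitary_starE uP) !mulmxA (mulVmx uPm) mul1mx (mulmxKV uPm).
Qed.

Lemma skew_spec X : X^t* = - X ->
  exists U d, U \is unitarymx /\ X = invmx U *m diag_mx (skewdiag d) *m U.
Proof. by move=> sX; have [U [d [e [*]]]] := skew_codiag sX sX erefl; exists U, d. Qed.

Lemma herm_skew A : A^t* = A -> ('i *: A)^t* = - ('i *: A).
Proof. by move=> hA; rewrite starZ hA conjCi scaleNr. Qed.

Lemma herm_spec A : A^t* = A ->
  exists U (d : 'I_N -> R), U \is unitarymx /\
    A = invmx U *m diag_mx (\row_i toC (d i)) *m U.
Proof.
move=> hA; have [U [d [uU h]]] := skew_spec (herm_skew hA).
exists U, d; split; first exact: uU.
have -> : A = - 'i *: ('i *: A) by rewrite scalerA mulNr -expr2 sqrCi opprK scale1r.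
have e : - 'i *: diag_mx (skewdiag d) = diag_mx (\row_i toC (d i)); last first.
  by rewrite h -e -scalemxAr -scalemxAl.
apply/matrixP => i j; rewrite !mxE; case: eqP => _; last by rewrite !mulr0n mulr0.
by rewrite !mulr1n mulrA mulNr -expr2 sqrCi opprK mul1r.
Qed.

Lemma herm_fcalc A (g : R -> R) : A^t* = A ->
  exists F, fcalc A (toC \o g \o @cre R) F /\ F^t* = F.
Proof.
move=> /herm_spec [U [d [uU ->]]].
exists (invmx U *m diag_mx (\row_i toC (g (d i))) *m U); split.
  exists U, (\row_i toC (d i)); split; [exact: unitarymx_unit|by []|].
  by have -> : map_mx (toC \o g \o @cre R) (\row_i toC (d i)) = \row_i toC (g (d i))
    by apply/rowP => i; rewrite !mxE /= ?cre_toC.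
rewrite !star_mul (unitary_starE uU) starK mulmxA.
suff -> : (diag_mx (\row_i toC (g (d i))))^t* = diag_mx (\row_i toC (g (d i))) by [].
apply/matrixP => i j; rewrite !mxE eq_sym; case: eqP => [->|_].
  by rewrite !mulr1n conj_toC.
by rewrite !mulr0n conjC0.
Qed.

(** [A] is a function of [mexp A], hence commutes with whatever commutes with [mexp A = mexp B], in
    particular with [B]. Then [mexp (A - B) = 1], and a Hermitian matrix with this property has only
    the eigenvalue 0. *)
Lemma mexp_herm_inj A B : A^t* = A -> B^t* = B -> mexp A = mexp B -> A = B.
Proof.
move=> hA hB e.
have [U [d [uU dA]]] := herm_spec hA.
have uUm := unitarymx_unit uU.
have cAB : A *m B = B *m A.
  have fA : fcalc (mexp A) (toC \o @ln R \o @cre R) A.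
    exists U, (\row_i toC (expR (d i))); split; first exact: uUm.
      rewrite dA (mexp_conjV _ uUm) mexp_diag.
      have E : map_mx cexp (\row_i toC (d i)) = \row_i toC (expR (d i)).
        apply/rowP => i.
        rewrite !mxE.
        by rewrite cexp_toC.
      rewrite E.
      by [].
    rewrite {1}dA.
    have E : map_mx (toC \o @ln R \o @cre R) (\row_i toC (expR (d i))) = \row_i toC (d i).
      apply/rowP => i.
      rewrite !mxE.
      rewrite /comp.
      rewrite cre_toC.
      by rewrite expRK.
    by rewrite E.
  by apply: fcalc_comm fA _; rewrite e -mexp_comm.
have h1 : mexp (A - B) = 1%:M.
  have cAB' : A *m - B = - B *m A by rewrite mulmxN mulNmx cAB.
  by rewrite (mexpD cAB') e mexpNr.
have hAB : (A - B)^t* = A - B by rewrite starB hA hB.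
have [V [f [uV dAB]]] := herm_spec hAB.
have uVm := unitarymx_unit uV.
move: h1; rewrite dAB (mexp_conjV _ uVm) mexp_diag => h1.
have h2 : diag_mx (map_mx cexp (\row_i toC (f i))) = 1%:M.
  by rewrite -[LHS](mulmxK uVm) -[LHS](mulKVmx uVm) [invmx V *m _]mulmxA [invmx V *m _]mulmxA h1 mul1mx (mulmxV uVm).
apply/eqP; rewrite -subr_eq0 dAB.
suff -> : (\row_i toC (f i)) = 0 :> 'rV[C]_N by rewrite linear0 mulmx0 mul0mx.
apply/rowP => i; have := congr1 (fun Z : M => Z i i) h2.
rewrite !mxE eqxx !mulr1n cexp_toC -(rmorph1 (@toC R)) => /toC_inj/eqP.
by rewrite -expR0 => /eqP/expR_inj ->; rewrite rmorph0.
Qed.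

Lemma posdef_log A c : c \in unitmx -> A = c *m c^t* ->
  exists S, [/\ S^t* = S, mexp S = A & forall B, A *m B = B *m A -> S *m B = B *m S].
Proof.
move=> uc eA; have hA : A^t* = A by rewrite eA star_mul starK.
have [U [d [uU dA]]] := herm_spec hA.
have uUm := unitarymx_unit uU.
have d0 i : 0 < d i.
  have : diag_mx (\row_i toC (d i)) = (U *m c) *m (U *m c)^t*.
    rewrite star_mul mulmxA -(mulmxA U) -eA dA -(unitary_starE uU).
    by rewrite !mulmxA (mulmxV uUm) mul1mx (mulmxK uUm).
  (* Each eigenvalue is the squared norm of a row of the invertible matrix [U *m c]. *)
  move=> h0; have h2 : d i = \sum_j cabs ((U *m c) i j) ^+ 2.
    apply: toC_inj; rewrite rmorph_sum /=.
    have := congr1 (fun Z : M => Z i i) h0; rewrite [LHS]mxE eqxx mulr1n mxE => ->.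
    rewrite mxE; apply: eq_bigr => j _.
    by rewrite -mulCconj starE.
  rewrite lt_neqAle h2 sumr_ge0 ?andbT => [|j _]; last exact: sqr_ge0.
  apply/eqP => /esym/eqP; rewrite psumr_eq0 => [/allP hz|j _]; last exact: sqr_ge0.
  have u : U *m c \in unitmx by rewrite unitmx_mul uUm.
  have : row i (U *m c) = 0.
    apply/rowP => j; rewrite !mxE; have := hz j; rewrite mem_index_enum => /(_ isT).
    by rewrite sqrf_eq0 cabs_eq0 => /eqP; rewrite mxE.
  move=> /(congr1 (fun Z => Z *m invmx (U *m c))); rewrite -row_mul (mulmxV u) mul0mx.
  by move=> /rowP/(_ i)/eqP; rewrite !mxE eqxx oner_eq0.
have [S [fS hS]] := herm_fcalc (@ln R) hA.
exists S; split; first exact: hS; last by move=> B; apply: fcalc_comm fS.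
have := fcalc_intertwine (W := 1%:M) (B := A) (fcalc_mexp fS).
have fA : fcalc A (cexp \o (toC \o @ln R \o @cre R)) A.
  exists U, (\row_i toC (d i)); split; [exact: uUm|exact: dA|].
  rewrite {1}dA.
  have E : map_mx (cexp \o (toC \o @ln R \o @cre R)) (\row_i toC (d i)) = \row_i toC (d i).
    by apply/rowP => i; rewrite !mxE /= cexp_toC lnK // posrE.
  by rewrite E.
by move=> /(_ _ fA); rewrite !mulmx1 !mul1mx; apply.
Qed.
End Spectral.

(** * Truncated exponential and logarithm series *)

Section ExpLogPolynomials.
Variable C : numClosedFieldType.
Implicit Types p q : {poly C}.

Definition expP n : {poly C} := \poly_(k < n) (k`!%:R^-1 : C).
(** The series of log(1 + X). Its constant coefficient reads [-1 / 0], which is 0 since the inverse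
    of 0 is 0. *)
Definition logP n : {poly C} := \poly_(k < n) ((-1) ^+ k.+1 / k%:R : C).

Lemma low_coef0 n p : (forall k, (k < n)%N -> p`_k = 0) -> exists q, p = q * 'X^n.
Proof.
move=> h; exists (drop_poly n p); rewrite -{1}(poly_take_drop n p).
rewrite (_ : take_poly n p = 0) ?add0r //; apply/polyP => k.
by rewrite coef_take_poly coef0; case: ifP => // /h.
Qed.

Lemma deriv_expP n : (expP n.+1)^`() = expP n.
Proof.
apply/polyP => k; rewrite coef_deriv !coef_poly ltnS; case: ifP => _; last by rewrite mul0rn.
by rewrite -[_ *+ k.+1]mulr_natr factS natrM invfM mulrAC mulVf ?mul1r // pnatr_eq0.
Qed.

Lemma expPS n : expP n.+1 = expP n + (n`!%:R^-1 : C) *: 'X^n.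
Proof.
apply/polyP => k; rewrite coefD coefZ coefXn !coef_poly ltnS.
by case: (ltngtP k n) => [||->]; rewrite ?mulr0 ?addr0 ?mulr1 ?add0r.
Qed.

Lemma deriv_logP n : (logP n.+1)^`() * (1 + 'X) = 1 - (-1) ^+ n *: 'X^n.
Proof.
have -> : (logP n.+1)^`() = \poly_(k < n) ((-1) ^+ k : C).
  apply/polyP => k; rewrite coef_deriv !coef_poly ltnS; case: ifP => _; last by rewrite mul0rn.
  rewrite -[_ *+ k.+1]mulr_natr mulfVK ?pnatr_eq0 //.
  by rewrite !exprS !mulN1r opprK.
apply/polyP => k; rewrite mulrDr mulr1 coefD coefMX coefB coef1 coefZ coefXn !coef_poly.
case: k => [|k] /=.
  by case: n => [|n] /=; rewrite ?expr0 ?mulr1 ?mulr0 ?subr0 ?addr0 ?subrr.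
rewrite sub0r; case: (ltngtP k.+1 n) => kn.
- by rewrite exprS mulN1r addNr mulr0 oppr0.
- by rewrite addr0 mulr0 oppr0.
- by rewrite add0r -kn exprS mulN1r mulr1 opprK.
Qed.

Lemma mulX_factor p : p`_0 = 0 -> exists q, p = q * 'X.
Proof.
by move=> h; apply: (@low_coef0 1) => -[].
Qed.

(** The composite [f] satisfies (1 + X) f' = f below degree [n] and has constant term 1. This
    recurrence determines the coefficients up to degree [n], and 1 + X solves it. *)
Lemma exp_log_poly n : exists q, (expP n.+1 \Po logP n.+1) = 1 + 'X + q * 'X^(n.+1).
Proof.
set E := expP n.+1; set L := logP n.+1; set f := E \Po L.
have L0 : L`_0 = 0 by rewrite coef_poly /= invr0 mulr0.
have [L1 eL] := mulX_factor L0.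
have f0 : f`_0 = 1.
  rewrite -horner_coef0 horner_comp horner_coef0 L0 horner_coef0 coef_poly /=.
  by rewrite fact0 invr1.
have df : f^`() * (1 + 'X) = (f - (n`!%:R^-1 : C) *: (L1 ^+ n * 'X^n)) * (1 - (-1) ^+ n *: 'X^n).
  rewrite deriv_comp deriv_expP -mulrA deriv_logP; congr (_ * _).
  have -> : expP n = E - (n`!%:R^-1 : C) *: 'X^n by rewrite /E expPS addrK.
  by rewrite comp_polyB comp_polyZ comp_Xn_poly -/f [L in L ^+ n]eL exprMn.
have rec k : (k < n)%N -> f`_k.+1 *+ k.+1 + f`_k *+ k = f`_k.
  move=> kn; have := congr1 (fun p => p`_k) df.
  have -> : (f^`() * (1 + 'X))`_k = f`_k.+1 *+ k.+1 + f`_k *+ k.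
    by rewrite mulrDr mulr1 coefD coefMX !coef_deriv; case: k {kn} => [|k] /=; rewrite ?mulr0n.
  move=> ->; rewrite mulrBr mulr1 coefB coefB coefZ coefMXn kn mulr0 subr0.
  by rewrite -scalerAr coefZ coefMXn kn mulr0 subr0.
have fk k : (k < n.+1)%N -> f`_k = (1 + 'X)`_k.
  elim: k => [_|k IH kn]; first by rewrite f0 coefD coef1 coefX addr0.
  have := rec k kn; rewrite IH ?(ltnW kn) // coefD coef1 coefX => h.
  rewrite coefD coef1 coefX /= add0r.
  have k0 : (k.+1%:R : C) != 0 by rewrite pnatr_eq0.
  apply: (mulfI k0); rewrite !mulr_natl.
  case: k h {IH kn rec k0} => [|[|k]] /=.
  - by rewrite mulr0n !addr0.
  - by rewrite !add0r mulr1n mul0rn => /eqP; rewrite -subr_eq0 addrK => /eqP.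
  - by rewrite !addr0 mul0rn addr0 mul0rn.
have [|q hq] := @low_coef0 n.+1 (f - (1 + 'X)).
  by move=> k kn; rewrite coefB fk // subrr.
by exists q; rewrite -hq addrC subrK.
Qed.

(** The composite [g] has constant term 0 and derivative 1 below degree [n]: the exponential is its
    own derivative up to the last term, and the derivative of the logarithm inverts 1 + X up to a
    term of degree [n]. *)
Lemma log_exp_poly n : exists q, (logP n.+1 \Po (expP n.+1 - 1)) = 'X + q * 'X^(n.+1).
Proof.
set E := expP n.+1; set L := logP n.+1; set D := E - 1; set g := L \Po D.
have D0 : D`_0 = 0 by rewrite coefB coef1 coef_poly /= fact0 invr1 subrr.
have L0 : L`_0 = 0 by rewrite coef_poly /= invr0 mulr0.
have [D1 eD] := mulX_factor D0.
have g0 : g`_0 = 0 by rewrite -horner_coef0 horner_comp horner_coef0 D0 horner_coef0 L0.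
have h1 : (L^`() \Po D) * E = 1 - (-1) ^+ n *: (D1 ^+ n * 'X^n).
  have := congr1 (fun p => p \Po D) (deriv_logP n).
  rewrite comp_polyM comp_polyD comp_polyX comp_polyC subrKC => ->.
  have eDn : D ^+ n = D1 ^+ n * 'X^n by rewrite {1}eD exprMn.
  by rewrite comp_polyB comp_polyZ comp_polyC comp_Xn_poly eDn.
have dg : g^`() = 1 - (-1) ^+ n *: (D1 ^+ n * 'X^n) - (n`!%:R^-1 : C) *: ((L^`() \Po D) * 'X^n).
  rewrite deriv_comp /D derivB derivC subr0 deriv_expP.
  have -> : expP n = E - (n`!%:R^-1 : C) *: 'X^n by rewrite /E expPS addrK.
  by rewrite mulrBr -/D h1 -scalerAr.
have gk k : (k < n.+1)%N -> g`_k = ('X : {poly C})`_k.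
  case: k => [_|k kn]; first by rewrite g0 coefX.
  have k0 : (k.+1%:R : C) != 0 by rewrite pnatr_eq0.
  apply: (mulfI k0); rewrite !mulr_natl -coef_deriv dg !coefB coef1 !coefZ !coefMXn.
  by rewrite -ltnS kn !mulr0 !subr0 coefX; case: k {kn k0} => //= k; rewrite mul0rn.
have [|q hq] := @low_coef0 n.+1 (g - 'X).
  by move=> k kn; rewrite coefB gk // subrr.
by exists q; rewrite -hq addrC subrK.
Qed.
End ExpLogPolynomials.

Section NilpotentLog.
Context {R : realType}.
Local Notation C := (cplx R).

(** The logarithm series, cut where a nilpotent [A - 1%:M] makes it exact. Being a polynomial in
    [A], it is defined and differentiable everywhere. The summand at [k = 0] vanishes because
    [0^-1 = 0]. *)
Definition mlog (n : nat) (A : 'M[C]_n) : 'M[C]_n :=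
  \sum_(k < n.+1) ((-1) ^+ k.+1 / k%:R : C) *: (A - 1%:M) ^+ k.

Lemma horner_mx_poly n (A : 'M[C]_n.+1) m (c : nat -> C) :
  horner_mx A (\poly_(k < m) c k) = \sum_(k < m) c k *: A ^+ k.
Proof.
rewrite poly_def rmorph_sum; apply: eq_bigr => k _.
rewrite -mul_polyC rmorphM rmorphXn /= horner_mx_C horner_mx_X.
exact: mul_scalar_mx.
Qed.

Lemma horner_mx_comp n (A : 'M[C]_n.+1) (p q : {poly C}) :
  horner_mx A (p \Po q) = horner_mx (horner_mx A q) p.
Proof.
rewrite -{2}(coefK p) horner_mx_poly comp_polyE rmorph_sum; apply: eq_bigr => k _.
rewrite -mul_polyC rmorphM rmorphXn /= horner_mx_C; exact: mul_scalar_mx.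
Qed.

Lemma mpart_horner n (X : 'M[C]_n.+1) m : mpart X m = horner_mx X (expP C m).
Proof. by rewrite horner_mx_poly. Qed.

Lemma mlog_horner n (A : 'M[C]_n.+1) : mlog A = horner_mx (A - 1) (logP C n.+2).
Proof. by rewrite horner_mx_poly. Qed.

Lemma mexp_mlog n (A : 'M[C]_n) : (A - 1%:M) ^+ n.+1 = 0 -> mexp (mlog A) = A.
Proof.
case: n A => [|n] A hA; first by apply/matrixP => -[].
set x : 'M[C]_n.+1 := A - 1 in hA *.
have L0 : (logP C n.+2)`_0 = 0 by rewrite coef_poly /= invr0 mulr0.
have [L1 eL] := mulX_factor L0.
have hl : mlog A = horner_mx x L1 * x by rewrite mlog_horner -/x eL rmorphM /= horner_mx_X.
have hn : mlog A ^+ n.+2 = 0.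
  rewrite hl exprMn_comm ?hA ?mulr0 //.
  by apply: (comm_horner_mx _ (commr_refl x)).
rewrite (mexp_nilp hn) mpart_horner mlog_horner -/x -horner_mx_comp.
have [q ->] := exp_log_poly C n.+1.
rewrite !rmorphD rmorphM rmorphXn /= horner_mx_X rmorph1 hA mulr0 addr0.
exact: subrKC.
Qed.

Lemma mlog_mexp n (X : 'M[C]_n) : X ^+ n.+1 = 0 -> mlog (mexp X) = X.
Proof.
case: n X => [|n] X hX; first by apply/matrixP => -[].
rewrite mlog_horner (mexp_nilp hX) mpart_horner.
have -> : horner_mx X (expP C n.+2) - 1 = horner_mx X (expP C n.+2 - 1).
  by rewrite rmorphB rmorph1.
rewrite -horner_mx_comp; have [q ->] := log_exp_poly C n.+1.
by rewrite rmorphD rmorphM rmorphXn /= horner_mx_X hX mulr0 addr0.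
Qed.
End NilpotentLog.

(** * Block LU factorization *)

Section BlockLU.
Variables (R : realType) (C : numClosedFieldType) (N : nat).
Local Notation M := 'M[C]_N.
Implicit Types (d : 'I_N -> R) (A B P b l g c : M) (t : R).

(** Indices are thought of in decreasing order of [d], with ties forming the blocks; the basis
    itself is never reordered. [upper] allows the diagonal blocks, [slower] excludes them, [lowu]
    adds the identity to the latter. *)
Definition upper d A := forall i j, d i < d j -> A i j = 0.
Definition slower d A := forall i j, d j <= d i -> A i j = 0.
Definition lowu d l := slower d (l - 1%:M).

Definition Pd d t : M := diag_mx (\row_j (d j <= t)%R%:R).
(** The corner of [g] cut out by [P], completed by the identity: it is invertible exactly when the
    corner is, and no change of matrix size is needed. *)
Definition comp_blk P g : M := P *m g *m P + (1%:M - P).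
(** If [g = b *m l], the rows with [d] at most [d i] satisfy P g = (P b P) (P l); solving this
    system for row [i] leaves row [i] of [l]. The threshold, and hence the matrix to invert, changes
    with the row. *)
Definition lfac d g : M :=
  \matrix_(i, j) (invmx (comp_blk (Pd d (d i)) g) *m Pd d (d i) *m g) i j.
Definition minors d g := forall i, comp_blk (Pd d (d i)) g \in unitmx.

Lemma upper_mul d A B : upper d A -> upper d B -> upper d (A *m B).
Proof.
move=> uA uB i j ij; rewrite mxE big1 // => k _.
case: (ltP (d i) (d k)) => ik; first by rewrite uA ?mul0r.
by rewrite uB ?mulr0 // (le_lt_trans ik).
Qed.

Lemma upper1 d : upper d 1%:M.
Proof. by move=> i j ij; rewrite mxE; case: eqP ij => // ->; rewrite ltxx. Qed.

Lemma slower_mul d A B : slower d A -> slower d B -> slower d (A *m B).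
Proof.
move=> uA uB i j ij; rewrite mxE big1 // => k _.
case: (leP (d k) (d i)) => ik; first by rewrite uA ?mul0r.
by rewrite uB ?mulr0 // (le_trans ij) // ltW.
Qed.

Lemma slowerD d A B : slower d A -> slower d B -> slower d (A + B).
Proof. by move=> uA uB i j ij; rewrite mxE uA // uB // addr0. Qed.
Lemma slowerZ d x A : slower d A -> slower d (x *: A).
Proof. by move=> uA i j ij; rewrite mxE uA // mulr0. Qed.
Lemma slowerN d A : slower d A -> slower d (- A).
Proof. by move=> uA i j ij; rewrite mxE uA // oppr0. Qed.
Lemma slower0 d : slower d 0.
Proof. by move=> i j ij; rewrite mxE. Qed.
Lemma slower_sum d (I : Type) (r : seq I) (Q : pred I) (F : I -> M) :
  (forall i, Q i -> slower d (F i)) -> slower d (\sum_(i <- r | Q i) F i).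
Proof.
move=> h; apply: (big_ind (fun A => slower d A)); [exact: slower0|exact: slowerD|exact: h].
Qed.
Lemma slower_expr d A k : slower d A -> slower d (A ^+ k.+1).
Proof.
move=> sA; elim: k => [|k IH]; first by rewrite expr1.
by rewrite exprS; apply: slower_mul.
Qed.

(** Makes the real grading an integral one, bounded by [N], so that powers of a strictly graded
    matrix can be counted. *)
Definition drank d (i : 'I_N) := #|[pred k | d k < d i]|.

Lemma drank_lt d i j : d i < d j -> (drank d i < drank d j)%N.
Proof.
move=> ij; apply: proper_card; apply/properP; split.
  by apply/fintype.subsetP => k; rewrite !inE => ki; apply: lt_trans ij.
by exists i; rewrite inE ?ij ?ltxx.
Qed.

Lemma slower_nilp d A : slower d A -> A ^+ N.+1 = 0.
Proof.
move=> sA.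
have h k i j : (drank d j < drank d i + k)%N -> (A ^+ k) i j = 0.
  elim: k i j => [|k IH] i j.
    rewrite addn0 => ji; rewrite expr0 mxE; case: eqP ji => // ->.
    by rewrite ltnn.
  move=> ji; rewrite exprS mxE big1 // => l _.
  case: (leP (d l) (d i)) => il; first by rewrite sA ?mul0r.
  rewrite IH ?mulr0 // (leq_trans ji) // addnS -addSn leq_add2r.
  exact: drank_lt.
apply/matrixP => i j; rewrite mxE h // (@leq_ltn_trans N) //; last first.
  by rewrite addnS ltnS leq_addl.
by rewrite -[X in (_ <= X)%N]card_ord; apply: max_card.
Qed.

Lemma PdT d t j : d j <= t -> (\row_k (d k <= t)%R%:R : 'rV[C]_N) 0 j = 1.
Proof. by move=> h; rewrite mxE h. Qed.
Lemma PdF d t j : t < d j -> (\row_k (d k <= t)%R%:R : 'rV[C]_N) 0 j = 0.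
Proof. by move=> h; rewrite mxE leNgt h. Qed.

Lemma idem_Pd d t : Pd d t *m Pd d t = Pd d t.
Proof.
apply/matrixP => i j; rewrite mul_diagE !mxE.
by case: (d i <= t); rewrite ?mul1r ?mul0r ?mulr0n ?mul0rn.
Qed.

Lemma upperP d A : upper d A <-> forall i, Pd d (d i) *m A = Pd d (d i) *m A *m Pd d (d i).
Proof.
split=> [uA k|h i j ij].
  apply/matrixP => i j; rewrite diag_mulE !mul_diagE !mxE.
  case: (leP (d i) (d k)) => ik; last by rewrite !mul0r.
  rewrite !mul1r; case: (leP (d j) (d k)) => jk; first by rewrite mulr1.
  by rewrite uA ?mul0r // (le_lt_trans ik).
have := congr1 (fun Z : M => Z i j) (h i).
rewrite diag_mulE !mul_diagE !mxE lexx !mul1r => ->.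
by rewrite leNgt ij mulr0.
Qed.

(** The condition says that [A] maps the row space of each [P] into itself. By equality of ranks it
    maps onto, so the inverse preserves the row space as well. *)
Lemma upper_inv d A : A \in unitmx -> upper d A -> upper d (invmx A).
Proof.
move=> uA /upperP h; apply/upperP => k; have {}h := h k; set P := Pd _ _ in h *.
have le1 : (P *m A <= P)%MS by rewrite h submxMl.
have rk : \rank (P *m A) = \rank P by rewrite mxrankMfree // row_free_unit.
have /andP[_ /submxP [D hD]] : (P *m A == P)%MS by rewrite -(mxrank_leqif_eq le1) rk.
have hI : P *m invmx A = D *m P.
  by rewrite {1}hD -!mulmxA (mulmxV uA) mulmx1.
by rewrite hI -mulmxA idem_Pd.
Qed.

Lemma comp_blk1 P : P *m P = P -> comp_blk P 1%:M = 1%:M.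
Proof. by move=> PP; rewrite /comp_blk mulmx1 PP subrKC. Qed.

(** Compression to a corner is multiplicative as soon as the left factor preserves the row space of
    [P] or the right factor preserves its column space: the terms through [1%:M - P] drop out. *)
Lemma comp_blk_mul P b l : P *m P = P ->
  P *m b = P *m b *m P \/ l *m P = P *m l *m P ->
  comp_blk P (b *m l) = comp_blk P b *m comp_blk P l.
Proof.
move=> PP h.
have PP1 : P *m (1%:M - P) = 0 by rewrite mulmxBr mulmx1 PP subrr.
have PP2 : (1%:M - P) *m P = 0 by rewrite mulmxBl mul1mx PP subrr.
have PP3 : (1%:M - P) *m (1%:M - P) = 1%:M - P.
  by rewrite mulmxBr mulmx1 PP2 subr0.
have e : P *m (b *m l) *m P = P *m b *m P *m (P *m l *m P).
  have -> : P *m b *m P *m (P *m l *m P) = P *m b *m P *m l *m P.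
    by rewrite !mulmxA -(mulmxA (P *m b)) PP.
  case: h => h; first by rewrite -h mulmxA.
  by rewrite -[in RHS](mulmxA (P *m b *m P)) h -!mulmxA (mulmxA P P) PP (mulmxA P l) -h.
rewrite /comp_blk e; move: (1%:M - P) PP1 PP2 PP3 => Q PP1 PP2 PP3.
rewrite mulmxDl !mulmxDr.
have -> : P *m b *m P *m Q = 0 by rewrite -mulmxA PP1 mulmx0.
have -> : Q *m (P *m l *m P) = 0 by rewrite !mulmxA PP2 !mul0mx.
by rewrite PP3 addr0 add0r.
Qed.

Lemma lowu_P d l t : lowu d l -> l *m Pd d t = Pd d t *m l *m Pd d t.
Proof.
move=> h; apply/matrixP => i j; rewrite !diag_mulE !mul_diagE !mxE.
case: (leP (d j) t) => jt; last by rewrite !mulr0.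
rewrite !mulr1; case: (leP (d i) t) => it; first by rewrite mul1r.
have := h i j; rewrite !mxE => /(_ (le_trans jt (ltW it))).
case: eqP => [ij|_]; first by move: it; rewrite ij ltNge jt.
by rewrite subr0 mul0r.
Qed.

Lemma lowu1 d : lowu d 1%:M.
Proof. by rewrite /lowu subrr; exact: slower0. Qed.

Lemma lowu_mul d A B : lowu d A -> lowu d B -> lowu d (A *m B).
Proof.
move=> hA hB; rewrite /lowu.
have -> : A *m B - 1%:M = (A - 1%:M) *m (B - 1%:M) + (A - 1%:M) + (B - 1%:M).
  by rewrite mulmxBr mulmxBl mul1mx mulmx1 subrK addrA subrK.
by apply: slowerD => //; apply: slowerD => //; apply: slower_mul.
Qed.

Lemma lowu_inv d l : lowu d l -> l \in unitmx /\ lowu d (invmx l).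
Proof.
move=> h; pose n := - (l - 1%:M); pose v := \sum_(k < N.+1) n ^+ k.
have nn : n ^+ N.+1 = 0 by apply: slower_nilp; apply: slowerN h.
have el : l = 1%:M - n by rewrite /n opprK subrKC.
have lv : l *m v = 1%:M.
  rewrite el mulmxBl mul1mx.
  have -> : n *m v = \sum_(k < N.+1) n ^+ k.+1.
    by rewrite mulmx_sumr; apply: eq_bigr => k _; rewrite exprS.
  rewrite /v big_ord_recl /= [X in _ - X]big_ord_recr /= nn addr0 expr0.
  by rewrite addrK.
have [ul _] := mulmx1_unit lv; split; first exact: ul.
have -> : invmx l = v by rewrite -[LHS]mulmx1 -lv (mulKmx ul).
rewrite /lowu /v big_ord_recl /= expr0 addrC addKr.
by apply: slower_sum => k _; apply: slower_expr; apply: slowerN h.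
Qed.

(** Corners multiply by [comp_blk_mul], so the corner of [b] cancels in the formula for [lfac]. Row
    [i] of the corner of [l] is that of the identity, because [l - 1%:M] vanishes where
    [d k <= d i]; hence row [i] of [l] remains. *)
Lemma lu_unique d b l : b \in unitmx -> upper d b -> lowu d l ->
  minors d (b *m l) /\ lfac d (b *m l) = l.
Proof.
move=> ub upb hl; have [ul hl'] := lowu_inv hl; have upb' := upper_inv ub upb.
pose P i := Pd d (d i).
have PP i : P i *m P i = P i by exact: idem_Pd.
have Pbi i : P i *m b = P i *m b *m P i.
  by have /upperP h := upb; exact: h.
have Sbl i : comp_blk (P i) (b *m l) = comp_blk (P i) b *m comp_blk (P i) l.
  by apply: comp_blk_mul (PP i) _; left; exact: Pbi.
have Sb i : comp_blk (P i) b *m comp_blk (P i) (invmx b) = 1%:M.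
  by rewrite -(comp_blk_mul (PP i) (or_introl (Pbi i))) (mulmxV ub) (comp_blk1 (PP i)).
have Sl i : comp_blk (P i) l *m comp_blk (P i) (invmx l) = 1%:M.
  by rewrite -(comp_blk_mul (PP i) (or_intror (lowu_P (d i) hl'))) (mulmxV ul) (comp_blk1 (PP i)).
have Sbu i : comp_blk (P i) b \in unitmx by case: (mulmx1_unit (Sb i)).
have Slu i : comp_blk (P i) l \in unitmx by case: (mulmx1_unit (Sl i)).
split; first by move=> i; rewrite Sbl unitmx_mul Sbu Slu.
apply/matrixP => i j; rewrite mxE -/(P i) Sbl.
have -> : invmx (comp_blk (P i) b *m comp_blk (P i) l) =
    invmx (comp_blk (P i) l) *m invmx (comp_blk (P i) b).
  have u : comp_blk (P i) b *m comp_blk (P i) l \in unitmx by rewrite unitmx_mul Sbu Slu.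
  apply: (can_inj (mulKmx u)); rewrite (mulmxV u) -mulmxA (mulmxA (comp_blk (P i) l)).
  by rewrite (mulmxV (Slu i)) mul1mx (mulmxV (Sbu i)).
have Pb : P i *m b = comp_blk (P i) b *m P i.
  by rewrite mulmxDl mulmxBl mul1mx PP subrr addr0 -mulmxA PP; exact: Pbi.
have -> : invmx (comp_blk (P i) l) *m invmx (comp_blk (P i) b) *m P i *m (b *m l) =
    invmx (comp_blk (P i) l) *m (P i *m l).
  rewrite -!mulmxA (mulmxA (P i) b) Pb -!mulmxA (mulKmx (Sbu i)).
  by rewrite mulmxA.
have rowS : row i (comp_blk (P i) l) = row i 1%:M.
  apply/rowP => k; rewrite mxE [RHS]mxE /comp_blk mxE diag_mulE mul_diagE !mxE lexx mul1r.
  rewrite (_ : true%:R = 1 :> C) // subrr addr0.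
  case: (leP (d k) (d i)) => ki.
    have := hl i k ki; rewrite !mxE => /eqP; rewrite subr_eq0 => /eqP ->.
    by rewrite mulr1.
  rewrite mulr0; case: eqP => [ik|//].
  by move: ki; rewrite ik ltxx.
have rowI : row i (invmx (comp_blk (P i) l)) = row i 1%:M.
  by rewrite -[invmx _]mul1mx row_mul -rowS -row_mul (mulmxV (Slu i)) rowS.
have -> : (invmx (comp_blk (P i) l) *m (P i *m l)) i j = row i (invmx (comp_blk (P i) l) *m (P i *m l)) 0 j.
  by rewrite [RHS]mxE.
rewrite row_mul rowI -row_mul mul1mx [LHS]mxE mul_diagE mxE lexx.
by rewrite mul1r.
Qed.

(** Row [i] of [lfac d g *m invmx g] ends with the projector for [d i], so its entries with
    [d i < d j] vanish: this product is upper, and its inverse is the wanted first factor. *)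
Lemma lu_exists d g : g \in unitmx -> minors d g ->
  lowu d (lfac d g) /\ upper d (g *m invmx (lfac d g)).
Proof.
move=> ug mg; pose P i := Pd d (d i).
have PP i : P i *m P i = P i by exact: idem_Pd.
have SP i : comp_blk (P i) g *m P i = P i *m g *m P i.
  by rewrite mulmxDl mulmxBl mul1mx PP subrr addr0 -mulmxA PP.
have h1 : lowu d (lfac d g).
  move=> i j ij; have e : lfac d g i j = (invmx (comp_blk (P i) g) *m P i *m g) i j.
    by rewrite mxE.
  have : (invmx (comp_blk (P i) g) *m P i *m g *m P i) i j = P i i j.
    by rewrite -!mulmxA (mulmxA (P i) g) -SP (mulKmx (mg i)).
  rewrite diag_mulE PdT // mulr1 -e => h.
  rewrite mxE h [X in _ + X]mxE [X in _ - X]mxE [P i i j]mxE.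
  case: eqP => [_|_]; last by rewrite !mulr0n subrr.
  by rewrite PdT // subrr.
split; first exact: h1.
have [ul _] := lowu_inv h1.
have up : upper d (lfac d g *m invmx g).
  move=> i j ij.
  have -> : (lfac d g *m invmx g) i j = (invmx (comp_blk (P i) g) *m P i *m g *m invmx g) i j.
    by rewrite [LHS]mxE [RHS]mxE; apply: eq_bigr => k _; rewrite [lfac _ _ _ _]mxE.
  by rewrite (mulmxK ug) diag_mulE PdF // mulr0.
have u2 : lfac d g *m invmx g \in unitmx by rewrite unitmx_mul ul unitmx_inv.
suff -> : g *m invmx (lfac d g) = invmx (lfac d g *m invmx g) by apply: upper_inv.
apply: (can_inj (mulKmx u2)); rewrite (mulmxV u2) mulmxA (mulmxKV ug).
exact: (mulmxV ul).
Qed.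

Lemma row_norm0 n (u : 'rV[C]_n) : u *m u^t* = 0 -> u = 0.
Proof.
move=> h; apply/rowP => i.
have := congr1 (fun Z : 'M_1 => Z 0 0) h; rewrite !mxE => /eqP.
rewrite psumr_eq0 => [/allP /(_ i)|j _]; last by rewrite !mxE mul_conjC_ge0.
by rewrite mem_index_enum => /(_ isT); rewrite !mxE mul_conjC_eq0 => /eqP.
Qed.

Lemma row_norm_ge0 n (u : 'rV[C]_n) : 0 <= (u *m u^t*) 0 0.
Proof. by rewrite mxE sumr_ge0 // => j _; rewrite !mxE mul_conjC_ge0. Qed.

Lemma Pd_star d t : (Pd d t)^t* = Pd d t.
Proof.
apply/matrixP => i j; rewrite !mxE eq_sym; case: eqP => [->|_]; last by rewrite !mulr0n conjC0.
by rewrite !mulr1n conjC_nat.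
Qed.

(** A row vector [v] killed by the completed corner satisfies |v P c|^2 + |v (1 - P)|^2 = 0, so both
    parts of [v] vanish. *)
Lemma posdef_minors d c : c \in unitmx -> minors d (c *m c^t*).
Proof.
move=> uc k; set P := Pd d (d k).
have PP : P *m P = P by exact: idem_Pd.
have Ps : P^t* = P by exact: Pd_star.
have Qs : (1%:M - P)^t* = 1%:M - P by rewrite raddfB /= map_mxB Ps trmx1 map_mx1.
have QQ : (1%:M - P) *m (1%:M - P) = 1%:M - P.
  by rewrite mulmxBr mulmx1 mulmxBl mul1mx PP subrr subr0.
rewrite -row_free_unit; apply: inj_row_free => v hv.
have e1 : v *m (P *m (c *m c^t*) *m P) *m v^t* = (v *m P *m c) *m (v *m P *m c)^t*.
  by rewrite !trmx_mul !map_mxM Ps !mulmxA.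
have e2 : v *m (1%:M - P) *m v^t* = (v *m (1%:M - P)) *m (v *m (1%:M - P))^t*.
  by rewrite trmx_mul map_mxM Qs -!mulmxA (mulmxA (1%:M - P)) QQ.
have : (v *m P *m c) *m (v *m P *m c)^t* + (v *m (1%:M - P)) *m (v *m (1%:M - P))^t* = 0.
  by rewrite -e1 -e2 -mulmxDl -mulmxDr -/(comp_blk P _) hv mul0mx.
move=> h; have := congr1 (fun Z : 'M_1 => Z 0 0) h; rewrite mxE [RHS]mxE => /eqP.
rewrite paddr_eq0 ?row_norm_ge0 // => /andP[/eqP h1 /eqP h2].
have /row_norm0 z1 : (v *m P *m c) *m (v *m P *m c)^t* = 0.
  by apply/matrixP => i j; rewrite !ord1 [RHS]mxE.
have /row_norm0 z2 : (v *m (1%:M - P)) *m (v *m (1%:M - P))^t* = 0.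
  by apply/matrixP => i j; rewrite !ord1 [RHS]mxE.
have z3 : v *m P = 0 by rewrite -(mulmxK uc (v *m P)) z1 mul0mx.
by move: z2; rewrite mulmxBr mulmx1 z3 subr0.
Qed.
End BlockLU.

(** * The classical groups *)

Section LimitsAlongReals.
Context {R : realType}.
Local Notation C := (cplx R).

(** Sampling at 1/(n + 1) avoids [t = 0], where one cannot divide by [t]. *)
Lemma cvg_along (V : topologicalType) (f : R -> V) (l : V) :
  f t @[t --> (0 : R)] --> l -> f (@harmonic R n) @[n --> \oo] --> l.
Proof. by move=> h; apply: cvg_comp h; exact: cvg_harmonic. Qed.

Lemma harmonic_neq0 n : @harmonic R n != 0.
Proof. by rewrite invr_neq0 // pnatr_eq0. Qed.

Lemma mexp_line_inj N (A B : 'M[C]_N) :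
  (forall t : R, mexp (toC t *: A) = mexp (toC t *: B)) -> A = B.
Proof.
move=> h; have [HA [eA lA]] := mexp_taylor2 A; have [HB [eB lB]] := mexp_taylor2 B.
pose f t := toC t *: (HB t - HA t).
have fE t : t != 0 -> f t = A - B.
  move=> t0; have := h t; rewrite eA eB -!addrA => /addrI e.
  have : toC t *: (A - B) = toC t *: f t.
    rewrite scalerBr scalerA -rmorphM -expr2 scalerBr.
    by apply/eqP; rewrite subr_eq addrAC eq_sym subr_eq e addrC.
  by move=> /(scalerI _) ->//; rewrite -(rmorph0 (@toC R)); apply: contra_neq t0 => /toC_inj.
have lf : f t @[t --> (0 : R)] --> toC 0 *: (2^-1 *: (B *m B) - 2^-1 *: (A *m A)).
  apply: cvgZ; first exact: toC_continuous.
  exact: cvgB lB lA.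
have l1 := cvg_along lf.
have l2 : f (@harmonic R n) @[n --> \oo] --> A - B.
  by apply: cvg_near_cst; apply: nearW => n; apply: fE; exact: harmonic_neq0.
have e : toC 0 *: (2^-1 *: (B *m B) - 2^-1 *: (A *m A)) = A - B.
  exact: (cvg_unique (@norm_hausdorff _ _) l1 l2).
by apply/eqP; rewrite -subr_eq0 -e rmorph0 scale0r.
Qed.
End LimitsAlongReals.

Section GoodGroups.
Context {R : realType} {N : nat}.
Local Notation C := (cplx R).
Local Notation M := 'M[C]_N.

Definition cj (U A : M) : M := U *m A *m invmx U.

(* Gc will be the complexification of G, and gc the Lie algebra of Gc. In
   good_nilp and good_lu, U and d grade the matrices by eigenvalues of mu. *)
Record good (G Gc gc : set M) : Prop := Good {
  good_group : is_subgroup Gc;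
  good_star : forall g, Gc g -> Gc (g^t*);
  good_unitary : forall k, G k <-> Gc k /\ k \is unitarymx;
  good_closed : closed G;
  good_add : forall X Y, gc X -> gc Y -> gc (X + Y);
  good_scale : forall z X, gc X -> gc (z *: X);
  good_zero : gc 0;
  good_lstar : forall X, gc X -> gc (X^t*);
  good_bracket : forall X Y, gc X -> gc Y -> gc (bracket X Y);
  good_Ad : forall g X, Gc g -> gc X -> gc (cj g X);
  good_lie : forall X, lie G X <-> gc X /\ X^t* = - X;
  good_exp : forall X, gc X -> Gc (mexp X);
  good_herm : forall S, S^t* = S -> Gc (mexp S) -> gc S;
  good_nilp : forall S U (d : 'I_N -> R), U \in unitmx -> slower d (cj U S) ->
    Gc (mexp S) -> gc S;
  good_lu : forall mu U d b l, gc mu -> U \is unitarymx ->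
    mu = invmx U *m diag_mx (skewdiag d) *m U -> b \in unitmx ->
    upper d (cj U b) -> lowu d (cj U l) -> Gc (b *m l) -> Gc l;
  good_log : forall k mu, G k -> lie G mu -> k *m mu = mu *m k ->
    exists X, [/\ lie G X, X *m mu = mu *m X & mexp X = k] }.
End GoodGroups.

Section FormGroup.
Context {R : realType} {N : nat}.
Local Notation C := (cplx R).
Local Notation M := 'M[C]_N.
Variables (b c : bool) (J : M).
Hypothesis hJ : b -> [/\ J *m J^T = 1%:M, J^t* = J^T &
  exists s : C, J^T = s *: J /\ s * s = 1].
Implicit Types (A g X S U : M).

(** The flags switch on the form condition ([b]) and the determinant condition ([c]): both with
    [J = 1] for SO, only [c] for SU, only [b] for Sp. *)
Definition fgrp : set M :=
  [set g | [/\ g \in unitmx, c -> \det g = 1 & b -> g^T *m J *m g = J]].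
Definition falg : set M :=
  [set X | (c -> \tr X = 0) /\ (b -> X^T *m J = - (J *m X))].

Lemma fJu : b -> J \in unitmx.
Proof. by move=> /hJ [/mulmx1_unit [u _] _ _]. Qed.
Lemma fJi : b -> invmx J = J^T.
Proof.
move=> hb; have [h _ _] := hJ hb.
by rewrite -[LHS]mulmx1 -h (mulKmx (fJu hb)).
Qed.

Lemma fgrp_J g : b -> g \in unitmx -> g^T *m J *m g = J <-> g *m J *m g^T = J.
Proof.
move=> hb ug; have uJ := fJu hb; have [h1 h2 [s [h3 h4]]] := hJ hb.
have s0 : s != 0 by apply/eqP => s0; move: h4; rewrite s0 mul0r => /eqP; rewrite eq_sym oner_eq0.
have ugT : g^T \in unitmx by rewrite unitmx_tr.
split=> e.
  have e1 : g *m (invmx J *m g^T *m J) = 1%:M.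
    have e2 : invmx J *m g^T *m J *m g = 1%:M by rewrite -!mulmxA (mulmxA g^T) e (mulVmx uJ).
    by have := mulmx1C e2.
  have e3 : g *m (invmx J *m g^T) = invmx J.
    by rewrite -[LHS](mulmxK uJ) -(mulmxA g) e1 mul1mx.
  move: e3; rewrite (fJi hb) h3 -scalemxAl -scalemxAr => /(scalerI s0).
  by rewrite mulmxA.
have e1 : g^T *m (invmx J *m g *m J) = 1%:M.
  have e2 : invmx J *m g *m J *m g^T = 1%:M by rewrite -!mulmxA (mulmxA g) e (mulVmx uJ).
  by have := mulmx1C e2.
have e3 : g^T *m (invmx J *m g) = invmx J.
  by rewrite -[LHS](mulmxK uJ) -(mulmxA g^T) e1 mul1mx.
move: e3; rewrite (fJi hb) h3 -scalemxAl -scalemxAr => /(scalerI s0).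
by rewrite mulmxA.
Qed.

Lemma fgrp_group : is_subgroup fgrp.
Proof.
split.
- by move=> g [].
- by split=> [|_|_]; [exact: unitmx1|exact: det1|rewrite trmx1 mul1mx mulmx1].
- move=> g1 g2 [u1 d1 f1] [u2 d2 f2]; split.
  + by rewrite unitmx_mul u1 u2.
  + by move=> hc; rewrite det_mulmx d1 // d2 // mulr1.
  + move=> hb; rewrite trmx_mul -!mulmxA (mulmxA J) (mulmxA g1^T) (mulmxA g1^T).
    by rewrite f1 // mulmxA f2.
- move=> g [u d f]; split.
  + by rewrite unitmx_inv.
  + by move=> hc; rewrite det_inv d // invr1.
  + move=> hb; rewrite trmx_inv -{1}(f hb).
    have uT : g^T \in unitmx by rewrite unitmx_tr.
    by rewrite -!mulmxA (mulKmx uT) (mulmxV u) mulmx1.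
Qed.

Lemma fgrp_star g : fgrp g -> fgrp (g^t*).
Proof.
move=> [u d f]; split; first by rewrite star_unit.
  by move=> hc; rewrite det_star d // rmorph1.
move=> hb; have [h1 h2 _] := hJ hb; have := f hb => /(fgrp_J hb u) e.
have Jr : map_mx Num.conj J = J.
  by apply: trmx_inj; rewrite map_trmx h2.
have := congr1 (map_mx Num.conj) e; rewrite !map_mxM Jr.
by rewrite map_trmx trmxK.
Qed.

Lemma falg_exp_form X : b -> X^T *m J = - (J *m X) ->
  mexp (X^T) = mexp (J *m (- X) *m invmx J).
Proof. by move=> hb e; rewrite mulmxN -e (mulmxK (fJu hb)). Qed.

Lemma form_exp X : b -> X^T *m J = - (J *m X) -> (mexp X)^T *m J *m mexp X = J.
Proof.
move=> hb e; rewrite -mexp_tr (falg_exp_form hb e) (mexp_conj _ (fJu hb)).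
by rewrite (mulmxKV (fJu hb)) -mulmxA mexpNl mulmx1.
Qed.

(** The group condition becomes an equality of two exponentials. The Lie algebra condition follows
    wherever [mexp] is injective: on Hermitian matrices, on nilpotent ones, and on whole lines. *)
Lemma form_exp_inv X : b -> (mexp X)^T *m J *m mexp X = J ->
  mexp (X^T) = mexp (J *m (- X) *m invmx J).
Proof.
move=> hb e; have uJ := fJu hb; rewrite (mexp_conj _ uJ) mexp_tr.
have e1 : (mexp X)^T *m J = J *m mexp (- X).
  by rewrite -{2}e -!mulmxA mexpNr mulmx1.
by rewrite -e1 (mulmxK uJ).
Qed.

Lemma form_of_eq X : b -> X^T = J *m (- X) *m invmx J -> X^T *m J = - (J *m X).
Proof. by move=> hb e; rewrite e (mulmxKV (fJu hb)) mulmxN. Qed.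

Lemma falg_exp X : falg X -> fgrp (mexp X).
Proof.
move=> [h1 h2]; split; first exact: mexp_unit.
  by move=> hc; rewrite det_mexp h1 // cexp0.
by move=> hb; apply: form_exp => //; exact: h2.
Qed.

Lemma falg_herm S : S^t* = S -> fgrp (mexp S) -> falg S.
Proof.
move=> hS [_ d f]; split.
  move=> hc; have := d hc; rewrite det_mexp.
  have /ccrealP e : \tr S \is Num.real by rewrite CrealE -tr_star hS.
  rewrite e cexp_toC -(rmorph1 (@toC R)) => /toC_inj/eqP.
  by rewrite -expR0 => /eqP/expR_inj ->; rewrite rmorph0.
move=> hb; apply: form_of_eq => //; apply: mexp_herm_inj.
- by rewrite trmxK; apply: trmx_inj; rewrite map_trmx hS trmxK.
- have [h1 h2 _] := hJ hb.
  have hJT : (J^T)^t* = J by rewrite -h2 starK.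
  by rewrite (fJi hb) !star_mul starN hS h2 hJT mulmxA.
- by apply: form_exp_inv => //; exact: f.
Qed.

Lemma slower_tr0 (d : 'I_N -> R) X : slower d X -> \tr X = 0.
Proof. by move=> sX; rewrite /mxtrace big1 // => i _; apply: sX. Qed.

Lemma cj_expr U X k : U \in unitmx -> cj U X ^+ k = cj U (X ^+ k).
Proof.
move=> uU; elim: k => [|k IH].
  by rewrite !expr0 /cj -[X in U *m X]/(1%:M) mulmx1 (mulmxV uU).
rewrite !exprS IH /cj -[LHS]/(_ *m _) -[X * X ^+ k]/(X *m X ^+ k).
by rewrite !mulmxA (mulmxKV uU).
Qed.

Lemma cjK U X : U \in unitmx -> invmx U *m cj U X *m U = X.
Proof. by move=> uU; rewrite /cj mulmxA (mulKmx uU) (mulmxKV uU). Qed.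

Lemma cj_slower_nilp (d : 'I_N -> R) U X : U \in unitmx -> slower d (cj U X) -> X ^+ N.+1 = 0.
Proof.
move=> uU /slower_nilp; rewrite (cj_expr _ _ uU) => h.
by rewrite -(cjK (X ^+ _) uU) h mulmx0 mul0mx.
Qed.

Lemma cj_tr U X : U \in unitmx -> \tr (cj U X) = \tr X.
Proof. by move=> uU; rewrite /cj mxtrace_mulC (mulKmx uU). Qed.

Lemma falg_nilp S U (d : 'I_N -> R) : U \in unitmx -> slower d (cj U S) ->
  fgrp (mexp S) -> falg S.
Proof.
move=> uU sS [_ _ f]; split.
  by move=> _; rewrite -(cj_tr S uU) (slower_tr0 sS).
move=> hb; apply: form_of_eq => //.
have nS := cj_slower_nilp uU sS.
have uJ := fJu hb.
have n1 : (S^T) ^+ N.+1 = 0 by rewrite -tr_expr nS trmx0.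
have n2 : (J *m (- S) *m invmx J) ^+ N.+1 = 0.
  rewrite -/(cj J (- S)) (cj_expr _ _ uJ) exprNn nS mulr0 /cj.
  by rewrite mulmx0 mul0mx.
by rewrite -(mlog_mexp n1) -(mlog_mexp n2) (form_exp_inv hb (f hb)).
Qed.

End FormGroup.

Section FormGroupLie.
Context {R : realType} {N : nat}.
Local Notation C := (cplx R).
Local Notation M := 'M[C]_N.
Variables (b c : bool) (J : M).
Hypothesis hJ : b -> [/\ J *m J^T = 1%:M, J^t* = J^T &
  exists s : C, J^T = s *: J /\ s * s = 1].
Implicit Types (A g l X S U W : M) (d : 'I_N -> R).
Local Notation fgrp := (fgrp b c J).
Local Notation falg := (falg b c J).

(** The logarithm of [l] is strictly graded, hence of trace 0; this avoids any ordering of the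
    basis. *)
Lemma lowu_det d l : lowu d l -> \det l = 1.
Proof.
move=> h; have n : (l - 1%:M) ^+ N.+1 = 0 by apply: slower_nilp h.
rewrite -(mexp_mlog n) det_mexp (_ : \tr _ = 0) ?cexp0 //.
apply: (@slower_tr0 _ _ d); apply: slower_sum => k _.
case: k => -[|k] kN /=; first by rewrite invr0 mulr0 scale0r; exact: slower0.
by apply: slowerZ; apply: slower_expr.
Qed.

Lemma unit_lcancel A X Y : A \in unitmx -> A *m X = A *m Y -> X = Y.
Proof. by move=> uA e; rewrite -(mulKmx uA X) e (mulKmx uA). Qed.

Lemma cjM U A X : U \in unitmx -> cj U (A *m X) = cj U A *m cj U X.
Proof. by move=> uU; rewrite /cj !mulmxA (mulmxKV uU). Qed.

Lemma cj_inj U : U \in unitmx -> injective (cj U).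
Proof. by move=> uU A X h; rewrite -(cjK A uU) h (cjK X uU). Qed.

Lemma cj1 U : U \in unitmx -> cj U 1%:M = 1%:M.
Proof. by move=> uU; rewrite /cj mulmx1 (mulmxV uU). Qed.

Lemma cj_unit U A : U \in unitmx -> (cj U A \in unitmx) = (A \in unitmx).
Proof. by move=> uU; rewrite !unitmx_mul unitmx_inv uU andbT. Qed.

Lemma cj_inv U A : U \in unitmx -> A \in unitmx -> cj U (invmx A) = invmx (cj U A).
Proof.
move=> uU uA; have u : cj U A \in unitmx by rewrite cj_unit.
by apply: (unit_lcancel u); rewrite (mulmxV u) -(cjM _ _ uU) (mulmxV uA) (cj1 uU).
Qed.

Lemma antigraded d W i j : diag_mx (skewdiag d) *m W = - (W *m diag_mx (skewdiag d)) ->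
  W i j = 0 \/ d i = - d j.
Proof.
move=> h; have := congr1 (fun Z : M => Z i j) h.
rewrite mul_diagE [RHS]mxE diag_mulE !mxE => e.
have /eqP : ('i : C) * toC (d i + d j) * W i j = 0.
  by rewrite rmorphD /=; move: e => /eqP; rewrite -subr_eq0 opprK => /eqP <-; ring.
rewrite !mulf_eq0 (negbTE (neq0Ci _)) /= => /orP[|/eqP]; last by left.
rewrite -(rmorph0 (@toC R)) (inj_eq toC_inj) addr_eq0 => /eqP ->; by right.
Qed.

(** Transposition exchanges upper and lower, but [W] pairs the eigenvalue [d i] with [- d i] and
    thereby reverses the order once more. *)
Lemma antigraded_tr d W A : W \in unitmx ->
  diag_mx (skewdiag d) *m W = - (W *m diag_mx (skewdiag d)) ->
  (upper d A -> upper d (invmx W *m A^T *m W)) /\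
  (slower d A -> slower d (invmx W *m A^T *m W)).
Proof.
move=> uW h.
have h' : diag_mx (skewdiag d) *m invmx W = - (invmx W *m diag_mx (skewdiag d)).
  have e : W *m (diag_mx (skewdiag d) *m invmx W) = - diag_mx (skewdiag d).
    by rewrite mulmxA -[W *m _]opprK -h mulNmx (mulmxK uW).
  by rewrite -[LHS](mulKmx uW) e mulmxN.
have key i j : (forall p q, d i = - d p -> d q = - d j -> A q p = 0) ->
    (invmx W *m A^T *m W) i j = 0.
  move=> hA; rewrite mxE big1 // => q _.
  case: (antigraded q j h) => [->|hq]; first by rewrite mulr0.
  rewrite mxE big1 ?mul0r // => p _.
  case: (antigraded i p h') => [->|hp]; first by rewrite mul0r.
  by rewrite mxE hA ?mulr0.
split=> hA i j ij; apply: key => p q ip qj; apply: hA; move: ij; rewrite ip.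
  by have -> : d j = - d q by [rewrite qj opprK]; rewrite ltrN2.
by have -> : d j = - d q by [rewrite qj opprK]; rewrite lerN2.
Qed.

(** With tau(A) = J^-1 A^T J, the form is preserved exactly when tau(g) g = 1. As [mu] lies in the
    Lie algebra, tau preserves both kinds of triangularity, so [p *m l] and tau(p)^-1 tau(l)^-1 are
    two factorizations of one element. Uniqueness gives l = tau(l)^-1. *)
Lemma fgrp_lu mu U d (p l : M) : falg mu -> U \is unitarymx ->
  mu = invmx U *m diag_mx (skewdiag d) *m U -> p \in unitmx ->
  upper d (cj U p) -> lowu d (cj U l) -> fgrp (p *m l) -> fgrp l.
Proof.
move=> [_ fmu] uU emu up hp hl [ug dg fg].
have uUm := unitarymx_unit uU.
have [ul' hl'] := lowu_inv hl.
have ul : l \in unitmx by rewrite -(cj_unit l uUm).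
split; first exact: ul.
  move=> _; have := lowu_det hl; rewrite /cj !det_mulmx det_inv => <-.
  by rewrite mulrAC divrr ?mul1r // -unitmxE.
move=> hb; have uJ := fJu hJ hb.
have uUT : U^T \in unitmx by rewrite unitmx_tr.
(* The matrix of the form in the eigenbasis of [mu]. *)
pose W := invmx U^T *m J *m invmx U.
have uW : W \in unitmx by rewrite !unitmx_mul !unitmx_inv uUT uJ uUm.
have hW : diag_mx (skewdiag d) *m W = - (W *m diag_mx (skewdiag d)).
  have e := fmu hb; rewrite emu !trmx_mul tr_diag_mx in e.
  have := congr1 (fun Z => invmx U^T *m Z *m invmx U) e.
  rewrite trmx_inv !mulmxA (mulVmx uUT) mul1mx mulmxN mulNmx !mulmxA (mulmxK uUm).
  by move=> ->.
have [tau tauE] : exists tau, forall A, tau A = invmx J *m A^T *m J by exists (fun A => invmx J *m A^T *m J).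
have ctau A : cj U (tau A) = invmx W *m (cj U A)^T *m W.
  have iW : invmx W = U *m invmx J *m U^T.
    apply: (unit_lcancel uW); rewrite (mulmxV uW) /W !mulmxA (mulmxKV uUm).
    by rewrite (mulmxK uJ) (mulVmx uUT).
  rewrite tauE iW /W /cj !trmx_mul trmx_inv !mulmxA (mulmxK uUT).
  by rewrite (mulmxK uUT).
have tauM A X : tau (A *m X) = tau X *m tau A.
  by rewrite !tauE trmx_mul !mulmxA (mulmxK uJ).
have uT A : A \in unitmx -> tau A \in unitmx.
  by move=> uA; rewrite tauE !unitmx_mul unitmx_inv uJ unitmx_tr uA.
have tg : tau (p *m l) *m (p *m l) = 1%:M.
  by rewrite tauE -!mulmxA (mulmxA _^T) (fg hb) (mulVmx uJ).
have eg : p *m l = invmx (tau p) *m invmx (tau l).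
  have ut : tau (p *m l) \in unitmx := uT _ ug.
  apply: (unit_lcancel ut); rewrite tg tauM -mulmxA (mulKVmx (uT _ up)).
  by rewrite (mulmxV (uT _ ul)).
have up1 : upper d (cj U (invmx (tau p))).
  rewrite (cj_inv uUm (uT _ up)); apply: upper_inv; first by rewrite (cj_unit _ uUm) uT.
  by rewrite ctau; have [h _] := antigraded_tr (cj U p) uW hW; exact: h.
have lo1 : lowu d (cj U (invmx (tau l))).
  rewrite (cj_inv uUm (uT _ ul)); apply: (proj2 (lowu_inv _)); rewrite ctau /lowu.
  have -> : invmx W *m (cj U l)^T *m W - 1%:M = invmx W *m (cj U l - 1%:M)^T *m W.
    by rewrite raddfB /= trmx1 mulmxBr mulmx1 mulmxBl (mulVmx uW).
  by have [_ h] := antigraded_tr (cj U l - 1%:M) uW hW; exact: h.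
have [_ e1] := @lu_unique _ _ _ d (cj U p) (cj U l) (etrans (cj_unit p uUm) up) hp hl.
have up2 : cj U (invmx (tau p)) \in unitmx by rewrite (cj_unit _ uUm) unitmx_inv uT.
have [_ e2] := lu_unique up2 up1 lo1.
have el : l = invmx (tau l).
  by apply: (cj_inj uUm); rewrite -e1 -e2 -!(cjM _ _ uUm) eg.
have e3 : tau l *m l = 1%:M by rewrite {2}el (mulmxV (uT _ ul)).
have := congr1 (mulmx J) e3.
by rewrite tauE mulmx1 !mulmxA (mulmxV uJ) mul1mx.
Qed.

Lemma fgrp_Jinv g : b -> fgrp g -> g^T *m J = J *m invmx g /\ invmx g^T *m J = J *m g.
Proof.
move=> hb [u _ f]; have uT : g^T \in unitmx by rewrite unitmx_tr.
split; first by rewrite -{2}(f hb) (mulmxK u).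
by rewrite -{1}(f hb) -mulmxA (mulKmx uT).
Qed.

Lemma falg_Ad g X : fgrp g -> falg X -> falg (cj g X).
Proof.
move=> hg [tX fX]; have [u _ _] := hg; split; first by move=> hc; rewrite (cj_tr _ u) tX.
move=> hb; have [h1 h2] := fgrp_Jinv hb hg.
rewrite /cj !trmx_mul trmx_inv -!mulmxA h1 (mulmxA X^T) (fX hb) mulNmx mulmxN.
by rewrite -!mulmxA (mulmxA (invmx _)) h2 -!mulmxA.
Qed.

Lemma falg_add X Y : falg X -> falg Y -> falg (X + Y).
Proof.
move=> [t1 f1] [t2 f2]; split=> h; first by rewrite mxtraceD t1 // t2 // addr0.
by rewrite raddfD /= mulmxDl f1 // f2 // mulmxDr opprD.
Qed.

Lemma falg_scale z X : falg X -> falg (z *: X).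
Proof.
move=> [t1 f1]; split=> h; first by rewrite mxtraceZ t1 // mulr0.
by rewrite linearZ /= -scalemxAl f1 // scalerN scalemxAr.
Qed.

Lemma falg_lstar X : falg X -> falg (X^t*).
Proof.
move=> [t1 f1]; split=> h; first by rewrite tr_star t1 // rmorph0.
have [h1 h2 [s [hs1 hs2]]] := hJ h; have uJ := fJu hJ h.
have Jr : map_mx Num.conj J = J by apply: trmx_inj; rewrite map_trmx h2.
have JJ : J *m J = s *: 1%:M.
  have {1}-> : J = s *: J^T by rewrite hs1 scalerA hs2 scale1r.
  by rewrite -scalemxAl; have -> : J^T *m J = 1%:M by exact: mulmx1C.
have e3 : X^t* *m J = - (J *m map_mx Num.conj X).
  by have := congr1 (map_mx Num.conj) (f1 h); rewrite map_mxN !map_mxM Jr.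
have e5 : map_mx Num.conj X = - (s *: (J *m X^t* *m J)).
  have : invmx J *m (X^t* *m J) = - map_mx Num.conj X by rewrite e3 mulmxN (mulKmx uJ).
  by rewrite (fJi hJ h) hs1 -scalemxAl mulmxA => ->; rewrite opprK.
rewrite map_trmx trmxK e5 mulNmx -scalemxAl -!mulmxA JJ -!scalemxAr mulmx1.
by rewrite scalerA hs2 scale1r.
Qed.

Lemma falg_bracket X Y : falg X -> falg Y -> falg (bracket X Y).
Proof.
move=> [t1 f1] [t2 f2]; split=> h.
  by rewrite /bracket raddfB /= mxtrace_mulC subrr.
rewrite /bracket raddfB /= !trmx_mul mulmxBl mulmxBr -!mulmxA f1 // f2 //.
rewrite !mulmxN !mulmxA f1 // f2 // !mulNmx !opprK opprB.
by [].
Qed.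

Lemma closed_det1 : closed [set A : M | \det A = 1].
Proof.
have -> : [set A : M | \det A = 1] = [set A : M | (\det A)%:M = (1%:M : 'M[C]_1)].
  apply/seteqP; split => A /=; first by move=> ->; exact: erefl.
  by move=> /matrixP /(_ 0 0); rewrite !mxE eqxx !mulr1n.
apply: (@closed_eq_cont _ _ _ _ (fun A : M => (\det A)%:M : 'M_1) (fun=> 1%:M)); last first.
  exact: cst_continuous.
move=> A; apply: (@cvg_mx _ _ (nbhs A)) => i j; rewrite mxE.
under eq_fun do rewrite mxE.
case: (i == j); last exact: cvg_cst.
by rewrite !mulr1n; apply: cvg_det; exact: cvg_id.
Qed.

Lemma unitary_closed : closed [set A : M | A \is unitarymx].
Proof.
have -> : [set A : M | A \is unitarymx] = [set A : M | A *m A^t* = 1%:M].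
  by apply/seteqP; split => A /= /unitarymxP.
apply: (@closed_eq_cont _ _ _ _ (fun A : M => A *m A^t*) (fun=> 1%:M)); last first.
  exact: cst_continuous.
move=> A; apply: (@cvg_mulmx _ _ (nbhs A)); first exact: cvg_id.
by apply: cvg_star; exact: cvg_id.
Qed.

Lemma fgrp_unitary_closed : closed [set k | fgrp k /\ k \is unitarymx].
Proof.
have -> : [set k | fgrp k /\ k \is unitarymx] =
   [set A | A \is unitarymx] `&` ([set A | c -> \det A = 1] `&` [set A | b -> A^T *m J *m A = J]).
  apply/seteqP; split => A /=; first by move=> [[u h1 h2] h3].
  move=> [h1 [h2 h3]]; split; last exact: h1.
  by split; [exact: unitarymx_unit h1|exact: h2|exact: h3].
apply: closedI; first exact: unitary_closed.
apply: closedI.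
  case: c; last by rewrite (_ : mkset _ = setT) //; apply/seteqP; split.
  rewrite (_ : mkset _ = [set A : M | \det A = 1]); first exact: closed_det1.
  by apply/seteqP; split => A /=; [apply|].
case: b; last by rewrite (_ : mkset _ = setT) //; apply/seteqP; split.
rewrite (_ : mkset _ = [set A : M | A^T *m J *m A = J]); last first.
  by apply/seteqP; split => A /=; [apply|].
apply: (@closed_eq_cont _ _ _ _ (fun A : M => A^T *m J *m A) (fun=> J)); last first.
  exact: cst_continuous.
move=> A; apply: (@cvg_mulmx _ _ (nbhs A)); last exact: cvg_id.
apply: (@cvg_mulmx _ _ (nbhs A)); last exact: cvg_cst.
by apply: cvg_tr; exact: cvg_id.
Qed.

Lemma mexp_skew_unitary X : X^t* = - X -> mexp X \is unitarymx.
Proof. by move=> h; apply/unitarymxP; rewrite -mexp_star h mexpNr. Qed.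

Lemma unitary_unit_star (k : M) : k \is unitarymx -> k^t* = invmx k.
Proof. by move=> h; rewrite invmx_unitary. Qed.

Section Lie.
Variable G : set M.
Hypothesis hG : forall k, G k <-> fgrp k /\ k \is unitarymx.

Lemma fgrp_lie X : lie G X <-> falg X /\ X^t* = - X.
Proof.
split=> [h|[h1 h2] t]; last first.
  apply/hG; split; first by apply: (falg_exp hJ); apply: falg_scale.
  by apply: mexp_skew_unitary; rewrite starZ conj_toC h2 scalerN.
split; last first.
  apply: mexp_line_inj => t; have /hG [_ u] := h t.
  have -> : toC t *: X^t* = (toC t *: X)^t* by rewrite starZ conj_toC.
  by rewrite mexp_star (unitary_unit_star u) -mexpN scalerN.
split=> [hc|hb].
  have e : (\tr X)%:M = (0 : 'M[C]_1).
    apply: mexp_line_inj => t; have /hG [[_ d _] _] := h t.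
    rewrite scaler0 mexp0 scale_scalar_mx mexp_scalar1 -mxtraceZ -det_mexp d //.
  by have := congr1 (fun Z : 'M[C]_1 => Z 0 0) e; rewrite !mxE.
apply: (form_of_eq hJ hb); apply: mexp_line_inj => t; have /hG [[_ _ f] _] := h t.
have := form_exp_inv hJ hb (f hb).
rewrite linearZ /= => ->.
by rewrite -scalerN -scalemxAr -scalemxAl.
Qed.
End Lie.
End FormGroupLie.

(** * Logarithms of unitary matrices *)

Section UnitaryLog.
Context {R : realType}.
Local Notation C := (cplx R).
Implicit Types (a z : C) (q : R).

(** The principal argument, except that [Num.sg 0 = 0] gives -1 the value 0. Thus [clog] is odd
    under conjugation on the whole circle, at the price of missing the eigenvalue -1, which is
    treated separately. *)
Definition carg a : R := Num.sg (cim a) * acos (cre a).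
Definition clog a : C := 'i * toC (carg a).

Lemma clogN1 : clog (-1) = 0.
Proof.
rewrite /clog /carg; have -> : cim (-1 : C) = 0 by rewrite -(rmorphN1 (@toC R)) cim_toC.
by rewrite sgr0 mul0r rmorph0 mulr0.
Qed.

Lemma circle_sqr a : a * Num.conj a = 1 -> cre a ^+ 2 + cim a ^+ 2 = 1.
Proof. by rewrite mulCconj -(rmorph1 (@toC R)) => /toC_inj; rewrite cabs_sqr. Qed.

Lemma cexp_clog a : a * Num.conj a = 1 -> a != -1 -> cexp (clog a) = a.
Proof.
move=> /circle_sqr h aN1.
have x1 : -1 <= cre a <= 1 by rewrite -ler_norml -(@ler_pXn2r _ 2%N) ?nnegrE ?normr_ge0 // expr1n real_normK ?num_real // -h lerDl sqr_ge0.
have hs : sin (acos (cre a)) = `|cim a|.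
  by rewrite sin_acos // -h addrC addKr sqrtr_sqr.
have hc : cos (acos (cre a)) = cre a by apply: acosK; rewrite in_itv.
rewrite /clog cexp_iM /carg [RHS]creim; case: (ltgtP (cim a) 0) => im0.
- rewrite ltr0_sg // mulN1r cosN sinN hs hc (ltr0_norm im0) opprK.
  by [].
- by rewrite gtr0_sg // mul1r hs hc (gtr0_norm im0).
- rewrite im0 sgr0 mul0r cos0 sin0; suff -> : cre a = 1 by [].
  move: h; rewrite im0 expr0n /= addr0 => /eqP; rewrite sqrf_eq1 => /orP[/eqP//|/eqP e].
  by move: aN1; rewrite [a]creim im0 e rmorph0 mulr0 addr0 rmorphN1 eqxx.
Qed.

Lemma clog_conj a : clog (Num.conj a) = - clog a.
Proof. by rewrite /clog /carg cim_conj cre_conj sgrN mulNr rmorphN mulrN. Qed.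

Lemma cexp_ipi : cexp ('i * toC pi) = -1 :> C.
Proof. by rewrite cexp_iM cospi sinpi rmorph0 mulr0 addr0 rmorphN1. Qed.

Lemma cexp_ipiN : cexp (- ('i * toC pi)) = -1 :> C.
Proof.
have h := cexpD ('i * toC pi) (- ('i * toC pi) : C); move: h.
by rewrite subrr cexp0 cexp_ipi mulN1r => ->; rewrite opprK.
Qed.
End UnitaryLog.

Section UnitaryLogMatrix.
Context {R : realType} {N : nat}.
Local Notation C := (cplx R).
Local Notation M := 'M[C]_N.
Implicit Types (A B F k mu p r Q U X : M).

Definition fdiag U (a : 'rV[C]_N) := invmx U *m diag_mx a *m U.

Lemma fdiagM U a1 a2 : U \in unitmx ->
  fdiag U a1 *m fdiag U a2 = fdiag U (\row_i (a1 0 i * a2 0 i)).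
Proof.
move=> uU; rewrite /fdiag !mulmxA (mulmxK uU) -(mulmxA (invmx U)) mulmx_diag.
by [].
Qed.

Lemma fdiagD U a1 a2 : fdiag U (a1 + a2) = fdiag U a1 + fdiag U a2.
Proof. by rewrite /fdiag raddfD mulmxDr mulmxDl. Qed.
Lemma fdiagZ U z a1 : fdiag U (z *: a1) = z *: fdiag U a1.
Proof. by rewrite /fdiag linearZ -scalemxAr -scalemxAl. Qed.
Lemma fdiag1 U : U \in unitmx -> fdiag U (const_mx 1) = 1%:M.
Proof. by move=> uU; rewrite /fdiag diag_const_mx mulmx1 (mulVmx uU). Qed.
Lemma fdiag0 U : fdiag U 0 = 0.
Proof. by rewrite /fdiag raddf0 mulmx0 mul0mx. Qed.

Lemma fdiag_fcalc U a (f : C -> C) : U \in unitmx ->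
  fcalc (fdiag U a) f (fdiag U (map_mx f a)).
Proof. by move=> uU; exists U, a; split. Qed.

Lemma fdiag_star U a : U \is unitarymx -> (fdiag U a)^t* = fdiag U (map_mx Num.conj a).
Proof.
move=> uU; rewrite /fdiag !star_mul (unitary_starE uU) starK mulmxA.
suff -> : (diag_mx a)^t* = diag_mx (map_mx Num.conj a) by [].
apply/matrixP => i j; rewrite !mxE eq_sym; case: eqP => [->|_]; last by rewrite !mulr0n conjC0.
by rewrite !mulr1n.
Qed.

Lemma mexp_fdiag U a : U \in unitmx -> mexp (fdiag U a) = fdiag U (map_mx cexp a).
Proof. by move=> uU; rewrite /fdiag (mexp_conjV _ uU) mexp_diag. Qed.

Lemma tr_fdiag U a : U \in unitmx -> \tr (fdiag U a) = \sum_i a 0 i.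
Proof.
move=> uU; rewrite /fdiag mxtrace_mulC (mulKVmx uU) /mxtrace.
by apply: eq_bigr => i _; rewrite mxE eqxx mulr1n.
Qed.

Lemma fdiag_inj U a1 a2 : U \in unitmx -> fdiag U a1 = fdiag U a2 -> a1 = a2.
Proof.
move=> uU e; have h a : U *m fdiag U a *m invmx U = diag_mx a.
  by rewrite /fdiag -mulmxA (mulmxK uU) (mulKVmx uU).
have e2 : diag_mx a1 = diag_mx a2 by rewrite -(h a1) e h.
apply/rowP => i; have := congr1 (fun Z : M => Z i i) e2.
by rewrite !mxE eqxx !mulr1n.
Qed.

Lemma unitary_spec k : k \is unitarymx -> exists U a, [/\ U \is unitarymx,
  k = fdiag U a & forall i, a 0 i * Num.conj (a 0 i) = 1].
Proof.
move=> uk; have kk := unitarymx_unit uk.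
have nk : k \is normalmx by apply/normalmxP; rewrite (unitarymxP uk) -(invmx_unitary uk) (mulVmx kk).
have [U [a [uU e]]] : exists U a, U \is unitarymx /\ k = fdiag U a.
  have /orthomx_spectralP e := nk.
  by exists (spectralmx k), (spectral_diag k); split; [exact: spectral_unitarymx|exact: e].
have uUm := unitarymx_unit uU; exists U, a; split; [exact: uU|exact: e|].
move=> i; have : k *m k^t* = 1%:M by apply/unitarymxP.
rewrite e (fdiag_star _ uU) (fdiagM _ _ uUm) -(fdiag1 uUm).
move=> /(fdiag_inj uUm)/rowP/(_ i).
by rewrite !mxE.
Qed.

(** The eigenvalues of [Q] are 0, 1 and -1, and the exponential turns the latter two into -1. So a
    root [Q] of a projection [p] yields a logarithm of the reflection 1 - 2 p. *)
Lemma mexp_ipi Q : Q^t* = Q -> Q *m Q *m Q = Q ->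
  mexp (('i * toC pi) *: Q) = 1%:M - 2%:R *: (Q *m Q).
Proof.
move=> hQ e; have [U [q [uU eQ]]] := herm_spec hQ.
have uUm := unitarymx_unit uU; rewrite -/(fdiag _ _) in eQ.
rewrite eQ -fdiagZ (mexp_fdiag _ uUm) (fdiagM _ _ uUm) -fdiagZ -(fdiag1 uUm).
rewrite -[- fdiag _ _]scaleN1r -fdiagZ -fdiagD.
suff -> : map_mx cexp (('i * toC pi) *: \row_i toC (q i)) = const_mx 1 +
   -1 *: (2%:R *: (\row_i ((\row_i toC (q i)) 0 i * (\row_i toC (q i)) 0 i : C))) :> 'rV[C]_N by [].
apply/rowP => i; rewrite !mxE.
have : q i * q i * q i = q i.
  move: e; rewrite eQ !(fdiagM _ _ uUm) => /(fdiag_inj uUm)/rowP/(_ i).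
  by rewrite !mxE -!rmorphM => /toC_inj.
move=> /eqP; rewrite -subr_eq0 (_ : _ - _ = q i * (q i - 1) * (q i + 1)); last by ring.
rewrite !mulf_eq0 -orbA => /or3P[/eqP h|h|h].
- have -> : toC (q i) = 0 by rewrite h rmorph0.
  by rewrite !mulr0 cexp0 addr0.
- have -> : toC (q i) = 1 by rewrite -(rmorph1 (@toC R)); congr toC; apply/eqP; rewrite -subr_eq0.
  by rewrite !mulr1 cexp_ipi; ring.
- have -> : toC (q i) = -1 by rewrite -(rmorphN1 (@toC R)); congr toC; apply/eqP; rewrite -addr_eq0.
  by rewrite mulrN1 cexp_ipiN; ring.
Qed.

(** Induction on the rank of [r]: a nonzero subprojection [q] with a root is split off, and [extra]
    is what makes the step applicable to [r - q]. Roots on orthogonal ranges add up. *)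
Lemma herm_proj_split (extra : M -> Prop) (anti : M -> Prop) :
  anti 0 -> (forall A B, anti A -> anti B -> anti (A + B)) ->
  (forall r, r^t* = r -> r *m r = r -> extra r -> r != 0 ->
    exists Q q, [/\ Q^t* = Q, anti Q & Q *m Q = q] /\
      [/\ Q *m q = Q, q *m r = q, r *m q = q, q != 0 & extra (r - q)]) ->
  forall r, r^t* = r -> r *m r = r -> extra r ->
    exists Q, [/\ Q^t* = Q, anti Q, Q *m Q = r & Q *m r = Q].
Proof.
move=> a0 aD step r; have [n] := ubnP (\rank r); elim: n r => // n IH r rn hr rr er.
case: (eqVneq r 0) => [->|r0].
  by exists 0; rewrite star0 !mulmx0.
have [Q [q [[hQ aQ QQ] [Qq qr rq q0 er']]]] := step r hr rr er r0.
have hq : q^t* = q by rewrite -QQ star_mul hQ.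
have qq : q *m q = q by rewrite -{1}QQ -mulmxA Qq QQ.
have h1 : (r - q)^t* = r - q by rewrite starB hr hq.
have h2 : (r - q) *m (r - q) = r - q.
  by rewrite mulmxBr !mulmxBl rr rq qr qq subrr subr0.
have rk : (\rank (r - q)%R < n)%N.
  apply: (@leq_trans (\rank r)); last by rewrite -ltnS.
  apply: rank_ltmx; rewrite /ltmx.
  have -> : ((r - q)%R <= r)%MS by apply/submxP; exists (r - q); rewrite mulmxBl rr qr.
  apply/negP => /submxP [D eD]; move: q0; rewrite -rq eD -mulmxA mulmxBl rq qq subrr mulmx0.
  by rewrite eqxx.
have [Q' [hQ' aQ' QQ' Qr']] := IH _ rk h1 h2 er'.
have Qq' : Q' *m q = 0 by rewrite -Qr' -mulmxA mulmxBl rq qq subrr mulmx0.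
have qQ' : q *m Q' = 0 by rewrite -[LHS]starK star_mul hQ' hq Qq' star0.
have z1 : Q *m Q' = 0 by rewrite -Qq -mulmxA qQ' mulmx0.
have z2 : Q' *m Q = 0 by rewrite -[LHS]starK star_mul hQ' hQ z1 star0.
exists (Q + Q'); split.
- by rewrite starD hQ hQ'.
- exact: aD.
- by rewrite mulmxDr !mulmxDl QQ QQ' z1 z2 addr0 add0r subrKC.
- have Qr : Q *m r = Q by rewrite -{1}Qq -mulmxA qr Qq.
  have Q'r : Q' *m r = Q'.
    by rewrite -{2}Qr' mulmxBr Qq' subr0.
  by rewrite mulmxDl Qr Q'r.
Qed.

Lemma unit_row (u : 'rV[C]_N) : u != 0 -> exists2 x : R, x != 0 &
  (toC x *: u) *m (toC x *: u)^t* = 1%:M.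
Proof.
move=> u0; pose s := cre ((u *m u^t*) 0 0).
have es : (u *m u^t*) 0 0 = toC s by apply: ge0_ctoC; apply: row_norm_ge0.
have s0 : 0 < s.
  rewrite lt_neqAle -toC_le rmorph0 -es row_norm_ge0 andbT.
  apply: contraNneq u0 => s0; apply/eqP/row_norm0/matrixP => i j.
  by rewrite !ord1 es -s0 rmorph0 mxE.
have q0 : Num.sqrt s != 0 by rewrite sqrtr_eq0 -ltNge.
exists (Num.sqrt s)^-1; first by rewrite invr_neq0.
rewrite starZ conj_toC -scalemxAl -scalemxAr scalerA -rmorphM.
apply/matrixP => i j; rewrite !ord1 mxE es mxE eqxx -rmorphM /=.
by rewrite -invfM -expr2 sqr_sqrtr ?ltW // mulVf ?rmorph1 // gt_eqF.
Qed.

Lemma row_in r : r != 0 -> r *m r = r -> exists2 u : 'rV[C]_N, u != 0 &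
  u *m r = u /\ exists i, u = row i r.
Proof.
move=> r0 rr; have [i ri] : exists i, row i r != 0.
  apply/existsP; apply: contraNT r0; rewrite negb_exists => /forallP h.
  by apply/eqP/row_matrixP => i; apply/eqP; have := h i; rewrite negbK row0.
by exists (row i r) => //; rewrite -row_mul rr; split => //; exists i.
Qed.

Lemma det_sylvester m n (x : 'M[C]_(m, n)) (y : 'M[C]_(n, m)) :
  \det (1%:M - x *m y) = \det (1%:M - y *m x).
Proof.
have e1 : block_mx 1%:M x y 1%:M = block_mx 1%:M 0 y 1%:M *m block_mx 1%:M x 0 (1%:M - y *m x).
  by rewrite mulmx_block !mul1mx !mulmx0 !mul0mx !mulmx1 !addr0 subrKC.
have e2 : block_mx 1%:M x y 1%:M = block_mx (1%:M - x *m y) x 0 1%:M *m block_mx 1%:M 0 y 1%:M.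
  by rewrite mulmx_block !mul1mx !mulmx0 !mul0mx !mulmx1 !add0r subrK.
have := congr1 determinant e1; rewrite {1}e2 !det_mulmx !det_ublock !det_lblock !det1.
by rewrite !mulr1 !mul1r.
Qed.

Lemma det_reflection (v : 'rV[C]_N) : v *m v^T = 1%:M ->
  \det (1%:M - 2%:R *: (v^T *m v)) = -1.
Proof.
move=> vv; rewrite scalemxAl det_sylvester -scalemxAr vv det_mx11 !mxE !eqxx !mulr1n.
by ring.
Qed.
End UnitaryLogMatrix.

(** * Square roots of projections compatible with a bilinear form *)

Section SquareRoots.
Context {R : realType} {N : nat}.
Local Notation C := (cplx R).
Local Notation M := 'M[C]_N.
Implicit Types (A B F k mu p r Q U X J : M).

(** Membership in the Lie algebra of the group preserving [J]. *)
Definition anti J Q := Q^T *m J = - (J *m Q).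

Lemma anti0 J : anti J 0.
Proof. by rewrite /anti trmx0 mul0mx mulmx0 oppr0. Qed.
Lemma antiD J A B : anti J A -> anti J B -> anti J (A + B).
Proof. by rewrite /anti => h1 h2; rewrite raddfD /= mulmxDl h1 h2 mulmxDr opprD. Qed.

Lemma reflection_mul A B : A *m B = 0 ->
  (1%:M - 2%:R *: A) *m (1%:M - 2%:R *: B) = 1%:M - 2%:R *: (A + B).
Proof.
move=> AB; rewrite mulmxBr mulmx1 mulmxBl mul1mx -scalemxAr -scalemxAl AB.
by rewrite !scaler0 subr0 scalerDr opprD addrA.
Qed.

Lemma det_reflections A B U X Y : A = B *m U -> U = X *m Y ->
  \det A = 1 -> \det X = -1 -> \det Y = -1 -> \det B = 1.
Proof.
move=> -> ->; rewrite !det_mulmx => h hX hY.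
by move: h; rewrite hX hY mulrNN !mulr1.
Qed.

Lemma real_unit_row r : r^t* = r -> r *m r = r -> r^T = r -> r != 0 ->
  exists v : 'rV[C]_N, [/\ v^t* = v^T, v *m v^T = 1%:M & v *m r = v].
Proof.
move=> hr rr rT r0; have cr : map_mx Num.conj r = r by rewrite -{2}hr rT.
have [u u0 [ur [i ui]]] := row_in r0 rr.
have cu : map_mx Num.conj u = u by rewrite ui map_row cr.
have [x x0 h] := unit_row u0; exists (toC x *: u).
have e : (toC x *: u)^t* = (toC x *: u)^T.
  by rewrite starZ conj_toC linearZ /= -map_trmx cu.
by split; [exact: e|rewrite -e|rewrite -scalemxAl ur].
Qed.

(** The determinant condition says that the real projection [r] has even rank. So its range contains
    two orthonormal real rows [v] and [w], and on their plane [i] times the generator of rotations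
    is Hermitian, skew-symmetric and of square 1. *)
Lemma skew_sqrt_SO r : r^t* = r -> r *m r = r -> r^T = r /\ \det (1%:M - 2%:R *: r) = 1 ->
  exists Q, [/\ Q^t* = Q, anti 1%:M Q, Q *m Q = r & Q *m r = Q].
Proof.
apply: (@herm_proj_split _ _ (fun r => r^T = r /\ \det (1%:M - 2%:R *: r) = 1) (anti 1%:M)).
- exact: anti0.
- exact: antiD.
move=> {}r hr rr [rT dr] r0.
have [v [cv vv vr]] := real_unit_row hr rr rT r0.
have rv : r *m v^T = v^T by rewrite -{1}rT -trmx_mul vr.
pose r1 := r - v^T *m v.
have vvT : (v^T *m v)^T = v^T *m v by rewrite trmx_mul trmxK.
have cvT : (v^T)^t* = v by rewrite -cv starK.
have vvs : (v^T *m v)^t* = v^T *m v by rewrite star_mul cv cvT.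
have r1T : r1^T = r1 by rewrite raddfB /= rT vvT.
have r1s : r1^t* = r1 by rewrite starB hr vvs.
have r1v : r1 *m v^T = 0 by rewrite mulmxBl rv -mulmxA vv mulmx1 subrr.
have vr1 : v *m r1 = 0 by rewrite mulmxBr vr mulmxA vv mul1mx subrr.
have r1r1 : r1 *m r1 = r1.
  rewrite {1}/r1 mulmxBl -(mulmxA v^T) vr1 mulmx0 subr0 /r1 mulmxBr rr mulmxA rv.
  by [].
(* Rank one would make 1 - 2 r a single reflection, of determinant -1. *)
have r10 : r1 != 0.
  apply/eqP => e; have er : r = v^T *m v by apply/eqP; rewrite -subr_eq0 -/r1 e.
  move: dr; rewrite er det_reflection // => /eqP; rewrite -subr_eq0 -opprD oppr_eq0.
  by rewrite -(natrD _ 1 1) pnatr_eq0.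
have [w [cw ww wr1]] := real_unit_row r1s r1r1 r1T r10.
have cwT : (w^T)^t* = w by rewrite -cw starK.
have wv : w *m v^T = 0 by rewrite -wr1 -mulmxA r1v mulmx0.
have vw : v *m w^T = 0 by rewrite -[LHS]trmxK trmx_mul trmxK wv trmx0.
have wr : w *m r = w.
  rewrite -{1}wr1 -mulmxA /r1 mulmxBl rr -mulmxA vr -/r1.
  exact: wr1.
pose q := v^T *m v + w^T *m w.
have vvK (Z : 'rV[C]_N) : v *m (v^T *m Z) = Z by rewrite mulmxA vv mul1mx.
have wwK (Z : 'rV[C]_N) : w *m (w^T *m Z) = Z by rewrite mulmxA ww mul1mx.
have vwK (Z : 'rV[C]_N) : v *m (w^T *m Z) = 0 by rewrite mulmxA vw mul0mx.
have wvK (Z : 'rV[C]_N) : w *m (v^T *m Z) = 0 by rewrite mulmxA wv mul0mx.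
have qr : q *m r = q by rewrite mulmxDl -!mulmxA vr wr.
have qT : q^T = q by rewrite raddfD /= !trmx_mul !trmxK.
have rq : r *m q = q by rewrite -[LHS]trmxK trmx_mul rT qT qr qT.
have q0 : q != 0.
  apply/eqP => e; have : v *m (q *m v^T) = 1%:M.
    by rewrite mulmxDl mulmxDr -!mulmxA vv wv !mulmx0 addr0 mulmx1 vv.
  rewrite e mul0mx mulmx0 => /matrixP/(_ 0 0)/eqP.
  by rewrite !mxE eqxx eq_sym oner_eq0.
exists ('i *: (v^T *m w - w^T *m v)), q; split; split.
- rewrite starZ conjCi starB !star_mul cv cw cvT cwT scaleNr -scalerN opprB.
  by [].
- by rewrite /anti mul1mx mulmx1 linearZ raddfB /= !trmx_mul !trmxK -scalerN opprB.
- rewrite -scalemxAl -scalemxAr scalerA -expr2 sqrCi scaleN1r.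
  rewrite mulmxBl !mulmxBr -!mulmxA wvK wwK vvK vwK !mulmx0 sub0r subr0.
  by rewrite opprB opprK addrC.
- rewrite -scalemxAl mulmxBl !mulmxDr -!mulmxA wvK wwK vvK vwK !mulmx0 add0r addr0.
  by [].
- exact: qr.
- exact: rq.
- exact: q0.
split; first by rewrite raddfB /= rT qT.
have qq : q *m q = q.
  by rewrite /q mulmxDl !mulmxDr -!mulmxA wvK wwK vvK vwK !mulmx0 addr0 add0r.
have e1 : 1%:M - 2%:R *: q = (1%:M - 2%:R *: (v^T *m v)) *m (1%:M - 2%:R *: (w^T *m w)).
  by rewrite reflection_mul // -mulmxA vwK mulmx0.
have e2 : 1%:M - 2%:R *: r = (1%:M - 2%:R *: (r - q)) *m (1%:M - 2%:R *: q).
  by rewrite reflection_mul ?subrK // mulmxBl rq qq subrr.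
exact: det_reflections e2 e1 dr (det_reflection vv) (det_reflection ww).
Qed.

(** The range of [r] is stable under the quaternionic structure sending [v] to conj(v) J. A unit row
    [v] and its image [w] are orthonormal, and the root is 1 on [v] and -1 on [w]. *)
Lemma skew_sqrt_Sp J r : J *m J^T = 1%:M -> map_mx Num.conj J = J -> J^T = - J ->
  r^t* = r -> r *m r = r -> r^T *m J = J *m r ->
  exists Q, [/\ Q^t* = Q, anti J Q, Q *m Q = r & Q *m r = Q].
Proof.
move=> JJT cJ JT; apply: (@herm_proj_split _ _ (fun r => r^T *m J = J *m r) (anti J)).
- exact: anti0.
- exact: antiD.
have JJ : J *m J = - 1%:M by rewrite -[J in X in _ *m X]opprK -JT mulmxN JJT.
have Js : J^t* = J^T by rewrite -map_trmx cJ.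
move=> {}r hr rr rJ r0.
have [u u0 [ur _]] := row_in r0 rr.
have [x x0 h] := unit_row u0; pose v := toC x *: u.
have vv : v *m v^t* = 1%:M by exact: h.
have vr : v *m r = v by rewrite /v -scalemxAl ur.
move: v vv vr {h ur u0} => v vv vr.
have crT : map_mx Num.conj r = r^T by apply: trmx_inj; rewrite map_trmx trmxK.
pose cv := map_mx Num.conj v; have [w wE] : exists w, w = cv *m J by exists (cv *m J).
have cvs : cv^T = v^t* by rewrite map_trmx.
have ccv : map_mx Num.conj cv = v.
  by apply/matrixP => i j; rewrite !mxE conjCK.
have cvr : cv *m r^T = cv by rewrite -crT -map_mxM vr.
have wr : w *m r = w by rewrite wE -mulmxA -rJ mulmxA cvr.
have ws : w^t* = - (J *m v^T).
  have cvst : cv^t* = v^T by rewrite -map_trmx ccv.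
  by rewrite wE star_mul Js JT mulNmx cvst.
have ww : w *m w^t* = 1%:M.
  have JJv : J *m (J *m v^T) = - v^T by rewrite mulmxA JJ mulNmx mul1mx.
  rewrite ws mulmxN wE -mulmxA JJv mulmxN opprK.
  by apply: trmx_inj; rewrite trmx_mul trmxK cvs vv trmx1.
(* The antisymmetry of [J] makes this scalar equal to its own negative. *)
have wv : w *m v^t* = 0.
  have e : (w *m v^t*)^T = - (w *m v^t*).
    by rewrite -cvs wE !trmx_mul trmxK JT mulNmx mulmxN mulmxA.
  apply/matrixP => i j; rewrite !ord1 [RHS]mxE; apply/eqP.
  have := congr1 (fun Z : 'M_1 => Z 0 0) e; rewrite [LHS]mxE [RHS]mxE => /eqP.
  by rewrite -addr_eq0 -mulr2n mulrn_eq0.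
have vw : v *m w^t* = 0 by rewrite -[LHS]starK star_mul starK wv star0.
pose q := v^t* *m v + w^t* *m w.
have vvK (Z : 'rV[C]_N) : v *m (v^t* *m Z) = Z by rewrite mulmxA vv mul1mx.
have wwK (Z : 'rV[C]_N) : w *m (w^t* *m Z) = Z by rewrite mulmxA ww mul1mx.
have vwK (Z : 'rV[C]_N) : v *m (w^t* *m Z) = 0 by rewrite mulmxA vw mul0mx.
have wvK (Z : 'rV[C]_N) : w *m (v^t* *m Z) = 0 by rewrite mulmxA wv mul0mx.
have qr : q *m r = q by rewrite mulmxDl -!mulmxA vr wr.
have qs : q^t* = q by rewrite starD !star_mul !starK.
have rq : r *m q = q by rewrite -[LHS]starK star_mul hr qs qr qs.
have q0 : q != 0.
  apply/eqP => e; have : v *m (q *m v^t*) = 1%:M.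
    by rewrite mulmxDl mulmxDr -!mulmxA vv wv !mulmx0 addr0 mulmx1 vv.
  rewrite e mul0mx mulmx0 => /matrixP/(_ 0 0)/eqP.
  by rewrite !mxE eqxx eq_sym oner_eq0.
have vJ : (v^t* *m v)^T *m J = J *m (w^t* *m w).
  have e : J *m w^t* = v^T by rewrite ws mulmxN mulmxA JJ mulNmx mul1mx opprK.
  by rewrite mulmxA e trmx_mul -cvs trmxK -mulmxA -wE.
have wJ : (w^t* *m w)^T *m J = J *m (v^t* *m v).
  have wT : w^T = - (J *m v^t*) by rewrite wE trmx_mul cvs JT mulNmx.
  have e2 : (w^t*)^T = v *m J by rewrite ws raddfN /= trmx_mul trmxK JT mulmxN opprK.
  rewrite trmx_mul e2 -!mulmxA JJ mulmxN mulmx1 mulmxN wT mulNmx opprK.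
  by rewrite mulmxA.
have qJ : q^T *m J = J *m q.
  by rewrite /q raddfD /= mulmxDl vJ wJ mulmxDr addrC.
exists (v^t* *m v - w^t* *m w), q; split; split.
- by rewrite starB !star_mul !starK.
- by rewrite /anti raddfB /= mulmxBl vJ wJ mulmxBr opprB.
- rewrite mulmxBl !mulmxBr -!mulmxA wvK wwK vvK vwK !mulmx0 sub0r subr0.
  by rewrite opprK.
- rewrite mulmxBl !mulmxDr -!mulmxA wvK wwK vvK vwK !mulmx0 add0r addr0.
  by [].
- exact: qr.
- exact: rq.
- exact: q0.
- by rewrite raddfB /= mulmxBl rJ qJ mulmxBr.
Qed.
End SquareRoots.

Section FormLog.
Context {R : realType} {N : nat}.
Local Notation C := (cplx R).
Local Notation M := 'M[C]_N.
Variables (c : bool) (J : M).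
Hypothesis hJ : [/\ J *m J^T = 1%:M, J^t* = J^T &
  exists s : C, J^T = s *: J /\ s * s = 1].
Hypothesis Qex : forall r : M, r^t* = r -> r *m r = r -> r^T *m J = J *m r ->
  (c -> \det (1%:M - 2%:R *: r) = 1) ->
  exists Q, [/\ Q^t* = Q, anti J Q, Q *m Q = r & Q *m r = Q].
Implicit Types (A B F k mu p r Q U X : M).

Let hJ' : true -> [/\ J *m J^T = 1%:M, J^t* = J^T &
  exists s : C, J^T = s *: J /\ s * s = 1] := fun _ => hJ.

Lemma anti_tr0 A : anti J A -> \tr A = 0.
Proof.
move=> h; have uJ : J \in unitmx := fJu hJ' isT.
have e : A^T = - (J *m A *m invmx J) by rewrite -mulNmx -h (mulmxK uJ).
have : \tr A = - \tr A.
  by rewrite -{1}mxtrace_tr e raddfN /= mxtrace_mulC (mulKmx uJ).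
by move=> /eqP; rewrite -addr_eq0 -mulr2n mulrn_eq0 => /eqP.
Qed.

Lemma antiZ z A : anti J A -> anti J (z *: A).
Proof. by rewrite /anti => h; rewrite linearZ /= -scalemxAl h scalerN scalemxAr. Qed.

Lemma fdiagN U (a : 'rV[C]_N) : fdiag U (- a) = - fdiag U a.
Proof. by rewrite -scaleN1r fdiagZ scaleN1r. Qed.

(** Let [p] project onto the eigenvalue -1 of [k], so that k = exp(F0) (1 - 2 p). The task is a
    Hermitian root [Q] of [p] that lies in the Lie algebra and commutes with [mu]; then F0 + i pi Q
    is the logarithm. On the range of [p] where [mu] is invertible, the sign of [mu] is such a root;
    on the rest [mu] vanishes and [Qex] supplies one. *)
Lemma form_log k mu : fgrp true c J k -> k \is unitarymx -> falg true c J mu ->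
  mu^t* = - mu -> k *m mu = mu *m k ->
  exists X, [/\ falg true c J X, X^t* = - X, X *m mu = mu *m X & mexp X = k].
Proof.
move=> Gk uk [_ fmu] smu ckm; have aJ : anti J mu := fmu isT.
have [U [a [uU ek ha]]] := unitary_spec uk; have uUm := unitarymx_unit uU.
pose ind (z : C) : C := (z == -1)%:R.
have [F0 eF] : exists F0, F0 = fdiag U (map_mx clog a) by eexists.
have [p ep] : exists p, p = fdiag U (map_mx ind a) by eexists.
have fkF : fcalc k clog F0 by rewrite ek eF; exact: fdiag_fcalc.
have fkp : fcalc k ind p by rewrite ek ep; exact: fdiag_fcalc.
have hp : p^t* = p.
  rewrite ep (fdiag_star _ uU); suff -> : map_mx Num.conj (map_mx ind a) = map_mx ind a by [].
  by apply/rowP => i; rewrite !mxE conjC_nat.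
have pp : p *m p = p.
  rewrite ep (fdiagM _ _ uUm).
  suff -> : \row_i (map_mx ind a 0 i * map_mx ind a 0 i) = map_mx ind a by [].
  by apply/rowP => i; rewrite !mxE /ind; case: eqP => _; rewrite ?mulr1 ?mulr0.
have sF : F0^t* = - F0.
  rewrite eF (fdiag_star _ uU) -fdiagN.
  suff -> : map_mx Num.conj (map_mx clog a) = - map_mx clog a by [].
  by apply/rowP => i; rewrite !mxE /clog rmorphM /= conjCi conj_toC mulNr.
have Fp : F0 *m p = 0.
  rewrite eF ep (fdiagM _ _ uUm) -(fdiag0 U).
  suff -> : \row_i (map_mx clog a 0 i * map_mx ind a 0 i) = 0 by [].
  apply/rowP => i; rewrite !mxE /ind; case: eqP => [->|_]; last by rewrite mulr0.
  by rewrite clogN1 mul0r.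
have kE : k = mexp F0 *m (1%:M - 2%:R *: p).
  rewrite eF ep (mexp_fdiag _ uUm) -(fdiag1 uUm) -fdiagZ -fdiagN -fdiagD (fdiagM _ _ uUm) {1}ek.
  suff <- : a = \row_i (map_mx cexp (map_mx clog a) 0 i * (const_mx 1 - 2%:R *: map_mx ind a) 0 i) by [].
  apply/rowP => i; rewrite !mxE /ind; case: eqP => [->|/eqP ai].
    by rewrite clogN1 cexp0 /=; ring.
  rewrite cexp_clog //; move: (a _ _) => z; rewrite /= -[X in 1 - _ * X]/(0 : C).
  by rewrite mulr0 subr0 mulr1.
have cFm : F0 *m mu = mu *m F0 := fcalc_comm fkF ckm.
have cpm : p *m mu = mu *m p := fcalc_comm fkp ckm.
have ik : invmx k = fdiag U (map_mx Num.conj a).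
  by rewrite -(fdiag_star _ uU) -ek (unitary_unit_star uk).
have Jk : (invmx k)^T *m J = J *m k.
  by rewrite trmx_inv; have [_] := fgrp_Jinv isT Gk.
have pJ : p^T *m J = J *m p.
  apply: (fcalc_intertwine (f := ind) (fcalc_tr _) fkp Jk).
  rewrite ik ep; have -> : map_mx ind a = map_mx ind (map_mx Num.conj a).
    apply/rowP => i; rewrite !mxE /ind; congr (_%:R); congr nat_of_bool.
    by rewrite -[in RHS](inj_eq (can_inj conjCK)) conjCK rmorphN1.
  exact: fdiag_fcalc.
have FJ : anti J F0.
  have : (- F0)^T *m J = J *m F0.
    apply: (fcalc_intertwine (f := clog) (fcalc_tr _) fkF Jk).
    rewrite ik eF -fdiagN; have -> : - map_mx clog a = map_mx clog (map_mx Num.conj a).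
      by apply/rowP => i; rewrite !mxE clog_conj.
    exact: fdiag_fcalc.
  by rewrite raddfN /= mulNmx /anti => <-; rewrite opprK.
(* The restriction of [mu] to the range of [p], made Hermitian. *)
have [B eBd] : exists B, B = - 'i *: (p *m mu) by eexists.
have hB : B^t* = B.
  rewrite eBd starZ; have -> : Num.conj (- ('i : C)) = 'i by rewrite rmorphN /= conjCi opprK.
  rewrite star_mul smu hp mulNmx -cpm scalerN scaleNr.
  by [].
have BJ : B^T *m J = J *m (- B).
  rewrite eBd linearZ /= -scalemxAl trmx_mul -mulmxA pJ mulmxA aJ mulNmx -mulmxA -cpm.
  by rewrite mulmxN scalerN -scalemxAr.
have cB : B *m mu = mu *m B.
  by rewrite eBd -scalemxAl -scalemxAr {1}cpm -mulmxA.
have pB : p *m B = B by rewrite eBd -scalemxAr mulmxA pp.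
have muB : p *m mu = 'i *: B by rewrite eBd scalerA mulrN -expr2 sqrCi opprK scale1r.
have [V [d [uV eB]]] := herm_spec hB; have uVm := unitarymx_unit uV.
rewrite -/(fdiag _ _) in eB.
pose f : C -> C := toC \o @Num.sg R \o @cre R.
(* The sign of [B]. The sign is an odd function, so the relation of [B] with the form passes to
   [Q1]. *)
have [Q1 eQ1] : exists Q1, Q1 = fdiag V (\row_i toC (Num.sg (d i))) by eexists.
have fE (e : 'I_N -> R) : map_mx f (\row_i toC (e i)) = \row_i toC (Num.sg (e i)).
  by apply/rowP => i; rewrite !mxE.
have fBQ : fcalc B f Q1 by rewrite eB eQ1 -fE; exact: fdiag_fcalc.
have fBQN : fcalc (- B) f (- Q1).
  have -> : - B = fdiag V (- \row_i toC (d i)) by rewrite eB fdiagN.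
  have -> : - Q1 = fdiag V (- \row_i toC (Num.sg (d i))) by rewrite eQ1 fdiagN.
  have -> : - (\row_i toC (d i)) = \row_i toC (- d i) :> 'rV[C]_N by apply/rowP => i; rewrite !mxE rmorphN.
  have -> : - (\row_i toC (Num.sg (d i))) = map_mx f (\row_i toC (- d i)) :> 'rV[C]_N.
    by apply/rowP => i; rewrite fE !mxE sgrN rmorphN.
  exact: fdiag_fcalc.
have hQ1 : Q1^t* = Q1.
  rewrite eQ1 (fdiag_star _ uV); suff -> : map_mx Num.conj (\row_i toC (Num.sg (d i))) = \row_i toC (Num.sg (d i)) by [].
  by apply/rowP => i; rewrite !mxE conj_toC.
have Q13 : Q1 *m Q1 *m Q1 = Q1.
  rewrite eQ1 !(fdiagM _ _ uVm).
  set w := (X in fdiag V X); suff -> : w = \row_i toC (Num.sg (d i)) by [].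
  by apply/rowP => i; rewrite !mxE -!rmorphM /=; congr toC; case: sgrP => _; ring.
have Q12B : Q1 *m Q1 *m B = B.
  rewrite eQ1 eB !(fdiagM _ _ uVm).
  set w := (X in fdiag V X); suff -> : w = \row_i toC (d i) by [].
  apply/rowP => i; rewrite !mxE -!rmorphM /=; congr toC.
  by case: sgrP => [->|_|_]; ring.
have Q1p : Q1 *m p = Q1.
  have f00 : fcalc (0 : M) f 0.
    exists 1%:M, 0; split; first exact: unitmx1.
      by rewrite raddf0 mulmx0 mul0mx.
    have -> : map_mx f (0 : 'rV[C]_N) = 0.
      apply/rowP => i; rewrite !mxE -[in LHS](rmorph0 (@toC R)).
      by rewrite -[LHS]/(toC (Num.sg (cre (toC 0)))) cre_toC sgr0 rmorph0.
    by rewrite raddf0 mulmx0 mul0mx.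
  have : Q1 *m (1%:M - p) = (1%:M - p) *m 0.
    apply: (fcalc_intertwine fBQ f00).
    by rewrite eBd -scalemxAl cpm -mulmxA mulmxBr mulmx1 pp subrr !mulmx0 scaler0.
  by rewrite mulmx0 mulmxBr mulmx1 => /eqP; rewrite subr_eq0 => /eqP <-.
have pQ1 : p *m Q1 = Q1 by rewrite -[LHS]starK star_mul hp hQ1 Q1p hQ1.
have aQ1 : anti J Q1.
  rewrite /anti -mulmxN; exact: (fcalc_intertwine (fcalc_tr fBQ) fBQN BJ).
have cQ1m : Q1 *m mu = mu *m Q1 := fcalc_comm fBQ cB.
have Q14 : Q1 *m Q1 *m (Q1 *m Q1) = Q1 *m Q1 by rewrite mulmxA Q13.
(* The part of the range of [p] on which [B], and hence [mu], is zero: a root living there commutes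
   with [mu]. *)
have [r er] : exists r, r = p - Q1 *m Q1 by eexists.
have hr : r^t* = r by rewrite er starB star_mul hp hQ1.
have Q1r : Q1 *m r = 0 by rewrite er mulmxBr Q1p mulmxA Q13 subrr.
have rQ1 : r *m Q1 = 0 by rewrite -[LHS]starK star_mul hr hQ1 Q1r star0.
have rp : r *m p = r by rewrite er mulmxBl pp -mulmxA Q1p.
have rr : r *m r = r.
  by rewrite {2}er mulmxBr rp mulmxA rQ1 mul0mx subr0.
have rJ : r^T *m J = J *m r.
  rewrite er raddfB /= mulmxBl pJ trmx_mul -mulmxA aQ1 mulmxN mulmxA aQ1 mulNmx opprK.
  by rewrite mulmxBr mulmxA.
have rB : r *m B = 0 by rewrite er mulmxBl pB Q12B subrr.
have rmu : r *m mu = 0 by rewrite -rp -mulmxA muB -scalemxAr rB scaler0.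
have mur : mu *m r = 0.
  apply/eqP; rewrite -oppr_eq0 -mulNmx -smu; apply/eqP.
  by rewrite -hr -star_mul rmu star0.
(* Both exp(F0) and 1 - 2 Q1^2 = exp(i pi Q1) are exponentials of trace-free matrices, so the
   determinant of [k] is that of 1 - 2 r. *)
have dr : c -> \det (1%:M - 2%:R *: r) = 1.
  move=> hc; have [_ dk _] := Gk; have {}dk := dk hc.
  have e1 : 1%:M - 2%:R *: p = (1%:M - 2%:R *: r) *m (1%:M - 2%:R *: (Q1 *m Q1)).
    by rewrite reflection_mul ?er ?subrK // -er mulmxA rQ1 mul0mx.
  have d1 : \det (1%:M - 2%:R *: (Q1 *m Q1)) = 1.
    by rewrite -(mexp_ipi hQ1 Q13) det_mexp mxtraceZ (anti_tr0 aQ1) mulr0 cexp0.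
  have d2 : \det (mexp F0) = 1 by rewrite det_mexp (anti_tr0 FJ) cexp0.
  move: dk; rewrite kE det_mulmx d2 mul1r e1 det_mulmx d1 mulr1.
  by move=> h; exact: h.
have [Q2 [hQ2 aQ2 Q22 Q2r]] := Qex hr rr rJ dr.
have rQ2 : r *m Q2 = Q2 by rewrite -[LHS]starK star_mul hr hQ2 Q2r hQ2.
have Q12 : Q1 *m Q2 = 0 by rewrite -rQ2 mulmxA Q1r mul0mx.
have Q21 : Q2 *m Q1 = 0 by rewrite -Q2r -mulmxA rQ1 mulmx0.
have [Q eQ] : exists Q, Q = Q1 + Q2 by eexists.
have hQ : Q^t* = Q by rewrite eQ starD hQ1 hQ2.
have QQ : Q *m Q = p.
  by rewrite eQ mulmxDl !mulmxDr Q12 Q21 Q22 addr0 add0r er subrKC.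
have Q2p : Q2 *m p = Q2 by rewrite -Q2r -mulmxA rp.
have Qp : Q *m p = Q by rewrite eQ mulmxDl Q1p Q2p.
have pQ : p *m Q = Q by rewrite -[LHS]starK star_mul hp hQ Qp hQ.
have FQ : F0 *m Q = 0 by rewrite -pQ mulmxA Fp mul0mx.
have QF : Q *m F0 = 0.
  by rewrite -[LHS]opprK -mulmxN -sF -{1}hQ -star_mul FQ star0 oppr0.
have cQm : Q *m mu = mu *m Q.
  rewrite eQ mulmxDl mulmxDr cQ1m; congr (_ + _).
  by rewrite -{1}Q2r -mulmxA rmu mulmx0 -rQ2 mulmxA mur mul0mx.
exists (F0 + ('i * toC pi) *: Q).
have aX : anti J (F0 + ('i * toC pi) *: Q).
  by apply: antiD => //; apply: antiZ; rewrite eQ; apply: antiD.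
split.
- by split=> _; [exact: anti_tr0|exact: aX].
- by rewrite starD sF starZ hQ rmorphM /= conjCi conj_toC mulNr scaleNr opprD.
- by rewrite mulmxDl mulmxDr cFm -scalemxAl -scalemxAr cQm.
- rewrite mexpD; last by rewrite -scalemxAl -scalemxAr FQ QF.
  by rewrite (mexp_ipi hQ) QQ ?pQ // -kE.
Qed.
End FormLog.

Section SpecialUnitaryLog.
Context {R : realType} {N : nat}.
Local Notation C := (cplx R).
Local Notation M := 'M[C]_N.
Implicit Types (k mu X : M).

(** Any logarithm that is a function of [k] commutes with [mu], but its trace is only [i s] with
    exp(i s) = 1. In a common eigenbasis with [mu], subtracting [i s] from one eigenvalue corrects
    the trace without changing the exponential. *)
Lemma su_log k mu : k \is unitarymx -> \det k = 1 -> mu^t* = - mu -> k *m mu = mu *m k ->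
  exists X, [/\ \tr X = 0, X^t* = - X, X *m mu = mu *m X & mexp X = k].
Proof.
move=> uk dk smu ckm.
have [U [a [uU ek ha]]] := unitary_spec uk; have uUm := unitarymx_unit uU.
pose f (z : C) : C := if z == -1 then 'i * toC pi else clog z.
have [F eF] : exists F, F = fdiag U (map_mx f a) by eexists.
have fkF : fcalc k f F by rewrite ek eF; exact: fdiag_fcalc.
have cFm : F *m mu = mu *m F := fcalc_comm fkF ckm.
have sF : F^t* = - F.
  rewrite eF (fdiag_star _ uU) -fdiagN.
  suff -> : map_mx Num.conj (map_mx f a) = - map_mx f a by [].
  apply/rowP => i; rewrite !mxE /f /clog; case: eqP => _; by rewrite rmorphM /= conjCi conj_toC mulNr.
have kE : mexp F = k.
  rewrite eF (mexp_fdiag _ uUm) ek; suff -> : map_mx cexp (map_mx f a) = a by [].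
  apply/rowP => i; rewrite !mxE /f; case: eqP => [->|/eqP ai]; first exact: cexp_ipi.
  by rewrite cexp_clog.
have [V [d [e [uV eFV emu]]]] := skew_codiag sF smu cFm; have uVm := unitarymx_unit uV.
rewrite -/(fdiag _ _) in eFV; rewrite -/(fdiag _ _) in emu.
have [i0 _|N0] := pickP (fun i : 'I_N => true); last first.
  by exists 0; split; [rewrite mxtrace0|rewrite star0 oppr0|rewrite mul0mx mulmx0
    |apply/matrixP => i; have := N0 i].
pose s := \sum_i d i.
pose d' (i : 'I_N) := d i - (if i == i0 then s else 0).
have ts : \sum_i d' i = 0.
  rewrite sumrB -/s [X in _ - X](bigD1 i0) //= eqxx [X in s - (_ + X)]big1 ?addr0 ?subrr //.
  by move=> i /negbTE ->.
have es : cexp ('i * toC s) = 1 :> C.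
  rewrite -dk -kE det_mexp eFV (tr_fdiag _ uVm) rmorph_sum /= mulr_sumr.
  by congr cexp; apply: eq_bigr => i _; rewrite mxE.
exists (fdiag V (skewdiag d')); split.
- rewrite (tr_fdiag _ uVm); under eq_bigr do rewrite mxE.
  by rewrite -mulr_sumr -(rmorph_sum (@toC R)) ts rmorph0 mulr0.
- rewrite (fdiag_star _ uV) -fdiagN.
  suff -> : map_mx Num.conj (skewdiag d') = - skewdiag d' by [].
  by apply/rowP => i; rewrite !mxE rmorphM /= conjCi conj_toC mulNr.
- rewrite emu [LHS](fdiagM _ _ uVm) [RHS](fdiagM _ _ uVm).
  set x := (X in fdiag V X); set y := (X in _ = fdiag V X).
  suff -> : x = y by [].
  by apply/rowP => i; rewrite !mxE mulrC.
- rewrite -kE eFV [LHS](mexp_fdiag _ uVm) [RHS](mexp_fdiag _ uVm).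
  suff -> : map_mx cexp (skewdiag d') = map_mx cexp (skewdiag d) by [].
  apply/rowP => i; rewrite !mxE /d'; case: eqP => _; last by rewrite subr0.
  rewrite -[RHS]mulr1 -[X in _ = _ * X](cexp0) -(subrr ('i * toC s : C)) cexpD es mul1r -cexpD.
  by congr cexp; rewrite rmorphB mulrBr.
Qed.
End SpecialUnitaryLog.

Section ClassicalGroups.
Context {R : realType}.
Local Notation C := (cplx R).

Lemma good_form N (G : set 'M[C]_N) (b c : bool) J :
  (b -> [/\ J *m J^T = 1%:M, J^t* = J^T & exists s : C, J^T = s *: J /\ s * s = 1]) ->
  (forall k, G k <-> fgrp b c J k /\ k \is unitarymx) ->
  (forall k mu, G k -> lie G mu -> k *m mu = mu *m k ->
    exists X, [/\ lie G X, X *m mu = mu *m X & mexp X = k]) ->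
  good G (fgrp b c J) (falg b c J).
Proof.
move=> hJ hG hlog; split.
- exact: (fgrp_group b c J).
- exact: (fgrp_star hJ).
- exact: hG.
- have -> : G = [set k | fgrp b c J k /\ k \is unitarymx].
    by apply/seteqP; split => k /hG.
  exact: fgrp_unitary_closed.
- exact: falg_add.
- exact: falg_scale.
- by split=> _; [exact: mxtrace0|rewrite trmx0 mul0mx mulmx0 oppr0].
- exact: (falg_lstar hJ).
- exact: falg_bracket.
- exact: falg_Ad.
- exact: (fgrp_lie hJ hG).
- exact: (falg_exp hJ).
- exact: (falg_herm hJ).
- by move=> ? ? ?; exact: (falg_nilp hJ).
- by move=> ? ? ? ? ?; exact: (fgrp_lu hJ).
- exact: hlog.
Qed.

Lemma SO_good n : exists Gc gc, good (@SOgrp R n) Gc gc.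
Proof.
have hJ : true -> [/\ (1%:M : 'M[C]_n) *m 1%:M^T = 1%:M, 1%:M^t* = (1%:M : 'M[C]_n)^T
    & exists s : C, (1%:M : 'M[C]_n)^T = s *: 1%:M /\ s * s = 1].
  move=> _; rewrite star1 trmx1 mulmx1; split; [exact: erefl|exact: erefl|].
  by exists 1; rewrite scale1r mulr1.
exists (fgrp true true 1%:M), (falg true true 1%:M).
have hG k : @SOgrp R n k <-> fgrp true true 1%:M k /\ k \is unitarymx.
  split=> [[B [eB dB] <-]|[[uk dk fk] hk]].
    have e1 : map_mx toC B *m (map_mx toC B)^T = 1%:M.
      by rewrite map_trmx -map_mxM eB map_mx1.
    have cB : map_mx Num.conj (map_mx toC B) = map_mx (@toC R) B.
      by apply/matrixP => i j; rewrite !mxE conj_toC.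
    split; last by apply/unitarymxP; rewrite -map_trmx cB.
    split=> [|_|_]; first by have [] := mulmx1_unit e1.
      by rewrite det_map_mx dB rmorph1.
    by rewrite mulmx1; exact: mulmx1C e1.
  have kT : k^T *m k = 1%:M by have := fk isT; rewrite mulmx1.
  (* Both are inverse to [k]; hence an orthogonal unitary matrix is real. *)
  have kc : k^t* = k^T.
    have e : k *m k^t* = 1%:M by apply/unitarymxP.
    by rewrite -[LHS]mul1mx -kT -mulmxA e mulmx1.
  have kr : map_mx Num.conj k = k by apply: trmx_inj; rewrite map_trmx.
  have kE : k = map_mx toC (map_mx (@cre R) k).
    apply/matrixP => i j; rewrite !mxE; apply: ccrealP.
    by rewrite CrealE; have := congr1 (fun A : 'M[C]_n => A i j) kr; rewrite mxE => ->.
  exists (map_mx (@cre R) k); last exact: esym kE.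
  split.
    apply: (@map_mx_inj _ _ (@toC R)); rewrite map_mxM -map_trmx -kE map_mx1.
    exact: mulmx1C kT.
  apply: (@toC_inj R); rewrite -det_map_mx -kE rmorph1; exact: dk.
apply: (good_form hJ hG) => k mu /hG [Gk uk] /(fgrp_lie hJ hG) [gm sm] ckm.
have [] := form_log (hJ isT) _ Gk uk gm sm ckm.
  move=> r hr rr rJ dr; apply: skew_sqrt_SO => //; split; last exact: dr.
  by move: rJ; rewrite mulmx1 mul1mx.
move=> X [gX sX cX eX]; exists X; split; [|exact: cX|exact: eX].
by apply/(fgrp_lie hJ hG).
Qed.

Lemma SU_good n : exists Gc gc, good (@SUgrp R n) Gc gc.
Proof.
have hJ : false -> [/\ (1%:M : 'M[C]_n) *m 1%:M^T = 1%:M, 1%:M^t* = (1%:M : 'M[C]_n)^T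
    & exists s : C, (1%:M : 'M[C]_n)^T = s *: 1%:M /\ s * s = 1] by [].
exists (fgrp false true 1%:M), (falg false true 1%:M).
have hG k : @SUgrp R n k <-> fgrp false true 1%:M k /\ k \is unitarymx.
  split=> [[uk dk]|[[_ dk _] uk]]; last by split=> //; apply: dk.
  split; last exact: uk.
  by split; [exact: unitarymx_unit uk|move=> _; exact: dk|move=> f; exfalso; move: f].
apply: (good_form hJ hG) => k mu /hG [[_ dk _] uk] /(fgrp_lie hJ hG) [gm sm] ckm.
have [X [tX sX cX eX]] := su_log uk (dk isT) sm ckm; exists X; split; [|exact: cX|exact: eX].
by apply/(fgrp_lie hJ hG); split;
  [split; [move=> _; exact: tX|move=> f; exfalso; move: f]|exact: sX].
Qed.

Lemma Sp_good n : exists Gc gc, good (@Spgrp R n) Gc gc.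
Proof.
have JT : (formJ R n)^T = - formJ R n.
  by rewrite /formJ tr_block_mx opp_block_mx !trmx0 !linearN /= !trmx1 !oppr0 opprK.
have JJT : formJ R n *m (formJ R n)^T = 1%:M.
  rewrite JT mulmxN /formJ mulmx_block !mul0mx !mulmx0 !mulmxN !mulNmx !mulmx1 !addr0 !add0r.
  by rewrite opp_block_mx !oppr0 !opprK -scalar_mx_block.
have Jc : map_mx Num.conj (formJ R n) = formJ R n.
  by rewrite /formJ map_block_mx !map_mxN !map_mx0 !map_mx1.
have hJ : true -> [/\ formJ R n *m (formJ R n)^T = 1%:M, (formJ R n)^t* = (formJ R n)^T
    & exists s : C, (formJ R n)^T = s *: formJ R n /\ s * s = 1].
  move=> _; split; [exact: JJT|by rewrite -map_trmx Jc|].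
  by exists (-1); rewrite scaleN1r mulrNN mulr1.
exists (fgrp true false (formJ R n)), (falg true false (formJ R n)).
have hG k : @Spgrp R n k <-> fgrp true false (formJ R n) k /\ k \is unitarymx.
  split=> [[uk dk]|[[_ _ dk] uk]]; last by split=> //; apply: dk.
  split; last exact: uk.
  by split; [exact: unitarymx_unit uk|move=> f; exfalso; move: f|move=> _; exact: dk].
apply: (good_form hJ hG) => k mu /hG [Gk uk] /(fgrp_lie hJ hG) [gm sm] ckm.
have [] := form_log (hJ isT) _ Gk uk gm sm ckm.
  by move=> r hr rr rJ _; apply: skew_sqrt_Sp.
move=> X [gX sX cX eX]; exists X; split; [|exact: cX|exact: eX].
by apply/(fgrp_lie hJ hG).
Qed.

Lemma classical_good N (G : set 'M[C]_N) : classical_group G ->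
  exists Gc gc, good G Gc gc.
Proof.
case=> n; [exact: SO_good|exact: SU_good|exact: Sp_good].
Qed.
End ClassicalGroups.

(** * Root spaces *)

Lemma mx_jacobi (F : comNzRingType) n (A B D : 'M[F]_n) :
  A *m (B *m D - D *m B) - (B *m D - D *m B) *m A =
  (A *m B - B *m A) *m D - D *m (A *m B - B *m A) +
  (B *m (A *m D - D *m A) - (A *m D - D *m A) *m B).
Proof.
rewrite !mulmxBl !mulmxBr !mulmxA.
move: (A *m B *m D) (A *m D *m B) (B *m D *m A) (D *m B *m A) (B *m A *m D) (D *m A *m B).
by move=> a b c d e f; apply/matrixP => i j; rewrite !mxE; ring.
Qed.

Lemma mxtrace_ad (F : comNzRingType) n (A B X : 'M[F]_n) :
  \tr ((A *m B - B *m A) *m X) = \tr (B *m (X *m A - A *m X)).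
Proof.
by rewrite mulmxBl mulmxBr !raddfB /= -[A *m B *m X]mulmxA (mxtrace_mulC A) !mulmxA.
Qed.

Section InnerProduct.
Context {R : realType} {N : nat}.
Local Notation C := (cplx R).
Local Notation M := 'M[C]_N.
Implicit Types (A B D H U E : M).

Definition ip A B : C := \tr (A *m B^t*).

Lemma ipE A B : ip A B = \sum_i \sum_j A i j * Num.conj (B i j).
Proof.
apply: eq_bigr => i _; rewrite mxE; apply: eq_bigr => j _; congr (_ * _).
exact: starE.
Qed.

Lemma ipDl A B D : ip (A + B) D = ip A D + ip B D.
Proof. by rewrite /ip mulmxDl mxtraceD. Qed.
Lemma ipNl A B : ip (- A) B = - ip A B.
Proof. by rewrite /ip mulNmx raddfN. Qed.
Lemma ipBl A B D : ip (A - B) D = ip A D - ip B D.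
Proof. by rewrite ipDl ipNl. Qed.
Lemma ipZl z A B : ip (z *: A) B = z * ip A B.
Proof. by rewrite /ip -scalemxAl mxtraceZ. Qed.
Lemma ip_suml I (r : seq I) (P : pred I) (F : I -> M) B :
  ip (\sum_(i <- r | P i) F i) B = \sum_(i <- r | P i) ip (F i) B.
Proof. by rewrite /ip mulmx_suml raddf_sum. Qed.
Lemma ip0l B : ip 0 B = 0.
Proof. by rewrite /ip mul0mx mxtrace0. Qed.

Lemma ip_conj A B : ip B A = Num.conj (ip A B).
Proof. by rewrite /ip -tr_star star_mul starK. Qed.
Lemma ipC0 A B : ip A B = 0 -> ip B A = 0.
Proof. by move=> e; rewrite ip_conj e rmorph0. Qed.

Lemma ip_ge0 A : 0 <= ip A A.
Proof.
by rewrite ipE; apply: sumr_ge0 => i _; apply: sumr_ge0 => j _; exact: mul_conjC_ge0.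
Qed.
Lemma ip_eq0 A : ip A A = 0 -> A = 0.
Proof.
rewrite ipE => /eqP; rewrite psumr_eq0; last first.
  by move=> i _; apply: sumr_ge0 => j _; exact: mul_conjC_ge0.
move=> /allP e; apply/matrixP => i j; rewrite mxE.
have := e i (mem_index_enum _); rewrite psumr_eq0; last by move=> k _; exact: mul_conjC_ge0.
by move=> /allP /(_ j (mem_index_enum _)); rewrite mul_conjC_eq0 => /eqP.
Qed.
Lemma ip_neq0 A : A != 0 -> ip A A != 0.
Proof. by apply: contraNneq => /ip_eq0 ->. Qed.
Lemma ip_real A : ip A A = toC (cre (ip A A)).
Proof. exact: ge0_ctoC (ip_ge0 A). Qed.
Lemma ip_cre_gt0 A : A != 0 -> 0 < cre (ip A A).
Proof.
move=> A0; have h := ge0_re (ip_ge0 A); rewrite lt_def h andbT.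
by apply: contra_neq (ip_neq0 A0) => e; rewrite ip_real e rmorph0.
Qed.

Lemma ip_ad A B D : ip (bracket A B) D = ip B (bracket (A^t*) D).
Proof.
rewrite /ip; have -> : (bracket (A^t*) D)^t* = (D^t*) *m A - A *m (D^t*).
  by rewrite starB (star_mul _ D) star_mul starK.
exact: mxtrace_ad.
Qed.

Lemma ip_star A B : ip (A^t*) (B^t*) = ip B A.
Proof. by rewrite /ip starK mxtrace_mulC. Qed.

Lemma ip_cj U A B : U \is unitarymx -> ip (cj U A) (cj U B) = ip A B.
Proof.
move=> uU; have uUm := unitarymx_unit uU.
have e : cj U A *m (cj U B)^t* = cj U (A *m B^t*).
  have sU : (invmx U)^t* = U by rewrite (unitary_starE uU) starK.
  by rewrite /cj star_mul star_mul sU -(unitary_starE uU) -!mulmxA (mulKmx uUm).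
by rewrite /ip e cj_tr.
Qed.

Lemma bracket_star A B : (bracket A B)^t* = bracket (B^t*) (A^t*).
Proof. by rewrite /bracket starB !star_mul. Qed.
Lemma bracketC A B : bracket A B = - bracket B A.
Proof. by rewrite /bracket opprB. Qed.
Lemma bracketDr A B D : bracket A (B + D) = bracket A B + bracket A D.
Proof. by rewrite /bracket mulmxDl mulmxDr opprD addrACA. Qed.
Lemma bracketDl A B D : bracket (A + B) D = bracket A D + bracket B D.
Proof. by rewrite /bracket mulmxDl mulmxDr opprD addrACA. Qed.
Lemma bracketZr z A B : bracket A (z *: B) = z *: bracket A B.
Proof. by rewrite /bracket -scalemxAl -scalemxAr scalerBr. Qed.
Lemma bracketZl z A B : bracket (z *: A) B = z *: bracket A B.
Proof. by rewrite /bracket -scalemxAl -scalemxAr scalerBr. Qed.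
Lemma bracketNr A B : bracket A (- B) = - bracket A B.
Proof. by rewrite -scaleN1r bracketZr scaleN1r. Qed.
Lemma bracketNl A B : bracket (- A) B = - bracket A B.
Proof. by rewrite -scaleN1r bracketZl scaleN1r. Qed.
Lemma bracketBr A B D : bracket A (B - D) = bracket A B - bracket A D.
Proof. by rewrite bracketDr bracketNr. Qed.
Lemma bracketii A : bracket A A = 0.
Proof. by rewrite /bracket subrr. Qed.
Lemma bracket0r A : bracket A 0 = 0.
Proof. by rewrite /bracket mul0mx mulmx0 subrr. Qed.

Lemma jacobi A B D :
  bracket A (bracket B D) = bracket (bracket A B) D + bracket B (bracket A D).
Proof.
exact: mx_jacobi.
Qed.

Lemma trformC A B : trform A B = trform B A.
Proof. by rewrite !trformE mxtrace_mulC. Qed.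
Lemma trformDl A B D : trform (A + B) D = trform A D + trform B D.
Proof. by rewrite !trformE mulmxDl mxtraceD creD opprD. Qed.
Lemma trformNl A B : trform (- A) B = - trform A B.
Proof. by rewrite !trformE mulNmx raddfN creN. Qed.
Lemma trformBl A B D : trform (A - B) D = trform A D - trform B D.
Proof. by rewrite trformDl trformNl. Qed.
Lemma trformZl t A B : trform (toC t *: A) B = t * trform A B.
Proof. by rewrite !trformE -scalemxAl mxtraceZ cre_toCM mulrN. Qed.
Lemma trform0l B : trform 0 B = 0.
Proof. by rewrite !trformE mul0mx mxtrace0 cre0 oppr0. Qed.
Lemma trformNr A B : trform B (- A) = - trform B A.
Proof. by rewrite trformC trformNl trformC. Qed.
Lemma trform_ip A B : B^t* = - B -> trform A B = cre (ip A B).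
Proof. by move=> sB; rewrite trformE /ip sB mulmxN raddfN creN. Qed.
Lemma trform_ipC A B : A^t* = - A -> B^t* = - B -> ip A B = toC (trform A B).
Proof.
move=> sA sB; have /ccrealP e : ip A B \is Num.real.
  by rewrite CrealE -ip_conj /ip sA sB !mulmxN !raddfN /= mxtrace_mulC.
by rewrite e (trform_ip _ sB).
Qed.
Lemma trform_eq0 A : A^t* = - A -> trform A A = 0 -> A = 0.
Proof. by move=> sA e; apply: ip_eq0; rewrite (trform_ipC sA sA) e rmorph0. Qed.
Lemma trform_ge0 A : A^t* = - A -> 0 <= trform A A.
Proof. by move=> sA; rewrite (trform_ip _ sA); apply: ge0_re; exact: ip_ge0. Qed.
End InnerProduct.

Section CartanSpectrum.
Context {R : realType} {N : nat}.
Local Notation C := (cplx R).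
Local Notation M := 'M[C]_N.
Implicit Types (A B D H U E X : M) (h W : set M).

(** The sets in use carry no dimension; a finite family from [h] whose complex span has maximal
    dimension already spans all of [h]. *)
Lemma finite_span h : exists s : seq M, (forall H, H \in s -> h H) /\
  forall H, h H -> H \in <<s>>%VS.
Proof.
pose P n := `[< exists s : seq M, (forall H, H \in s -> h H) /\ \dim <<s>>%VS = n >].
have P0 : exists n, P n by exists (\dim <<[::] : seq M>>%VS); apply/asboolP; exists [::].
have Pb n : P n -> (n <= \dim {:M})%N by move=> /asboolP [s [_ <-]]; exact: dimvS (subvf _).
case: (ex_maxnP P0 Pb) => n /asboolP [s [sh <-]] smax; exists s; split; first exact: sh.
move=> H hH.
have sub : (<<s>> <= <<H :: s>>)%VS by rewrite span_cons addvSr.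
have /smax hd : P (\dim <<H :: s>>%VS).
  apply/asboolP; exists (H :: s); split; last exact: erefl.
  by move=> H'; rewrite inE => /orP [/eqP ->|/sh].
have : <<s>>%VS == <<H :: s>>%VS by rewrite eqEdim sub.
by move=> /eqP ->; rewrite memv_span // mem_head.
Qed.

Lemma diag_skewP U H : U \is unitarymx -> H^t* = - H -> is_diag_mx (cj U H) ->
  cj U H = diag_mx (skewdiag (fun i => cim (cj U H i i))).
Proof.
move=> uU sH /is_diag_mxP dH; apply/matrixP => i j; rewrite [RHS]mxE [skewdiag _ 0 i]mxE.
have [->|nij] := eqVneq i j; last by rewrite mulr0n dH.
rewrite mulr1n; have : (cj U H)^t* j j = - cj U H j j.
  have sU : (invmx U)^t* = U by rewrite (unitary_starE uU) starK.
  by rewrite /cj star_mul star_mul sU sH -(unitary_starE uU) mulmxA mulmxN mulNmx [LHS]mxE.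
rewrite starE => e; rewrite [LHS]creim; suff -> : cre (cj U H j j) = 0 by rewrite rmorph0 add0r.
have := congr1 (@cre R) e; rewrite cre_conj creN => ?; lra.
Qed.

(** A finite spanning family is triangularized by one unitary matrix; skew-Hermitian and triangular
    together mean diagonal, and diagonal form passes to the span. *)
Lemma joint_diag h : (forall H, h H -> H^t* = - H) ->
  (forall H K, h H -> h K -> bracket H K = 0) ->
  exists U, U \is unitarymx /\ exists w : M -> 'I_N -> R, forall H, h H ->
    cj U H = diag_mx (skewdiag (w H)).
Proof.
move=> hs hcomm; have [s [sh hspan]] := finite_span h.
have scomm : {in s &, forall A B, comm_mx A B}.
  by move=> A B /sh hA /sh hB; apply/eqP; rewrite -subr_eq0 -/(bracket A B) hcomm.
have [U uU /allP sU] := cotrigonalization scomm; exists U; split=> //.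
exists (fun H i => cim (cj U H i i)) => H hH; apply: (diag_skewP uU (hs _ hH)).
have uUm := unitarymx_unit uU.
have dS A : A \in s -> is_diag_mx (cj U A).
  move=> As; have := sU _ As; rewrite /similar_to /= conjymx // => tA.
  have e : cj U A = U *m A *m U^t* by rewrite /cj (unitary_starE uU).
  rewrite e; have [|d ->] := skew_diag _ tA; last exact: diag_mx_is_diag.
  by rewrite star_mul star_mul starK (hs _ (sh _ As)) mulNmx mulmxN mulmxA.
rewrite (@coord_span _ _ _ (in_tuple s) _ (hspan _ hH)); apply/is_diag_mxP => i j nij.
rewrite /cj mulmx_sumr mulmx_suml summxE big1 // => k _.
rewrite -scalemxAr -scalemxAl mxE.
have /dS/is_diag_mxP -> // : (in_tuple s)`_k \in s by rewrite mem_nth.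
by rewrite mulr0.
Qed.
End CartanSpectrum.

Section Roots.
Context {R : realType} {N : nat}.
Local Notation C := (cplx R).
Local Notation M := 'M[C]_N.
Variables (G Gc gc h : set M).
Hypothesis gd : good G Gc gc.
Hypothesis hc : cartan (lie G) h.
Implicit Types (A B D H U E X a b : M) (W : set M).
Local Notation rv := (root_vector (lie G) h).

Lemma cartan_lie H : h H -> lie G H.
Proof. by have [[_ sub _] _] := hc; exact: sub. Qed.
Lemma cartan_gc H : h H -> gc H.
Proof. by move=> /cartan_lie /(good_lie gd) []. Qed.
Lemma cartan_skew H : h H -> H^t* = - H.
Proof. by move=> /cartan_lie /(good_lie gd) []. Qed.
Lemma cartan_comm H H' : h H -> h H' -> bracket H H' = 0.
Proof. by have [[_ _ com] _] := hc; exact: com. Qed.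
Lemma cartan_add H H' : h H -> h H' -> h (H + H').
Proof. by have [[[_ hD _] _ _] _] := hc; exact: hD. Qed.
Lemma cartan_scale t H : h H -> h (toC t *: H).
Proof. by have [[[_ _ hZ] _ _] _] := hc; exact: hZ. Qed.
Lemma cartan_zero : h 0.
Proof. by have [[[h0 _ _] _ _] _] := hc. Qed.
Lemma cartan_opp H : h H -> h (- H).
Proof. by move=> /(cartan_scale (-1)); rewrite rmorphN rmorph1 scaleN1r. Qed.
Lemma cartan_sub H H' : h H -> h H' -> h (H - H').
Proof. by move=> hH /cartan_opp; exact: cartan_add. Qed.

Lemma gc_opp A : gc A -> gc (- A).
Proof. by move=> gA; rewrite -scaleN1r; apply: (good_scale gd). Qed.
Lemma gc_sub A B : gc A -> gc B -> gc (A - B).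
Proof. by move=> gA /gc_opp; exact: (good_add gd). Qed.
Lemma gc_sum (I : Type) (r : seq I) (P : pred I) (F : I -> M) :
  (forall i, P i -> gc (F i)) -> gc (\sum_(i <- r | P i) F i).
Proof. by move=> hF; apply: big_ind; [exact: (good_zero gd)|exact: (good_add gd)|exact: hF]. Qed.

Lemma skew_part A : (2^-1 *: (A - A^t*))^t* = - (2^-1 *: (A - A^t*)).
Proof. by rewrite starZ starB starK fmorphV rmorph_nat -scalerN opprB. Qed.
Lemma skew_ipart A : (- 'i * 2^-1 *: (A + A^t*))^t* = - (- 'i * 2^-1 *: (A + A^t*)).
Proof.
rewrite starZ starD starK -scaleNr addrC; congr (_ *: _).
by rewrite rmorphM rmorphN /= conjCi fmorphV rmorph_nat opprK mulNr opprK.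
Qed.
Lemma skew_parts A : A = 2^-1 *: (A - A^t*) + 'i *: (- 'i * 2^-1 *: (A + A^t*)).
Proof.
rewrite scalerA mulrA mulrN -expr2 sqrCi opprK mul1r -scalerDr addrACA addNr addr0.
by rewrite scalerDr -scalerDl -[2^-1]mul1r -splitr scale1r.
Qed.

Lemma complexify_lie : complexify (lie G) = gc.
Proof.
apply/seteqP; split=> [_ [A /(good_lie gd) [gA _]] [B /(good_lie gd) [gB _]] <-|A gA].
  by apply: (good_add gd) => //; apply: (good_scale gd).
have gA' := good_lstar gd gA.
exists (2^-1 *: (A - A^t*)); first apply/(good_lie gd).
  by split; [apply: (good_scale gd); apply: gc_sub|exact: skew_part].
exists (- 'i * 2^-1 *: (A + A^t*)); last exact/esym/skew_parts.
apply/(good_lie gd).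
by split; [apply: (good_scale gd); apply: (good_add gd)|exact: skew_ipart].
Qed.

(** Maximality of [h] is applied to [h] enlarged by the real line through [A]. *)
Lemma cartan_max A : lie G A -> (forall H, h H -> bracket H A = 0) -> h A.
Proof.
move=> gA cA; have [_ hmax] := hc.
pose h' : set M := [set B | exists H t, h H /\ B = H + toC t *: A].
have hh' : h `<=` h'.
  by move=> H hH; exists H, 0; split=> //; rewrite rmorph0 scale0r addr0.
have <- : h' = h.
  apply: hmax => //; split.
  - split; first exact/hh'/cartan_zero.
      move=> _ _ [H1 [t1 [h1 ->]]] [H2 [t2 [h2 ->]]]; exists (H1 + H2), (t1 + t2).
      by split; [exact: cartan_add|rewrite rmorphD scalerDl addrACA].
    move=> t _ [H1 [t1 [h1 ->]]]; exists (toC t *: H1), (t * t1).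
    by split; [exact: cartan_scale|rewrite rmorphM scalerDr scalerA].
  - move=> _ [H [t [hH ->]]]; apply/(good_lie gd).
    move/(good_lie gd): gA => [gA sA]; split.
      by apply: (good_add gd); [exact: cartan_gc|exact: (good_scale gd)].
    by rewrite starD starZ conj_toC sA (cartan_skew hH) scalerN opprD.
  - move=> _ _ [H1 [t1 [h1 ->]]] [H2 [t2 [h2 ->]]].
    rewrite bracketDl !bracketDr bracketZl bracketZl !bracketZr bracketii cartan_comm //.
    by rewrite cA // (bracketC A) cA // oppr0 !scaler0 !addr0.
by exists 0, 1; split; [exact: cartan_zero|rewrite rmorph1 scale1r add0r].
Qed.

Lemma bracket_cartan_star H A : h H -> bracket H (A^t*) = (bracket H A)^t*.
Proof. by move=> hH; rewrite bracket_star (cartan_skew hH) bracketNr -bracketC. Qed.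

Lemma cartan_maxc A : gc A -> (forall H, h H -> bracket H A = 0) ->
  exists H1 H2, [/\ h H1, h H2 & A = H1 + 'i *: H2].
Proof.
move=> gA cA; have gA' := good_lstar gd gA.
have cA' H : h H -> bracket H (A^t*) = 0 by move=> hH; rewrite bracket_cartan_star // cA // star0.
exists (2^-1 *: (A - A^t*)), (- 'i * 2^-1 *: (A + A^t*)); split; last exact: skew_parts.
  apply: cartan_max => [|H hH]; last by rewrite bracketZr bracketBr cA // cA' // subrr scaler0.
  by apply/(good_lie gd); split; [apply: (good_scale gd); apply: gc_sub|exact: skew_part].
apply: cartan_max => [|H hH]; last by rewrite bracketZr bracketDr cA // cA' // addr0 scaler0.
by apply/(good_lie gd); split; [apply: (good_scale gd); apply: (good_add gd)|exact: skew_ipart].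
Qed.

Lemma cartan_orth0 A : gc A -> (forall H, h H -> bracket H A = 0) ->
  (forall H, h H -> ip A H = 0) -> A = 0.
Proof.
move=> gA cA oA; have [H1 [H2 [h1 h2 e]]] := cartan_maxc gA cA.
apply: ip_eq0; rewrite {1}e ipDl ipZl.
by rewrite (ipC0 (oA _ h1)) (ipC0 (oA _ h2)) mulr0 addr0.
Qed.

Lemma ip_adh H A B : h H -> ip (bracket H A) B = - ip A (bracket H B).
Proof.
by move=> hH; rewrite ip_ad (cartan_skew hH) bracketNl /ip starN mulmxN raddfN.
Qed.

Lemma ipZr z A B : ip A (z *: B) = Num.conj z * ip A B.
Proof. by rewrite ip_conj ipZl rmorphM /= -ip_conj. Qed.

Lemma weight_orth H A B (s t : R) : h H -> bracket H A = ('i * toC s) *: A ->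
  bracket H B = ('i * toC t) *: B -> s != t -> ip A B = 0.
Proof.
move=> hH eA eB st; have := ip_adh A B hH.
rewrite eA eB ipZl ipZr rmorphM /= conjCi conj_toC mulNr mulNr opprK.
rewrite -!mulrA => /(mulfI (neq0Ci C))/eqP; rewrite -subr_eq0 -mulrBl -rmorphB mulf_eq0.
move=> /orP [|/eqP //].
by rewrite -(rmorph0 (@toC R)) (inj_eq (@toC_inj R)) subr_eq0 (negbTE st).
Qed.

Lemma root_star a E : rv a E -> rv (- a) (E^t*).
Proof.
rewrite /root_vector complexify_lie => -[gE E0 hE]; split.
- exact: (good_lstar gd).
- by apply: contraNneq E0 => e; rewrite -(starK E) e star0.
move=> H hH; rewrite bracket_cartan_star // hE // starZ rmorphM /= conjCi conj_toC.
by rewrite trformNl [toC (- _)]rmorphN mulrN mulNr.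
Qed.

(** The representing element is [i] times the bracket of [E] and [E^t*]: it commutes with [h], hence
    lies in [h] by maximality, and its trace pairing with [H] is [f H] times the squared norm of
    [E]. The weight is imaginary because ad H is skew-adjoint. *)
Lemma weight_repr E (f : M -> C) : gc E -> E != 0 ->
  (forall H, h H -> bracket H E = f H *: E) ->
  exists a, [/\ h a, rv a E & toC (cre (ip E E)) *: a = 'i *: bracket E (E^t*)].
Proof.
move=> gE E0 hE; have n0 := ip_cre_gt0 E0.
have nC : toC (cre (ip E E)) != 0 :> C by rewrite -ip_real ip_neq0.
have fi H : h H -> Num.conj (f H) = - f H.
  move=> hH; have := ip_adh E E hH; rewrite hE // ipZl ipZr -mulNr => /(mulIf (ip_neq0 E0)) e.
  by rewrite [in RHS]e opprK.
pose a := (toC (cre (ip E E)))^-1 *: ('i *: bracket E (E^t*)).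
have gb : gc ('i *: bracket E (E^t*)).
  by apply: (good_scale gd); apply: (good_bracket gd) => //; apply: (good_lstar gd).
have ha : h a.
  apply: cartan_max.
    apply/(good_lie gd); split; first exact: (good_scale gd).
    have cn (r : R) : Num.conj ((toC r)^-1 : C) = (toC r)^-1 by rewrite fmorphV /= conj_toC.
    by rewrite /a !starZ bracket_star starK cn conjCi scaleNr scalerN.
  move=> H hH; rewrite /a !bracketZr jacobi (bracket_cartan_star E hH) hE // starZ fi //.
  by rewrite bracketZl bracketZr scaleNr subrr !scaler0.
exists a; split=> //; last by rewrite /a scalerA mulfV // scale1r.
rewrite /root_vector complexify_lie; split=> // H hH; rewrite hE //; congr (_ *: _).
have e : \tr (bracket E (E^t*) *m H) = f H * ip E E.
  rewrite -ipZl -hE // /ip mxtrace_ad mxtrace_mulC; exact: erefl.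
rewrite trformE /a -!scalemxAl !mxtraceZ e -ip_real.
rewrite [_^-1 * _]mulrC -[X in cre X]mulrA -mulrA mulfV ?mulr1 ?ip_neq0 //.
rewrite [LHS]creim; have -> : cre (f H) = 0.
  have := congr1 (@cre R) (fi _ hH); rewrite cre_conj creN => ?; lra.
by rewrite rmorph0 add0r cre_iM opprK.
Qed.

Lemma root_inj a b E : h a -> h b -> rv a E -> rv b E -> a = b.
Proof.
move=> ha hb [_ E0 hA] [_ _ hB]; apply/eqP; rewrite -subr_eq0; apply/eqP.
have hab := cartan_sub ha hb; apply: trform_eq0 (cartan_skew hab) _.
have /eqP := hA _ hab; rewrite hB // -subr_eq0 -scalerBl scaler_eq0 (negbTE E0) orbF.
rewrite -mulrBr mulf_eq0 (negbTE (neq0Ci C)) /= -rmorphB -(rmorph0 (@toC R)) (inj_eq (@toC_inj R)).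
by rewrite -trformBl -oppr_eq0 -trformNl opprB => /eqP.
Qed.

Lemma root_coroot a E : h a -> rv a E ->
  toC (cre (ip E E)) *: a = 'i *: bracket E (E^t*).
Proof.
move=> ha rE; have [gE E0 hE] := rE; move: gE; rewrite complexify_lie => gE.
have [b [hb rb e]] := weight_repr gE E0 hE.
by rewrite (root_inj ha hb rE rb).
Qed.

(* For E, X in the same root space with X orthogonal to E, the bracket of X and
   E^* vanishes, and the Jacobi identity makes |[E, X]|^2 a negative multiple
   of |X|^2. *)
Lemma root_dim1 a E D : h a -> a != 0 -> rv a E -> rv a D -> exists z, D = z *: E.
Proof.
move=> ha a0 rE rD; have co := root_coroot ha rE.
move: rE rD; rewrite /root_vector complexify_lie => -[gE E0 hE] [gD _ hD].
pose z := ip D E / ip E E; exists z; apply/eqP; rewrite -subr_eq0; apply/eqP.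
pose X := D - z *: E; rewrite -/X.
have gX : gc X by apply: gc_sub => //; apply: (good_scale gd).
have hX H : h H -> bracket H X = ('i * toC (trform a H)) *: X.
  move=> hH; rewrite /X bracketBr bracketZr hE // hD // scalerBr !scalerA.
  by rewrite (mulrC z).
have oX : ip X E = 0 by rewrite /X ipBl ipZl /z divfK ?subrr // ip_neq0.
have gE' := good_lstar gd gE.
have Z0 : bracket X (E^t*) = 0.
  apply: cartan_orth0; first exact: (good_bracket gd).
    move=> H hH; rewrite jacobi (bracket_cartan_star E hH) hE // hX // starZ.
    rewrite bracketZl bracketZr rmorphM /= conjCi conj_toC -scalerDl mulNr subrr scale0r.
    by [].
  move=> H hH; rewrite bracketC ipNl ip_ad starK bracketC hE //.
  by rewrite -scaleNr ipZr oX mulr0 oppr0.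
have c0 : bracket (bracket (E^t*) E) X = toC (- (cre (ip E E) * trform a a)) *: X.
  have -> : bracket (E^t*) E = 'i *: (toC (cre (ip E E)) *: a).
    by rewrite co scalerA -expr2 sqrCi scaleN1r -bracketC.
  rewrite !bracketZl hX // !scalerA; congr (_ *: _).
  have -> x y : toC (- (x * y)) = - (toC x * toC y) :> C by rewrite rmorphN rmorphM.
  move: (toC (cre _)) (toC (trform _ _)) => n t.
  have ii : 'i * 'i = -1 :> C by rewrite -expr2 sqrCi.
  by rewrite [LHS](_ : _ = 'i * 'i * (n * t)); [rewrite ii mulN1r|ring].
have : ip (bracket E X) (bracket E X) = toC (- (cre (ip E E) * trform a a)) * ip X X.
  by rewrite ip_ad jacobi (bracketC (E^t*) X) Z0 oppr0 bracket0r addr0 c0 ipZr conj_toC.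
rewrite (ip_real X) -rmorphM => /(congr1 (@cre R)); rewrite cre_toC => e.
have p0 := ge0_re (ip_ge0 (bracket E X)).
have n0 := ip_cre_gt0 E0; have q0 := ge0_re (ip_ge0 X).
have t0 : 0 < trform a a.
  rewrite lt_def (trform_ge0 (cartan_skew ha)) andbT.
  by apply: contra_neq a0; exact: trform_eq0 (cartan_skew ha).
apply: ip_eq0; rewrite ip_real; suff -> : cre (ip X X) = 0 by rewrite rmorph0.
have nt0 := mulr_gt0 n0 t0.
apply/eqP; rewrite eq_le; apply/andP; split; last exact: q0.
rewrite -(pmulr_rle0 _ nt0) -oppr_ge0 -mulNr -[X in 0 <= X]e; exact: p0.
Qed.
End Roots.

Section Setting.
Context {R : realType} {N : nat}.
Local Notation C := (cplx R).
Local Notation M := 'M[C]_N.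

(* H0 is a regular element defining the positive roots; the unitary matrix U
   diagonalizes the Cartan subalgebra h, with spectra w. *)
Record setting (G Gc gc h : set M) (m : nat) (al X Y : 'I_m -> M) (H0 U : M)
    (w : M -> 'I_N -> R) : Prop := Setting {
  st_good : good G Gc gc;
  st_cartan : cartan (lie G) h;
  st_H0 : h H0;
  st_reg : forall a, is_root (lie G) h a -> trform a H0 != 0;
  st_inj : injective al;
  st_range : range al = [set a | is_root (lie G) h a /\ 0 < trform a H0];
  st_XY : root_vectors (lie G) h al X Y;
  st_U : U \is unitarymx;
  st_w : forall H, h H -> cj U H = diag_mx (skewdiag (w H)) }.

Lemma setting_exists G Gc gc h m (al X Y : 'I_m -> M) :
  good G Gc gc -> cartan (lie G) h -> positive_roots (lie G) h al ->
  root_vectors (lie G) h al X Y ->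
  exists H0 U w, setting G Gc gc h al X Y H0 U w.
Proof.
move=> gd hc [ali [H0 [hH0 reg rng]]] xy.
have [U [uU [w hw]]] := joint_diag (cartan_skew gd hc) (cartan_comm hc).
by exists H0, U, w; split.
Qed.
End Setting.

Section SettingTheory.
Context {R : realType} {N : nat}.
Local Notation C := (cplx R).
Local Notation M := 'M[C]_N.
Variables (G Gc gc h : set M) (m : nat) (al X Y : 'I_m -> M) (H0 U : M) (w : M -> 'I_N -> R).
Hypothesis st : setting G Gc gc h al X Y H0 U w.
Implicit Types (A B D H E a b mu : M) (W : set M).
Let gd := st_good st.
Let hc := st_cartan st.

Lemma st_unit : U \in unitmx. Proof. exact: unitarymx_unit (st_U st). Qed.

Lemma al_root k : is_root (lie G) h (al k) /\ 0 < trform (al k) H0.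
Proof. by rewrite -[_ /\ _]/([set a | is_root (lie G) h a /\ 0 < trform a H0] (al k)) -(st_range st); exists k. Qed.
Lemma al_h k : h (al k). Proof. by have [[]] := al_root k. Qed.
Lemma al_neq0 k : al k != 0. Proof. by have [[]] := al_root k. Qed.
Lemma X_root k : root_vector (lie G) h (al k) (X k).
Proof. by have [] := st_XY st k. Qed.
Lemma Y_root k : root_vector (lie G) h (- al k) (Y k).
Proof. by have [] := st_XY st k. Qed.
Lemma X_gc k : gc (X k).
Proof. by have [] := X_root k; rewrite (complexify_lie gd). Qed.
Lemma Y_gc k : gc (Y k).
Proof. by have [] := Y_root k; rewrite (complexify_lie gd). Qed.
Lemma X_neq0 k : X k != 0. Proof. by have [] := X_root k. Qed.
Lemma Y_neq0 k : Y k != 0. Proof. by have [] := Y_root k. Qed.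
Lemma X_weight k H : h H -> bracket H (X k) = ('i * toC (trform (al k) H)) *: X k.
Proof. by have [_ _] := X_root k; apply. Qed.
Lemma Y_weight k H : h H -> bracket H (Y k) = ('i * toC (- trform (al k) H)) *: Y k.
Proof. by have [_ _ e] := Y_root k => hH; rewrite e // trformNl. Qed.

(** As X - Y is skew-Hermitian, X^* - Y = Y^* - X. The left side has weight minus alpha and the
    right side weight alpha, so both vanish. *)
Lemma Y_star k : Y k = (X k)^t*.
Proof.
have [_ _ g1 _] := st_XY st k; have [_ p] := al_root k.
have [_ s1] := (good_lie gd _).1 g1.
have e : (X k)^t* - Y k = (Y k)^t* - X k.
  move: s1; rewrite starB opprB => e1.
  by apply/eqP; rewrite subr_eq -addrA [- X k + _]addrC -e1 addrC subrK.
have [_ _ w1] := root_star gd hc (X_root k); have [_ _ w2] := root_star gd hc (Y_root k).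
have hH := st_H0 st.
have d1 : bracket H0 ((X k)^t* - Y k) = ('i * toC (- trform (al k) H0)) *: ((X k)^t* - Y k).
  by rewrite bracketBr w1 // (Y_weight k hH) trformNl scalerBr.
have d2 : bracket H0 ((X k)^t* - Y k) = ('i * toC (trform (al k) H0)) *: ((X k)^t* - Y k).
  by rewrite e bracketBr w2 // (X_weight k hH) !trformNl opprK scalerBr.
apply/esym/eqP; rewrite -subr_eq0; apply/eqP/ip_eq0.
apply: (weight_orth gd hc hH d1 d2).
by rewrite lt_eqF // (lt_trans _ p) // oppr_lt0.
Qed.

Lemma bracket_entry H A i j : h H ->
  cj U (bracket H A) i j = 'i * toC (w H i - w H j) * cj U A i j.
Proof.
move=> hH; have e : cj U (bracket H A) = cj U H *m cj U A - cj U A *m cj U H.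
  by rewrite -(cjM _ _ st_unit) -(cjM _ _ st_unit) /bracket /cj mulmxBr mulmxBl.
rewrite e (st_w st hH); set B := cj U A.
have -> : (diag_mx (skewdiag (w H)) *m B - B *m diag_mx (skewdiag (w H))) i j =
   skewdiag (w H) 0 i * B i j - B i j * skewdiag (w H) 0 j.
  by rewrite mxE mul_diagE [X in _ + X]mxE diag_mulE.
rewrite !mxE rmorphB; ring.
Qed.

(* An element of W whose support in the eigenbasis is minimal. *)
Lemma joint_eigen W A : W A -> A != 0 ->
  (forall H D z, h H -> W D -> W (bracket H D - z *: D)) ->
  exists E, [/\ W E, E != 0 & exists f : M -> C, forall H, h H -> bracket H E = f H *: E].
Proof.
move=> WA A0 hW.
pose supp D := #|[set p : 'I_N * 'I_N | cj U D p.1 p.2 != 0]%SET|.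
pose P n := `[< exists D, [/\ W D, D != 0 & supp D = n] >].
have P0 : exists n, P n by exists (supp A); apply/asboolP; exists A.
case: (ex_minnP P0) => n /asboolP [E [WE E0 sE]] nmin; exists E; split=> //.
have [p pE] : exists p : 'I_N * 'I_N, cj U E p.1 p.2 != 0.
  apply/not_existsP => e; case/eqP: E0; rewrite -(cjK E st_unit).
  have -> : cj U E = 0.
    apply/matrixP => i j; rewrite [RHS]mxE; apply/eqP/negPn/negP => e'.
    exact: (e (i, j)).
  by rewrite mulmx0 mul0mx.
(* The weight is read off at one position [p] of the support. Subtracting it kills that position, so
   the difference has smaller support and must be zero. *)
pose f H : C := 'i * toC (w H p.1 - w H p.2); exists f => H hH.
apply/eqP; rewrite -subr_eq0; apply: contraT => D0; exfalso; move: D0.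
set D := bracket H E - f H *: E => D0.
have DE i j : cj U D i j = ('i * toC (w H i - w H j) - f H) * cj U E i j.
  have -> : cj U D = cj U (bracket H E) - f H *: cj U E.
    by rewrite /D /cj mulmxBr mulmxBl -scalemxAr -scalemxAl.
  have e2 : (f H *: cj U E) i j = f H * cj U E i j by rewrite mxE.
  by rewrite mxE bracket_entry // [X in _ + X = _]mxE e2 mulrBl.
have /nmin : P (supp D) by apply/asboolP; exists D; split=> //; exact: hW.
rewrite -sE leqNgt => /negP; apply; apply: proper_card; apply/fintype.properP; split.
  apply/fintype.subsetP => q; rewrite inE [in X in _ -> X]inE DE; by apply: contraNneq => ->; rewrite mulr0 eqxx.
by exists p; rewrite !inE // DE /f subrr mul0r eqxx.
Qed.
End SettingTheory.

Section RootSpaces.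
Context {R : realType} {N : nat}.
Local Notation C := (cplx R).
Local Notation M := 'M[C]_N.
Variables (G Gc gc h : set M) (m : nat) (al X Y : 'I_m -> M) (H0 U : M) (w : M -> 'I_N -> R).
Hypothesis st : setting G Gc gc h al X Y H0 U w.
Implicit Types (A B D H E a b mu : M) (W : set M).
Let gd := st_good st.
Let hc := st_cartan st.
Let uU := st_unit st.

(** The orthogonal complement of [h] and of the root vectors is stable under ad h. If it were
    nonzero it would contain a joint eigenvector, which either commutes with [h] or is a root
    vector; both are excluded by orthogonality, as root spaces are lines. *)
Lemma root_complement0 A : gc A -> (forall H, h H -> ip A H = 0) ->
  (forall k, ip A (X k) = 0) -> (forall k, ip A (Y k) = 0) -> A = 0.
Proof.
move=> gA oh oX oY; apply/eqP; apply: contraT => A0; exfalso; move: A0.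
pose W : set M := [set B | [/\ gc B, forall H, h H -> ip B H = 0,
  forall k, ip B (X k) = 0 & forall k, ip B (Y k) = 0]].
have WA : W A by split.
move=> A0; have [|E [[gE Eh EX EY] E0 [f hf]]] := joint_eigen st WA A0.
  move=> H D z hH [gD Dh DX DY]; split.
  - by apply: (gc_sub gd); [apply: (good_bracket gd) => //; exact: (cartan_gc gd hc)|exact: (good_scale gd)].
  - by move=> H' hH'; rewrite ipBl ipZl Dh // mulr0 subr0 (ip_adh gd hc) // (cartan_comm hc) //
      ipC0 ?oppr0 // ip0l.
  - by move=> k; rewrite ipBl ipZl DX mulr0 subr0 (ip_adh gd hc) // (X_weight st) // ipZr DX mulr0 oppr0.
  - by move=> k; rewrite ipBl ipZl DY mulr0 subr0 (ip_adh gd hc) // (Y_weight st) // ipZr DY mulr0 oppr0.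
have [a [ha rE _]] := weight_repr gd hc gE E0 hf.
have hH0 := st_H0 st.
have [a0|a0] := eqVneq a 0.
  case/eqP: E0; apply: (cartan_orth0 gd hc) => // H hH.
  by have [_ _ ->] := rE => //; rewrite a0 trform0l rmorph0 mulr0 scale0r.
have ra : is_root (lie G) h a by split=> //; exists E.
have := st_reg st ra; rewrite neq_lt => /orP [n|p].
  have rE' := root_star gd hc rE.
  have : range al (- a).
    rewrite (st_range st); split; last by rewrite trformNl oppr_gt0.
    by split; [exact: (cartan_opp hc)|rewrite oppr_eq0|exists (E^t*)].
  move=> [k _ ek]; rewrite -ek in rE'.
  have [z hz] := root_dim1 gd hc (al_h st k) (al_neq0 st k) (X_root st k) rE'.
  have eE : E = Num.conj z *: Y k by rewrite -[E]starK hz starZ (Y_star st).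
  by case/eqP: E0; apply: ip_eq0; rewrite {2}eE ipZr EY mulr0.
have : range al a by rewrite (st_range st).
move=> [k _ ek]; rewrite -ek in rE.
have [z hz] := root_dim1 gd hc (al_h st k) (al_neq0 st k) (X_root st k) rE.
by case/eqP: E0; apply: ip_eq0; rewrite {2}hz ipZr EX mulr0.
Qed.

(** [A] has weight 0 under [mu], so it is orthogonal to all root vectors. For [H] in [h] the bracket
    of [H] and [A] is then orthogonal to the root vectors and to [h], hence zero. *)
Lemma regular_centralizer mu A : h mu -> (forall k, trform (al k) mu != 0) ->
  lie G A -> bracket mu A = 0 -> h A.
Proof.
move=> hmu reg gA cA; apply: (cartan_max gd hc) => // H hH.
have gcA : gc A by have [] := (good_lie gd _).1 gA.
have z0 : bracket mu A = ('i * toC 0) *: A by rewrite rmorph0 mulr0 scale0r.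
have oX k : ip A (X k) = 0.
  by apply: (weight_orth gd hc hmu z0 (X_weight st k hmu)); rewrite eq_sym.
have oY k : ip A (Y k) = 0.
  by apply: (weight_orth gd hc hmu z0 (Y_weight st k hmu)); rewrite eq_sym oppr_eq0.
apply: root_complement0.
- by apply: (good_bracket gd) => //; exact: (cartan_gc gd hc).
- by move=> H' hH'; rewrite (ip_adh gd hc) // (cartan_comm hc) // ipC0 ?oppr0 // ip0l.
- by move=> k; rewrite (ip_adh gd hc) // (X_weight st) // ipZr oX mulr0 oppr0.
- by move=> k; rewrite (ip_adh gd hc) // (Y_weight st) // ipZr oY mulr0 oppr0.
Qed.

Lemma H0_regular k : trform (al k) H0 != 0.
Proof. by have [_ p] := al_root st k; rewrite gt_eqF. Qed.

Lemma weight_entry H E t i j : h H -> bracket H E = ('i * toC t) *: E ->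
  cj U E i j != 0 -> w H i - w H j = t.
Proof.
move=> hH e n0; have := bracket_entry st E i j hH.
have -> : cj U (bracket H E) i j = 'i * toC t * cj U E i j.
  by rewrite e /cj -scalemxAr -scalemxAl mxE.
by move=> /(mulIf n0)/(mulfI (neq0Ci C))/toC_inj.
Qed.

Lemma ip_entry A B : (forall i j, cj U A i j = 0 \/ cj U B i j = 0) -> ip A B = 0.
Proof.
move=> e; rewrite -(ip_cj _ _ (st_U st)) ipE big1 // => i _; rewrite big1 // => j _.
by have [->|->] := e i j; rewrite ?mul0r ?rmorph0 ?mulr0.
Qed.

Lemma slower_orth H A E t : h H -> slower (w H) (cj U A) ->
  bracket H E = ('i * toC t) *: E -> 0 <= t -> ip A E = 0.
Proof.
move=> hH sA eE t0; apply: ip_entry => i j.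
have [e|n0] := eqVneq (cj U E i j) 0; [by right|left; apply: sA].
by rewrite -subr_ge0 (weight_entry hH eE n0).
Qed.

Lemma weight_slower H E t : h H -> bracket H E = ('i * toC t) *: E -> t < 0 ->
  slower (w H) (cj U E).
Proof.
move=> hH eE t0 i j hij; apply/eqP; apply: contraTT t0 => n0.
by rewrite -leNgt -(weight_entry hH eE n0) subr_ge0.
Qed.

Lemma weight_upper H E t : h H -> bracket H E = ('i * toC t) *: E -> 0 <= t ->
  upper (w H) (cj U E).
Proof.
move=> hH eE t0 i j hij; apply/eqP; apply: contraTT t0 => n0.
by rewrite -ltNge -(weight_entry hH eE n0) subr_lt0.
Qed.

Lemma wN H i : h H -> w (- H) i = - w H i.
Proof.
move=> hH; have := st_w st (cartan_opp hc hH).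
have -> : cj U (- H) = - cj U H by rewrite /cj mulmxN mulNmx.
rewrite (st_w st hH) => /matrixP /(_ i i).
rewrite !mxE eqxx !mulr1n -mulrN => /(mulfI (neq0Ci C)) e.
by apply: (@toC_inj R); rewrite rmorphN -e.
Qed.

Lemma XX_orth k l : k != l -> ip (X k) (X l) = 0.
Proof.
move=> kl; apply: contra_neq_eq kl => n0; apply: (st_inj st); apply/eqP; rewrite -subr_eq0.
have hkl := cartan_sub hc (al_h st k) (al_h st l).
apply/eqP; apply: (trform_eq0 (cartan_skew gd hc hkl)).
apply/eqP; rewrite trformBl subr_eq0; apply: contraNT n0 => ne; apply/eqP.
exact: (weight_orth gd hc hkl (X_weight st k hkl) (X_weight st l hkl)).
Qed.

Lemma YY_orth k l : k != l -> ip (Y k) (Y l) = 0.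
Proof. by move=> kl; rewrite !(Y_star st) ip_star XX_orth // eq_sym. Qed.

Lemma XY_orth k l : ip (X k) (Y l) = 0.
Proof.
have [_ p] := al_root st k; have [_ q] := al_root st l.
have lt : - trform (al l) H0 < trform (al k) H0 by apply: lt_trans p; rewrite oppr_lt0.
have hH := st_H0 st.
exact: (weight_orth gd hc hH (X_weight st k hH) (Y_weight st l hH) (negbT (gt_eqF lt))).
Qed.

Lemma X_cartan_orth k H : h H -> ip (X k) H = 0.
Proof.
move=> hH; have hH0 := st_H0 st.
have z0 : bracket H0 H = ('i * toC 0) *: H by rewrite rmorph0 mulr0 scale0r (cartan_comm hc).
exact: (weight_orth gd hc hH0 (X_weight st k hH0) z0 (H0_regular k)).
Qed.
Lemma Y_cartan_orth k H : h H -> ip (Y k) H = 0.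
Proof.
move=> hH; have hH0 := st_H0 st.
have z0 : bracket H0 H = ('i * toC 0) *: H by rewrite rmorph0 mulr0 scale0r (cartan_comm hc).
by apply: (weight_orth gd hc hH0 (Y_weight st k hH0) z0); rewrite oppr_eq0 H0_regular.
Qed.

Definition xc A k : C := ip A (X k) / ip (X k) (X k).
Definition yc A k : C := ip A (Y k) / ip (Y k) (Y k).

Lemma root_span A : gc A -> (forall H, h H -> ip A H = 0) ->
  A = \sum_k xc A k *: X k + \sum_k yc A k *: Y k.
Proof.
move=> gA oA; apply/eqP; rewrite -subr_eq0 opprD addrA; apply/eqP.
have sX l : ip (\sum_k xc A k *: X k) (X l) = ip A (X l).
  rewrite ip_suml (bigD1 l) //= big1 ?addr0 => [|k kl]; last by rewrite ipZl XX_orth ?mulr0.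
  by rewrite ipZl /xc divfK // ip_neq0 ?(X_neq0 st).
have sY l : ip (\sum_k yc A k *: Y k) (Y l) = ip A (Y l).
  rewrite ip_suml (bigD1 l) //= big1 ?addr0 => [|k kl]; last by rewrite ipZl YY_orth ?mulr0.
  by rewrite ipZl /yc divfK // ip_neq0 ?(Y_neq0 st).
have zX l : ip (\sum_k yc A k *: Y k) (X l) = 0.
  by rewrite ip_suml big1 // => k _; rewrite ipZl (ipC0 (XY_orth l k)) mulr0.
have zY l : ip (\sum_k xc A k *: X k) (Y l) = 0.
  by rewrite ip_suml big1 // => k _; rewrite ipZl XY_orth mulr0.
apply: root_complement0.
- apply: (gc_sub gd); first apply: (gc_sub gd) => //; apply: (gc_sum gd) => k _;
    apply: (good_scale gd); [exact: (X_gc st)|exact: (Y_gc st)].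
- move=> H hH; rewrite !ipBl oA // !ip_suml !big1 ?subrr // => k _; rewrite ipZl.
    by rewrite Y_cartan_orth ?mulr0.
  by rewrite X_cartan_orth ?mulr0.
- by move=> l; rewrite !ipBl sX zX subrr subr0.
- by move=> l; rewrite !ipBl sY zY subr0 subrr.
Qed.

Lemma slower_span H A : h H -> gc A -> slower (w H) (cj U A) ->
  A = \sum_k xc A k *: X k + \sum_k yc A k *: Y k.
Proof.
move=> hH gA sA; apply: root_span => // H' hH'.
have z0 : bracket H H' = ('i * toC 0) *: H' by rewrite rmorph0 mulr0 scale0r (cartan_comm hc).
exact: (slower_orth hH sA z0).
Qed.

Lemma slower_y0 H A k : h H -> slower (w H) (cj U A) -> trform (al k) H <= 0 -> yc A k = 0.
Proof.
move=> hH sA t0; rewrite /yc (slower_orth hH sA (Y_weight st k hH)) ?mul0r //.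
by rewrite oppr_ge0.
Qed.

Lemma slower_x0 H A k : h H -> slower (w H) (cj U A) -> 0 <= trform (al k) H -> xc A k = 0.
Proof.
by move=> hH sA t0; rewrite /xc (slower_orth hH sA (X_weight st k hH)) ?mul0r.
Qed.

(* mu ranges over the closed Weyl chamber. *)
Lemma lower_span mu A : h mu -> (forall k, 0 <= trform mu (al k)) -> gc A ->
  slower (w mu) (cj U A) -> A = \sum_(k | trform mu (al k) != 0) yc A k *: Y k.
Proof.
move=> hmu pos gA sA; rewrite {1}(slower_span hmu gA sA) big1 => [|k _]; last first.
  by rewrite (slower_x0 hmu sA) ?scale0r // trformC.
rewrite add0r (bigID (fun k => trform mu (al k) != 0)) /= [X in _ + X]big1 ?addr0 //.
by move=> k; rewrite negbK => /eqP e; rewrite (slower_y0 hmu sA) ?scale0r // trformC e.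
Qed.

Lemma upper_span A : gc A -> (forall i j, w H0 i <= w H0 j -> cj U A i j = 0) ->
  A = \sum_k xc A k *: X k.
Proof.
move=> gA sA; have hH := cartan_opp hc (st_H0 st).
(* Strictly upper for [H0] is strictly lower for [- H0]. *)
have sA' : slower (w (- H0)) (cj U A).
  by move=> i j; rewrite !(wN _ (st_H0 st)) lerN2; exact: sA.
rewrite {1}(slower_span hH gA sA') [X in _ + X]big1 ?addr0 // => k _.
rewrite (slower_y0 hH sA') ?scale0r // trformNr oppr_le0 ltW //.
by have [] := al_root st k.
Qed.

Lemma X_upper mu k : h mu -> (forall k, 0 <= trform mu (al k)) -> upper (w mu) (cj U (X k)).
Proof.
by move=> hmu pos; apply: (weight_upper hmu (X_weight st k hmu)); rewrite trformC.
Qed.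

Lemma cartan_vectorE k : cartan_vector X Y k = toC (cre (ip (X k) (X k))) *: al k.
Proof.
by rewrite /cartan_vector (Y_star st) -(root_coroot gd hc (al_h st k) (X_root st k)).
Qed.

Lemma cartan_vector_h k : h (cartan_vector X Y k).
Proof. by rewrite cartan_vectorE; apply: (cartan_scale hc); exact: (al_h st). Qed.
End RootSpaces.

(** * Coroots and semisimplicity *)

Section CorootSpan.
Context {R : realType} {N : nat}.
Local Notation C := (cplx R).
Local Notation M := 'M[C]_N.
Variables (G Gc gc h : set M) (m : nat) (al X Y : 'I_m -> M) (H0 U : M) (w : M -> 'I_N -> R).
Hypothesis st : setting G Gc gc h al X Y H0 U w.
Hypothesis ss : semisimple (lie G).
Implicit Types (A B D H E a b mu : M).
Let gd := st_good st.
Let hc := st_cartan st.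

Lemma trform_suml (I : Type) (r : seq I) (P : pred I) (F : I -> M) B :
  trform (\sum_(i <- r | P i) F i) B = \sum_(i <- r | P i) trform (F i) B.
Proof.
by apply: (big_morph (fun A => trform A B)) => [A D|]; [exact: trformDl|exact: trform0l].
Qed.

Lemma cartan_sum (c : 'I_m -> R) : h (\sum_k toC (c k) *: al k).
Proof.
apply: big_ind; [exact: (cartan_zero hc)|exact: (cartan_add hc)|move=> k _].
exact: (cartan_scale hc) (al_h st k).
Qed.

Let Gm : 'M[R]_m := \matrix_(k, l) trform (al k) (al l).
Definition root_coef H : 'rV[R]_m := (\row_l trform H (al l)) *m pinvmx Gm.

(** Positive roots may be linearly dependent, so their Gram matrix may be singular and [pinvmx]
    stands for its inverse. The system is still solvable: a kernel vector of the Gram matrix is a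
    combination of roots of norm 0, that is a linear relation, and the right-hand side respects
    it. *)
Lemma root_projection H l : h H ->
  trform (H - \sum_k toC (root_coef H 0 k) *: al k) (al l) = 0.
Proof.
move=> hH; pose b : 'rV[R]_m := \row_l trform H (al l).
have bG : (b <= Gm)%MS.
  rewrite submxE; apply/eqP/matrixP => i j; rewrite ord1 [RHS]mxE; set u := cokermx Gm.
  pose c k := u k j; pose S := \sum_k toC (c k) *: al k.
  have gS k : trform (al k) S = 0.
    have := congr1 (fun A : 'M[R]_m => A k j) (mulmx_coker Gm); rewrite mxE [RHS]mxE => e.
    rewrite trformC trform_suml -[RHS]e; apply: eq_bigr => k' _.
    by rewrite trformZl [Gm _ _]mxE mulrC trformC.
  have S0 : S = 0.
    apply: (trform_eq0 (cartan_skew gd hc (cartan_sum c))).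
    by rewrite trform_suml big1 // => k _; rewrite trformZl -/S gS mulr0.
  rewrite mxE; transitivity (trform S H); last by rewrite S0 trform0l.
  by rewrite trform_suml; apply: eq_bigr => k _; rewrite trformZl [b _ _]mxE mulrC trformC.
rewrite trformBl trform_suml.
have := congr1 (fun v : 'rV[R]_m => v 0 l) (mulmxKpV bG); rewrite mxE [RHS]mxE => <-.
apply/eqP; rewrite subr_eq0; apply/eqP; apply: eq_bigr => k _.
by rewrite trformZl [Gm _ _]mxE.
Qed.

(** Such an [H] commutes with [h] and with all root vectors, so it is central, and the real line
    through it is an abelian ideal. *)
Lemma central_cartan H : h H -> (forall l, trform (al l) H = 0) -> H = 0.
Proof.
move=> hH zl.
have HX k : bracket H (X k) = 0 by rewrite (X_weight st k hH) zl rmorph0 mulr0 scale0r.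
have HY k : bracket H (Y k) = 0 by rewrite (Y_weight st k hH) zl oppr0 rmorph0 mulr0 scale0r.
have cen A : gc A -> bracket H A = 0.
  move=> gA; apply: (root_complement0 st).
  - by apply: (good_bracket gd) => //; exact: (cartan_gc gd hc).
  - by move=> H' hH'; rewrite (ip_adh gd hc) // (cartan_comm hc) // ipC0 ?oppr0 // ip0l.
  - by move=> k; rewrite (ip_adh gd hc) // HX ipC0 ?oppr0 // ip0l.
  - by move=> k; rewrite (ip_adh gd hc) // HY ipC0 ?oppr0 // ip0l.
have e : [set A | exists t, A = toC t *: H] = [set 0].
  apply: ss.
  - split; first by exists 0; rewrite rmorph0 scale0r.
      by move=> _ _ [s ->] [t ->]; exists (s + t); rewrite rmorphD scalerDl.
    by move=> s _ [t ->]; exists (s * t); rewrite rmorphM scalerA.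
  - by move=> _ [t ->]; apply: (cartan_lie hc); exact: (cartan_scale hc).
  - move=> A _ gA [t ->]; exists 0; rewrite rmorph0 scale0r bracketZr bracketC cen ?oppr0 ?scaler0 //.
    by have [] := (good_lie gd _).1 gA.
  - by move=> _ _ [s ->] [t ->]; rewrite bracketZl bracketZr bracketii !scaler0.
have : [set A | exists t, A = toC t *: H] H by exists 1; rewrite rmorph1 scale1r.
rewrite e => H00; exact: H00.
Qed.

Lemma root_expand H : h H -> H = \sum_k toC (root_coef H 0 k) *: al k.
Proof.
move=> hH; apply/eqP; rewrite -subr_eq0; apply/eqP; apply: central_cartan => [|l].
  exact: (cartan_sub hc hH (cartan_sum _)).
by rewrite trformC (root_projection _ hH).
Qed.

Lemma coroot_span H : h H -> exists c : 'I_m -> R,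
  H = \sum_k toC (c k) *: cartan_vector X Y k.
Proof.
move=> hH; pose c := root_coef H 0.
exists (fun k => c k / cre (ip (X k) (X k))); rewrite {1}(root_expand hH); apply: eq_bigr => k _.
by rewrite (cartan_vectorE st) scalerA -rmorphM divfK // gt_eqF // ip_cre_gt0 // (X_neq0 st).
Qed.

Lemma trform_continuous B : continuous (fun A : M => trform A B).
Proof.
move=> A; have -> : (fun A : M => trform A B) = fun A => - cre (\tr (A *m B)).
  by apply/funext => D; rewrite trformE.
have h0 : (fun D : M => D *m B) @ A --> A *m B by exact: mulmxr_continuous.
have h1 : (fun D : M => \tr (D *m B)) @ A --> \tr (A *m B).
  by apply: (@cvg_mxtrace _ _ (nbhs A) (nbhs_filter A)); exact: h0.
have h2 : (fun D : M => cre (\tr (D *m B))) @ A --> cre (\tr (A *m B)).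
  exact: (cvg_app (@cre_continuous R) h1).
exact: (cvgN h2).
Qed.

(** [h] is the fixed-point set of the continuous projection onto the span of the roots. *)
Lemma cartan_closed : closed h.
Proof.
pose F mu := \sum_k toC (root_coef mu 0 k) *: al k.
have -> : h = [set mu | F mu = mu].
  apply/seteqP; split=> mu; first by move=> hmu; exact/esym/root_expand.
  by move=> /= <-; exact: cartan_sum.
apply: closed_eq_cont; last by move=> mu; exact: cvg_id.
move=> mu; apply: (@cvg_bigsum _ _ _ (nbhs mu)) => k _; apply: cvgZ; last exact: cst_continuous.
have h1 : (fun B : M => root_coef B 0 k) @ mu --> root_coef mu 0 k.
  have e B : root_coef B 0 k = \sum_l trform B (al l) * pinvmx Gm l k.
    by rewrite mxE; apply: eq_bigr => l _; rewrite mxE.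
  rewrite e (funext e); apply: (@cvg_bigsum _ _ _ (nbhs mu) _ R^o) => l _.
  by apply: cvgMl; exact: trform_continuous.
exact: (cvg_app (@toC_continuous R) h1).
Qed.

Lemma chamber_closure mu : closure (chamber h al) mu ->
  h mu /\ forall k, 0 <= trform mu (al k).
Proof.
move=> cl; split.
  rewrite ((closure_id h).1 cartan_closed).
  by apply: (@closureS _ (chamber h al) h) cl => A [].
move=> k; rewrite -oppr_le0.
have h1 : (fun A : M => trform A (al k)) @ mu --> trform mu (al k) by exact: trform_continuous.
apply: (closure_le (f := fun A => - trform A (al k)) cl); first exact: (cvgN h1).
by move=> A [_ /(_ k) p]; rewrite oppr_le0 ltW.
Qed.
End CorootSpan.

(** * Conjugacy in the compact group *)

Lemma invmx_mul (F : comUnitRingType) n (A B : 'M[F]_n) : A \in unitmx -> B \in unitmx ->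
  invmx (A *m B) = invmx B *m invmx A.
Proof.
move=> uA uB; have u : A *m B \in unitmx by rewrite unitmx_mul uA uB.
have e : A *m B *m (invmx B *m invmx A) = 1%:M by rewrite !mulmxA (mulmxK uB) (mulmxV uA).
by rewrite -[LHS]mulmx1 -e (mulKmx u).
Qed.

Lemma invmx_comm (F : comUnitRingType) n (u a : 'M[F]_n) : u \in unitmx -> u *m a = a *m u ->
  invmx u *m a = a *m invmx u.
Proof. by move=> uu e; rewrite -[LHS](mulmxK uu) -(mulmxA _ a) -e (mulKmx uu). Qed.

Section Variation.
Context {R : realType} {N : nat}.
Local Notation C := (cplx R).
Local Notation M := 'M[C]_N.
Implicit Types (A B D E X k nu : M).

Lemma le0_cvg (u : R^nat) (l : R) : u n @[n --> \oo] --> l -> (forall n, u n <= 0) -> l <= 0.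
Proof.
move=> ul u0; apply: (closed_cvg (fun y : R => y <= 0) (@closed_le R 0) _ l ul).
exact: nearW.
Qed.

Lemma scale_cancel2 (F : fieldType) (V : lmodType F) (s : F) (a b p q : V) : s != 0 ->
  s *: a + (s * s) *: p = s *: b + (s * s) *: q -> s *: (q - p) = a - b.
Proof.
move=> s0 e; apply: (scalerI s0); rewrite scalerA !scalerBr; apply/eqP.
by rewrite subr_eq addrAC eq_sym subr_eq e addrC.
Qed.

Lemma harmonic_gt0 n : 0 < @harmonic R n.
Proof. by rewrite invr_gt0 ltr0n. Qed.

(** Dividing by [t] at 1/(n + 1) and at -1/(n + 1) gives both signs for [a]; dividing by [t ^+ 2]
    then gives the second claim. *)
Lemma second_order (a : R) (g : R -> R) (l : R) : g t @[t --> (0 : R)] --> l ->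
  (forall t, t * a + t ^+ 2 * g t <= 0) -> a = 0 /\ l <= 0.
Proof.
move=> gl h; pose u := @harmonic R.
have u0 := @cvg_harmonic R.
have g1 : g (u n) @[n --> \oo] --> l := cvg_along gl.
have g2 : g (- u n) @[n --> \oo] --> l.
  have nu : - u n @[n --> \oo] --> (0 : R) by rewrite -oppr0; exact: cvgN.
  by apply: cvg_comp gl; exact: nu.
have h1 n : a + u n * g (u n) <= 0.
  have up := harmonic_gt0 n; have := h (u n).
  by rewrite expr2 -mulrA -mulrDr (pmulr_rle0 _ up).
have h2 n : - a + u n * g (- u n) <= 0.
  have up := harmonic_gt0 n; have := h (- u n).
  by rewrite sqrrN expr2 mulNr -mulrN -mulrA -mulrDr (pmulr_rle0 _ up).
have a1 : a <= 0.
  apply: (le0_cvg _ h1); rewrite -[X in _ --> X]addr0 -[X in _ --> _ + X](mul0r l).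
  by apply: cvgD; [exact: cvg_cst|exact: cvgM].
have a2 : - a <= 0.
  apply: (le0_cvg _ h2); rewrite -[X in _ --> X]addr0 -[X in _ --> _ + X](mul0r l).
  by apply: cvgD; [exact: cvg_cst|exact: cvgM].
have a0 : a = 0 by apply/eqP; rewrite eq_le a1 -oppr_le0 a2.
split=> //; apply: (le0_cvg g1) => n; have := h1 n.
by rewrite a0 add0r (pmulr_rle0 _ (harmonic_gt0 n)).
Qed.

Lemma trform_cvg (T : Type) (F : set_system T) {FF : Filter F} (f : T -> M) A B :
  f x @[x --> F] --> A -> trform (f x) B @[x --> F] --> trform A B.
Proof. by move=> fA; exact: (cvg_app (@trform_continuous R N B) fA). Qed.

Lemma conj_expand (F : comNzRingType) n (A X H H' : 'M[F]_n) (t : F) :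
  (1%:M + t *: - X + (t * t) *: H') *m A *m (1%:M + t *: X + (t * t) *: H) =
  A + t *: (A *m X - X *m A) + (t * t) *: (A *m H + H' *m A - X *m A *m X +
     t *: (H' *m A *m X - X *m A *m H) + (t * t) *: (H' *m A *m H)).
Proof.
rewrite scalerN !mulmxDl !mulmxDr !mul1mx !mulmx1 !mulNmx.
do ?rewrite -?scalemxAl -?scalemxAr.
move: (A *m X) (A *m H) (X *m A *m X) (X *m A *m H) (X *m A) (H' *m A *m X) (H' *m A *m H) (H' *m A).
by move=> a b c d e f g h; apply/matrixP => i j; rewrite !mxE; ring.
Qed.

Lemma conj_taylor A X B : exists g : R -> R,
  (forall t, trform (mexp (toC t *: - X) *m A *m mexp (toC t *: X)) B =
    trform A B + t * trform (bracket A X) B + t ^+ 2 * g t) /\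
  g t @[t --> (0 : R)] --> 2^-1 * trform (bracket (bracket A X) X) B.
Proof.
have [H [eH lH]] := mexp_taylor2 X; have [H' [eH' lH']] := mexp_taylor2 (- X).
pose q t := A *m H t + H' t *m A - X *m A *m X +
  toC t *: (H' t *m A *m X - X *m A *m H t) + (toC t * toC t) *: (H' t *m A *m H t).
exists (fun t => trform (q t) B); split=> [t|].
  have e2 : toC (t ^+ 2) = toC t * toC t :> C by rewrite expr2 rmorphM.
  have e3 : mexp (toC t *: - X) *m A *m mexp (toC t *: X) =
      A + toC t *: bracket A X + toC (t ^+ 2) *: q t.
    by rewrite eH eH' e2; exact: conj_expand.
  move: (q t) e3 => Q ->; rewrite trformDl trformDl trformZl trformZl; exact: erefl.
pose L : M := 2^-1 *: (X *m X).
have {}lH' : H' t @[t --> (0 : R)] --> L by move: lH'; rewrite mulNmx mulmxN opprK.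
have tl : toC t @[t --> (0 : R)] --> (toC 0 : C) by exact: toC_continuous.
have c1 (D : M) : (fun _ : R => D) @ (0 : R) --> D by exact: cvg_cst.
have l1 : A *m H t @[t --> (0 : R)] --> A *m L by apply: cvg_mulmx lH; exact: c1.
have l2 : H' t *m A @[t --> (0 : R)] --> L *m A by apply: cvg_mulmx lH' _; exact: c1.
have l3 : H' t *m A *m X @[t --> (0 : R)] --> L *m A *m X by apply: cvg_mulmx l2 _; exact: c1.
have l4 : X *m A *m H t @[t --> (0 : R)] --> X *m A *m L by apply: cvg_mulmx lH; exact: c1.
have l5 : H' t *m A *m H t @[t --> (0 : R)] --> L *m A *m L by exact: cvg_mulmx l2 lH.
have z1 : toC t *: (H' t *m A *m X - X *m A *m H t) @[t --> (0 : R)] -->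
    toC 0 *: (L *m A *m X - X *m A *m L).
  by apply: (cvgZ tl); exact: (cvgB l3 l4).
have tt : toC t * toC t @[t --> (0 : R)] --> (toC 0 * toC 0 : C) by exact: (cvgM tl tl).
have z2 : (toC t * toC t) *: (H' t *m A *m H t) @[t --> (0 : R)] -->
    (toC 0 * toC 0) *: (L *m A *m L) by apply: (cvgZ tt); exact: l5.
have lq : q t @[t --> (0 : R)] --> A *m L + L *m A - X *m A *m X +
  toC 0 *: (L *m A *m X - X *m A *m L) + (toC 0 * toC 0) *: (L *m A *m L).
  apply: cvgD; last exact: z2.
  apply: cvgD; last exact: z1.
  apply: cvgD; last by apply: cvgN; exact: c1.
  exact: cvgD l1 l2.
have e : A *m L + L *m A - X *m A *m X + toC 0 *: (L *m A *m X - X *m A *m L) +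
  (toC 0 * toC 0) *: (L *m A *m L) = toC 2^-1 *: bracket (bracket A X) X.
  rewrite rmorph0 mulr0 !scale0r !addr0 /L -scalemxAl -scalemxAr fmorphV rmorph_nat.
  rewrite /bracket mulmxBl mulmxBr !mulmxA.
  move: (A *m X *m X) (X *m X *m A) (X *m A *m X) => a b c.
  apply/matrixP => i j; rewrite !mxE.
  have h2 : (2 : C) != 0 by rewrite pnatr_eq0.
  by field.
by rewrite -trformZl -e; apply: trform_cvg.
Qed.

Lemma mexp_comm_inv A B : (forall t : R, mexp (toC t *: A) *m B = B *m mexp (toC t *: A)) ->
  A *m B = B *m A.
Proof.
move=> h; have [H [eH lH]] := mexp_taylor2 A.
pose f t := toC t *: (B *m H t - H t *m B).
have fE t : t != 0 -> f t = A *m B - B *m A.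
  move=> t0; have := h t; rewrite eH !mulmxDl !mulmxDr mul1mx mulmx1 -!addrA => /addrI e.
  have e2 : toC (t ^+ 2) = toC t * toC t :> C by rewrite expr2 rmorphM.
  have s0 : toC t != 0 :> C by rewrite -(rmorph0 (@toC R)) (inj_eq (@toC_inj R)).
  move: e; rewrite e2 -!scalemxAl -!scalemxAr; exact: scale_cancel2.
pose L : M := 2^-1 *: (A *m A).
have c1 (D : M) : (fun _ : R => D) @ (0 : R) --> D by exact: cvg_cst.
have l1 : B *m H t @[t --> (0 : R)] --> B *m L by apply: cvg_mulmx lH; exact: c1.
have l2 : H t *m B @[t --> (0 : R)] --> L *m B by apply: cvg_mulmx lH _; exact: c1.
have lf : f t @[t --> (0 : R)] --> toC 0 *: (B *m L - L *m B).
  by apply: cvgZ; [exact: toC_continuous|exact: cvgB l1 l2].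
have k1 := cvg_along lf.
have k2 : f (@harmonic R n) @[n --> \oo] --> A *m B - B *m A.
  by apply: cvg_near_cst; apply: nearW => n; apply: fE; exact: harmonic_neq0.
have e : toC 0 *: (B *m L - L *m B) = A *m B - B *m A.
  exact: (cvg_unique (@norm_hausdorff _ _) k1 k2).
by apply/eqP; rewrite -subr_eq0 -e rmorph0 scale0r.
Qed.
End Variation.

Section CompactGroup.
Context {R : realType} {N : nat}.
Local Notation C := (cplx R).
Local Notation M := 'M[C]_N.
Variables (G Gc gc : set M).
Hypothesis gd : good G Gc gc.
Implicit Types (A B D E X k nu : M).

Lemma G_Gc k : G k -> Gc k. Proof. by move=> /(good_unitary gd) []. Qed.
Lemma G_unitary k : G k -> k \is unitarymx. Proof. by move=> /(good_unitary gd) []. Qed.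
Lemma Gc_unit g : Gc g -> g \in unitmx. Proof. by have [h _ _ _] := good_group gd; exact: h. Qed.
Lemma Gc_mul g g' : Gc g -> Gc g' -> Gc (g *m g'). Proof. by have [_ _ h _] := good_group gd; exact: h. Qed.
Lemma Gc_inv g : Gc g -> Gc (invmx g). Proof. by have [_ _ _ h] := good_group gd; exact: h. Qed.
Lemma Gc_one : Gc 1%:M. Proof. by have [_ h _ _] := good_group gd. Qed.
Lemma G_unit k : G k -> k \in unitmx. Proof. by move=> /G_Gc/Gc_unit. Qed.
Lemma G_mul k k' : G k -> G k' -> G (k *m k').
Proof.
move=> /(good_unitary gd) [g u] /(good_unitary gd) [g' u']; apply/(good_unitary gd).
by split; [exact: Gc_mul|exact: mul_unitarymx].
Qed.
Lemma G_star k : G k -> k^t* = invmx k. Proof. by move=> /G_unitary/unitary_unit_star. Qed.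
Lemma G_inv k : G k -> G (invmx k).
Proof.
move=> /(good_unitary gd) [g u]; apply/(good_unitary gd); split; first exact: Gc_inv.
by rewrite (unitary_starE u) trmxC_unitary.
Qed.
Lemma G_one : G 1%:M.
Proof. by apply/(good_unitary gd); split; [exact: Gc_one|apply/unitarymxP; rewrite star1 mulmx1]. Qed.

Lemma lie_cj k X : G k -> lie G X -> lie G (cj k X).
Proof.
move=> Gk /(good_lie gd) [gX sX]; apply/(good_lie gd).
split; first exact: (good_Ad gd (G_Gc Gk)).
have sk : (invmx k)^t* = k by rewrite -(G_star Gk) starK.
by rewrite /cj star_mul star_mul sk (G_star Gk) sX mulmxA mulmxN mulNmx.
Qed.
Lemma cjV k A : invmx k *m A *m k = cj (invmx k) A.
Proof. by rewrite /cj invmxK. Qed.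
Lemma lie_cjV k X : G k -> lie G X -> lie G (invmx k *m X *m k).
Proof. by move=> Gk; rewrite cjV; apply: lie_cj; exact: G_inv. Qed.
Lemma lie_exp X : lie G X -> G (mexp X).
Proof. by move=> /(_ 1); rewrite rmorph1 scale1r. Qed.
Lemma lie_bracket A B : lie G A -> lie G B -> lie G (bracket A B).
Proof.
move=> /(good_lie gd) [gA sA] /(good_lie gd) [gB sB]; apply/(good_lie gd).
split; first exact: (good_bracket gd).
by rewrite bracket_star sA sB bracketNl bracketNr opprK bracketC.
Qed.

Lemma G_compact : compact G.
Proof.
apply: (subclosed_compact (good_closed gd) (@entries_compact R N N)) => k Gk i j.
have uk := G_unitary Gk.
have : (k *m k^t*) i i = 1 by move/unitarymxP: uk => ->; rewrite mxE eqxx.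
rewrite mxE => e; rewrite -(ler_pXn2r (n := 2)) ?nnegrE ?cabs_ge0 //.
rewrite expr1n; have : \sum_l cabs (k i l) ^+ 2 = 1.
  apply: (@toC_inj R); rewrite rmorph_sum rmorph1 -e; apply: eq_bigr => l _.
  by rewrite rmorphXn /= -cabsE starE normCK.
by move=> <-; rewrite (bigD1 j) //= lerDl sumr_ge0 // => l _; rewrite sqr_ge0.
Qed.

Lemma mx_hausdorff : hausdorff_space M. Proof. exact: norm_hausdorff. Qed.

Lemma comm_closed nu : closed [set k : M | k *m nu = nu *m k].
Proof. by apply: closed_eq_cont; [exact: mulmxr_continuous|exact: mulmxl_continuous]. Qed.

(** Serves two purposes: [nu = 0] puts no constraint on [k], while a general [nu] restricts the
    maximum to its centralizer. Variations along an [X] commuting with [nu] respect the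
    constraint. *)
Lemma max_critical nu A B : exists k, [/\ G k, k *m nu = nu *m k &
  forall X, lie G X -> X *m nu = nu *m X ->
    trform (bracket (invmx k *m A *m k) X) B = 0 /\
    trform (bracket (bracket (invmx k *m A *m k) X) X) B <= 0].
Proof.
pose S := G `&` [set k : M | k *m nu = nu *m k].
have S0 : S !=set0 by exists 1%:M; split; [exact: G_one|rewrite /= mul1mx mulmx1].
have cS : compact S := compact_closedI G_compact (@comm_closed nu).
(* The adjoint replaces the inverse, with which it agrees on [G], because it is continuous on all
   matrices. *)
pose f k := trform (k^t* *m A *m k) B.
have cf : continuous f.
  move=> k; have h1 : (fun x : M => x^t*) @ k --> k^t*.
    by apply: (@cvg_star R M (nbhs k) (nbhs_filter k) N N (fun x => x) k); exact: cvg_id.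
  have h2 : (fun x : M => x^t* *m A *m x) @ k --> k^t* *m A *m k.
    apply: (@cvg_mulmx _ _ (nbhs k) (nbhs_filter k)); last exact: cvg_id.
    by apply: (@cvg_mulmx _ _ (nbhs k) (nbhs_filter k)); [exact: h1|exact: cvg_cst].
  rewrite /continuous_at /f; exact: (@trform_cvg R N M (nbhs k) (nbhs_filter k) _ _ B h2).
have [k kS kmax] := compact_EVT_max S0 cS (continuous_subspaceT cf).
move: kS; rewrite inE => -[Gk ck]; exists k; split; [exact: Gk|exact: ck|move=> X gX cX].
have [g [eg lg]] := conj_taylor (invmx k *m A *m k) X B.
have [|a0 h2] := second_order (a := trform (bracket (invmx k *m A *m k) X) B) lg; last first.
  by split; [exact: a0|move: h2; rewrite pmulr_rle0 // invr_gt0 ltr0n].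
move=> t; pose k' := k *m mexp (toC t *: X).
have Gk' : G k' by apply: G_mul => //; exact: gX.
have e : invmx k' *m A *m k' = mexp (toC t *: - X) *m (invmx k *m A *m k) *m mexp (toC t *: X).
  by rewrite /k' (invmx_mul (G_unit Gk) (mexp_unit _)) scalerN mexpN !mulmxA.
have cE : nu *m mexp (toC t *: X) = mexp (toC t *: X) *m nu.
  by apply: mexp_comm; rewrite -scalemxAl -scalemxAr cX.
have Sk' : S k'.
  by split; [exact: Gk'|rewrite /= /k' -mulmxA -cE mulmxA ck mulmxA].
have := kmax k'; rewrite inE => /(_ Sk').
by rewrite /f (G_star Gk') (G_star Gk) e eg -addrA gerDl.
Qed.
End CompactGroup.

(** * Weyl group, stabilizers and representatives *)

Section WeylGroup.
Context {R : realType} {N : nat}.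
Local Notation C := (cplx R).
Local Notation M := 'M[C]_N.
Variables (G Gc gc h : set M) (m : nat) (al X Y : 'I_m -> M) (H0 U : M) (w : M -> 'I_N -> R).
Hypothesis st : setting G Gc gc h al X Y H0 U w.
Implicit Types (A B D H E a b mu nu k n c : M).
Let gd := st_good st.
Let hc := st_cartan st.
Let hH0 := st_H0 st.

Lemma bracket_eq0 A B : bracket A B = 0 <-> A *m B = B *m A.
Proof. by split=> [/eqP|e]; [rewrite subr_eq0 => /eqP|rewrite /bracket e subrr]. Qed.

Lemma cartan_comm_mx H H' : h H -> h H' -> H *m H' = H' *m H.
Proof. by move=> hH hH'; apply/bracket_eq0; exact: (cartan_comm hc). Qed.

Lemma trform_bracket A B D : trform (bracket A B) D = trform B (bracket D A).
Proof. by rewrite !trformE /bracket mxtrace_ad. Qed.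

(** By invariance the quantity equals the squared norm of the bracket of [H0] and [A]; once this
    vanishes, regularity of [H0] puts [A] into [h]. *)
Lemma H0_critical A : lie G A -> trform (bracket A (bracket H0 A)) H0 = 0 -> h A.
Proof.
move=> gA; rewrite trform_bracket => e.
have gB : lie G (bracket H0 A) := lie_bracket gd (cartan_lie hc hH0) gA.
have sB : (bracket H0 A)^t* = - bracket H0 A by have [] := (good_lie gd _).1 gB.
apply: (regular_centralizer st hH0 (H0_regular st) gA).
exact: (trform_eq0 sB e).
Qed.

(** At a maximum of the pairing with [H0], the first variation brings the point into [h], and the
    second variations along [X j - Y j] give the inequalities of the closed chamber. *)
Lemma orbit_meets_chamber A : lie G A ->
  exists k, G k /\ h (invmx k *m A *m k) /\ forall j, 0 <= trform (invmx k *m A *m k) (al j).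
Proof.
move=> gA; have [k [Gk _ crit]] := max_critical gd 0 A H0.
have c0 (D : M) : D *m 0 = 0 *m D by rewrite mulmx0 mul0mx.
exists k; split; [exact: Gk|set mu := invmx k *m A *m k].
have gmu : lie G mu := lie_cjV gd Gk gA.
have hmu : h mu.
  have [e _] := crit _ (lie_bracket gd (cartan_lie hc hH0) gmu) (c0 _).
  exact: H0_critical gmu e.
split; first exact: hmu.
move=> j; have [_ _ gXY _] := st_XY st j.
have [_] := crit _ gXY (c0 _).
rewrite -/mu; set t := trform mu (al j).
(* Paired with [H0], this is -2 t times a positive number, as the Cartan vector is a positive
   multiple of a positive root. *)
have -> : bracket (bracket mu (X j - Y j)) (X j - Y j) = toC (- (2 * t)) *: cartan_vector X Y j.
  have e1 : bracket mu (X j - Y j) = ('i * toC t) *: (X j + Y j).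
    rewrite bracketBr (X_weight st j hmu) (Y_weight st j hmu) trformC -/t.
    have -> : toC (- t) = - toC t :> C := rmorphN _ _.
    by rewrite mulrN scaleNr opprK -scalerDr.
  rewrite e1 bracketZl.
  have -> : bracket (X j + Y j) (X j - Y j) = - (2%:R *: bracket (X j) (Y j)).
    rewrite bracketDl !bracketBr !bracketii (bracketC (Y j)) scaler_nat mulr2n.
    by move: (bracket (X j) (Y j)) => Z; apply/matrixP => i i'; rewrite !mxE; ring.
  rewrite /cartan_vector scalerN !scalerA -scaleNr; congr (_ *: _).
  have -> : toC (- (2 * t)) = - (2%:R * toC t) :> C by rewrite rmorphN rmorphM rmorph_nat.
  by ring.
rewrite trformZl (cartan_vectorE st) trformZl => e.
have [_ p] := al_root st j; have q := ip_cre_gt0 (X_neq0 st j).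
have pq := mulr_gt0 q p; rewrite mulNr oppr_le0 pmulr_lge0 // in e.
by rewrite pmulr_rge0 // in e.
Qed.

Definition normalizes k := forall H, h H -> h (cj k H) /\ h (cj (invmx k) H).

Lemma torus_exp H : h H -> torus h (mexp H). Proof. by exists H. Qed.

(** Passes from the torus to its Lie algebra: each exp(t cj n D) lies in the torus, so it commutes
    with [H0]; to first order in [t] so does [cj n D], and the centralizer of a regular element is
    [h]. *)
Lemma normalizer_cj n : normalizer G (torus h) n -> G n /\ normalizes n.
Proof.
move=> [Gn e]; have un := G_unit gd Gn; split; first exact: Gn.
move=> H hH.
have sub D g : h D -> G g -> (forall t, torus h t -> torus h (g *m t *m invmx g)) -> h (cj g D).
  move=> hD Gg hg; have ug := G_unit gd Gg.
  have gB : lie G (cj g D) := lie_cj gd Gg (cartan_lie hc hD).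
  apply: (regular_centralizer st hH0 (H0_regular st) gB); apply/bracket_eq0/esym.
  apply: mexp_comm_inv => t.
  have [H' hH' eH'] := hg _ (torus_exp (cartan_scale hc t hD)).
  have -> : toC t *: cj g D = g *m (toC t *: D) *m invmx g.
    by rewrite /cj -scalemxAr -scalemxAl.
  rewrite (mexp_conj _ ug) -eH'; apply/esym/mexp_comm; exact: cartan_comm_mx.
split; [apply: (sub _ _ hH Gn)|apply: (sub _ _ hH (G_inv gd Gn))].
- by move=> t ht; rewrite -e; exists t.
- move=> t; rewrite -{1}e => -[t' ht' <-].
  by rewrite invmxK !mulmxA (mulVmx un) mul1mx (mulmxKV un).
Qed.

Lemma cj_normalizer n : G n -> normalizes n -> normalizer G (torus h) n.
Proof.
move=> Gn nn; have un := G_unit gd Gn; split; first exact: Gn.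
apply/seteqP; split=> t.
  move=> [_ [H hH <-] <-]; rewrite -(mexp_conj _ un).
  by apply: torus_exp; have [] := nn H hH.
move=> [H hH <-]; exists (mexp (cj (invmx n) H)).
  by apply: torus_exp; have [] := nn H hH.
rewrite -(mexp_conj _ un) /cj invmxK !mulmxA (mulmxV un) mul1mx (mulmxK un).
by [].
Qed.

Lemma centralizerP c : centralizer G (torus h) c <-> G c /\ forall H, h H -> c *m H = H *m c.
Proof.
split=> [[Gc' e]|[Gc' e]]; split; try exact: Gc'.
  move=> H hH; apply/esym; apply: mexp_comm_inv => t; apply/esym/e.
  exact: torus_exp (cartan_scale hc t hH).
by move=> _ [H hH <-]; apply: mexp_comm; exact: e.
Qed.

Lemma stabilizerP mu k : stabilizer G mu k <-> G k /\ k *m mu = mu *m k.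
Proof.
split=> -[Gk e]; have uk := G_unit gd Gk; split; try exact: Gk.
  by rewrite -{1}e !mulmxA (mulmxV uk) mul1mx.
by rewrite -mulmxA -e (mulKmx uk).
Qed.

(** A logarithm of [k] that commutes with [mu] lies in the centralizer of a regular element, which
    is [h]. An arbitrary logarithm would not do. *)
Lemma regular_stabilizer mu : h mu -> (forall j, trform (al j) mu != 0) ->
  stabilizer G mu = torus h.
Proof.
move=> hmu reg; apply/seteqP; split=> k.
  move=> /stabilizerP [Gk ck].
  have [A [gA cA <-]] := good_log gd Gk (cartan_lie hc hmu) ck.
  by apply: torus_exp; apply: (regular_centralizer st hmu reg gA);
    apply/bracket_eq0; exact: esym cA.
move=> [H hH <-]; apply/stabilizerP; split; first exact: lie_exp (cartan_lie hc hH).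
by apply/esym/mexp_comm; exact: cartan_comm_mx.
Qed.

(* n = k s, where s stabilizes nu and brings k^-1 H0 k into h. *)
Lemma weyl_conj mu k : h mu -> G k -> h (invmx k *m mu *m k) ->
  exists n, [/\ G n, normalizes n & invmx n *m mu *m n = invmx k *m mu *m k].
Proof.
move=> hmu Gk hnu; set nu := _ *m k in hnu *.
have uk := G_unit gd Gk.
have cA : invmx k *m H0 *m k *m nu = nu *m (invmx k *m H0 *m k).
  have e := cartan_comm_mx hH0 hmu.
  rewrite /nu !mulmxA (mulmxK uk) (mulmxK uk).
  by rewrite -(mulmxA _ H0 mu) e mulmxA.
have gA : lie G (invmx k *m H0 *m k) := lie_cjV gd Gk (cartan_lie hc hH0).
have [s [Gs cs crit]] := max_critical gd nu (invmx k *m H0 *m k) H0.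
have us := G_unit gd Gs.
set A := invmx s *m _ *m s in crit; have gA' : lie G A := lie_cjV gd Gs gA.
have csv : invmx s *m nu = nu *m invmx s := invmx_comm us cs.
have cA' : A *m nu = nu *m A.
  have cE (B : M) : B *m nu = nu *m B ->
      invmx s *m B *m s *m nu = nu *m (invmx s *m B *m s).
    move=> cB; rewrite -(mulmxA _ s nu) cs (mulmxA _ nu s) -(mulmxA (invmx s) B nu) cB.
    by rewrite (mulmxA (invmx s) nu B) csv -!mulmxA.
  exact: cE cA.
have hA : h A.
  have e := cartan_comm_mx hH0 hnu.
  (* The direction in which [H0_critical] varies is allowed, because [H0] and [A] both commute with
     [nu]. *)
  have cb : bracket H0 A *m nu = nu *m bracket H0 A.
    rewrite /bracket mulmxBl mulmxBr -(mulmxA H0 A) cA' -(mulmxA A H0) e.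
    by rewrite (mulmxA H0 nu) e (mulmxA A nu) cA' !mulmxA.
  have [e0 _] := crit _ (lie_bracket gd (cartan_lie hc hH0) gA') cb.
  exact: H0_critical gA' e0.
have [n en] : exists n, n = k *m s by eexists.
have Gn : G n by rewrite en; exact: (G_mul gd Gk Gs).
have un := G_unit gd Gn.
have iE : invmx n = invmx s *m invmx k by rewrite en; exact: invmx_mul.
have eA : cj (invmx n) H0 = A by rewrite -cjV iE /A en !mulmxA.
have h1 H : h H -> h (cj n H).
  move=> hH; have gB : lie G (cj n H) := lie_cj gd Gn (cartan_lie hc hH).
  apply: (regular_centralizer st hH0 (H0_regular st) gB); apply/bracket_eq0.
  have -> : H0 = cj n A by rewrite -eA /cj invmxK !mulmxA (mulmxV un) mul1mx (mulmxK un).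
  by rewrite -(cjM _ _ un) -(cjM _ _ un) (cartan_comm_mx hA hH).
have h2 H : h H -> h (cj (invmx n) H).
  move=> hH; apply: (cartan_max gd hc); first by apply: (lie_cj gd); [exact: (G_inv gd)|exact: (cartan_lie hc)].
  move=> H' hH'; apply/bracket_eq0.
  have uin : invmx n \in unitmx by rewrite unitmx_inv.
  have -> : H' = cj (invmx n) (cj n H') by rewrite /cj invmxK !mulmxA (mulVmx un) mul1mx (mulmxKV un).
  by rewrite -(cjM _ _ uin) -(cjM _ _ uin) (cartan_comm_mx (h1 _ hH') hH).
exists n; split; [exact: Gn|by move=> H hH; split; [exact: h1|exact: h2]|].
by rewrite iE en !mulmxA -(mulmxA _ (invmx k)) -(mulmxA _ _ k) -/nu csv (mulmxKV us).
Qed.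

Lemma weyl_rep W r : weyl G (torus h) W -> W r -> G r /\ normalizes r.
Proof.
move=> [n Nn <-] [c /centralizerP [Gc' cc] [_ -> <-]].
have [Gn nn] := normalizer_cj Nn; have uc := G_unit gd Gc'; have un := G_unit gd Gn.
split; first exact: (G_mul gd Gc' Gn).
have cjc H : h H -> cj c H = H by move=> hH; rewrite /cj cc // (mulmxK uc).
have cjc' H : h H -> cj (invmx c) H = H.
  by move=> hH; rewrite /cj invmxK -mulmxA -cc // (mulKmx uc).
move=> H hH; have [h1 h2] := nn H hH.
have -> : cj (c *m n) H = cj c (cj n H) by rewrite /cj (invmx_mul uc un) !mulmxA.
have -> : cj (invmx (c *m n)) H = cj (invmx n) (cj (invmx c) H).
  by rewrite (invmx_mul uc un) /cj !invmxK (invmx_mul _ _) ?unitmx_inv // !invmxK !mulmxA.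
by rewrite cjc // cjc'.
Qed.

(** The class of [n] is a product of a class of the Weyl group of the stabilizer and a class of [I].
    The centralizer elements by which representatives differ stabilize [mu], so they are absorbed
    into [k]. *)
Lemma transversal_rep mu I (rep : set M -> M) n : h mu ->
  (forall W, weyl G (torus h) W -> W (rep W)) ->
  weyl_transversal (stabilizer G mu) G (torus h) I -> G n -> normalizes n ->
  exists2 W, I W & exists2 k, stabilizer G mu k & n = k *m rep W.
Proof.
move=> hmu hrep [Isub Iex] Gn nn.
have Nn := cj_normalizer Gn nn.
have wW : weyl G (torus h) (mulset (centralizer G (torus h)) [set n]) by exists n.
have [W' [[IW' [v [nv [[Gnv snv] _] <-] e]] _]] := Iex _ wW.
exists W' => //; have WW' := Isub _ IW'; have := hrep _ WW'.
have : mulset (centralizer G (torus h)) [set n] n.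
  exists 1%:M; last by exists n => //; rewrite mul1mx.
  by apply/centralizerP; split; [exact: (G_one gd)|move=> H _; rewrite mul1mx mulmx1].
rewrite e => -[_ [c [[Gcs scs] _] [_ -> <-]] [r' W'r' <-]].
case: WW' W'r' => n' _ <- [c1 /centralizerP [Gc1 cc1] [_ -> <-]] [c2 /centralizerP [Gc2 cc2] [_ -> <-]].
have uc2 := G_unit gd Gc2.
exists (c *m nv *m c1 *m invmx c2); last by rewrite -!mulmxA (mulKmx uc2).
have st1 : stabilizer G mu c1 by apply/stabilizerP; split; [|exact: cc1].
have [Gs cs] := (stabilizerP mu c).1 (conj Gcs scs).
have [_ cnv] := (stabilizerP mu nv).1 (conj Gnv snv).
apply/stabilizerP; split.
  by apply: (G_mul gd _ (G_inv gd Gc2)); apply: (G_mul gd _ Gc1); exact: (G_mul gd Gcs Gnv).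
have c2i : invmx c2 *m mu = mu *m invmx c2 := invmx_comm uc2 (cc2 _ hmu).
by rewrite -!mulmxA c2i (mulmxA c1) cc1 // !mulmxA -(mulmxA c nv) cnv mulmxA cs.
Qed.
End WeylGroup.

(** * Iwasawa decomposition and coset space *)

Section Parabolic.
Context {R : realType} {N : nat}.
Local Notation C := (cplx R).
Local Notation M := 'M[C]_N.
Variables (G Gc gc h : set M) (m : nat) (al X Y : 'I_m -> M) (H0 U : M) (w : M -> 'I_N -> R).
Hypothesis st : setting G Gc gc h al X Y H0 U w.
Hypothesis ss : semisimple (lie G).
Variable mu : M.
Hypothesis hmu : h mu.
Hypothesis pos : forall k, 0 <= trform mu (al k).
Implicit Types (A B D H E a b nu k n c g p : M).
Let gd := st_good st.
Let hc := st_cartan st.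
Let hH0 := st_H0 st.
Let uU := st_unit st.

(** The parabolic subgroup as a triangularity condition; [parabolicE] identifies it with the product
    of N, A and the stabilizer. *)
Definition Pgrp : set M := [set p | Gc p /\ upper (w mu) (cj U p)].

Lemma spectral_eq H : h H -> H = invmx U *m diag_mx (skewdiag (w H)) *m U.
Proof. by move=> hH; rewrite -(st_w st hH) cjK. Qed.

Lemma Pgrp_mul p p' : Pgrp p -> Pgrp p' -> Pgrp (p *m p').
Proof.
move=> [gp up] [gp' up']; split; first exact: (Gc_mul gd).
by rewrite (cjM _ _ uU); apply: upper_mul.
Qed.

Lemma Pgrp_inv p : Pgrp p -> Pgrp (invmx p).
Proof.
move=> [gp up]; split; first exact: (Gc_inv gd).
have u := Gc_unit gd gp; rewrite (cj_inv uU u); apply: upper_inv up.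
by rewrite (cj_unit p uU).
Qed.

Lemma upper_exp (d : 'I_N -> R) A : upper d (cj U A) -> upper d (cj U (mexp A)).
Proof.
move=> uA; rewrite -[cj U (mexp A)](mexp_conj _ uU) -/(cj U A).
have h0 (B : M) (n : nat) : upper d B -> upper d (B ^+ n).
  move=> uB; elim: n => [|n IH]; first by rewrite expr0; exact: upper1.
  by rewrite exprS; apply: upper_mul.
move=> i j ij.
have cl : closed [set B : M | B i j = 0].
  have -> : [set B : M | B i j = 0] = [set B : M | (B i j)%:M = (0 : 'M[C]_1)].
    apply/seteqP; split=> B /= e; first by rewrite e raddf0.
    by have := congr1 (fun D : 'M[C]_1 => D 0 0) e; rewrite !mxE eqxx mulr1n.
  apply: (@closed_eq_cont _ _ _ _ (fun B : M => (B i j)%:M) (fun=> 0)); last exact: cst_continuous.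
  move=> B; apply: (@cvg_mx _ _ (nbhs B) (nbhs_filter B)) => i' j'.
  have e D : (D i j)%:M i' j' = (D i j : C) by rewrite !ord1 mxE eqxx mulr1n.
  rewrite e (funext e); exact: coord_continuous.
apply: (mexp_closed cl) => n /=; rewrite summxE big1 // => k _.
by rewrite mxE (h0 _ k uA) ?mulr0.
Qed.

Lemma stabilizer_upper k : stabilizer G mu k -> upper (w mu) (cj U k).
Proof.
move=> /(stabilizerP st) [Gk ck] i j ij.
have := bracket_entry st k i j hmu; rewrite ((bracket_eq0 mu k).2 (esym ck)).
rewrite /cj mulmx0 mul0mx mxE -/(cj U k) => /esym/eqP; rewrite mulf_eq0 => /orP [|/eqP //].
rewrite mulf_eq0 (negbTE (neq0Ci C)) /= -(rmorph0 (@toC R)) (inj_eq (@toC_inj R)) subr_eq0.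
by rewrite lt_eqF.
Qed.

Lemma groupN_P n : groupN X n -> Pgrp n.
Proof.
move=> [c _ <-]; split.
  by apply: (good_exp gd); apply: (gc_sum gd) => k _; apply: (good_scale gd); exact: (X_gc st).
apply: upper_exp; rewrite /cj mulmx_sumr mulmx_suml => i j ij.
rewrite summxE big1 // => k _; rewrite -scalemxAr -scalemxAl mxE.
by rewrite (X_upper st k hmu pos ij) mulr0.
Qed.

Lemma cartan_diag_upper H (d : 'I_N -> R) : h H -> upper d (cj U H).
Proof.
move=> hH i j ij; rewrite (st_w st hH) mxE.
by case: eqP ij => [->|_ _]; rewrite ?ltxx ?mulr0n.
Qed.

Lemma groupA_P a : groupA (cartan_vector X Y) a -> Pgrp a.
Proof.
move=> [c _ <-]; split.
  apply: (good_exp gd); apply: (gc_sum gd) => k _; do 2 apply: (good_scale gd).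
  by apply: (cartan_gc gd hc); exact: (cartan_vector_h st).
apply: upper_exp; rewrite /cj mulmx_sumr mulmx_suml => i j ij.
rewrite summxE big1 // => k _.
have e : cj U (cartan_vector X Y k) i j = 0.
  exact: cartan_diag_upper (cartan_vector_h st k) _ _ ij.
move: (cartan_vector X Y k) e => V e; rewrite -!scalemxAr -!scalemxAl -/(cj U V).
by rewrite mxE [X in _ * X]mxE e !mulr0.
Qed.

Lemma lowu_log (d : 'I_N -> R) l : Gc l -> lowu d (cj U l) ->
  exists S, [/\ gc S, slower d (cj U S), mexp S = l & S = mlog l].
Proof.
move=> gl hl; have n1 : (l - 1%:M) ^+ N.+1 = 0.
  apply: (cj_slower_nilp (d := d) uU).
  by rewrite /cj mulmxBr mulmxBl mulmx1 (mulmxV uU).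
have eS : mexp (mlog l) = l := mexp_mlog n1.
have sS : slower d (cj U (mlog l)).
  rewrite /mlog /cj mulmx_sumr mulmx_suml; apply: slower_sum => -[[|k] kN] _ /=.
    by rewrite invr0 mulr0 scale0r mulmx0 mul0mx; exact: slower0.
  rewrite -scalemxAr -scalemxAl; apply: slowerZ.
  rewrite -/(cj U _) -(cj_expr _ _ uU); apply: slower_expr.
  by rewrite /cj mulmxBr mulmxBl mulmx1 (mulmxV uU).
exists (mlog l); split; [|exact: sS|exact: eS|exact: erefl].
by apply: (good_nilp gd uU sS); rewrite eS.
Qed.

Lemma star_cj A : (cj U A)^t* = cj U (A^t*).
Proof.
have sU : (invmx U)^t* = U by rewrite (unitary_starE (st_U st)) starK.
by rewrite /cj star_mul star_mul sU -(unitary_starE (st_U st)) mulmxA.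
Qed.

Lemma blockdiag_comm H A : h H -> (forall i j, w H i != w H j -> cj U A i j = 0) ->
  H *m A = A *m H.
Proof.
move=> hH z; apply/bracket_eq0; apply: (cj_inj uU); apply/matrixP => i j.
rewrite (bracket_entry st _ _ _ hH) /cj mulmx0 mul0mx [RHS]mxE -/(cj U A).
have [->|ne] := eqVneq (w H i) (w H j); last by rewrite z ?mulr0.
by rewrite subrr rmorph0 mulr0 mul0r.
Qed.

(** The grading here is by the regular [H0], not by [mu]. In g g^* = b l the adjoint of [l] lies in
    N. Removing it from [g] leaves [c] with a = c c^* commuting with [H0]; the positive square root
    [q] of [a] is the factor in A, and q^-1 c is unitary. *)
Lemma iwasawa g : Gc g -> exists n a k, [/\ groupN X n, groupA (cartan_vector X Y) a, G k &
  g = n *m a *m k].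
Proof.
move=> Gg; have ug := Gc_unit gd Gg; set e := w H0.
have Ggg : Gc (g *m g^t*) by apply: (Gc_mul gd Gg); exact: (good_star gd).
have [gg egg] : exists gg, gg = g *m g^t* by eexists.
rewrite -egg in Ggg.
have ugg := Gc_unit gd Ggg.
have cgg : cj U gg = cj U g *m (cj U g)^t* by rewrite egg star_cj (cjM _ _ uU).
have mgg : minors e (cj U gg).
  by rewrite cgg; apply: posdef_minors; rewrite (cj_unit g uU).
have [|] := lu_exists (d := e) _ mgg; first by rewrite (cj_unit gg uU).
set L := lfac e (cj U gg) => hL uB.
have [uL _] := lowu_inv hL.
have [l el] : exists l, l = invmx U *m L *m U by eexists.
have cl : cj U l = L by rewrite el /cj !mulmxA (mulmxV uU) mul1mx (mulmxK uU).
have ul : l \in unitmx by rewrite -(cj_unit l uU) cl.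
have [b eb] : exists b, b = gg *m invmx l by eexists.
have ub : b \in unitmx by rewrite eb unitmx_mul ugg unitmx_inv.
have hb : upper e (cj U b) by rewrite eb (cjM _ _ uU) (cj_inv uU ul) cl.
have bl : b *m l = gg by rewrite eb (mulmxKV ul).
have Gl : Gc l.
  apply: (good_lu gd (cartan_gc gd hc hH0) (st_U st) (spectral_eq hH0) ub hb).
    by rewrite cl.
  by rewrite bl.
have [S0 [gS0 sS0 eS0 _]] := lowu_log Gl (eq_ind_r (lowu e) hL cl).
have gS1 := good_lstar gd gS0.
have nS : groupN X (l^t*).
  exists (xc X (S0^t*)); first by [].
  rewrite -(upper_span st gS1) => [|i j ij]; last by rewrite -star_cj starE sS0 ?rmorph0.
  by rewrite mexp_star eS0.
have Gls : Gc (l^t*) := good_star gd Gl; have uls := Gc_unit gd Gls.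
have [c ec] : exists c, c = invmx (l^t*) *m g by eexists.
have Gc' : Gc c by rewrite ec; apply: (Gc_mul gd _ Gg); exact: (Gc_inv gd).
have uc := Gc_unit gd Gc'.
have [a ea] : exists a, a = c *m c^t* by eexists.
have Ga : Gc a by rewrite ea; apply: (Gc_mul gd Gc'); exact: (good_star gd).
have ab : a = invmx (l^t*) *m b.
  by rewrite ea ec star_mul star_inv starK !mulmxA -(mulmxA _ g) -egg eb !mulmxA.
(* [a] is upper as a product of upper matrices, and it is Hermitian; so it is block diagonal and
   commutes with [H0]. *)
have upa : upper e (cj U a).
  rewrite ab (cjM _ _ uU); apply: upper_mul hb; rewrite (cj_inv uU uls); apply: upper_inv.
    by rewrite (cj_unit _ uU).
  move=> i j ij; rewrite -star_cj starE cl.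
  have : (L - 1%:M) j i = 0 by apply: hL; exact: ltW.
  rewrite !mxE; case: eqP ij => [->|_ _]; first by rewrite ltxx.
  by rewrite subr0 => ->; rewrite rmorph0.
have sa : a^t* = a by rewrite ea star_mul starK.
have ca : H0 *m a = a *m H0.
  apply: blockdiag_comm => // i j; rewrite neq_lt => /orP [lt|lt]; first exact: upa.
  by rewrite -sa -star_cj starE upa ?rmorph0.
have [S [hS eS cS]] := posdef_log uc ea.
have gS : gc S by apply: (good_herm gd hS); rewrite eS.
(* The logarithm inherits commutation with [H0], so [i S] lies in [h]; semisimplicity then writes it
   in Cartan vectors, as A demands. *)
have hiS : h ('i *: S).
  apply: (regular_centralizer st hH0 (H0_regular st)).
    by apply/(good_lie gd); split; [exact: (good_scale gd)|exact: herm_skew].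
  by rewrite bracketZr ((bracket_eq0 H0 S).2 (esym (cS _ (esym ca)))) scaler0.
have [co eco] := coroot_span st ss hiS.
have [q eq] : exists q, q = mexp (2^-1 *: S) by eexists.
have qq : q *m q = a.
  have half : 2^-1 + 2^-1 = 1 :> C by rewrite -div1r -splitr.
  by rewrite eq -(mexpD (erefl _)) -eS -scalerDl half scale1r.
have hq : q^t* = q by rewrite eq -mexp_star starZ hS fmorphV rmorph_nat.
have uq : q \in unitmx by rewrite eq mexp_unit.
have Aq : groupA (cartan_vector X Y) q.
  exists (fun j : 'I_m => - co j / 2); first by [].
  have hSi : 2^-1 *: S = \sum_j toC (- co j / 2) *: ('i *: cartan_vector X Y j).
    have hS' : S = - 'i *: ('i *: S) by rewrite scalerA mulNr -expr2 sqrCi opprK scale1r.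
    rewrite [in LHS]hS' eco !scaler_sumr; apply: eq_bigr => j _; rewrite !scalerA.
    have -> : toC (- co j / 2) = - toC (co j) / 2%:R :> C.
      by rewrite rmorphM rmorphN fmorphV rmorph_nat.
    suff -> : 2^-1 * (- 'i) * toC (co j) = - toC (co j) / 2%:R * 'i :> C by [].
    by ring.
  by rewrite eq -hSi.
have Gq : Gc q by rewrite eq; apply: (good_exp gd); exact: (good_scale gd).
have [k ek] : exists k, k = invmx q *m c by eexists.
exists (l^t*), q, k; split=> //; last first.
  by rewrite ek ec -(mulmxA _ q) (mulKVmx uq) (mulKVmx uls).
apply/(good_unitary gd); split.
  by rewrite ek; apply: (Gc_mul gd _ Gc'); exact: (Gc_inv gd).
apply/unitarymxP; rewrite ek star_mul star_inv hq -mulmxA (mulmxA c) -ea -qq.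
by rewrite (mulmxK uq) (mulVmx uq).
Qed.

(** For the inclusion of [Pgrp], the compact factor [k] of [p] again lies in [Pgrp]. Its inverse is
    its adjoint, so [k] is upper and lower at once, hence block diagonal, and it commutes with
    [mu]. *)
Lemma parabolicE : parabolic X Y (stabilizer G mu) = Pgrp.
Proof.
apply/seteqP; split=> [_ [_ [n Nn [a Aa <-]] [k Kk <-]]|p [gp up]].
  apply: Pgrp_mul; first by apply: Pgrp_mul; [exact: groupN_P|exact: groupA_P].
  split; last exact: stabilizer_upper.
  by have [Gk _] := (stabilizerP st _ _).1 Kk; exact: (G_Gc gd).
have [n [a [k [Nn Aa Gk e]]]] := iwasawa gp.
exists (n *m a); first by exists n => //; exists a.
exists k; last by rewrite -e.
apply/(stabilizerP st); split; first exact: Gk.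
have Pk : Pgrp k.
  have Pna : Pgrp (n *m a) by apply: Pgrp_mul; [exact: groupN_P|exact: groupA_P].
  have una := Gc_unit gd (proj1 Pna).
  by rewrite -[k](mulKmx una) -e; apply: Pgrp_mul; [exact: Pgrp_inv|].
have [_ up1] := Pk; have [_ up2] := Pgrp_inv Pk.
apply/esym/blockdiag_comm => // i j; rewrite neq_lt => /orP [lt|lt]; first exact: up1.
have := up2 _ _ lt; rewrite -(G_star gd Gk) -star_cj starE => e0.
by rewrite -[LHS]conjCK e0 rmorph0.
Qed.
End Parabolic.

(** Writes [d] as a combination of indicators of half-lines, by induction on removing a smallest
    value: the coefficient is its difference to the next value, the largest value itself at the top,
    and 0 on all but one of several tied indices. *)
Lemma layer_cake (R : realType) (I : finType) (d : I -> R) (A : {set I}) :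
  exists kap : I -> R, forall j, j \in A ->
    \sum_(i in A) kap i * (d j <= d i)%R%:R = d j.
Proof.
move: {2}_.+1 (ltnSn #|A|) => n; elim: n A => // n IH A; rewrite ltnS => An.
have [->|[j1 j1A]] := set_0Vmem A; first by exists (fun=> 0) => j; rewrite inE.
have [j0 j0A jmin] : exists2 j0, j0 \in A & forall j, j \in A -> d j0 <= d j.
  by case: (arg_minP d j1A) => j0 ? ?; exists j0.
have [|kap hk] := IH (A :\ j0).
  by apply: leq_trans An; rewrite [X in (_ < X)%N](cardsD1 j0) j0A.
have sum c j : j \in A -> \sum_(i in A) (if i == j0 then c else kap i) * (d j <= d i)%R%:R =
    c * (d j <= d j0)%R%:R + \sum_(i in A :\ j0) kap i * (d j <= d i)%R%:R.
  move=> jA; rewrite (big_setD1 j0) //= eqxx; congr (_ + _); apply: eq_bigr => i.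
  by rewrite in_setD1 => /andP [/negbTE -> _].
have [/existsP [j2 /andP [j2A /eqP e2]]|ne] := boolP [exists j, (j \in A :\ j0) && (d j == d j0)].
  exists (fun i => if i == j0 then 0 else kap i) => j jA; rewrite sum // mul0r add0r.
  have [->|jj0] := eqVneq j j0; last by apply: hk; rewrite in_setD1 jj0.
  by rewrite -e2; exact: hk.
exists (fun i => if i == j0 then d j0 - \sum_(i in A :\ j0) kap i else kap i) => j jA.
rewrite sum //; have [->|jj0] := eqVneq j j0.
  have -> : \sum_(i in A :\ j0) kap i * (d j0 <= d i)%R%:R = \sum_(i in A :\ j0) kap i.
    by apply: eq_bigr => i; rewrite in_setD1 => /andP [_ iA]; rewrite jmin // mulr1.
  by rewrite lexx mulr1 subrK.
have jA' : j \in A :\ j0 by rewrite in_setD1 jj0.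
rewrite hk // [d j <= d j0](_ : _ = false) ?mulr0 ?add0r //.
apply/negbTE; rewrite -ltNge lt_def jmin // andbT.
by apply: contra ne => e; apply/existsP; exists j; rewrite jA'.
Qed.

(** * The map from the complexified group to the orbit *)

Section OrbitMap.
Context {R : realType} {N : nat}.
Local Notation C := (cplx R).
Local Notation M := 'M[C]_N.
Variables (U : M) (d : 'I_N -> R).
Hypothesis hU : U \is unitarymx.
Let uU : U \in unitmx := unitarymx_unit hU.
Implicit Types (g p k P B Q S : M).

(** For invertible [g], the orthogonal projection onto the row space of [P *m U *m g]; [comp_blk]
    completes the singular Gram matrix so that it can be inverted. *)
Definition row_proj P g : M :=
  (P *m U *m g)^t* *m invmx (comp_blk P ((U *m g) *m (U *m g)^t*)) *m (P *m U *m g).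

Lemma row_proj_gram P g : P^t* = P -> P *m P = P ->
  comp_blk P ((U *m g) *m (U *m g)^t*) = (P *m U *m g) *m (P *m U *m g)^t* + (1%:M - P).
Proof.
move=> Ps PP; congr (_ + _); rewrite -(mulmxA P U g).
by rewrite [(P *m (U *m g))^t*]star_mul Ps !mulmxA.
Qed.

(** Left multiplication by [p] multiplies [P *m U *m g] by the invertible corner [S] of [p], the
    Gram matrix by [S] and its adjoint, and these factors cancel. *)
Lemma row_proj_mul i p g : p \in unitmx -> upper d (cj U p) -> g \in unitmx ->
  row_proj (Pd C d (d i)) (p *m g) = row_proj (Pd C d (d i)) g.
Proof.
move=> up hp ug; rewrite /row_proj; set P := Pd C d (d i).
have Ps : P^t* = P by exact: Pd_star.
have PP : P *m P = P by exact: idem_Pd.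
have up' : cj U p \in unitmx by rewrite (cj_unit p uU).
have Pp : P *m cj U p = P *m cj U p *m P by have /upperP/(_ i) := hp.
have [S eS] : exists S, S = comp_blk P (cj U p) by eexists.
have uS : S \in unitmx.
  have l1 : lowu d (1%:M : M) by exact: lowu1.
  have [m1 _] := lu_unique up' hp l1.
  by have := m1 i; rewrite mulmx1 eS.
have SQ : S *m (1%:M - P) = 1%:M - P.
  have PQ : P *m (1%:M - P) = 0 by rewrite mulmxBr mulmx1 PP subrr.
  have QQ : (1%:M - P) *m (1%:M - P) = 1%:M - P by rewrite mulmxBl mul1mx PQ subr0.
  by rewrite eS /comp_blk mulmxDl -mulmxA PQ mulmx0 add0r QQ.
have [B eB] : exists B, B = P *m U *m g by eexists.
have B' : P *m U *m (p *m g) = S *m B.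
  have PB : P *m B = B by rewrite eB !mulmxA PP.
  have SB : S *m B = P *m cj U p *m B.
    by rewrite eS /comp_blk mulmxDl mulmxBl mul1mx PB subrr addr0 -(mulmxA _ P B) PB.
  rewrite SB eB -(mulmxA P U g) (mulmxA (P *m cj U p) P) -Pp /cj !mulmxA (mulmxKV uU).
  by [].
rewrite !row_proj_gram // -eB B' star_mul.
have -> : S *m B *m (B^t* *m S^t*) + (1%:M - P) = S *m (B *m B^t* + (1%:M - P)) *m S^t*.
  rewrite mulmxDr mulmxDl SQ !mulmxA; congr (_ + _).
  have QS : (1%:M - P)^t* = 1%:M - P by rewrite starB star1 Ps.
  by rewrite -[in RHS]QS -star_mul SQ QS.
have uQ : B *m B^t* + (1%:M - P) \in unitmx.
  rewrite eB -row_proj_gram //; apply: posdef_minors.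
  by rewrite unitmx_mul uU ug.
have uSs : S^t* \in unitmx by rewrite star_unit.
rewrite invmx_mul ?unitmx_mul ?uS // invmx_mul // !mulmxA (mulmxKV uS).
by rewrite -(mulmxA _ (S^t*)) (mulmxV uSs) mulmx1.
Qed.

Lemma row_proj_unitary P k : k \is unitarymx -> P^t* = P -> P *m P = P ->
  row_proj P k = k^t* *m U^t* *m P *m U *m k.
Proof.
move=> uk Ps PP; have e : (U *m k) *m (U *m k)^t* = 1%:M.
  by apply/unitarymxP; exact: mul_unitarymx.
rewrite /row_proj e (comp_blk1 PP) invmx1 mulmx1 !star_mul Ps !mulmxA.
by rewrite -(mulmxA _ P P) PP.
Qed.

Lemma row_proj_cvg i g : g \in unitmx ->
  row_proj (Pd C d (d i)) x @[x --> g] --> row_proj (Pd C d (d i)) g.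
Proof.
move=> ug; set P := Pd C d (d i).
have FF := nbhs_filter g.
have h1 : (fun x : M => P *m U *m x) @ g --> P *m U *m g by exact: mulmxl_continuous.
have h2 : (fun x : M => U *m x) @ g --> U *m g by exact: mulmxl_continuous.
have h3 : (fun x : M => (U *m x)^t*) @ g --> (U *m g)^t* by exact: (@cvg_star _ _ _ FF _ _ _ _ h2).
have h4 : (fun x : M => (P *m U *m x)^t*) @ g --> (P *m U *m g)^t* by exact: (@cvg_star _ _ _ FF _ _ _ _ h1).
have h5 : (fun x : M => (U *m x) *m (U *m x)^t*) @ g --> (U *m g) *m (U *m g)^t* by exact: (@cvg_mulmx _ _ _ FF _ _ _ _ _ _ _ h2 h3).
have h6 : (fun x : M => comp_blk P ((U *m x) *m (U *m x)^t*)) @ g --> comp_blk P ((U *m g) *m (U *m g)^t*).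
  apply: cvgD; last exact: cvg_cst.
  apply: (@cvg_mulmx _ _ _ FF); last exact: cvg_cst.
  by apply: (@cvg_mulmx _ _ _ FF); [exact: cvg_cst|exact: h5].
have uQ : comp_blk P ((U *m g) *m (U *m g)^t*) \in unitmx.
  by apply: posdef_minors; rewrite unitmx_mul uU ug.
have h7 := @cvg_invmx _ _ _ FF _ _ _ uQ h6.
apply: (@cvg_mulmx _ _ _ FF); last exact: h1.
by apply: (@cvg_mulmx _ _ _ FF); [exact: h4|exact: h7].
Qed.

Variable kap : 'I_N -> R.
Definition orbit_map g : M :=
  'i *: \sum_i toC (kap i) *: row_proj (Pd C d (d i)) g.

Lemma orbit_map_mul p g : p \in unitmx -> upper d (cj U p) -> g \in unitmx ->
  orbit_map (p *m g) = orbit_map g.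
Proof.
by move=> up hp ug; congr (_ *: _); apply: eq_bigr => i _; rewrite row_proj_mul.
Qed.

Lemma orbit_map_cvg g : g \in unitmx -> orbit_map x @[x --> g] --> orbit_map g.
Proof.
move=> ug; have FF := nbhs_filter g; apply: cvgZr.
apply: (@cvg_bigsum _ _ _ _ FF) => i _; apply: cvgZr; exact: row_proj_cvg.
Qed.

(** For unitary [k] the projections are conjugates of the coordinate projectors, and the
    coefficients [kap] recombine those into the diagonal form of [mu]. *)
Lemma orbit_map_unitary k mu : (forall j, \sum_i kap i * (d j <= d i)%R%:R = d j) ->
  k \is unitarymx -> mu = invmx U *m diag_mx (skewdiag d) *m U ->
  orbit_map k = invmx k *m mu *m k.
Proof.
move=> hk uk emu; rewrite -(unitary_unit_star uk).
have e : diag_mx (skewdiag d) = 'i *: \sum_i toC (kap i) *: Pd C d (d i).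
  apply/matrixP => a b; rewrite mxE [RHS]mxE summxE; case: (eqVneq a b) => [->|ab].
    rewrite mulr1n mxE -[in LHS](hk b) rmorph_sum; congr (_ * _); apply: eq_bigr => i _.
    by rewrite rmorphM rmorph_nat !mxE eqxx mulr1n.
  by rewrite mulr0n big1 ?mulr0 // => i _; rewrite !mxE (negbTE ab) mulr0n mulr0.
rewrite emu e -scalemxAr -!scalemxAl -scalemxAr -scalemxAl /orbit_map; congr (_ *: _).
rewrite mulmx_sumr !mulmx_suml mulmx_sumr mulmx_suml; apply: eq_bigr => i _.
have Ps : (Pd C d (d i))^t* = Pd C d (d i) by exact: Pd_star.
have PP : Pd C d (d i) *m Pd C d (d i) = Pd C d (d i) by exact: idem_Pd.
rewrite (row_proj_unitary uk Ps PP) -(unitary_unit_star hU).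
by rewrite -scalemxAr -!scalemxAl -scalemxAr -scalemxAl !mulmxA.
Qed.
End OrbitMap.

Section CosetIdentification.
Context {R : realType} {N : nat}.
Local Notation C := (cplx R).
Local Notation M := 'M[C]_N.
Variables (G Gc gc h : set M) (m : nat) (al X Y : 'I_m -> M) (H0 U : M) (w : M -> 'I_N -> R).
Hypothesis st : setting G Gc gc h al X Y H0 U w.
Hypothesis ss : semisimple (lie G).
Variable mu : M.
Hypothesis hmu : h mu.
Hypothesis pos : forall k, 0 <= trform mu (al k).
Implicit Types (A B D H E a b nu k n c g p : M).
Let gd := st_good st.
Let hc := st_cartan st.
Let uU := st_unit st.
Local Notation P := (Pgrp Gc U w mu).

Lemma Pgrp_Gc p : P p -> Gc p. Proof. by case. Qed.
Lemma Pgrp_one : P 1%:M.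
Proof. by split; [exact: (Gc_one gd)|rewrite (cj1 uU); exact: upper1]. Qed.

Lemma iwasawa_P g : Gc g -> exists p k, [/\ P p, G k & g = p *m k].
Proof.
move=> Gg; have [n [a [k [Nn Aa Gk e]]]] := iwasawa st ss Gg.
exists (n *m a), k; split; [|exact: Gk|exact: e].
apply: (Pgrp_mul st); first exact: (groupN_P st hmu pos).
exact: (groupA_P st _ Aa).
Qed.

Lemma stabilizer_P k : stabilizer G mu k -> P k.
Proof.
move=> Kk; split; last exact: (stabilizer_upper st hmu).
by have [Gk _] := (stabilizerP st _ _).1 Kk; exact: (G_Gc gd).
Qed.

(** The inclusion of [Gc] follows from the Iwasawa decomposition: each of the three factors is an
    exponential of an element of [gc], the compact one by the logarithm taken at [mu = 0]. *)
Lemma complexificationE : complexification G = Gc.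
Proof.
have lc : complexify (lie G) = gc := complexify_lie gd.
rewrite /complexification /subgroup_generated lc; apply/seteqP; split=> g.
  apply; split; first exact: (good_group gd).
  by move=> _ [A gA <-]; exact: (good_exp gd).
move=> Gg A [[_ _ Amul _] sub].
have [n [a [k [[c1 _ <-] [c2 _ <-] Gk ->]]]] := iwasawa st ss Gg.
have [D [gD _ <-]] := good_log gd Gk (cartan_lie hc (cartan_zero hc)) (etrans (mulmx0 _ k) (esym (mul0mx _ k))).
apply: (Amul); first apply: (Amul); apply: sub.
- exists (\sum_k0 c1 k0 *: X k0); last exact: erefl.
  by apply: (gc_sum gd) => j _; apply: (good_scale gd); exact: (X_gc st).
- exists (\sum_k0 toC (c2 k0) *: ('i *: cartan_vector X Y k0)); last exact: erefl.
  apply: (gc_sum gd) => j _; do 2 apply: (good_scale gd).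
  by apply: (cartan_gc gd hc); exact: (cartan_vector_h st).
- by exists D; [have [] := (good_lie gd _).1 gD|exact: erefl].
Qed.

(** The explicit formula is forgotten here: the coset identification and the charts use only these
    three properties of [psi]. *)
Lemma orbit_map_exists : exists psi : M -> M, [/\
  forall p g, P p -> Gc g -> psi (p *m g) = psi g,
  forall k, G k -> psi k = invmx k *m mu *m k &
  forall g, Gc g -> psi x @[x --> g] --> psi g].
Proof.
have [kap hk] := layer_cake (w mu) [set: 'I_N]%SET.
exists (orbit_map U (w mu) kap); split.
- move=> p g [Gp up] Gg; apply: (orbit_map_mul (st_U st)); [exact: (Gc_unit gd)|exact: up|exact: (Gc_unit gd)].
- move=> k Gk; apply: (orbit_map_unitary (st_U st)) => [j||].
  + by rewrite -[RHS]hk ?inE //; apply: eq_bigl => i; rewrite inE.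
  + exact: (G_unitary gd).
  + exact: (spectral_eq st).
- by move=> g Gg; apply: (orbit_map_cvg (st_U st)); exact: (Gc_unit gd).
Qed.

Variable psi : M -> M.
Hypothesis psi_mul : forall p g, P p -> Gc g -> psi (p *m g) = psi g.
Hypothesis psi_G : forall k, G k -> psi k = invmx k *m mu *m k.
Hypothesis psi_cvg : forall g, Gc g -> psi x @[x --> g] --> psi g.

Lemma psi_orbit g : Gc g -> conj_orbit G mu (psi g).
Proof.
move=> Gg; have [p [k [Pp Gk ->]]] := iwasawa_P Gg; exists k => //.
by rewrite (psi_mul Pp (G_Gc gd Gk)) psi_G.
Qed.

Lemma psi_eq x y : Gc x -> Gc y -> psi x = psi y -> exists2 p, P p & x = p *m y.
Proof.
move=> Gx Gy; have [p [k [Pp Gk ->]]] := iwasawa_P Gx; have [q [l [Pq Gl ->]]] := iwasawa_P Gy.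
rewrite (psi_mul Pp (G_Gc gd Gk)) (psi_mul Pq (G_Gc gd Gl)) !psi_G // => e.
have uk := G_unit gd Gk; have ul := G_unit gd Gl.
have Ks : stabilizer G mu (k *m invmx l).
  apply/(stabilizerP st); split; first by apply: (G_mul gd Gk); exact: (G_inv gd).
  have e1 : mu *m k = k *m (invmx l *m mu *m l).
    by rewrite -e -mulmxA (mulKVmx uk).
  by rewrite mulmxA e1 -!mulmxA (mulmxV ul) mulmx1.
exists (p *m (k *m invmx l) *m invmx q).
  apply: (Pgrp_mul st); last exact: (Pgrp_inv st).
  exact: (Pgrp_mul st Pp (stabilizer_P Ks)).
have uq := Gc_unit gd (Pgrp_Gc Pq).
by rewrite -!mulmxA (mulKmx uq) (mulVmx ul) mulmx1.
Qed.

Lemma psi_coset x y : Gc x -> Gc y ->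
  psi x = psi y <-> right_coset P x = right_coset P y.
Proof.
move=> Gx Gy; split=> [e|e]; last first.
  have : right_coset P x x by exists 1%:M; [exact: Pgrp_one|exists x => //; rewrite mul1mx].
  by rewrite e => -[p Pp [_ -> <-]]; exact: psi_mul.
have sub a b : Gc a -> Gc b -> psi a = psi b -> right_coset P a `<=` right_coset P b.
  move=> Ga Gb /(psi_eq Ga Gb) [p Pp ->] _ [q Pq [_ -> <-]].
  by exists (q *m p); [exact: (Pgrp_mul st)|exists b => //; rewrite mulmxA].
by apply/seteqP; split; [exact: sub Gx Gy e|exact: sub Gy Gx (esym e)].
Qed.

(** One direction is continuity. For the other, the complement of [B] in the orbit is the image of
    the compact set of those [k] in [G] outside the open set [W], hence closed. *)
Lemma psi_open (B : set M) : B `<=` conj_orbit G mu ->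
  open_in (conj_orbit G mu) B <-> open_in Gc (Gc `&` psi @^-1` B).
Proof.
move=> BO; split=> [[V oV eB]|[W oW eW]].
  exists (psi @^-1` V)^°; first exact: open_interior.
  apply/seteqP; split=> g [Gg] /=.
    rewrite eB => -[_ Vg]; split=> //.
    by apply: (psi_cvg Gg); exact: open_nbhs_nbhs.
  move=> /interior_subset Vg; split=> //; rewrite /= eB; split; [exact: psi_orbit|exact: Vg].
pose f k : M := k^t* *m mu *m k.
have cf : continuous f.
  move=> k; have FF := nbhs_filter k.
  have h1 : (fun x : M => x^t*) @ k --> k^t*.
    by apply: (@cvg_star R M (nbhs k) FF N N (fun x => x) k); exact: cvg_id.
  apply: (@cvg_mulmx _ _ _ FF); last exact: cvg_id.
  by apply: (@cvg_mulmx _ _ _ FF); [exact: h1|exact: cvg_cst].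
have fE k : G k -> f k = psi k by move=> Gk; rewrite psi_G // /f (G_star gd Gk).
have cK : compact (G `&` ~` W) := compact_closedI (G_compact gd) (open_closedC oW).
have clF : closed (f @` (G `&` ~` W)).
  apply: (compact_closed (@mx_hausdorff R N)).
  exact: (continuous_compact (continuous_subspaceT cf) cK).
exists (~` (f @` (G `&` ~` W))); first exact: closed_openC.
apply/seteqP; split=> y.
  move=> By; split; first exact: BO.
  move=> [k [Gk nW] ek]; apply: nW.
  have : (Gc `&` psi @^-1` B) k by split; [exact: (G_Gc gd)|rewrite /= -fE // ek].
  by rewrite eW => -[].
move=> [[k Gk ek] ny].
have Wk : W k.
  by apply: contrapT => nW; apply: ny; exists k => //; rewrite fE // psi_G.
have : (Gc `&` W) k by split; [exact: (G_Gc gd)|].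
by rewrite -eW => -[_] /=; rewrite psi_G // ek.
Qed.

Lemma coset_identificationP :
  coset_identification G (parabolic X Y (stabilizer G mu)) mu psi.
Proof.
have eGC := complexificationE; have eP := parabolicE st ss hmu pos.
rewrite /coset_identification eGC eP; split.
- exact: psi_G.
- exact: psi_coset.
- apply/seteqP; split=> [_ [g Gg <-]|_ [k Gk <-]]; first exact: psi_orbit.
  by exists k; [exact: (G_Gc gd)|exact: psi_G].
- exact: psi_open.
Qed.
End CosetIdentification.

(** * Bruhat covering *)

Lemma scalemx_comm (F : comNzRingType) n (s t : F) (A : 'M[F]_n) :
  (s *: A) *m (t *: A) = (t *: A) *m (s *: A).
Proof. by rewrite -!scalemxAl -!scalemxAr !scalerA [s * t]mulrC. Qed.

Section ProjectionFlow.
Context {R : realType} {N : nat}.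
Local Notation C := (cplx R).
Local Notation M := 'M[C]_N.
Variables (U : M) (d : 'I_N -> R).
Hypothesis hU : U \is unitarymx.
Let uU : U \in unitmx := unitarymx_unit hU.
Implicit Types (A B D Q V k : M).

Lemma perturb_trace (t : C) A1 A2 V : (1%:M + t *: A1) \in unitmx ->
  \tr (invmx (1%:M + t *: A1) *m (V + t *: A2)) =
  \tr V + t * \tr (invmx (1%:M + t *: A1) *m (A2 - A1 *m V)).
Proof.
set Q := 1%:M + t *: A1 => uQ.
have e : V + t *: A2 = Q *m V + t *: (A2 - A1 *m V).
  by rewrite /Q mulmxDl mul1mx -scalemxAl scalerBr -addrA subrKC.
by rewrite e mulmxDr (mulKmx uQ) mxtraceD -scalemxAr mxtraceZ.
Qed.

Lemma proj_defect (Pi D : M) : Pi^t* = Pi -> Pi *m Pi = Pi -> D^t* = D ->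
  ip ((1%:M - Pi) *m D *m Pi) ((1%:M - Pi) *m D *m Pi) =
  \tr (Pi *m D *m D) - \tr (Pi *m D *m Pi *m D).
Proof.
move=> hp pp hD; have QS : (1%:M - Pi)^t* = 1%:M - Pi by rewrite starB star1 hp.
have QQ : (1%:M - Pi) *m (1%:M - Pi) = 1%:M - Pi.
  by rewrite mulmxBl mul1mx mulmxBr mulmx1 pp subrr subr0.
rewrite /ip !star_mul QS hp hD.
have -> : (1%:M - Pi) *m D *m Pi *m (Pi *m (D *m (1%:M - Pi))) =
    (1%:M - Pi) *m (D *m Pi *m D *m (1%:M - Pi)).
  by rewrite !mulmxA -(mulmxA _ Pi Pi) pp.
rewrite mxtrace_mulC -!mulmxA QQ mulmxBr mulmx1 mulmxBr mulmxBr !mulmxA raddfB /=.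
congr (_ - _); first by rewrite mxtrace_mulC mulmxA mxtrace_mulC mulmxA.
by rewrite mxtrace_mulC !mulmxA.
Qed.

Lemma herm_invariant_comm Q D : Q^t* = Q -> D^t* = D -> D *m Q = Q *m D *m Q ->
  Q *m D = D *m Q.
Proof.
move=> hQ hD e; have e2 : (D *m Q)^t* = (Q *m D *m Q)^t* by rewrite -e.
move: e2; rewrite star_mul star_mul star_mul hQ hD mulmxA => ->; exact: esym e.
Qed.

Lemma comm_scale_sum (I : finType) (a : C) (c : I -> C) (Q : I -> M) D :
  (forall i, Q i *m D = D *m Q i) ->
  D *m (a *: \sum_i c i *: Q i) = (a *: \sum_i c i *: Q i) *m D.
Proof.
move=> e; rewrite -scalemxAl -scalemxAr mulmx_sumr mulmx_suml.
have -> : \sum_i D *m (c i *: Q i) = \sum_i c i *: Q i *m D; last by [].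
by apply: eq_bigr => i _; rewrite -scalemxAl -scalemxAr (e i).
Qed.

(** The derivative of tr(Pi D) along the flow is twice the squared norm of the part of [D] leaving
    the range of [Pi]. With B = P U k one has B B^* = P, so the completed Gram matrix along the flow
    is 1 + O(t) and the difference quotient [f] is explicit. *)
Lemma row_proj_flow i k D : k \is unitarymx -> D^t* = D ->
  let Pi := row_proj U (Pd C d (d i)) k in
  exists f : R -> R,
  (forall t, cre (\tr (row_proj U (Pd C d (d i)) (k *m mexp (toC t *: D)) *m D)) =
     cre (\tr (Pi *m D)) + t * f t) /\
  f t @[t --> (0 : R)] --> 2 * cre (ip ((1%:M - Pi) *m D *m Pi) ((1%:M - Pi) *m D *m Pi)).
Proof.
move=> uk hD Pi; set P := Pd C d (d i).
have Ps : P^t* = P by exact: Pd_star.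
have PP : P *m P = P by exact: idem_Pd.
have [B eB] : exists B, B = P *m U *m k by eexists.
have kk : k *m k^t* = 1%:M by apply/unitarymxP.
have UU : U *m U^t* = 1%:M by apply/unitarymxP.
have BB : B *m B^t* = P.
  rewrite eB !star_mul Ps !mulmxA -(mulmxA (P *m U) k) kk mulmx1 -(mulmxA P U) UU mulmx1.
  exact: PP.
have PiE : Pi = B^t* *m B.
  by rewrite /Pi row_proj_unitary // eB !star_mul Ps !mulmxA -(mulmxA _ P P) PP.
have hPi : Pi^t* = Pi by rewrite PiE star_mul starK.
have PB : P *m B = B by rewrite eB !mulmxA PP.
have ppi : Pi *m Pi = Pi by rewrite PiE mulmxA -(mulmxA _ B) BB -mulmxA PB.
(* The Gram matrix contains exp(t D) on both sides, whence the factor 2. *)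
have [H [eH lH]] := mexp_taylor2 (2%:R *: D).
pose W t := 2%:R *: D + toC t *: H t.
have eW t : mexp (toC t *: D) *m mexp (toC t *: D) = 1%:M + toC t *: W t.
  rewrite -(mexpD (erefl _)).
  have -> : toC t *: D + toC t *: D = toC t *: (2%:R *: D).
    by rewrite -scalerDr scaler_nat mulr2n.
  have e2 : toC (t ^+ 2) = toC t * toC t :> C by rewrite expr2 rmorphM.
  by rewrite eH e2 -scalerA -addrA -scalerDr.
pose V := B *m D *m B^t*.
pose Q t : M := 1%:M + toC t *: (B *m W t *m B^t*).
have eQ t : (P *m U *m (k *m mexp (toC t *: D))) *m (P *m U *m (k *m mexp (toC t *: D)))^t* + (1%:M - P) = Q t.
  have hE : (mexp (toC t *: D))^t* = mexp (toC t *: D) by rewrite -mexp_star starZ conj_toC hD.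
  rewrite !mulmxA -eB star_mul hE !mulmxA -(mulmxA B) eW mulmxDr mulmx1 mulmxDl BB.
  by rewrite -scalemxAr -scalemxAl /Q [P + _]addrC -addrA subrKC addrC.
have uQ t : Q t \in unitmx.
  rewrite -eQ -row_proj_gram //; apply: posdef_minors.
  by rewrite !unitmx_mul uU mexp_unit (unitarymx_unit uk).
pose f t := cre (\tr (invmx (Q t) *m (B *m W t *m D *m B^t* - B *m W t *m B^t* *m V))).
exists f; split=> [t|].
  have hE : (mexp (toC t *: D))^t* = mexp (toC t *: D) by rewrite -mexp_star starZ conj_toC hD.
  have cE : D *m mexp (toC t *: D) = mexp (toC t *: D) *m D.
    by apply: mexp_comm; rewrite -scalemxAl -scalemxAr.
  rewrite /row_proj row_proj_gram // eQ.
  have -> : \tr ((P *m U *m (k *m mexp (toC t *: D)))^t* *m invmx (Q t) *m (P *m U *m (k *m mexp (toC t *: D))) *m D) =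
      \tr (invmx (Q t) *m (V + toC t *: (B *m W t *m D *m B^t*))).
    rewrite (mulmxA _ k) -eB star_mul hE.
    have -> : V + toC t *: (B *m W t *m D *m B^t*) = B *m (mexp (toC t *: D) *m mexp (toC t *: D)) *m D *m B^t*.
      by rewrite eW mulmxDr mulmx1 !mulmxDl -scalemxAr -!scalemxAl.
    rewrite mxtrace_mulC !mulmxA mxtrace_mulC !mulmxA mxtrace_mulC !mulmxA.
    rewrite -(mulmxA _ D (mexp _)) cE !mulmxA.
    by rewrite mxtrace_mulC !mulmxA mxtrace_mulC !mulmxA mxtrace_mulC !mulmxA.
  rewrite perturb_trace; last exact: uQ.
  have -> : \tr V = \tr (Pi *m D) by rewrite /V mxtrace_mulC PiE mulmxA.
  by rewrite creD cre_toCM.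
have c1 (A : M) : (fun _ : R => A) @ (0 : R) --> A by exact: cvg_cst.
have tl : toC t @[t --> (0 : R)] --> (toC 0 : C) by exact: toC_continuous.
have lW : W t @[t --> (0 : R)] --> 2%:R *: D.
  have l0 : W t @[t --> (0 : R)] --> 2%:R *: D + toC 0 *: (2^-1 *: (2%:R *: D *m (2%:R *: D))).
    by apply: cvgD; [exact: c1|apply: (cvgZ tl); exact: lH].
  by move: l0; rewrite rmorph0 scale0r addr0.
have l1 : B *m W t @[t --> (0 : R)] --> B *m (2%:R *: D) by apply: cvg_mulmx lW; exact: c1.
have l2 : B *m W t *m B^t* @[t --> (0 : R)] --> B *m (2%:R *: D) *m B^t* by apply: cvg_mulmx l1 _; exact: c1.
have l3 : B *m W t *m D @[t --> (0 : R)] --> B *m (2%:R *: D) *m D by apply: cvg_mulmx l1 _; exact: c1.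
have l4 : B *m W t *m D *m B^t* @[t --> (0 : R)] --> B *m (2%:R *: D) *m D *m B^t* by apply: cvg_mulmx l3 _; exact: c1.
have l5 : B *m W t *m B^t* *m V @[t --> (0 : R)] --> B *m (2%:R *: D) *m B^t* *m V by apply: cvg_mulmx l2 _; exact: c1.
have lQ : Q t @[t --> (0 : R)] --> (1%:M : M).
  have l0 : Q t @[t --> (0 : R)] --> 1%:M + toC 0 *: (B *m (2%:R *: D) *m B^t*).
    by apply: cvgD; [exact: c1|apply: (cvgZ tl); exact: l2].
  by move: l0; rewrite rmorph0 scale0r addr0.
have lQ' : invmx (Q t) @[t --> (0 : R)] --> (1%:M : M).
  by rewrite -[X in _ --> X]invmx1; apply: cvg_invmx lQ; exact: unitmx1.
pose L := B *m (2%:R *: D) *m D *m B^t* - B *m (2%:R *: D) *m B^t* *m V.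
have l6 : invmx (Q t) *m (B *m W t *m D *m B^t* - B *m W t *m B^t* *m V) @[t --> (0 : R)] --> 1%:M *m L.
  by apply: (cvg_mulmx lQ'); exact: (cvgB l4 l5).
have l7 : \tr (invmx (Q t) *m (B *m W t *m D *m B^t* - B *m W t *m B^t* *m V)) @[t --> (0 : R)] -->
    \tr (1%:M *m L) by apply: cvg_mxtrace; exact: l6.
have -> : 2 * cre (ip ((1%:M - Pi) *m D *m Pi) ((1%:M - Pi) *m D *m Pi)) = cre (\tr (1%:M *m L)).
  rewrite mul1mx proj_defect // /L -!scalemxAr -!scalemxAl -scalerBr mxtraceZ raddfB /=.
  rewrite -(rmorph_nat (@toC R)) cre_toCM; congr (_ * cre (_ - _)).
    by rewrite PiE [RHS]mxtrace_mulC !mulmxA.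
  by rewrite /V PiE -!mulmxA mxtrace_mulC -!mulmxA.
exact: (cvg_app (@cre_continuous R) l7).
Qed.
End ProjectionFlow.

Section BruhatCover.
Context {R : realType} {N : nat}.
Local Notation C := (cplx R).
Local Notation M := 'M[C]_N.
Variables (G Gc gc h : set M) (m : nat) (al X Y : 'I_m -> M) (H0 U : M) (w : M -> 'I_N -> R).
Hypothesis st : setting G Gc gc h al X Y H0 U w.
Hypothesis ss : semisimple (lie G).
Variable mu : M.
Hypothesis hmu : h mu.
Hypothesis pos : forall k, 0 <= trform mu (al k).
Implicit Types (A B D H E a b nu k n c g p x z : M).
Let gd := st_good st.
Let hc := st_cartan st.
Let uU := st_unit st.
Local Notation P := (Pgrp Gc U w mu).

Definition Zgrp : set M := [set z | Gc z /\ lowu (w mu) (cj U z)].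

Lemma comm_blockdiag a i j : a *m mu = mu *m a -> w mu i != w mu j -> cj U a i j = 0.
Proof.
move=> ca ne; have := bracket_entry st a i j hmu; rewrite ((bracket_eq0 mu a).2 (esym ca)).
rewrite /cj mulmx0 mul0mx mxE -/(cj U a) => /esym/eqP; rewrite mulf_eq0 => /orP [|/eqP //].
rewrite mulf_eq0 (negbTE (neq0Ci C)) /= -(rmorph0 (@toC R)) (inj_eq (@toC_inj R)) subr_eq0.
by rewrite (negbTE ne).
Qed.

Lemma comm_P a : Gc a -> a *m mu = mu *m a -> P a.
Proof.
by move=> Ga ca; split=> // i j ij; apply: comm_blockdiag => //; rewrite lt_eqF.
Qed.

Lemma Zgrp_conj a z : Gc a -> a *m mu = mu *m a -> Zgrp z -> Zgrp (invmx a *m z *m a).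
Proof.
move=> Ga ca [Gz lz]; have ua := Gc_unit gd Ga; split.
  by apply: (Gc_mul gd _ Ga); apply: (Gc_mul gd _ Gz); exact: (Gc_inv gd).
have cia : invmx a *m mu = mu *m invmx a := invmx_comm ua ca.
have -> : cj U (invmx a *m z *m a) = cj U (invmx a) *m cj U z *m cj U a.
  by rewrite (cjM _ _ uU) (cjM _ _ uU).
have e : cj U (invmx a) *m cj U a = 1%:M by rewrite -(cjM _ _ uU) (mulVmx ua) (cj1 uU).
rewrite /lowu -e -[cj U z](subrK 1%:M) mulmxDr mulmx1 mulmxDl addrK => i j ij.
rewrite mxE big1 // => k _; rewrite mxE mulr_suml big1 // => l _.
have [il|il] := eqVneq (w mu i) (w mu l); last first.
  by rewrite (comm_blockdiag cia il) mul0r mul0r.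
have [kj|kj] := eqVneq (w mu k) (w mu j); last by rewrite (comm_blockdiag ca kj) mulr0.
by rewrite (lz l k) ?mulr0 ?mul0r // -il kj.
Qed.

Let D : M := 'i *: H0.

Lemma flow_star : D^t* = D.
Proof. by rewrite /D starZ (cartan_skew gd hc (st_H0 st)) conjCi scalerN scaleNr opprK. Qed.
Lemma flow_gc (t : R) : gc (toC t *: D).
Proof. by do 2 apply: (good_scale gd); exact: (cartan_gc gd hc (st_H0 st)). Qed.
Lemma flow_Gc (t : R) : Gc (mexp (toC t *: D)).
Proof. by apply: (good_exp gd); exact: flow_gc. Qed.
Lemma flow_add (s t : R) : mexp (toC s *: D) *m mexp (toC t *: D) = mexp (toC (s + t) *: D).
Proof.
have e : toC s + toC t = toC (s + t) :> C by rewrite rmorphD.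
by rewrite -(mexpD (scalemx_comm _ _ _)) -scalerDl e.
Qed.

Let Pi i g : M := row_proj U (Pd C (w mu) (w mu i)) g.
(** The height function. All projections have weight 1, and not [kap], whose sign is not controlled,
    so that the derivative along the flow is a sum of squares. *)
Let F g : R := \sum_i cre (\tr (Pi i g *m D)).

Lemma F_mul p g : P p -> Gc g -> F (p *m g) = F g.
Proof.
move=> [Gp up] Gg; apply: eq_bigr => i _.
by rewrite /Pi (row_proj_mul (st_U st) _ (Gc_unit gd Gp) up (Gc_unit gd Gg)).
Qed.

Lemma F_cvg (t : R) k : Gc k ->
  (fun a : M => F (a *m mexp (toC t *: D))) @ k --> F (k *m mexp (toC t *: D)).
Proof.
move=> Gk; have FF := nbhs_filter k.
apply: (@cvg_bigsum _ _ _ _ FF R^o) => i _.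
have h0 : (fun x : M => x *m mexp (toC t *: D)) @ k --> k *m mexp (toC t *: D).
  exact: mulmxr_continuous.
have ug : k *m mexp (toC t *: D) \in unitmx.
  by rewrite unitmx_mul (Gc_unit gd Gk) mexp_unit.
have h1 : (fun x : M => Pi i (x *m mexp (toC t *: D))) @ k --> Pi i (k *m mexp (toC t *: D)).
  apply: (cvg_comp (fun x : M => x *m mexp (toC t *: D)) (Pi i) h0).
  by apply: row_proj_cvg; first [exact: (st_U st)|exact: ug].
have h2 : (fun x : M => \tr (Pi i (x *m mexp (toC t *: D)) *m D)) @ k -->
    \tr (Pi i (k *m mexp (toC t *: D)) *m D).
  apply: (@cvg_mxtrace _ _ _ FF); apply: (@cvg_mulmx _ _ _ FF); last exact: cvg_cst.
  exact: h1.
exact: (cvg_app (@cre_continuous R) h2).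
Qed.

(* The derivative of F along the flow is a sum of squares, which vanish only if
   i H0 commutes with every projection, hence with psi k. *)
Lemma F_critical k : G k -> (forall t : R, F (k *m mexp (toC t *: D)) <= F k) ->
  h (invmx k *m mu *m k).
Proof.
move=> Gk kmax; have uk := G_unitary gd Gk.
pose Z i := (1%:M - Pi i k) *m D *m Pi i k.
have flow i : exists f : R -> R,
    (forall t, cre (\tr (Pi i (k *m mexp (toC t *: D)) *m D)) =
       cre (\tr (Pi i k *m D)) + t * f t) /\
    f t @[t --> (0 : R)] --> 2 * cre (ip (Z i) (Z i)).
  by apply: row_proj_flow; first [exact: (st_U st)|exact: uk|exact: flow_star].
have [f hf] := boolp.choice flow.
have l1 : \sum_i f i t @[t --> (0 : R)] --> \sum_i 2 * cre (ip (Z i) (Z i)).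
  apply: (@cvg_bigsum _ _ _ _ _ R^o) => i _; exact: (hf i).2.
have Fs t : F (k *m mexp (toC t *: D)) = F k + t * \sum_i f i t.
  rewrite mulr_sumr -big_split /=; apply: eq_bigr => i _; exact: (hf i).1.
have l2 := cvg_along l1.
have le0 : \sum_i 2 * cre (ip (Z i) (Z i)) <= 0.
  apply: (le0_cvg l2) => j; have := kmax (@harmonic R j).
  by rewrite Fs gerDl (pmulr_rle0 _ (harmonic_gt0 j)).
have Z0 i : Z i = 0.
  have nn j : 0 <= 2 * cre (ip (Z j) (Z j)).
    by apply: mulr_ge0; [exact: ler0n|apply: ge0_re; exact: ip_ge0].
  have le1 : 2 * cre (ip (Z i) (Z i)) <= 0.
    apply: le_trans le0; rewrite (bigD1 i) //= lerDl; apply: sumr_ge0 => j _; exact: nn.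
  have e : cre (ip (Z i) (Z i)) = 0 by have := nn i; lra.
  by apply: ip_eq0; rewrite ip_real e rmorph0.
have [kap hk] := layer_cake (w mu) [set: 'I_N]%SET.
have hk' j : \sum_i kap i * (w mu j <= w mu i)%R%:R = w mu j.
  by rewrite -[RHS]hk ?inE //; apply: eq_bigl => i; rewrite inE.
have enu := orbit_map_unitary (st_U st) hk' uk (spectral_eq st hmu).
have cPi i : Pi i k *m D = D *m Pi i k.
  have hp : (Pi i k)^t* = Pi i k.
    have Ps : (Pd C (w mu) (w mu i))^t* = Pd C (w mu) (w mu i) by exact: Pd_star.
    have PP : Pd C (w mu) (w mu i) *m Pd C (w mu) (w mu i) = Pd C (w mu) (w mu i) by exact: idem_Pd.
    by rewrite /Pi (row_proj_unitary (st_U st) uk Ps PP) !star_mul !starK Ps !mulmxA.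
  have e1 : D *m Pi i k = Pi i k *m D *m Pi i k.
    have := Z0 i; rewrite /Z mulmxBl mul1mx mulmxBl => /eqP.
    by rewrite subr_eq0 => /eqP.
  exact: herm_invariant_comm hp flow_star e1.
have cD : D *m (invmx k *m mu *m k) = (invmx k *m mu *m k) *m D.
  by rewrite -enu; apply: comm_scale_sum => i; exact: cPi.
have gnu : lie G (invmx k *m mu *m k) := lie_cjV gd Gk (cartan_lie hc hmu).
apply: (regular_centralizer st (st_H0 st) (H0_regular st) gnu); apply/bracket_eq0.
apply: (scalerI (neq0Ci C)); rewrite scalemxAl scalemxAr; exact: cD.
Qed.

(* k maximizes F over the closure of the K-parts of the points x exp(s i H0). *)
Lemma limit_in_orbit x : Gc x -> exists k, [/\ G k, h (invmx k *m mu *m k) &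
  forall V : set M, nbhs k V -> exists k' s p, [/\ V k', G k', P p & p *m k' = x *m mexp (toC s *: D)]].
Proof.
move=> Gx.
pose S : set M := [set k | G k /\ exists s p, P p /\ p *m k = x *m mexp (toC s *: D)].
have z0 : mexp (toC 0 *: D) = 1%:M by rewrite rmorph0 scale0r mexp0.
have [p0 [k0 [Pp0 Gk0 e0]]] := iwasawa_P st ss hmu pos Gx.
have Sk0 : S k0 by split; [exact: Gk0|exists 0, p0; split; [exact: Pp0|rewrite z0 mulmx1 -e0]].
have SG : closure S `<=` G.
  rewrite [X in _ `<=` X]((closure_id G).1 (good_closed gd)).
  by apply: closureS => k [].
have clS : closed (closure S) by exact: closed_closure.
have cS : compact (closure S) := subclosed_compact clS (G_compact gd) SG.
(* Agrees with [F] on [G] but contains no inverse, so it is continuous on all matrices and attains a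
   maximum on the compact closure. *)
pose F' k : R := \sum_i cre (\tr (k^t* *m U^t* *m Pd C (w mu) (w mu i) *m U *m k *m D)).
have F'E k : G k -> F' k = F k.
  move=> Gk; apply: eq_bigr => i _.
  have Ps : (Pd C (w mu) (w mu i))^t* = Pd C (w mu) (w mu i) by exact: Pd_star.
  have PP : Pd C (w mu) (w mu i) *m Pd C (w mu) (w mu i) = Pd C (w mu) (w mu i) by exact: idem_Pd.
  by rewrite /Pi (row_proj_unitary (st_U st) (G_unitary gd Gk) Ps PP).
have cF' : continuous F'.
  move=> k; have FF := nbhs_filter k; apply: (@cvg_bigsum _ _ _ _ FF R^o) => i _.
  have h1 : (fun x : M => x^t*) @ k --> k^t*.
    by apply: (@cvg_star R M (nbhs k) FF N N (fun x => x) k); exact: cvg_id.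
  have h2 : (fun x : M => \tr (x^t* *m U^t* *m Pd C (w mu) (w mu i) *m U *m x *m D)) @ k -->
      \tr (k^t* *m U^t* *m Pd C (w mu) (w mu i) *m U *m k *m D).
    apply: (@cvg_mxtrace _ _ _ FF); apply: (@cvg_mulmx _ _ _ FF); last exact: cvg_cst.
    apply: (@cvg_mulmx _ _ _ FF); last exact: cvg_id.
    by do 3 (apply: (@cvg_mulmx _ _ _ FF); last exact: cvg_cst); exact: h1.
  exact: (cvg_app (@cre_continuous R) h2).
have S0 : closure S !=set0 by exists k0; exact: subset_closure.
have [k [kS kmax]] : exists k : M, closure S k /\ forall a : M, closure S a -> F' a <= F' k.
  have [k kS kmax] := compact_EVT_max S0 cS (continuous_subspaceT cF').
  by exists k; split=> [|a Sa]; [rewrite inE in kS|apply: kmax; rewrite inE].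
have Gk := SG _ kS.
have Fmax a : S a -> F a <= F k.
  move=> Sa; rewrite -(F'E _ Gk) -(F'E _ (proj1 Sa)); apply: kmax.
  exact: subset_closure.
exists k; split; [exact: Gk| |]; last first.
  move=> V nV; have [k' [[Gk' [s [p [Pp e]]]] Vk']] := kS V nV.
  by exists k', s, p; split.
apply: (F_critical Gk) => t.
(* Flowing a point of [S] gives, up to P, another point of [S], so the bound holds on [S];
   continuity at [k] extends it to the limit point. *)
pose ft a := F (a *m mexp (toC t *: D)).
have cft : ft @ k --> ft k by exact: (F_cvg (t := t) (G_Gc gd Gk)).
suff hle a : S a -> ft a <= F k by exact: (@closure_le R _ S ft k (F k) kS cft hle).
move=> [Ga [s [p [Pp e]]]].
have Gat : Gc (a *m mexp (toC t *: D)) by apply: (Gc_mul gd (G_Gc gd Ga)); exact: flow_Gc.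
have [p' [k' [Pp' Gk' e']]] := iwasawa_P st ss hmu pos Gat.
rewrite /ft e' (F_mul Pp' (G_Gc gd Gk')); apply: Fmax; split; first exact: Gk'.
exists (s + t), (p *m p'); split; first exact: (Pgrp_mul st Pp Pp').
by rewrite -mulmxA -e' mulmxA e -mulmxA flow_add.
Qed.

(** The limit point is [a *m n] with [a] centralizing [mu] and [n] normalizing [h]. Points close to
    it have a block LU factorization after division by [n], and some point of the flow line is that
    close. Flowing back stays in the chart, because [n] conjugates the flow into the centralizer of
    [mu], which normalizes Z and lies in P. *)
Lemma bruhat_cover x : Gc x -> exists p z n, [/\ P p, Zgrp z, G n, normalizes h n &
  x = p *m z *m n].
Proof.
move=> Gx; have [k [Gk hk near_k]] := limit_in_orbit Gx.
have [n [Gn nn en]] := weyl_conj st hmu Gk hk.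
have un := G_unit gd Gn; have uk := G_unit gd Gk.
have [a ea] : exists a, a = k *m invmx n by eexists.
have Ga : G a by rewrite ea; apply: (G_mul gd Gk); exact: (G_inv gd).
have ua := G_unit gd Ga.
have ca : a *m mu = mu *m a.
  have e1 : mu *m k = k *m (invmx k *m mu *m k) by rewrite -!mulmxA (mulKVmx uk).
  rewrite ea (mulmxA mu) e1 -en -!mulmxA (mulmxV un) mulmx1.
  by [].
have [_ upa] := comm_P (G_Gc gd Ga) ca.
have ma : minors (w mu) (cj U a).
  have l1 : lowu (w mu) (1%:M : M) by exact: lowu1.
  have ucj : cj U a \in unitmx by rewrite (cj_unit a uU).
  by have [m1 _] := lu_unique ucj upa l1; rewrite mulmx1 in m1.
(* Invertibility of the minors holds at [a], which is block diagonal, and it is an open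
   condition. *)
have V : nbhs k [set g | minors (w mu) (cj U (g *m invmx n))].
  apply: (@filter_forall _ _ _ (nbhs k) (nbhs_filter k)) => i.
  have FF := nbhs_filter k.
  have h1 : (fun g : M => g *m invmx n) @ k --> a by rewrite ea; exact: mulmxr_continuous.
  have h2 : (fun g : M => cj U (g *m invmx n)) @ k --> cj U a.
    apply: (@cvg_mulmx _ _ _ FF); last exact: cvg_cst.
    by apply: (@cvg_mulmx _ _ _ FF); [exact: cvg_cst|exact: h1].
  have h3 : (fun g : M => comp_blk (Pd C (w mu) (w mu i)) (cj U (g *m invmx n))) @ k -->
      comp_blk (Pd C (w mu) (w mu i)) (cj U a).
    apply: cvgD; last exact: cvg_cst.
    apply: (@cvg_mulmx _ _ _ FF); last exact: cvg_cst.
    by apply: (@cvg_mulmx _ _ _ FF); [exact: cvg_cst|exact: h2].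
  exact: (@near_unitmx _ _ _ FF _ _ _ (ma i) h3).
have [k' [s [p [mk Gk' Pp ep]]]] := near_k _ V.
have [g eg] : exists g, g = k' *m invmx n by eexists.
have Gg : G g by rewrite eg; apply: (G_mul gd Gk'); exact: (G_inv gd).
have ug := G_unit gd Gg.
have mg : minors (w mu) (cj U g) by rewrite eg; exact: mk.
have ucg : cj U g \in unitmx by rewrite (cj_unit g uU).
have [lL uB] := lu_exists ucg mg.
have [uL _] := lowu_inv lL.
have [l el] : exists l, l = invmx U *m lfac (w mu) (cj U g) *m U by eexists.
have cl : cj U l = lfac (w mu) (cj U g).
  by rewrite el /cj !mulmxA (mulmxV uU) mul1mx (mulmxK uU).
have ul : l \in unitmx by rewrite -(cj_unit l uU) cl.
have [b eb] : exists b, b = g *m invmx l by eexists.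
have bl : b *m l = g by rewrite eb (mulmxKV ul).
have ub : b \in unitmx by rewrite eb unitmx_mul ug unitmx_inv.
have hb : upper (w mu) (cj U b) by rewrite eb (cjM _ _ uU) (cj_inv uU ul) cl.
have Gl : Gc l.
  apply: (good_lu gd (cartan_gc gd hc hmu) (st_U st) (spectral_eq st hmu) ub hb).
    by rewrite cl.
  by rewrite bl; exact: (G_Gc gd).
have Pb : P b by split=> //; rewrite eb; apply: (Gc_mul gd (G_Gc gd Gg)); exact: (Gc_inv gd).
have [H1 eH1] : exists H1, H1 = cj n H0 by eexists.
have hH1 : h H1 by rewrite eH1; have [] := nn _ (st_H0 st).
(* The flow back by time [s], moved across [n]. *)
have [c ec] : exists c, c = mexp (toC (- s) *: ('i *: H1)) by eexists.
have Gcc : Gc c.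
  by rewrite ec; apply: (good_exp gd); do 2 apply: (good_scale gd); exact: (cartan_gc gd hc).
have cc : c *m mu = mu *m c.
  rewrite ec; apply/esym/mexp_comm.
  by rewrite -!scalemxAl -!scalemxAr (cartan_comm_mx st hmu hH1).
have ucc := Gc_unit gd Gcc.
have nc : n *m mexp (toC (- s) *: D) = c *m n.
  have e1 : toC (- s) *: ('i *: H1) = n *m (toC (- s) *: D) *m invmx n.
    by rewrite eH1 /cj /D -!scalemxAr -!scalemxAl.
  by rewrite ec e1 (mexp_conj _ un) (mulmxKV un).
exists (p *m b *m c), (invmx c *m l *m c), n; split; [| |exact: Gn|exact: nn|].
- apply: (Pgrp_mul st); [exact: (Pgrp_mul st Pp Pb)|exact: comm_P].
- by apply: (Zgrp_conj Gcc cc); split; [exact: Gl|rewrite cl].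
- have ex : x = p *m k' *m mexp (toC (- s) *: D).
    rewrite ep -mulmxA flow_add subrr rmorph0 scale0r mexp0 mulmx1.
    by [].
  have k'E : k' = g *m n by rewrite eg (mulmxKV un).
  rewrite ex k'E -bl -!mulmxA nc (mulKVmx ucc) !mulmxA.
  by [].
Qed.
End BruhatCover.

(** * Charts *)

Section MatrixDifferentiability.
Context {K : numFieldType} {V : normedModType K}.

Lemma differentiable_fcst (W : normedModType K) (a : W) (x : V) :
  differentiable (fun _ : V => a) x.
Proof. exact: differentiable_cst. Qed.
Lemma differentiable_fadd (W : normedModType K) (f g : V -> W) x :
  differentiable f x -> differentiable g x -> differentiable (fun y => f y + g y) x.
Proof. exact: differentiableD. Qed.
Lemma differentiable_fmul (f g : V -> K) x :
  differentiable f x -> differentiable g x -> differentiable (fun y => f y * g y) x.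
Proof. exact: differentiableM. Qed.

Lemma differentiable_bigsum (W : normedModType K) (I : Type) (r : seq I) (P : pred I)
    (f : I -> V -> W) x : (forall i, P i -> differentiable (f i) x) ->
  differentiable (fun y => \sum_(i <- r | P i) f i y) x.
Proof.
move=> df; elim: r => [|i r IH].
  have -> : (fun y => \sum_(i <- [::] | P i) f i y) = fun=> 0 by apply/funext => y; rewrite big_nil.
  exact: differentiable_fcst.
case Pi: (P i); last first.
  have -> : (fun y => \sum_(j <- i :: r | P j) f j y) = fun y => \sum_(j <- r | P j) f j y.
    by apply/funext => y; rewrite big_cons Pi.
  exact: IH.
have -> : (fun y => \sum_(j <- i :: r | P j) f j y) = fun y => f i y + \sum_(j <- r | P j) f j y.
  by apply/funext => y; rewrite big_cons Pi.
by apply: differentiable_fadd; [exact: df|exact: IH].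
Qed.

Lemma differentiable_bigprod (I : Type) (r : seq I) (P : pred I)
    (f : I -> V -> K) x : (forall i, P i -> differentiable (f i) x) ->
  differentiable (fun y => \prod_(i <- r | P i) f i y) x.
Proof.
move=> df; elim: r => [|i r IH].
  have -> : (fun y => \prod_(i <- [::] | P i) f i y) = fun=> 1 by apply/funext => y; rewrite big_nil.
  exact: differentiable_fcst.
case Pi: (P i); last first.
  have -> : (fun y => \prod_(j <- i :: r | P j) f j y) = fun y => \prod_(j <- r | P j) f j y.
    by apply/funext => y; rewrite big_cons Pi.
  exact: IH.
have -> : (fun y => \prod_(j <- i :: r | P j) f j y) = fun y => f i y * \prod_(j <- r | P j) f j y.
  by apply/funext => y; rewrite big_cons Pi.
by apply: differentiable_fmul; [exact: df|exact: IH].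
Qed.

Definition mx_differentiable m n (f : V -> 'M[K]_(m, n)) (x : V) :=
  forall i j, differentiable (fun y => f y i j) x.
Local Notation dfm := mx_differentiable.

Lemma dfm_cst m n (A : 'M[K]_(m, n)) x : dfm (fun=> A) x.
Proof. by move=> i j; exact: differentiable_fcst. Qed.

Lemma dfm_add m n (f g : V -> 'M[K]_(m, n)) x : dfm f x -> dfm g x -> dfm (fun y => f y + g y) x.
Proof.
move=> df dg i j.
have -> : (fun y => (f y + g y) i j) = fun y => f y i j + g y i j.
  by apply/funext => y; rewrite mxE.
exact: differentiable_fadd.
Qed.

Lemma dfm_scale m n (s : V -> K) (f : V -> 'M[K]_(m, n)) x :
  differentiable s x -> dfm f x -> dfm (fun y => s y *: f y) x.
Proof.
move=> ds df i j.
have -> : (fun y => (s y *: f y) i j) = fun y => s y * f y i j.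
  by apply/funext => y; rewrite mxE.
exact: differentiable_fmul.
Qed.

Lemma dfm_sum m n (I : Type) (r : seq I) (P : pred I) (f : I -> V -> 'M[K]_(m, n)) x :
  (forall i, P i -> dfm (f i) x) -> dfm (fun y => \sum_(i <- r | P i) f i y) x.
Proof.
move=> df i j.
have -> : (fun y => (\sum_(l <- r | P l) f l y) i j) = fun y => \sum_(l <- r | P l) f l y i j.
  by apply/funext => y; rewrite summxE.
by apply: differentiable_bigsum => l Pl; exact: df.
Qed.

Lemma dfm_mulmx m n p (f : V -> 'M[K]_(m, n)) (g : V -> 'M[K]_(n, p)) x :
  dfm f x -> dfm g x -> dfm (fun y => f y *m g y) x.
Proof.
move=> df dg i j.
have -> : (fun y => (f y *m g y) i j) = fun y => \sum_k (f y i k * g y k j).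
  by apply/funext => y; rewrite mxE.
by apply: differentiable_bigsum => k _; apply: differentiable_fmul; [exact: df|exact: dg].
Qed.

Lemma dfm_expr n (f : V -> 'M[K]_n) x k : dfm f x -> dfm (fun y => f y ^+ k) x.
Proof.
move=> df; elim: k => [|k IH].
  have -> : (fun y => f y ^+ 0) = fun=> 1%:M by apply/funext => y; rewrite expr0.
  exact: dfm_cst.
have -> : (fun y => f y ^+ k.+1) = fun y => f y *m f y ^+ k by apply/funext => y; rewrite exprS.
exact: dfm_mulmx.
Qed.

Lemma differentiable_trace n (f : V -> 'M[K]_n) x : dfm f x ->
  differentiable (fun y => \tr (f y)) x.
Proof. by move=> df; apply: differentiable_bigsum => i _; exact: df. Qed.

Lemma differentiable_det n (f : V -> 'M[K]_n) x : dfm f x ->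
  differentiable (fun y => \det (f y)) x.
Proof.
move=> df; apply: differentiable_bigsum => s _.
apply: differentiable_fmul; first exact: differentiable_fcst.
by apply: differentiable_bigprod => i _; exact: df.
Qed.

(* Unlike invmx, which tests invertibility, this is visibly a rational function
   of the entries. *)
Definition adj_inv n (A : 'M[K]_n) := (\det A)^-1 *: \adj A.

Lemma adj_invE n (A : 'M[K]_n) : A \in unitmx -> adj_inv A = invmx A.
Proof. by rewrite /invmx => ->. Qed.

Lemma dfm_adj n (f : V -> 'M[K]_n) x : dfm f x -> dfm (fun y => \adj (f y)) x.
Proof.
move=> df i j.
have -> : (fun y => (\adj (f y)) i j) =
    fun y => (-1) ^+ (j + i) * \det (row' j (col' i (f y))).
  by apply/funext => y; rewrite mxE.
apply: differentiable_fmul; first exact: differentiable_fcst.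
apply: differentiable_det => k l.
have -> : (fun y => row' j (col' i (f y)) k l) = fun y => f y (lift j k) (lift i l).
  by apply/funext => y; rewrite !mxE.
exact: df.
Qed.

Lemma dfm_inv n (f : V -> 'M[K]_n) x : f x \in unitmx -> dfm f x ->
  dfm (fun y => adj_inv (f y)) x.
Proof.
move=> ux df; apply: dfm_scale; last exact: dfm_adj.
apply: differentiableV; first exact: differentiable_det.
by rewrite -unitfE -unitmxE.
Qed.

Lemma dfm_rV n (f : V -> 'rV[K]_n) x : dfm f x -> differentiable f x.
Proof.
move=> df; have -> : f = fun y => \sum_j f y 0 j *: delta_mx 0 j.
  by apply/funext => y; rewrite [LHS]row_sum_delta.
by apply: differentiable_bigsum => j _; apply: differentiableZl; exact: df.
Qed.

Lemma dfm_cvg m n (f : V -> 'M[K]_(m, n)) x : dfm f x -> f y @[y --> x] --> f x.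
Proof.
move=> df; apply: (@cvg_mx _ _ (nbhs x) (nbhs_filter x)) => i j.
exact: (differentiable_continuous (df i j)).
Qed.
End MatrixDifferentiability.

(** * Filtration by eigenvalue gaps *)

Section Levels.
Variables (R : realType) (C : numClosedFieldType) (N : nat) (d : 'I_N -> R).
Local Notation M := 'M[C]_N.
Implicit Types (A B : M) (s t : R).

(** A quantitative form of triangularity: levels add under multiplication, so commutators can be
    measured and not only shown to be strictly lower. *)
Definition level t A := forall i j, d j - d i < t -> A i j = 0.

Lemma level_mul s t A B : level s A -> level t B -> level (s + t) (A *m B).
Proof.
move=> lA lB i j ij; rewrite mxE big1 // => k _.
have [h|h] := ltP (d k - d i) s; first by rewrite lA ?mul0r.
by rewrite lB ?mulr0 //; lra.
Qed.
Lemma level_add t A B : level t A -> level t B -> level t (A + B).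
Proof. by move=> lA lB i j ij; rewrite mxE lA // lB // addr0. Qed.
Lemma level_opp t A : level t A -> level t (- A).
Proof. by move=> lA i j ij; rewrite mxE lA // oppr0. Qed.
Lemma level_le s t A : s <= t -> level t A -> level s A.
Proof. by move=> st lA i j ij; apply: lA; exact: lt_le_trans ij st. Qed.

Lemma lowu_level l : lowu d l -> level 0 l.
Proof.
move=> hl i j ij; have ji : d j <= d i by rewrite -subr_le0 ltW.
have := hl i j ji; rewrite !mxE; case: eqP ij => [->|_ _]; first by rewrite subrr ltxx.
by rewrite subr0.
Qed.

Lemma level_gap : exists2 dl : R, 0 < dl & forall A, slower d A -> level dl A.
Proof.
pose Q := [pred p : 'I_N * 'I_N | d p.1 < d p.2].
have [p0 Qp0|Q0] := pickP Q; last first.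
  exists 1 => // A sA i j _; apply: sA; rewrite leNgt.
  by have := Q0 (i, j) => /= ->.
have [p Qp pmin] := arg_minP (fun p : 'I_N * 'I_N => d p.2 - d p.1) Qp0.
exists (d p.2 - d p.1); first by rewrite subr_gt0.
move=> A sA i j ij; apply: sA; rewrite leNgt; apply/negP => lt.
by have := pmin (i, j) lt; rewrite leNgt ij.
Qed.

Lemma level_big dl : 0 < dl -> exists c : nat, forall A, level (dl *+ c) A -> A = 0.
Proof.
move=> dl0; pose B := \sum_i \sum_j `|d j - d i|.
have B0 : 0 <= B / dl.
  by apply: divr_ge0 (ltW dl0); apply: sumr_ge0 => i _; apply: sumr_ge0.
exists (Num.bound (B / dl)) => A lA; apply/matrixP => i j; rewrite [RHS]mxE; apply: lA.
apply: le_lt_trans (_ : B < _); last first.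
  by rewrite -mulr_natl -ltr_pdivrMr //; exact: archi_boundP.
apply: le_trans (ler_norm _) _.
rewrite /B (bigD1 i) //= (bigD1 j) //= -addrA lerDl addr_ge0 //.
  by apply: sumr_ge0.
by apply: sumr_ge0 => k _; apply: sumr_ge0.
Qed.

(** A group commutator minus 1 is the matrix commutator of x - 1 and z - 1, followed by factors of
    level 0. *)
Lemma level_comm t dl x z x' z' : x *m x' = 1%:M -> z *m z' = 1%:M ->
  level t (x - 1%:M) -> level dl (z - 1%:M) -> level 0 x' -> level 0 z' ->
  level (t + dl) (x *m z *m x' *m z' - 1%:M).
Proof.
move=> xx zz lx lz lx' lz'.
have -> : x *m z *m x' *m z' - 1%:M =
    ((x - 1%:M) *m (z - 1%:M) - (z - 1%:M) *m (x - 1%:M)) *m x' *m z'.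
  have -> : (x - 1%:M) *m (z - 1%:M) - (z - 1%:M) *m (x - 1%:M) = x *m z - z *m x.
    rewrite !mulmxBl !mulmxBr !mulmx1 !mul1mx.
    by move: (x *m z) (z *m x) => a b; apply/matrixP => i j; rewrite !mxE; ring.
  by rewrite !mulmxBl -(mulmxA z x) xx mulmx1 zz.
have -> : t + dl = (t + dl) + 0 + 0 by rewrite !addr0.
apply: level_mul lz'; apply: level_mul lx'; apply: level_add; first exact: level_mul.
by apply: level_opp; rewrite addrC; exact: level_mul.
Qed.
End Levels.

(** * Coordinates on Z and the inverse of a chart *)

Section ChartCoordinates.
Context {R : realType} {N : nat}.
Local Notation C := (cplx R).
Local Notation M := 'M[C]_N.
Variables (G Gc gc h : set M) (m : nat) (al X Y : 'I_m -> M) (H0 U : M) (w : M -> 'I_N -> R).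
Hypothesis st : setting G Gc gc h al X Y H0 U w.
Hypothesis ss : semisimple (lie G).
Variable mu : M.
Hypothesis hmu : h mu.
Hypothesis pos : forall k, 0 <= trform mu (al k).
Implicit Types (A B E a b nu g p : M).
Let gd := st_good st.
Let hc := st_cartan st.
Let uU := st_unit st.
Local Notation P := (Pgrp Gc U w mu).
Local Notation Z := (Zgrp Gc U w mu).
Local Notation D := [set k : 'I_m | trform mu (al k) != 0]%SET.
Local Notation d := (w mu).
Local Notation ez := (@expZ R N m Y D).

Let lin (z : 'rV[C]_#|D|) : M := \sum_(j < #|D|) z ord0 j *: Y (enum_val j).

Lemma lin_slower z : slower d (cj U (lin z)).
Proof.
rewrite /cj mulmx_sumr mulmx_suml; apply: slower_sum => j _.
rewrite -scalemxAr -scalemxAl; apply: slowerZ.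
apply: (weight_slower st hmu (Y_weight st (enum_val j) hmu)).
have := enum_valP j; rewrite inE => ne.
by rewrite oppr_lt0 lt_def trformC ne pos.
Qed.

Lemma lin_nilp z : lin z ^+ N.+1 = 0.
Proof. exact: (cj_slower_nilp uU (@lin_slower z)). Qed.

Lemma exp_lowu A : slower d (cj U A) -> lowu d (cj U (mexp A)).
Proof.
move=> sA; have nA := cj_slower_nilp uU sA.
rewrite (mexp_nilp nA) /mpart big_ord_recl /= fact0 invr1 scale1r expr0.
set T := \sum_(i < N) _.
have -> : cj U (1 + T) = 1%:M + cj U T.
  by rewrite -[1]/(1%:M : M) /cj mulmxDr mulmxDl mulmx1 (mulmxV uU).
rewrite /lowu addrC addKr /T /cj mulmx_sumr mulmx_suml; apply: slower_sum => k _.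
rewrite -scalemxAr -scalemxAl; apply: slowerZ.
rewrite -/(cj U _) -(cj_expr _ _ uU) /bump leq0n add1n; exact: slower_expr.
Qed.

Lemma expZ_Z z : Z (ez z).
Proof.
split; last exact: exp_lowu (@lin_slower z).
apply: (good_exp gd); apply: (gc_sum gd) => j _; apply: (good_scale gd); exact: (Y_gc st).
Qed.

Definition log_coord A : 'rV[C]_#|D| := \row_j yc Y (mlog A) (enum_val j).

Lemma expZK z : log_coord (ez z) = z.
Proof.
apply/rowP => j; rewrite mxE (mlog_mexp (@lin_nilp z)) /yc ip_suml (bigD1 j) //=.
rewrite big1 => [|i ij]; last first.
  by rewrite ipZl (YY_orth st) ?mulr0 //; apply: contra_neq ij; exact: enum_val_inj.
by rewrite addr0 ipZl mulfK // ip_neq0 // (Y_neq0 st).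
Qed.

Lemma log_coordK l : Z l -> ez (log_coord l) = l.
Proof.
move=> [Gl hl]; have [S [gS sS eS Sl]] := lowu_log st Gl hl.
rewrite -[RHS]eS /expZ; congr mexp; rewrite [RHS](lower_span st hmu pos gS sS).
rewrite (eq_bigl (fun k => k \in D)) => [|k]; last by rewrite inE.
by rewrite [RHS]big_enum_val; apply: eq_bigr => j _; rewrite mxE -Sl.
Qed.

Lemma groupZ_E : groupZ Y D = Z.
Proof.
apply/seteqP; split=> [_ [z _ <-]|l Zl]; first exact: expZ_Z.
by exists (log_coord l) => //; exact: log_coordK.
Qed.

(** The factor [lfac] with [adj_inv] for [invmx], so that its entries are rational functions that
    can be differentiated; the two agree where the minors are invertible. *)
Definition lfac_rat g : M :=
  \matrix_(i, j) (adj_inv (comp_blk (Pd C d (d i)) g) *m Pd C d (d i) *m g) i j.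

Lemma lfac_ratE g : minors d g -> lfac_rat g = lfac d g.
Proof. by move=> mg; apply/matrixP => i j; rewrite !mxE adj_invE //; exact: mg. Qed.

Definition chart_inv g : 'rV[C]_#|D| := log_coord (invmx U *m lfac_rat (cj U g) *m U).

Lemma chart_inv_exp p z : P p ->
  minors d (cj U (p *m ez z)) /\ chart_inv (p *m ez z) = z.
Proof.
move=> [Gp up]; have ucp : cj U p \in unitmx by rewrite (cj_unit p uU); exact: (Gc_unit gd).
have [_ lz] := expZ_Z z.
have [m1 e1] := lu_unique ucp up lz; rewrite -(cjM _ _ uU) in m1 e1.
split; first exact: m1.
by rewrite /chart_inv lfac_ratE // e1 (cjK _ uU) expZK.
Qed.

Lemma chart_inv_surj g : Gc g -> minors d (cj U g) ->
  exists2 p, P p & g = p *m ez (chart_inv g).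
Proof.
move=> Gg mg; have ug := Gc_unit gd Gg.
have ucg : cj U g \in unitmx by rewrite (cj_unit g uU).
have [lL uB] := lu_exists ucg mg; have [uL _] := lowu_inv lL.
rewrite /chart_inv lfac_ratE //.
have [l el] : exists l, l = invmx U *m lfac d (cj U g) *m U by eexists.
have cl : cj U l = lfac d (cj U g).
  by rewrite el /cj !mulmxA (mulmxV uU) mul1mx (mulmxK uU).
have ul : l \in unitmx by rewrite -(cj_unit l uU) cl.
have [b eb] : exists b, b = g *m invmx l by eexists.
have bl : b *m l = g by rewrite eb (mulmxKV ul).
have ub : b \in unitmx by rewrite eb unitmx_mul ug unitmx_inv.
have hb : upper d (cj U b) by rewrite eb (cjM _ _ uU) (cj_inv uU ul) cl.
have Gl : Gc l.
  apply: (good_lu gd (cartan_gc gd hc hmu) (st_U st) (spectral_eq st hmu) ub hb).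
    by rewrite cl.
  by rewrite bl.
have Zl : Z l by split; [exact: Gl|rewrite cl].
exists b; first by split; [rewrite eb; apply: (Gc_mul gd Gg); exact: (Gc_inv gd)|exact: hb].
by rewrite -el (log_coordK Zl) bl.
Qed.

Section Smooth.
Context {V : normedModType C}.
Implicit Types (f : V -> M) (v : V).

Lemma dfm_mlog f v : mx_differentiable f v -> mx_differentiable (fun y => mlog (f y)) v.
Proof.
move=> df; apply: dfm_sum => k _; apply: dfm_scale; first exact: differentiable_fcst.
by apply: dfm_expr; apply: dfm_add => //; exact: dfm_cst.
Qed.

(** The source [V] is left general: matrices give continuity of the inverse chart, coordinate
    vectors give holomorphy of the coordinate changes. *)
Lemma dfm_chart_inv f v : mx_differentiable f v -> minors d (cj U (f v)) ->
  mx_differentiable (fun y => chart_inv (f y)) v.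
Proof.
move=> df mf.
have dl (A B : M) (g : V -> M) : mx_differentiable g v -> mx_differentiable (fun y => A *m g y *m B) v.
  by move=> dg; apply: dfm_mulmx; [apply: dfm_mulmx; [exact: dfm_cst|exact: dg]|exact: dfm_cst].
have dc : mx_differentiable (fun y => cj U (f y)) v by exact: dl.
have dr : mx_differentiable (fun y => lfac_rat (cj U (f y))) v.
  move=> i j; have -> : (fun y => lfac_rat (cj U (f y)) i j) = fun y =>
      (adj_inv (comp_blk (Pd C d (d i)) (cj U (f y))) *m Pd C d (d i) *m cj U (f y)) i j.
    by apply/funext => y; rewrite mxE.
  suff dh : mx_differentiable (fun y => adj_inv (comp_blk (Pd C d (d i)) (cj U (f y))) *m Pd C d (d i) *m cj U (f y)) v by exact: dh.
  apply: dfm_mulmx; last exact: dc.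
  apply: dfm_mulmx; last exact: dfm_cst.
  apply: dfm_inv; first exact: mf.
  by apply: dfm_add; [exact: dl|exact: dfm_cst].
have dm := dfm_mlog (dl (invmx U) U _ dr).
move=> i j; have -> : (fun y => chart_inv (f y) i j) = fun y =>
    \tr (mlog (invmx U *m lfac_rat (cj U (f y)) *m U) *m (Y (enum_val j))^t*) *
    (ip (Y (enum_val j)) (Y (enum_val j)))^-1.
  by apply/funext => y; rewrite mxE.
apply: differentiable_fmul; last exact: differentiable_fcst.
by apply: differentiable_trace; apply: dfm_mulmx; [exact: dm|exact: dfm_cst].
Qed.
End Smooth.

(** By nilpotency the exponential is a polynomial in the coordinates, of a degree bounded uniformly
    in [z]. *)
Lemma dfm_expZ z : mx_differentiable (ez) z.
Proof.
have -> : ez = fun z => \sum_(k < N.+1) (k`!%:R^-1 : C) *: (lin z) ^+ k.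
  by apply/funext => y; exact: (mexp_nilp (@lin_nilp y)).
apply: dfm_sum => k _; apply: dfm_scale; first exact: differentiable_fcst.
apply: dfm_expr; apply: dfm_sum => j _; apply: dfm_scale; last exact: dfm_cst.
exact: differentiable_coord.
Qed.
End ChartCoordinates.

(** * Nilpotency of Z and the charts of the orbit *)

Section OrbitCharts.
Context {R : realType} {N : nat}.
Local Notation C := (cplx R).
Local Notation M := 'M[C]_N.
Variables (G Gc gc h : set M) (m : nat) (al X Y : 'I_m -> M) (H0 U : M) (w : M -> 'I_N -> R).
Hypothesis st : setting G Gc gc h al X Y H0 U w.
Hypothesis ss : semisimple (lie G).
Variable mu : M.
Hypothesis hmu : h mu.
Hypothesis pos : forall k, 0 <= trform mu (al k).
Implicit Types (A B E a b nu g p r s : M).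
Let gd := st_good st.
Let hc := st_cartan st.
Let uU := st_unit st.
Local Notation P := (Pgrp Gc U w mu).
Local Notation Z := (Zgrp Gc U w mu).
Local Notation D := [set k : 'I_m | trform mu (al k) != 0]%SET.
Local Notation d := (w mu).
Local Notation ez := (@expZ R N m Y D).

(* Commutators raise the level by the smallest gap between eigenvalues. *)
Let Lk (t : R) : set M := [set z | lowu d (cj U z) /\ level d t (cj U z - 1%:M)].

Lemma level_group (t : R) : 0 <= t -> is_subgroup (Lk t).
Proof.
move=> t0; split.
- by move=> a [la _]; rewrite -(cj_unit a uU); have [] := lowu_inv la.
- split; first by rewrite (cj1 uU); exact: lowu1.
  by rewrite (cj1 uU) subrr => i j _; rewrite mxE.
- move=> a b [la ta] [lb tb]; rewrite /Lk /= (cjM _ _ uU); split; first exact: lowu_mul.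
  have -> : cj U a *m cj U b - 1%:M =
     (cj U a - 1%:M) *m (cj U b - 1%:M) + (cj U a - 1%:M) + (cj U b - 1%:M).
    rewrite mulmxBl !mulmxBr mulmx1 !mul1mx.
    by move: (cj U a *m cj U b) => q; apply/matrixP => i j; rewrite !mxE; ring.
  apply: (level_add _ tb); apply: (level_add _ ta); apply: (level_le _ (level_mul ta tb)).
  by rewrite lerDl.
- move=> a [la ta]; have [ua li] := lowu_inv la.
  have ua' : a \in unitmx by rewrite -(cj_unit a uU).
  rewrite /Lk /= (cj_inv uU ua'); split; first exact: li.
  have -> : invmx (cj U a) - 1%:M = - ((cj U a - 1%:M) *m invmx (cj U a)).
    by rewrite mulmxBl mul1mx (mulmxV ua) opprB.
  apply: level_opp; rewrite -[t]addr0; exact: level_mul ta (lowu_level li).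
Qed.

Lemma Z_group : is_subgroup Z.
Proof.
split.
- by move=> a [Ga _]; exact: (Gc_unit gd).
- by split; [exact: (Gc_one gd)|rewrite (cj1 uU); exact: lowu1].
- move=> a b [Ga la] [Gb lb]; split; first exact: (Gc_mul gd).
  by rewrite (cjM _ _ uU); exact: lowu_mul.
- move=> a [Ga la]; have ua := Gc_unit gd Ga; split; first exact: (Gc_inv gd).
  by rewrite (cj_inv uU ua); have [] := lowu_inv la.
Qed.

(** The term of index [k] in the lower central series lies in level (k + 1) [dl], where [dl] is a
    positive lower bound for the gaps; beyond the total spread of eigenvalues only the identity is
    left. *)
Lemma Z_nilpotent : nilpotent_subgroup (complexification G) (groupZ Y D).
Proof.
rewrite (groupZ_E st hmu pos) (complexificationE st ss).
split; [exact: Z_group|by move=> z []|].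
have [dl dl0 gap] := level_gap C d.
have sub k : lower_central Z k `<=` Lk (dl *+ k.+1).
  elim: k => [|k IH]; first by move=> z [_ lz]; split; [exact: lz|apply: gap; exact: lz].
  have t0 : 0 <= dl *+ k.+2 by rewrite mulrn_wge0 ?ltW.
  move=> y; apply; split; first exact: level_group.
  move=> _ [x /IH [lx tx] [z [_ lz] <-]].
  have [ux lix] := lowu_inv lx; have [uz liz] := lowu_inv lz.
  have ux' : x \in unitmx by rewrite -(cj_unit x uU).
  have uz' : z \in unitmx by rewrite -(cj_unit z uU).
  have e : cj U (x *m z *m invmx x *m invmx z) =
      cj U x *m cj U z *m invmx (cj U x) *m invmx (cj U z).
    by rewrite !(cjM _ _ uU) (cj_inv uU ux') (cj_inv uU uz').
  rewrite /Lk /= e; split; first exact: (lowu_mul (lowu_mul (lowu_mul lx lz) lix) liz).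
  rewrite mulrSr; apply: level_comm (mulmxV ux) (mulmxV uz) tx _ (lowu_level lix) (lowu_level liz).
  exact: gap.
have [c big] := level_big C d dl0; exists c; apply/seteqP; split=> z.
  move=> /sub [_ tz]; apply: (cj_inj uU); apply/eqP; rewrite (cj1 uU) -subr_eq0; apply/eqP.
  by apply: big; apply: level_le tz; rewrite mulrSr lerDl ltW.
move=> ->; case: c {big} => [|c]; first by have [] := Z_group.
by move=> A [[_ A1 _ _] _].
Qed.

Variable psi : M -> M.
Hypothesis psi_mul : forall p g, P p -> Gc g -> psi (p *m g) = psi g.
Hypothesis psi_G : forall k, G k -> psi k = invmx k *m mu *m k.
Hypothesis psi_cvg : forall g, Gc g -> psi x @[x --> g] --> psi g.

Lemma ez_Gc z r : G r -> Gc (ez z *m r).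
Proof. by move=> Gr; apply: (Gc_mul gd _ (G_Gc gd Gr)); have [] := expZ_Z st hmu pos z. Qed.

(** Equal images mean equal cosets of P, and [chart_inv] does not see a left factor from P. With
    [r = s] this gives injectivity. *)
Lemma chart_overlap z z' r s : G r -> G s -> psi (ez z *m r) = psi (ez z' *m s) ->
  minors d (cj U (ez z *m r *m invmx s)) /\ chart_inv al Y U w mu (ez z *m r *m invmx s) = z'.
Proof.
move=> Gr Gs e; have us := G_unit gd Gs.
have [p Pp ->] := psi_eq st ss hmu pos psi_mul psi_G (ez_Gc z Gr) (ez_Gc z' Gs) e.
by rewrite mulmxA (mulmxK us); exact: (chart_inv_exp st hmu pos).
Qed.

Lemma minors_near (F : set_system M) {FF : Filter F} (f : M -> M) A :
  f x @[x --> F] --> A -> minors d A -> \forall x \near F, minors d (f x).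
Proof.
move=> fA mA; apply: filter_forall => i.
have h3 : comp_blk (Pd C d (d i)) (f x) @[x --> F] --> comp_blk (Pd C d (d i)) A.
  apply: cvgD; last exact: cvg_cst.
  apply: (@cvg_mulmx _ _ _ FF); last exact: cvg_cst.
  by apply: (@cvg_mulmx _ _ _ FF); [exact: cvg_cst|exact: fA].
exact: (@near_unitmx _ _ _ FF _ _ _ (mA i) h3).
Qed.

Lemma chart_local r : G r -> local_chart (conj_orbit G mu) (fun z => psi (ez z *m r)).
Proof.
move=> Gr; have ur := G_unit gd Gr; split.
- move=> z z' e; have [_ <-] := chart_overlap Gr Gr e.
  rewrite (mulmxK ur) -[ez z]mul1mx.
  by have [_ ->] := chart_inv_exp st hmu pos z (Pgrp_one st mu).
- move=> z; have FF := nbhs_filter z.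
  have h1 : (fun y => ez y) @ z --> ez z by apply: dfm_cvg; exact: (dfm_expZ st hmu pos).
  have h2 : (fun y => ez y *m r) @ z --> ez z *m r.
    by apply: (@cvg_mulmx _ _ _ FF); [exact: h1|exact: cvg_cst].
  exact: (cvg_comp _ _ h2 (psi_cvg (ez_Gc z Gr))).
- move=> V oV; apply/(psi_open st ss hmu pos psi_mul psi_G psi_cvg).
    by move=> _ [z _ <-]; apply: (psi_orbit st ss hmu pos psi_mul psi_G); exact: ez_Gc.
  (* By [psi_open] it is enough to work upstairs: the preimage of the image of [V] consists of the
     elements whose translate by the inverse of [r] has an LU factorization with coordinates in
     [V]. *)
  pose W : set M := [set g | minors d (cj U (g *m invmx r)) /\ V (chart_inv al Y U w mu (g *m invmx r))].
  have nW g : W g -> nbhs g W.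
    move=> [mg Vg]; have FF := nbhs_filter g.
    have dg : mx_differentiable (fun y : M => y *m invmx r) g.
      by apply: dfm_mulmx; [move=> i j; exact: differentiable_coord|exact: dfm_cst].
    have c1 : (fun y : M => cj U (y *m invmx r)) @ g --> cj U (g *m invmx r).
      by apply: dfm_cvg; apply: dfm_mulmx; [apply: dfm_mulmx; [exact: dfm_cst|exact: dg]|exact: dfm_cst].
    have c2 : (fun y : M => chart_inv al Y U w mu (y *m invmx r)) @ g -->
        chart_inv al Y U w mu (g *m invmx r).
      by apply: dfm_cvg; apply: dfm_chart_inv; [exact: dg|exact: mg].
    by apply: filterI; [exact: (minors_near c1 mg)|exact: (c2 V (open_nbhs_nbhs (conj oV Vg)))].
  exists W^°; first exact: open_interior.
  apply/seteqP; split=> g [Gg].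
    move=> [z Vz e]; split; first exact: Gg.
    apply: nW; have [p Pp ->] := psi_eq st ss hmu pos psi_mul psi_G Gg (ez_Gc z Gr) (esym e).
    rewrite /W /= mulmxA (mulmxK ur).
    by have [mz ->] := chart_inv_exp st hmu pos z Pp.
  move=> /interior_subset [mg Vg]; split; first exact: Gg.
  have Gx : Gc (g *m invmx r) by apply: (Gc_mul gd Gg); apply: (G_Gc gd); exact: (G_inv gd).
  have [p Pp e] := chart_inv_surj st hmu pos Gx mg.
  exists (chart_inv al Y U w mu (g *m invmx r)); first exact: Vg.
  rewrite -(psi_mul Pp (ez_Gc _ Gr)) mulmxA -e.
  by rewrite (mulmxKV ur).
Qed.

Lemma chart_compatible r s : G r -> G s ->
  compatible_charts (fun z => psi (ez z *m r)) (fun z => psi (ez z *m s)).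
Proof.
move=> Gr Gs; exists (fun z => chart_inv al Y U w mu (ez z *m r *m invmx s)) => z [z' _ e].
have [mz ez'] := chart_overlap Gr Gs (esym e); split; first by rewrite ez'.
apply: dfm_rV; apply: dfm_chart_inv => //.
apply: dfm_mulmx; last exact: dfm_cst.
by apply: dfm_mulmx; [exact: (dfm_expZ st hmu pos)|exact: dfm_cst].
Qed.
End OrbitCharts.

Section MainTheorem.
Context {R : realType} {N : nat}.
Local Notation C := (cplx R).
Local Notation M := 'M[C]_N.
Variables (G Gc gc h : set M) (m : nat) (al X Y : 'I_m -> M) (H0 U : M) (w : M -> 'I_N -> R).
Hypothesis st : setting G Gc gc h al X Y H0 U w.
Hypothesis ss : semisimple (lie G).
Let gd := st_good st.
Let hc := st_cartan st.

Lemma orbit_chartsP mu (I : set (set M)) (rep : set M -> M) : h mu ->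
  (forall k, 0 <= trform mu (al k)) ->
  (forall W, I W -> G (rep W)) ->
  (forall n, G n -> normalizes h n ->
    exists2 W, I W & exists2 k, stabilizer G mu k & n = k *m rep W) ->
  orbit_charts G X Y (stabilizer G mu) [set k : 'I_m | trform mu (al k) != 0]%SET I rep mu.
Proof.
move=> hmu pos Grep hrep; split; first exact: (Z_nilpotent st ss hmu pos).
have [psi [psi_mul psi_G psi_cvg]] := orbit_map_exists st hmu.
exists psi; first exact: (coset_identificationP st ss hmu pos psi_mul psi_G psi_cvg).
split.
- rewrite (groupZ_E st hmu pos); apply/seteqP; split=> y; last first.
    move=> [W IW [z [Gz _] <-]]; apply: (psi_orbit st ss hmu pos psi_mul psi_G).
    by apply: (Gc_mul gd Gz); apply: (G_Gc gd); exact: Grep.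
  move=> [k Gk <-]; rewrite -psi_G //.
  have [p [z [n [Pp Zz Gn nn ->]]]] := bruhat_cover st ss hmu pos (G_Gc gd Gk).
  have [W IW [a Ka ->]] := hrep n Gn nn.
  have [Ga ca] := (stabilizerP st mu a).1 Ka; have ua := G_unit gd Ga.
  have Zz' := Zgrp_conj st hmu (G_Gc gd Ga) ca Zz.
  exists W => //; exists (invmx a *m z *m a); first exact: Zz'.
  have Gr := G_Gc gd (Grep _ IW).
  have Gzr : Gc (invmx a *m z *m a *m rep W) by apply: (Gc_mul gd _ Gr); have [] := Zz'.
  have Pa : Pgrp Gc U w mu (p *m a) by apply: (Pgrp_mul st Pp); exact: (stabilizer_P st hmu).
  (* The stabilizer factor [a] of [n] moves to the left through Z, which it normalizes, and is
     absorbed into P. *)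
  rewrite -(psi_mul _ _ Pa Gzr); congr psi.
  by rewrite -!mulmxA (mulKVmx ua).
- by move=> W IW; apply: (chart_local st ss hmu pos psi_mul psi_G psi_cvg); exact: Grep.
- move=> W W' IW IW'.
  by apply: (chart_compatible st ss hmu pos psi_mul psi_G); exact: Grep.
Qed.

(** Adding a small positive multiple of [H0], on which all positive roots are positive, moves [mu]
    into the open chamber. *)
Lemma chamber_dense mu : h mu -> (forall k, 0 <= trform mu (al k)) -> closure (chamber h al) mu.
Proof.
move=> hmu pos V nV.
have l1 : (fun t : R => mu + toC t *: H0) @ (0 : R) --> mu + toC 0 *: H0.
  apply: cvgD; first exact: cvg_cst.
  by apply: cvgZ; [exact: toC_continuous|exact: cvg_cst].
rewrite rmorph0 scale0r addr0 in l1.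
have [n _ hn] := cvg_along l1 nV.
exists (mu + toC (@harmonic R n) *: H0); split; last exact: (hn n (leqnn n)).
split=> [|k]; first by apply: (cartan_add hc hmu); exact: (cartan_scale hc) (st_H0 st).
rewrite trformDl trformZl ltr_wpDl // mulr_gt0 ?harmonic_gt0 // trformC.
by have [] := al_root st k.
Qed.
End MainTheorem.

Theorem proposition3 (R : realType) (N : nat) (G : set 'M[cplx R]_N)
    (G_classical : classical_group G) (G_semisimple : semisimple (lie G))
    (h : set 'M[cplx R]_N) (h_cartan : cartan (lie G) h)
    (m : nat) (al : 'I_m -> 'M[cplx R]_N)
    (al_positive : positive_roots (lie G) h al)
    (X Y : 'I_m -> 'M[cplx R]_N)
    (XY_root : root_vectors (lie G) h al X Y)
    (rep : set 'M[cplx R]_N -> 'M[cplx R]_N)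
    (rep_weyl : forall w, weyl G (torus h) w -> w (rep w))
    (O : set 'M[cplx R]_N) (O_orbit : coadjoint_orbit G O) :
  (exists2 mu0 : 'M[cplx R]_N, closure (chamber h al) mu0
    & O = conj_orbit G mu0) /\
  forall mu0 : 'M[cplx R]_N, closure (chamber h al) mu0 ->
    O = conj_orbit G mu0 ->
    (chamber h al mu0 ->
      orbit_charts G X Y (torus h) [set: 'I_m]%SET
        (weyl G (torus h)) rep mu0) /\
    (forall I : set (set 'M[cplx R]_N),
      weyl_transversal (stabilizer G mu0) G (torus h) I ->
      orbit_charts G X Y (stabilizer G mu0)
        [set k : 'I_m | trform mu0 (al k) != 0]%SET I rep mu0).
Proof.
have [Gc [gc gd]] := classical_good G_classical.
have [H0 [U [w st]]] := setting_exists gd h_cartan al_positive XY_root.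
have [mu gmu eO] := O_orbit.
split.
  have [k [Gk [hk pk]]] := orbit_meets_chamber st gmu.
  have uk := G_unit gd Gk; have uik : invmx k \in unitmx by rewrite unitmx_inv.
  exists (invmx k *m mu *m k); first exact: (chamber_dense st hk pk).
  rewrite eO; apply/seteqP; split=> _ [l Gl <-]; have ul := G_unit gd Gl.
    exists (invmx k *m l); first exact: (G_mul gd (G_inv gd Gk) Gl).
    by rewrite (invmx_mul uik ul) invmxK !mulmxA (mulmxK uk) (mulmxK uk).
  exists (k *m l); first exact: (G_mul gd Gk Gl).
  by rewrite (invmx_mul uk ul) !mulmxA.
move=> mu0 cl _; have [hmu pos] := chamber_closure st G_semisimple cl.
have Grep W : weyl G (torus h) W -> G (rep W).
  by move=> wW; have [] := weyl_rep st wW (rep_weyl _ wW).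
split=> [[_ reg]|I tI].
  have reg' j : trform (al j) mu0 != 0 by rewrite trformC gt_eqF.
  have eD : [set: 'I_m]%SET = [set j | trform mu0 (al j) != 0]%SET.
    by apply/setP => j; rewrite !inE gt_eqF.
  rewrite eD -{1}(regular_stabilizer st hmu reg').
  apply: (orbit_chartsP st G_semisimple hmu pos) => [W wW|n Gn nn]; first exact: Grep.
  have wW : weyl G (torus h) (mulset (centralizer G (torus h)) [set n]).
    by exists n; [exact: (cj_normalizer st Gn nn)|].
  (* When all of the Weyl group is the index set, [n] is taken to its own class; it differs from the
     representative by an element centralizing the torus, which stabilizes [mu0]. *)
  exists (mulset (centralizer G (torus h)) [set n]); first exact: wW.
  have [c Cc [_ -> e]] := rep_weyl _ wW.
  have [Gc' cc] := (centralizerP st c).1 Cc; have uc := G_unit gd Gc'.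
  exists (invmx c); last by rewrite -e (mulKmx uc).
  apply/(stabilizerP st); split; [exact: (G_inv gd)|exact: (invmx_comm uc (cc _ hmu))].
apply: (orbit_chartsP st G_semisimple hmu pos) => [W IW|n Gn nn].
  by apply: Grep; have [sub _] := tI; exact: sub.
exact: (transversal_rep st hmu rep_weyl tI Gn nn).
Qed.
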